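(* Let the types $\theta$, type projections $P_n$, pair laws $(\mu^{ab})$, diagonal laws $(\nu^a)$, deterministic companions $A_n$ with joint strong limit $(p,a)$ in $(B,\tau_B)$, and the covariance-matched free family $x=(x_1,\dots,x_d)$ be as described in the context (so $\operatorname{tr}_n(P_{a,n})\to\pi_a>0$; each $\mu^{ab}$ is centered with finite fourth moment and $\mu^{ba}=S_\#\mu^{ab}$; each $\nu^a$ is centered with finite second moment; $(P_n,A_n)$ converges jointly strongly to $(p,a)$). Suppose that the matrices $X_n=(X_{1,n},\dots,X_{d,n})$, $n\ge1$, are formed from the upper-left corners of one single infinite array sampled once: on one probability space there are independent random vectors $(V_{ij})_{1\le i<j<\infty}$, $V_{ij}=(\xi_{ij}^{(1)},\dots,\xi_{ij}^{(d)},\xi_{ji}^{(1)},\dots,\xi_{ji}^{(d)})\in\mathbb C^{2d}$, with $V_{ij}\sim\mu^{\theta(i)\theta(j)}$, and mutually independent random vectors $W_i=(\xi_{ii}^{(1)},\dots,\xi_{ii}^{(d)})\sim\nu^{\theta(i)}$, $i\ge 1$, independent of all $V_{ij}$, and $X_{\kappa,n}=n^{-1/2}(\xi_{ij}^{(\kappa)})_{1\le i,j\le n}$. Then there exists an event $\Omega_0$ of probability one such that, on $\Omega_0$, for every $q\ge1$ and every $M_q(\mathbb C)$-valued noncommutative $*$-polynomial $Q$ (both fixed independently of $n$), as $n\to\infty$, $$(\operatorname{tr}_q\otimes\operatorname{tr}_n)\,Q(P_n,A_n,X_n)\longrightarrow(\operatorname{tr}_q\otimes\tau_B)\,Q(p,a,x),\qquad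 \|Q(P_n,A_n,X_n)\|\longrightarrow\|Q(p,a,x)\|.$$
   Context: Notation: $[r]=\{1,\dots,r\}$; $\operatorname{tr}_n=n^{-1}\mathrm{Tr}$ on $M_n(\mathbb C)$; $\|\cdot\|$ is the operator ($C^*$) norm. Fix integers $d,r,m\ge1$. Types. $\theta:\mathbb N\to[r]$ is deterministic, $P_{a,n}=\sum_{i\le n,\ \theta(i)=a}E_{ii}\in M_n(\mathbb C)$, $P_n=(P_{1,n},\dots,P_{r,n})$, and $\operatorname{tr}_n(P_{a,n})\to\pi_a>0$ for every $a\in[r]$. Laws. Let $S(z_+,z_-)=(z_-,z_+)$ on $\mathbb C^{2d}=\mathbb C^d\oplus\mathbb C^d$. For every ordered pair $(a,b)\in[r]^2$, $\mu^{ab}$ is a probability law on $\mathbb C^{2d}$ with $\int v\,d\mu^{ab}(v)=0$, $\int\|v\|_2^4\,d\mu^{ab}(v)<\infty$ and $\mu^{ba}=S_\#\mu^{ab}$ (so $\mu^{aa}$ is invariant under $S$). For every $a$, $\nu^a$ is a law on $\mathbb C^d$ with mean zero and $\int\|w\|_2^2\,d\nu^a(w)<\infty$. Companions. $A_n=(A_{1,n},\dots,A_{m,n})\in M_n(\mathbb C)^m$ is deterministic and $(P_n,A_n)$ converges jointly strongly to $(p,a)=(p_1,\dots,p_r,a_1,\dots,a_m)$ in a tracial $C^*$-probability space $(B,\tau_B)$ with faithful trace: for every scalar noncommutative $*$-polynomial $R$, $\operatorname{tr}_nR(P_n,A_n)\to\tau_B(R(p,a))$ and $\|R(P_n,A_n)\|\to\|R(p,a)\|$.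 (The $p_a$ are then pairwise orthogonal projections with sum $1$ and $\tau_B(p_a)=\pi_a$.) An $M_q(\mathbb C)$-valued $*$-polynomial is a finite sum $Q=\sum_jC_j\otimes R_j$ with $C_j\in M_q(\mathbb C)$ and $R_j$ scalar noncommutative $*$-polynomials (in the variables and their adjoints). The covariance-matched free family $x$. All covariances are real covariances of $(\mathrm{Re},\mathrm{Im})$-realifications. Enlarge $(B,\tau_B)$ to a reduced free product (faithful trace still denoted $\tau_B$) containing the following sources, all mutually free and free from $B$: for each $a<b$ standard circular elements $c^{ab}_\ell$ ($\tau_B(c^{ab}_\ell(c^{ab}_\ell)^* )=1$), and for each $a$ standard semicircular elements $s^a_{+,\ell}$, $s^a_{-,\ell}$ (self-adjoint, variance $1$). Cross-type: for $a<b$ let $(Z^{ab}_+,Z^{ab}_-)$ be the centered real Gaussian vector in $\mathbb C^{d}\oplus\mathbb C^d\cong\mathbb R^{4d}$ with the same real covariance as $\mu^{ab}$; choose complex coefficients with $(Z^{ab}_{+,\kappa},Z^{ab}_{-,\kappa})_{\kappa\le d}=\sum_{\ell\le L_{ab}}(\alpha^{ab}_{\kappa\ell},\beta^{ab}_{\kappa\ell})_{\kappa\le d}\,g^{ab}_\ell$ in law, $L_{ab}\le4d$, $g^{ab}_\ell$ i.i.d. real $N(0,1)$. Put $x^{ab}_\kappa=\sum_\ell\big(\alpha^{ab}_{\kappa\ell}p_ac^{ab}_\ell p_b+\beta^{ab}_{\kappa\ell}p_b(c^{ab}_\ell)^*p_a\big)$. Same-type: let $(Z^a_+,Z^a_-)$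 be centered real Gaussian with the real covariance of $\mu^{aa}$, $U^a=(Z^a_++Z^a_-)/\sqrt2$, $V^a=(Z^a_+-Z^a_-)/\sqrt2$ (these are independent); choose $U^a_\kappa=\sum_{\ell\le L_{a,+}}\alpha^a_{\kappa\ell}g^a_{+,\ell}$, $V^a_\kappa=\sum_{\ell\le L_{a,-}}\beta^a_{\kappa\ell}g^a_{-,\ell}$ with complex coefficients, i.i.d. real $N(0,1)$ sources, and $L_{a,\pm}\le2d$. Put $x^{aa}_\kappa=\frac1{\sqrt2}p_a\big(\sum_\ell\alpha^a_{\kappa\ell}s^a_{+,\ell}-i\sum_\ell\beta^a_{\kappa\ell}s^a_{-,\ell}\big)p_a$. Finally $x_\kappa=\sum_ax^{aa}_\kappa+\sum_{a<b}x^{ab}_\kappa$ for $\kappa\in[d]$. *)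

(* Defs.v *)
(* MathComp-Analysis, over an arbitrary [R : realType]; the complex numbers are
   [R[i]]. *)
From HB Require Import structures.
From mathcomp Require Import all_boot all_order all_algebra.
From mathcomp Require Import complex mxtens.
From mathcomp Require Import all_classical all_reals all_analysis.

Set Implicit Arguments.
Unset Strict Implicit.
Unset Printing Implicit Defensive.

Import Order.TTheory GRing.Theory Num.Theory.
Import numFieldNormedType.Exports.

Local Open Scope classical_set_scope.
Local Open Scope ring_scope.
Local Open Scope complex_scope.

Notation normc := Normc.normc.

HB.mixin Record Algebra_hasStar (R : realType) A of GRing.Algebra R[i] A := {
  star : A -> A;
  starK : involutive star;
  starD : {morph star : x y / x + y};
  starZ : forall (c : R[i]) (x : A), star (c *: x) = c^* *: star x;
  starM : forall x y : A, star (x * y) = star y * star x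
}.

#[short(type="starAlgType")]
HB.structure Definition StarAlgebra (R : realType) :=
  {A of GRing.Algebra R[i] A & Algebra_hasStar R A}.

(* The norm is not the [`|_|] of [normedModType]: the hierarchy of the library
   has no join of normed modules and (non-integral) rings. *)
HB.mixin Record StarAlgebra_isCStar (R : realType) A of StarAlgebra R A := {
  cnorm : A -> R;
  cnorm_eq0 : forall x : A, cnorm x = 0 -> x = 0;
  cnormD : forall x y : A, cnorm (x + y) <= cnorm x + cnorm y;
  cnormZ : forall (c : R[i]) (x : A), cnorm (c *: x) = normc c * cnorm x;
  cnormM : forall x y : A, cnorm (x * y) <= cnorm x * cnorm y;
  cnorm_star : forall x : A, cnorm (star x * x) = cnorm x ^+ 2;
  cnorm_complete : forall u : nat -> A,
    (forall e : R, 0 < e -> exists N : nat, forall i j : nat,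
       (N <= i)%N -> (N <= j)%N -> cnorm (u i - u j) < e) ->
    exists l : A, (fun n => cnorm (u n - l)) @ \oo --> (0 : R)
}.

#[short(type="cstarAlgType")]
HB.structure Definition CStarAlgebra (R : realType) :=
  {A of StarAlgebra R A & StarAlgebra_isCStar R A}.

Section MatrixStar.
Variables (R : realType) (n : nat).
Implicit Types M N : 'M[R[i]]_n.+1.

Definition adjmx M : 'M[R[i]]_n.+1 := (map_mx (@conjc R) M)^T.

Lemma adjmxK : involutive adjmx.
Proof. by move=> M; apply/matrixP => i j; rewrite !mxE conjcK. Qed.

Lemma adjmxD : {morph adjmx : M N / M + N}.
Proof. by move=> M N; rewrite /adjmx map_mxD linearD. Qed.

Lemma adjmxZ (c : R[i]) M : adjmx (c *: M) = c^* *: adjmx M.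
Proof. by rewrite /adjmx map_mxZ linearZ. Qed.

Lemma adjmxM M N : adjmx (M * N) = adjmx N * adjmx M.
Proof. by rewrite /adjmx map_mxM trmx_mul. Qed.

HB.instance Definition _ :=
  Algebra_hasStar.Build R 'M[R[i]]_n.+1 adjmxK adjmxD adjmxZ adjmxM.

End MatrixStar.

Definition faithful_tracial_state (R : realType) (A : cstarAlgType R)
    (tau : {scalar A}) : Prop :=
  [/\ tau 1 = 1,
      forall x, 0 <= tau (star x * x),
      forall x y, tau (x * y) = tau (y * x) &
      forall x, tau (star x * x) = 0 -> x = 0].

(* A scalar *-polynomial in variables indexed by [I] is a list of monomials
   [(c, w)]; a letter [(i, true)] of the word [w] stands for the adjoint of the
   [i]-th variable, [(i, false)] for the variable itself. *)
Definition ncpoly (R : realType) (I : Type) := seq (R[i] * seq (I * bool)).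

Definition nceval (R : realType) (I : Type) (A : starAlgType R)
    (p : ncpoly R I) (x : I -> A) : A :=
  \sum_(m <- p)
    m.1 *: \prod_(l <- m.2) (if l.2 then star (x l.1) else x l.1).

(* A list of pairs [(C_j, R_j)], standing for [\sum_j C_j (x) R_j]. *)
Definition mxncpoly (R : realType) (q : nat) (I : Type) :=
  seq ('M[R[i]]_q * ncpoly R I).

(* Value in [M_q(C) (x) A = M_q(A)]. *)
Definition mxnceval (R : realType) (q : nat) (I : Type) (A : starAlgType R)
    (Q : mxncpoly R q I) (x : I -> A) : 'M[A]_q :=
  \sum_(t <- Q) \matrix_(k, l) (t.1 k l *: nceval t.2 x).

(* Value in [M_q(C) (x) M_n(C) = M_{qn}(C)]. *)
Definition mxnceval_tens (R : realType) (q n : nat) (I : Type)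
    (Q : mxncpoly R q I) (x : I -> 'M[R[i]]_n.+1) : 'M[R[i]]_(q * n.+1) :=
  \sum_(t <- Q) (t.1 *t nceval t.2 x).

Definition l2norm (R : realType) (n : nat) (v : 'cV[R[i]]_n) : R :=
  Num.sqrt (\sum_i normc (v i 0) ^+ 2).

Definition opnorm (R : realType) (n : nat) (M : 'M[R[i]]_n) : R :=
  sup [set l2norm (M *m v) | v in [set v | l2norm v <= 1]].

Definition ntrace (R : realType) (n : nat) (M : 'M[R[i]]_n) : R[i] :=
  n%:R^-1 * \tr M.

(* The C*-norm of [M_q(A)]: the operator norm of [T] acting by left
   multiplication on the right Hilbert [A]-module [A^q], whose inner product is
   [<b, b'> = \sum_k (b_k)^* b'_k]. *)
Definition modnorm (R : realType) (A : cstarAlgType R) (q : nat)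
    (b : 'cV[A]_q) : R :=
  Num.sqrt (cnorm (\sum_k star (b k 0) * b k 0)).

Definition mxcnorm (R : realType) (A : cstarAlgType R) (q : nat)
    (T : 'M[A]_q) : R :=
  sup [set modnorm (T *m b) | b in [set b | modnorm b <= 1]].

Definition mxtrace_tau (R : realType) (A : cstarAlgType R)
    (tau : {scalar A}) (q : nat) (T : 'M[A]_q) : R[i] :=
  q%:R^-1 * \sum_k tau (T k k).

(* The [n]-th term of every sequence of matrices has size [n.+1]. *)

Definition strong_cvg (R : realType) (I : Type)
    (u : forall n : nat, I -> 'M[R[i]]_n.+1)
    (A : cstarAlgType R) (tau : {scalar A}) (x : I -> A) : Prop :=
  forall p : ncpoly R I,
    (fun n => ntrace (nceval p (u n)) : R[i]^o) @ \oo
      --> (tau (nceval p x) : R[i]^o) /\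
    (fun n => opnorm (nceval p (u n))) @ \oo --> cnorm (nceval p x).

Definition mx_strong_cvg (R : realType) (I : Type)
    (u : forall n : nat, I -> 'M[R[i]]_n.+1)
    (A : cstarAlgType R) (tau : {scalar A}) (x : I -> A) : Prop :=
  forall q : nat, (1 <= q)%N -> forall Q : mxncpoly R q I,
    (fun n => ntrace (mxnceval_tens Q (u n)) : R[i]^o) @ \oo
      --> (mxtrace_tau tau (mxnceval Q x) : R[i]^o) /\
    (fun n => opnorm (mxnceval_tens Q (u n))) @ \oo
      --> mxcnorm (mxnceval Q x).

Definition join_vars (I J T : Type) (f : I -> T) (g : J -> T) (k : I + J) : T :=
  match k with inl i => f i | inr j => g j end.

(* The [S i], [i \in D], are meant to be unital *-subalgebras; freeness of their
   norm closures follows by continuity of [tau]. *)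
Definition free_family (R : realType) (A : cstarAlgType R) (tau : {scalar A})
    (I : eqType) (D : set I) (S : I -> set A) : Prop :=
  forall s : seq (I * A), s != [::] ->
    sorted (fun i j => i != j) [seq t.1 | t <- s] ->
    (forall k : 'I_(size s), let t := tnth (in_tuple s) k in
       [/\ D t.1, S t.1 t.2 & tau t.2 = 0]) ->
    tau (\prod_(t <- s) t.2) = 0.

Definition star_gen (R : realType) (A : cstarAlgType R) (x : A) : set A :=
  range (fun p : ncpoly R unit => nceval p (fun _ => x)).

Definition std_semicircular (R : realType) (A : cstarAlgType R)
    (tau : {scalar A}) (s : A) : Prop :=
  star s = s /\
  forall k : nat, tau (s ^+ k) =
    (\int[lebesgue_measure]_(t in `[(-2 : R), 2])
       (t ^+ k * (Num.sqrt (4 - t ^+ 2) / (2 * pi))))%:C.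

Definition std_circular (R : realType) (A : cstarAlgType R)
    (tau : {scalar A}) (c : A) : Prop :=
  exists s : bool -> A,
    [/\ forall b, std_semicircular tau (s b),
        free_family tau [set: bool] (fun b => star_gen (s b)) &
        c = ((Num.sqrt (2 : R))^-1)%:C *: (s true + 'i%C *: s false)].

Definition complex_display : measure_display.
Proof. exact. Qed.

Section ComplexMeasurable.
Variable R : realType.

HB.instance Definition _ := isPointed.Build R[i] 0.

(* The Borel sigma-algebra of [C = R^2]. *)
Let borelC : set (set R[i]) :=
  g_sigma_preimageU (@complex.Re R) (@complex.Im R).

Let borelC0 : borelC set0.
Proof. exact: sigma_algebra0. Qed.

Let borelCC A : borelC A -> borelC (~` A).
Proof. exact: sigma_algebraC. Qed.

Let borelC_bigcup (F : (set R[i])^nat) :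
  (forall i, borelC (F i)) -> borelC (\bigcup_i (F i)).
Proof. exact: sigma_algebra_bigcup. Qed.

HB.instance Definition _ :=
  @isMeasurable.Build complex_display R[i] borelC borelC0 borelCC borelC_bigcup.

End ComplexMeasurable.

Notation cvec R d := (d.-tuple R[i]).
Notation cvec2 R d := (d.-tuple R[i] * d.-tuple R[i])%type.

Section Laws.
Variables (R : realType) (d : nat).
Local Open Scope ereal_scope.

Definition swapv (v : cvec2 R d) : cvec2 R d := (v.2, v.1).

(* Real coordinates: real part for [true], imaginary part for [false]. *)
Definition part (b : bool) (z : R[i]) : R :=
  if b then complex.Re z else complex.Im z.

Definition rcoord (e : 'I_d * bool) (w : cvec R d) : R := part e.2 (tnth w e.1).

(* The first component selects [z_+] ([true]) or [z_-] ([false]). *)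
Definition rcoord2 (e : bool * ('I_d * bool)) (v : cvec2 R d) : R :=
  rcoord e.2 (if e.1 then v.1 else v.2).

Definition sqnorm (w : cvec R d) : R := (\sum_k normc (tnth w k) ^+ 2)%R.

Definition sqnorm2 (v : cvec2 R d) : R := (sqnorm v.1 + sqnorm v.2)%R.

Definition offdiag_law (mu : probability (cvec2 R d) R) : Prop :=
  (forall e, 'E_mu[rcoord2 e] = 0) /\
  \int[mu]_v ((sqnorm2 v) ^+ 2)%:E < +oo.

Definition diag_law (nu : probability (cvec R d) R) : Prop :=
  (forall e, 'E_nu[rcoord e] = 0) /\ \int[nu]_w (sqnorm w)%:E < +oo.

Definition same_covariance (mu gamma : probability (cvec2 R d) R) : Prop :=
  forall e f, covariance mu (rcoord2 e) (rcoord2 f) =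
              covariance gamma (rcoord2 e) (rcoord2 f).

(* [normal_prob] is the normal law only for a nonzero standard deviation. *)
Definition centered_normal (s : R) (U : set R) : \bar R :=
  if s == 0%R then \d_(0%R : R) U else normal_prob 0 s U.

Definition centered_gaussian (gamma : probability (cvec2 R d) R) : Prop :=
  forall t : bool * ('I_d * bool) -> R, exists s : R,
    forall U : set R, measurable U ->
      gamma [set v | U (\sum_e t e * rcoord2 e v)%R] = centered_normal s U.

End Laws.

(* Each [F i] is meant to be stable under finite intersections. *)
Definition indep_events (R : realType) (d : measure_display)
    (T : measurableType d) (P : probability T R) (I : eqType) (D : set I)
    (F : I -> set (set T)) : Prop :=
  forall (s : seq I) (E : I -> set T), uniq s ->
    (forall i, i \in s -> D i /\ F i (E i)) ->
    P (\big[setI/setT]_(i <- s) E i) = (\prod_(i <- s) P (E i))%E.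

Definition sigma_of (d d' : measure_display) (T : measurableType d)
    (T' : measurableType d') (X : T -> T') : set (set T) :=
  preimage_set_system setT X measurable.

Definition iid_std_normal (R : realType) (d : measure_display)
    (T : measurableType d) (P : probability T R) (I : eqType) (D : set I)
    (g : I -> T -> R) : Prop :=
  (forall i, D i -> measurable_fun setT (g i) /\
     forall U : set R, measurable U -> P (g i @^-1` U) = normal_prob 0 1 U) /\
  indep_events P D (fun i => sigma_of (g i)).

(* Coefficients; only the indices [l < L] are relevant. *)
Record matching_coefs (R : realType) (d r : nat) := MatchingCoefs {
  mcL : 'I_r -> 'I_r -> nat;
  mcalpha : 'I_r -> 'I_r -> 'I_d -> nat -> R[i];
  mcbeta : 'I_r -> 'I_r -> 'I_d -> nat -> R[i];
  mcLp : 'I_r -> nat;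
  mcLm : 'I_r -> nat;
  mcalphap : 'I_r -> 'I_d -> nat -> R[i];
  mcbetam : 'I_r -> 'I_d -> nat -> R[i] }.

Section Matching.
Variables (R : realType) (d : nat).

Definition lin_comb (L : nat) (c : 'I_d -> nat -> R[i]) (g : nat -> R) :
    cvec R d :=
  [tuple \sum_(l < L) c k l * (g l)%:C | k < d].

Definition cross_match (mu : probability (cvec2 R d) R) (L : nat)
    (alpha beta : 'I_d -> nat -> R[i]) : Prop :=
  exists gamma : probability (cvec2 R d) R,
    [/\ centered_gaussian gamma, same_covariance mu gamma &
      exists (dG : measure_display) (G : measurableType dG)
        (PG : probability G R) (g : nat -> G -> R),
        iid_std_normal PG [set l | (l < L)%N] g /\
        forall U : set (cvec2 R d), measurable U ->
          PG [set w | U (lin_comb L alpha (fun l => g l w),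
                         lin_comb L beta (fun l => g l w))] = gamma U].

(* [(z_+, z_-) |-> ((z_+ + z_-)/sqrt 2, (z_+ - z_-)/sqrt 2)]. *)
Definition rotv (v : cvec2 R d) : cvec2 R d :=
  ([tuple ((Num.sqrt (2 : R))^-1)%:C * (tnth v.1 k + tnth v.2 k) | k < d],
   [tuple ((Num.sqrt (2 : R))^-1)%:C * (tnth v.1 k - tnth v.2 k) | k < d]).

Definition same_match (mu : probability (cvec2 R d) R) (Lp Lm : nat)
    (alpha beta : 'I_d -> nat -> R[i]) : Prop :=
  exists gamma : probability (cvec2 R d) R,
    [/\ centered_gaussian gamma, same_covariance mu gamma &
      exists (dG : measure_display) (G : measurableType dG)
        (PG : probability G R) (g : bool * nat -> G -> R),
        iid_std_normal PG [set bl | (bl.2 < if bl.1 then Lp else Lm)%N] g /\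
        forall U : set (cvec2 R d), measurable U ->
          PG [set w | U (lin_comb Lp alpha (fun l => g (true, l) w),
                         lin_comb Lm beta (fun l => g (false, l) w))]
          = gamma (rotv @^-1` U)].

Variable r : nat.

Definition matching (mu : 'I_r -> 'I_r -> probability (cvec2 R d) R)
    (K : matching_coefs R d r) : Prop :=
  (forall a b : 'I_r, (a < b)%N ->
     (mcL K a b <= 4 * d)%N /\
     cross_match (mu a b) (mcL K a b) (mcalpha K a b) (mcbeta K a b)) /\
  (forall a : 'I_r,
     [/\ (mcLp K a <= 2 * d)%N, (mcLm K a <= 2 * d)%N &
       same_match (mu a a) (mcLp K a) (mcLm K a) (mcalphap K a) (mcbetam K a)]).

(* Labels of the free sources: [inl (a, b, l)] is the circular element
   [c^{ab}_l], [inr (a, true, l)] and [inr (a, false, l)] are the semicircular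
   elements [s^a_{+,l}] and [s^a_{-,l}]. *)
Definition source_label : eqType :=
  ('I_r * 'I_r * nat + 'I_r * bool * nat)%type.

Definition is_source (K : matching_coefs R d r) (i : source_label) : Prop :=
  match i with
  | inl (a, b, l) => (a < b)%N /\ (l < mcL K a b)%N
  | inr (a, e, l) => (l < if e then mcLp K a else mcLm K a)%N
  end.

(* The sources are free among themselves and free from [B], whose label is
   [None]. *)
Definition free_sources (A : cstarAlgType R) (tau : {scalar A}) (B : set A)
    (K : matching_coefs R d r) (src : source_label -> A) : Prop :=
  [/\ forall a b l, is_source K (inl (a, b, l)) ->
        std_circular tau (src (inl (a, b, l))),
      forall a e l, is_source K (inr (a, e, l)) ->
        std_semicircular tau (src (inr (a, e, l))) &
      free_family tau
        [set o : option source_label | if o is Some i then is_source K i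
                                       else True]
        (fun o => if o is Some i then star_gen (src i) else B)].

Variables (A : cstarAlgType R) (p : 'I_r -> A) (K : matching_coefs R d r)
  (src : source_label -> A).

Definition cross_elt (a b : 'I_r) (k : 'I_d) : A :=
  \sum_(l < mcL K a b)
    (mcalpha K a b k l *: (p a * src (inl (a, b, l : nat)) * p b) +
     mcbeta K a b k l *: (p b * star (src (inl (a, b, l : nat))) * p a)).

Definition same_elt (a : 'I_r) (k : 'I_d) : A :=
  ((Num.sqrt (2 : R))^-1)%:C *:
    (p a *
     (\sum_(l < mcLp K a) mcalphap K a k l *: src (inr (a, true, l : nat)) -
      'i%C *: \sum_(l < mcLm K a) mcbetam K a k l *: src (inr (a, false, l : nat)))
     * p a).

Definition matched_family (k : 'I_d) : A :=
  \sum_a same_elt a k + \sum_(a < r) \sum_(b < r | (a < b)%N) cross_elt a b k.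

End Matching.

(* Indices of the infinite array start at 0. *)

Definition type_proj (R : realType) (r : nat) (theta : nat -> 'I_r) (n : nat)
    (a : 'I_r) : 'M[R[i]]_n :=
  \sum_(i < n | theta i == a) delta_mx i i.

Section Array.
Variables (R : realType) (d r : nat) (dO : measure_display)
  (Om : measurableType dO) (xi : nat -> nat -> 'I_d -> Om -> R[i]).

Definition pairV (i j : nat) (w : Om) : cvec2 R d :=
  ([tuple xi i j k w | k < d], [tuple xi j i k w | k < d]).

Definition diagW (i : nat) (w : Om) : cvec R d := [tuple xi i i k w | k < d].

Definition corner (n : nat) (k : 'I_d) (w : Om) : 'M[R[i]]_n :=
  ((Num.sqrt (n%:R : R))^-1)%:C *: \matrix_(i < n, j < n) xi i j k w.

Definition array_model (P : probability Om R) (theta : nat -> 'I_r)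
    (mu : 'I_r -> 'I_r -> probability (cvec2 R d) R)
    (nu : 'I_r -> probability (cvec R d) R) : Prop :=
  [/\ forall i j : nat, (i < j)%N -> measurable_fun setT (pairV i j) /\
        forall U, measurable U ->
          P (pairV i j @^-1` U) = mu (theta i) (theta j) U,
      forall i : nat, measurable_fun setT (diagW i) /\
        forall U, measurable U -> P (diagW i @^-1` U) = nu (theta i) U &
      indep_events P [set ij : nat * nat | (ij.1 <= ij.2)%N]
        (fun ij => if (ij.1 < ij.2)%N then sigma_of (pairV ij.1 ij.2)
                   else sigma_of (diagW ij.1))].

End Array.

(* Main.v *)
(* After truncation and discretization the entries live on a finite product space, on whose vector-valued
   functions X_n acts by multiplication. On functions depending on few entries, X_n is up to a small remainder a
   sum of a creation and an annihilation operator contracting through an empirical covariance map, which tends to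
   that of x. Normal ordering then compares the powers of Q* Q with their limits on a Fock-type space, up to degree
   N_n >> log n, and bounds the norm from above; Markov's inequality and Borel-Cantelli make the traces and the
   upper bounds almost sure. The traces give the lower bounds. The truncated entries are isolated, hence their
   removal costs o(1) in norm, and the C*-identity reduces matrix coefficients to scalar ones. *)
Require Import Defs.
From HB Require Import structures.
From mathcomp Require Import all_boot all_order all_algebra.
From mathcomp Require Import complex mxtens.
From mathcomp Require Import all_classical all_reals all_analysis.
From mathcomp Require Import measurable_realfun ring lra zify.
Import Order.TTheory GRing.Theory Num.Theory.
Import numFieldNormedType.Exports.
Local Open Scope classical_set_scope.
Local Open Scope ring_scope.
Local Open Scope complex_scope.

Set Implicit Arguments.
Unset Strict Implicit.
Unset Printing Implicit Defensive.

(** With fourth moments only, single entries may be nearly as large as [sqrt n]. All scales are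
    powers of [rt5 n], the root of order 32 of [n + 1]: truncation at [rt5^14] and degree about
    [rt5]. The remainder of [X_n] is then of order [1 / rt5], the degree still exceeds every
    multiple of [log n], and a truncated entry has probability [O(rt5^-56)], so that two of them
    sharing an index are excluded over the whole infinite array by Borel-Cantelli. Neither a Fock
    space nor a Hilbert space is constructed: elementary tensors are the Wick products [fval] in the
    limit algebra, and semi-inner products replace completions. Terms with fixed numbers of
    creations and annihilations have norm at most [2 * cnorm Y], by removing the last tensor factor;
    this factor, the number of such blocks and all other constants disappear on passing to high
    powers. Traces concentrate without a variance estimate: on functions of the entries, the partial
    trace over the matrix index is multiplication by the random trace, so iterating it bounds
    moments of order [N_n / t]. *)

Notation letr := le_trans.
Local Notation mfunT := (measurable_fun setT).
Local Notation cRe := complex.Re.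
Local Notation ncM := Normc.normcM.
Local Notation sqrt := Num.sqrt.
Ltac eqr := apply: eq_bigr.
Ltac lers := apply: ler_sum.
Ltac sge0 := apply: sumr_ge0.

(** * Reflection for linear combinations in a module *)

Section LinearReflection.
Variables (K : comNzRingType) (V : lmodType K).

Inductive lexp : Type :=
  | LVar of nat | LZero | LAdd of lexp & lexp | LOpp of lexp
  | LScale of K & lexp | LMuln of lexp & nat.

Fixpoint leval (env : seq V) (e : lexp) : V :=
  match e with
  | LVar n=> nth 0 env n | LZero=> 0 | LAdd a b=> leval env a + leval env b
  | LOpp a=> - leval env a | LScale c a=> c *: leval env a
  | LMuln a n=> leval env a *+ n end.

Fixpoint lcoef (e : lexp) (n : nat) : K :=
  match e with
  | LVar m=> if Nat.eqb m n then 1 else 0 | LZero=> 0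
  | LAdd a b=> lcoef a n + lcoef b n
  | LOpp a=> - lcoef a n | LScale c a=> c * lcoef a n
  | LMuln a k=> lcoef a n *+ k end.

Lemma leval_coef env e :
  leval env e = \sum_(n < size env) lcoef e n *: env`_n.
elim: e=> /= [m||a -> b ->|a ->|c a ->|a -> k].
- have [ms|ms] := ltnP m (size env).
    rewrite (bigD1 (Ordinal ms)) //= PeanoNat.Nat.eqb_refl scale1r big1 ?addr0 //.
    move=> i /eqP im; case: PeanoNat.Nat.eqb_spec=> [mi|_]; last by rewrite scale0r. by case: im; apply: val_inj.
  rewrite nth_default // big1 // => i _. case: PeanoNat.Nat.eqb_spec=> [mi|_]; last by rewrite scale0r.
  by move: ms; rewrite mi leqNgt ltn_ord.
- by rewrite big1 // => i _; rewrite scale0r.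
- by rewrite -big_split; eqr=> i _; rewrite scalerDl.
- by rewrite -sumrN; eqr=> i _; rewrite scaleNr.
- by rewrite scaler_sumr; eqr=> i _; rewrite scalerA.
- by rewrite -sumrMnl; eqr=> i _; rewrite scalerMnl.
Qed.

(** One scalar equation per atom, unfolded by [cbn] into a conjunction that [ring] solves; hence the
    comparison of indices by [Nat.eqb], which computes. *)
Fixpoint lcheck (n : nat) (a b : lexp) : Prop :=
  match n with 0%N=> True | k.+1=> lcoef a k = lcoef b k /\ lcheck k a b end.

Lemma leval_eq env a b : lcheck (size env) a b -> leval env a = leval env b.
move=> h; rewrite !leval_coef; eqr=> -[i /= ilt] _.
suff -> : lcoef a i = lcoef b i by [].
move: ilt h; elim: (size env)=> // n IH /=; rewrite ltnS leq_eqVlt=> /orP[/eqP -> []//|l [_]].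
exact: IH.
Qed.

End LinearReflection.

Ltac lsame x y := match constr:(Set) with
  | _=> let _ := match constr:(Set) with _=> unify x y end in constr:(true)
  | _=> constr:(false) end.
Ltac lmem x l :=
  lazymatch l with
  | cons ?y ?l'=> lazymatch lsame x y with true=> constr:(true) | _=> lmem x l' end
  | _=> constr:(false) end.
Ltac ladd x l := lazymatch lmem x l with true=> l | _=> constr:(cons x l) end.
Ltac latoms e l :=
  lazymatch e with
  | (?a + ?b)%R=> let l := latoms a l in latoms b l
  | (- ?a)%R=> latoms a l
  | (?c *: ?a)%R=> latoms a l
  | (?a *+ ?n)%R=> latoms a l
  | @Algebra.zero _=> l
  | _=> ladd e l end.
Ltac lidx x l :=
  lazymatch l with
  | cons ?y ?l'=> lazymatch lsame x y with true=> constr:(0%N)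
      | _=> let n := lidx x l' in constr:(S n) end end.
Ltac lreify K e l :=
  lazymatch e with
  | (?a + ?b)%R=> let a := lreify K a l in let b := lreify K b l in constr:(@LAdd K a b)
  | (- ?a)%R=> let a := lreify K a l in constr:(@LOpp K a)
  | (?c *: ?a)%R=> let a := lreify K a l in constr:(@LScale K c a)
  | (?a *+ ?n)%R=> let a := lreify K a l in constr:(@LMuln K a n)
  | @Algebra.zero _=> constr:(@LZero K)
  | _=> let n := lidx e l in constr:(@LVar K n) end.
Ltac ncexpand := rewrite ?(mulrDl, mulrDr, mulrN, mulNr, mulr1, mul1r, mulr0, mul0r, scalerDr, scalerN, mulrA) -?scalerAl -?scalerAr -?scalerAl.

(* Proves equalities between linear combinations in an [R[i]]-module. *)
Ltac lmodule R V :=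
  let K := constr:(complex_complex__canonical__GRing_ComNzRing R) in
  lazymatch goal with |- ?a = ?b =>
    let l := latoms a constr:(@nil V) in
    let l := latoms b l in
    let x := lreify K a l in
    let y := lreify K b l in
    let H := fresh in
    have H := @leval_eq K V l x y;
    apply: H; cbn [lcheck lcoef size Nat.eqb]; repeat split; ring
  end.

Section StrongConvergenceOfArrays.
Variable R : realType.
Notation C := R[i].

Lemma le_sq (x y : R) : 0 <= x -> 0 <= y -> (x ^+ 2 <= y ^+ 2) = (x <= y).
by move=> x0 y0; rewrite ler_sqr. Qed.

Lemma leX2 n (x y : R) : 0 <= x -> 0 <= y -> x <= y -> x ^+ n <= y ^+ n.
by move=> x0 y0; apply: lerXn2r. Qed.

(** * Semi-inner products and their tensor products *)

Section SemiInnerProduct.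

(** Null vectors are allowed, so that GNS forms, weighted function spaces and tensor forms need
    neither quotient nor completion. *)
Record is_sip (V : lmodType C) (ip : V -> V -> C) : Prop := IsSip {
  ipDr : forall u v w, ip u (v + w) = ip u v + ip u w;
  ipZr : forall u a v, ip u (a *: v) = a * ip u v;
  ipC : forall u v, ip u v = conjc (ip v u);
  ip_ge0 : forall v, 0 <= cRe (ip v v) }.

Definition n2 (V : lmodType C) (ip : V -> V -> C) v := cRe (ip v v).
Definition nrm (V : lmodType C) (ip : V -> V -> C) v := sqrt (n2 ip v).

Lemma nc_ge0 (z : C) : 0 <= normc z.
by case: z=> x y; rewrite /normc sqrtr_ge0. Qed.

Lemma normc_sqr (z : C) : normc z ^+ 2 = cRe z ^+ 2 + complex.Im z ^+ 2.
by case: z=> x y; rewrite /normc sqr_sqrtr // addr_ge0 // sqr_ge0. Qed.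

Lemma mulJc (z : C) : conjc z * z = (normc z ^+ 2)%:C.
by rewrite normc_sqr; case: z=> x y; apply/eqP; rewrite eq_complex /=; apply/andP; split; apply/eqP; ring. Qed.

Lemma ReD (x y : C) : cRe (x + y) = cRe x + cRe y.
by case: x=> a b; case: y=> c d. Qed.

Lemma ReN (x : C) : cRe (- x) = - cRe x.
by case: x=> a b. Qed.

Lemma ReJ (x : C) : cRe (conjc x) = cRe x.
by case: x. Qed.

Lemma Re_sum (I : Type) (r : seq I) (P : pred I) (F : I -> C) :
  cRe (\sum_(i <- r | P i) F i) = \sum_(i <- r | P i) cRe (F i).
by apply: (big_morph _ ReD). Qed.

Lemma conj_sum (I : Type) (r : seq I) (P : pred I) (F : I -> C) :
  conjc (\sum_(i <- r | P i) F i) = \sum_(i <- r | P i) conjc (F i).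
exact: rmorph_sum. Qed.

Lemma conjcM (x y : C) : conjc (x * y) = conjc x * conjc y.
exact: rmorphM. Qed.

Lemma conjcD (x y : C) : conjc (x + y) = conjc x + conjc y.
exact: rmorphD. Qed.

Lemma Re_normc (z : C) : cRe z <= normc z.
case: z=> x y /=; apply: (letr (ler_norm x)).
by rewrite -sqrtr_sqr ler_wsqrtr // lerDl sqr_ge0.
Qed.

Lemma conjcN (x : C) : conjc (- x) = - conjc x.
exact: rmorphN. Qed.

Lemma conjc0 : conjc (0 : C) = 0.
exact: rmorph0. Qed.

Lemma conjcR (x : R) : conjc x%:C = x%:C.
by rewrite /= oppr0. Qed.

Lemma realcM (x y : R) : (x * y)%:C = x%:C * y%:C.
exact: rmorphM. Qed.

Lemma Re_realM (x : R) (z : C) : cRe (x%:C * z) = x * cRe z.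
by case: z=> a b /=; rewrite mul0r subr0. Qed.

Lemma normcJ (z : C) : normc (conjc z) = normc z.
by case: z=> x y /=; rewrite sqrrN. Qed.

Lemma normcR (x : R) : normc x%:C = `|x|.
by rewrite /= expr0n addr0 sqrtr_sqr. Qed.

Lemma nc_sum (I : Type) (r : seq I) (P : pred I) (F : I -> C) :
  normc (\sum_(i <- r | P i) F i) <= \sum_(i <- r | P i) normc (F i).
elim/big_rec2: _=> [|i y z _ h]; first by rewrite Normc.normc0.
by apply: (letr (le_normcD _ _)); rewrite lerD2l.
Qed.

Section One.
Variables (V : lmodType C) (ip : V -> V -> C) (ipP : is_sip ip).

Lemma ipDl u v w : ip (u + v) w = ip u w + ip v w.
by rewrite (ipC ipP) (ipDr ipP) conjcD -!(ipC ipP). Qed.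

Lemma ipZl a u w : ip (a *: u) w = conjc a * ip u w.
by rewrite (ipC ipP) (ipZr ipP) conjcM -(ipC ipP). Qed.

Lemma ip0r u : ip u 0 = 0.
by rewrite -(scale0r 0) (ipZr ipP) mul0r. Qed.

Lemma ip0l u : ip 0 u = 0.
by rewrite (ipC ipP) ip0r conjc0. Qed.

Lemma ipNr u v : ip u (- v) = - ip u v.
by rewrite -scaleN1r (ipZr ipP) mulN1r. Qed.

Lemma ipNl u v : ip (- u) v = - ip u v.
by rewrite (ipC ipP) ipNr conjcN -(ipC ipP). Qed.

Lemma ipBr u v w : ip u (v - w) = ip u v - ip u w.
by rewrite (ipDr ipP) ipNr. Qed.

Lemma ipBl u v w : ip (u - v) w = ip u w - ip v w.
by rewrite ipDl ipNl. Qed.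

Lemma ip_sumr (I : Type) (r : seq I) (P : pred I) (F : I -> V) u :
  ip u (\sum_(i <- r | P i) F i) = \sum_(i <- r | P i) ip u (F i).
by rewrite (big_morph (ip u) (id1 := 0) (op1 := +%R)) // ?ip0r // => x y; rewrite (ipDr ipP). Qed.

Lemma ip_suml (I : Type) (r : seq I) (P : pred I) (F : I -> V) u :
  ip (\sum_(i <- r | P i) F i) u = \sum_(i <- r | P i) ip (F i) u.
by rewrite (big_morph (ip^~ u) (id1 := 0) (op1 := +%R)) // ?ip0l // => x y; rewrite ipDl. Qed.

Lemma ip_self v : ip v v = (n2 ip v)%:C.
have := ipC ipP v v; rewrite /n2; case: (ip v v)=> a b /= [] /eqP.
rewrite -addr_eq0 -mulr2n mulrn_eq0 /= => /eqP ->.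
by [].
Qed.

Lemma n2_ge0 v : 0 <= n2 ip v. exact: (ip_ge0 ipP). Qed.
Lemma nrm_ge0 v : 0 <= nrm ip v. exact: sqrtr_ge0. Qed.
Lemma nrm_sqr v : nrm ip v ^+ 2 = n2 ip v. by rewrite sqr_sqrtr // n2_ge0. Qed.

Lemma n2D u v : n2 ip (u + v) = n2 ip u + 2 * cRe (ip u v) + n2 ip v.
rewrite /n2 (ipDr ipP) !ipDl !ReD (ipC ipP v u) ReJ; ring.
Qed.

Lemma n2Z a v : n2 ip (a *: v) = normc a ^+ 2 * n2 ip v.
by rewrite /n2 ipZl (ipZr ipP) mulrA mulJc (ip_self v) Re_realM.
Qed.

Lemma CS_sqr u v : normc (ip u v) ^+ 2 <= n2 ip u * n2 ip v.
set z := ip u v; set p := normc z ^+ 2; have p0 : 0 <= p by exact: sqr_ge0.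
(* Expansion of the squared norm of [u - t (conj z) v] for real [t]. *)
have key (t : R) : 0 <= n2 ip u - 2 * t * p + t ^+ 2 * (p * n2 ip v).
  have := n2_ge0 (u + ((- t)%:C * conjc z) *: v).
  rewrite n2D n2Z (ipZr ipP) -/z (_ : _ * z = ((- t) * p)%:C); last first.
    by rewrite realcM -mulJc mulrA.
  rewrite [cRe _]/=. rewrite ncM normcJ normcR exprMn real_normK ?num_real // sqrrN.
  by rewrite -/p=> h; apply: (letr h); rewrite le_eqVlt; apply/orP; left; apply/eqP; ring.
(* For a null vector [v] the quadratic is affine in [t]; if [p > 0], the chosen [t] gives it the
   value -1. *)
have [v0|v0] := eqVneq (n2 ip v) 0.
  rewrite v0 mulr0; have [//|pn] := leP p 0. have := key ((n2 ip u + 1) / (2 * p)); rewrite v0 !mulr0 addr0.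
  rewrite (_ : 2 * _ * p = n2 ip u + 1); last by field; rewrite gt_eqF. by move=> h; exfalso; lra.
have vp : 0 < n2 ip v by rewrite lt_def v0 n2_ge0.
have := key (n2 ip v)^-1.
rewrite (_ : _ + _ = n2 ip u - p / n2 ip v); last by field.
by rewrite subr_ge0 ler_pdivrMr.
Qed.

Lemma CS u v : normc (ip u v) <= nrm ip u * nrm ip v.
rewrite -le_sq ?nc_ge0 ?mulr_ge0 ?nrm_ge0 // exprMn !nrm_sqr.
exact: CS_sqr.
Qed.

Lemma nrmD u v : nrm ip (u + v) <= nrm ip u + nrm ip v.
rewrite -le_sq ?addr_ge0 ?nrm_ge0 // nrm_sqr n2D sqrrD !nrm_sqr.
rewrite lerD2r lerD2l -[leRHS]mulr_natl ler_wpM2l //.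
exact: letr (Re_normc _) (CS _ _).
Qed.

Lemma nrmZ a v : nrm ip (a *: v) = normc a * nrm ip v.
by rewrite /nrm n2Z sqrtrM ?sqr_ge0 // sqrtr_sqr ger0_norm // nc_ge0. Qed.

Lemma nrm0 : nrm ip 0 = 0.
by rewrite /nrm /n2 ip0r sqrtr0. Qed.

(** Division by the norm of [v]. Operators are estimated below by testing their image against itself
    and applying this. *)
Lemma nrm_form v c : 0 <= c ->
  cRe (ip v v) <= c * nrm ip v -> nrm ip v <= c.
move=> c0; rewrite -/(n2 ip v) -nrm_sqr expr2.
have [v0|vp] := leP (nrm ip v) 0; first by move=> _; exact: letr c0.
by rewrite ler_pM2r.
Qed.

End One.

Section Schur.
Variables (V W : lmodType C) (ip : V -> V -> C) (jp : W -> W -> C) (ipP : is_sip ip) (jpP : is_sip jp).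

(* Gram-Schmidt on the first components. *)
Lemma schur_ge0 (s : seq (W * V)) :
  0 <= cRe (\sum_(x <- s) \sum_(y <- s) jp x.1 y.1 * ip x.2 y.2).
have [n] := ubnP (size s); elim: n s=> // n IH [|[c f] s] /= sz.
  by rewrite big_nil.
set P := n2 jp c.
have [P0|Pn] := eqVneq P 0.
  have z v : jp c v = 0.
    apply: Normc.eq0_normc; apply/eqP; rewrite -sqrf_eq0 eq_le sqr_ge0 andbT.
    by apply: letr (CS_sqr jpP _ _) _; rewrite -/P P0 mul0r.
  have z' v : jp v c = 0 by rewrite (ipC jpP) z conjc0.
  rewrite big_cons big1_seq /=; last by move=> i _; rewrite z mul0r. rewrite add0r.
  under eq_bigr do rewrite big_cons /= z' mul0r add0r. exact: IH.
pose a (x : W * V) : C := jp c x.1 / P%:C.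
pose t (x : W * V) : W * V := (x.1 - a x *: c, x.2).
have PC : P%:C != 0 :> C by rewrite fmorph_eq0.
have jcc : jp c c = P%:C by rewrite (ip_self jpP).
(* Removing the component along [c] splits the kernel [jp] into the kernel of the reduced vectors
   and a positive kernel of rank one. *)
have dec (x y : W * V) : jp x.1 y.1 = jp (t x).1 (t y).1 + P%:C * (conjc (a x) * a y).
  rewrite /t /= (ipBr jpP) !(ipBl jpP) !(ipZr jpP) !(ipZl jpP) jcc.
  rewrite (ipC jpP x.1 c) /a !conjcM (_ : conjc (P%:C)^-1 = (P%:C)^-1); last by rewrite -fmorphV conjcR.
  by field; rewrite PC.
pose g := f + \sum_(x <- s) a x *: x.2.
rewrite (_ : \sum_(x <- _) _ = \sum_(x <- [seq t x | x <- s])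
   \sum_(y <- [seq t x | x <- s]) jp x.1 y.1 * ip x.2 y.2 + P%:C * ip g g); last first.
  have ac : a (c, f) = 1 by rewrite /a /= jcc divff.
  have tc v : jp (t (c, f)).1 v = 0 by rewrite /t /= ac scale1r subrr (ip0l jpP).
  have tc' v : jp v (t (c, f)).1 = 0 by rewrite (ipC jpP) tc conjc0. have gE : g = \sum_(x <- (c, f) :: s) a x *: x.2.
    by rewrite big_cons ac scale1r.
  rewrite gE (ip_suml ipP) mulr_sumr. under [X in _ + X]eq_bigr do rewrite (ip_sumr ipP) mulr_sumr.
  rewrite (_ : \sum_(x <- [seq t x | x <- s]) _ = \sum_(x <- (c, f) :: s) \sum_(y <- (c, f) :: s) jp (t x).1 (t y).1 * ip x.2 y.2).
    rewrite -big_split; eqr=> x _; rewrite -big_split; eqr=> y _ /=. by rewrite dec (ipZl ipP) (ipZr ipP); ring.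
  rewrite big_cons [X in _ = X + _]big1 ?add0r; last by move=> i _; rewrite tc mul0r.
  rewrite big_map; eqr=> x _; rewrite big_map big_cons tc' mul0r add0r. by eqr.
rewrite ReD addr_ge0 //; first by apply: IH; rewrite size_map.
by rewrite (ip_self ipP) Re_realM /= mulr_ge0 ?(n2_ge0 ipP) ?(n2_ge0 jpP).
Qed.

End Schur.

Section Tensor.
Variables (V W : lmodType C) (ip : V -> V -> C) (jp : W -> W -> C) (ipP : is_sip ip) (jpP : is_sip jp)
  (I : finType) (c : I -> W).

(** The inner product of the tensors [sum_i c_i (x) f_i], written on the coordinates [f_i] so that
    no tensor product has to be formed. *)
Definition tip (f g : {ffun I -> V}) : C := \sum_i \sum_j jp (c i) (c j) * ip (f i) (g j).

Lemma tip_sip : is_sip tip.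
split.
- move=> u v w; rewrite /tip -big_split; eqr=> i _; rewrite -big_split.
  by eqr=> j _; rewrite !ffunE (ipDr ipP) mulrDr.
- move=> u a v; rewrite /tip mulr_sumr; eqr=> i _; rewrite mulr_sumr.
  by eqr=> j _; rewrite !ffunE (ipZr ipP); ring.
- move=> u v; rewrite /tip conj_sum exchange_big; eqr=> i _.
  rewrite conj_sum; eqr=> j _. by rewrite (ipC jpP) (ipC ipP) conjcM.
- move=> v; have := schur_ge0 ipP jpP [seq (c i, v i) | i <- enum I].
  rewrite big_map big_enum /=; under eq_bigr do rewrite big_map big_enum /=. by [].
Qed.

End Tensor.

(** The operator [1 (x) y] has norm at most [K]: the form [K^2 <u, v> - <y u, y v>] is again a
    semi-inner product, and its tensor product with [jp] stays positive. *)
Lemma tensor_bound (V W : lmodType C) (ip : V -> V -> C) (jp : W -> W -> C)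
  (ipP : is_sip ip) (jpP : is_sip jp) (I : finType) (c d : I -> W)
  (f g : {ffun I -> V}) (y : {linear V -> V}) (K : R) : 0 <= K ->
  (forall v, nrm ip (y v) <= K * nrm ip v) ->
  normc (\sum_i \sum_j jp (c i) (d j) * ip (f i) (y (g j))) <=
    K * (nrm (tip ip jp c) f * nrm (tip ip jp d) g).
move=> K0 yK.
(* Cauchy-Schwarz needs both families in one space: the index set is doubled and each vector
   extended by 0. *)
pose e (i : I + I) := match i with inl i=> c i | inr j=> d j end.
pose F : {ffun I + I -> V} := [ffun i=> match i with inl i=> f i | inr _=> 0 end].
pose G : {ffun I + I -> V} := [ffun i=> match i with inl i=> 0 | inr j=> g j end].
pose yG : {ffun I + I -> V} := [ffun i=> y (G i)].
have eP := tip_sip ipP jpP e.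
have nF : nrm (tip ip jp e) F = nrm (tip ip jp c) f.
  rewrite /nrm /n2 /tip big_sumType /= [X in _ + X]big1 ?addr0; last first.
    by move=> i _; rewrite big1 // => j _; rewrite ffunE (ip0l ipP) mulr0.
  congr (sqrt (cRe _)); eqr=> i _.
  rewrite big_sumType /= [X in _ + X]big1 ?addr0; last by move=> j _; rewrite !ffunE (ip0r ipP) mulr0.
  by eqr=> j _; rewrite !ffunE.
have nG : nrm (tip ip jp e) G = nrm (tip ip jp d) g.
  rewrite /nrm /n2 /tip big_sumType /= [X in X + _]big1 ?add0r; last first.
    by move=> i _; rewrite big1 // => j _; rewrite ffunE (ip0l ipP) mulr0.
  congr (sqrt (cRe _)); eqr=> i _.
  rewrite big_sumType /= [X in X + _]big1 ?add0r; last by move=> j _; rewrite !ffunE (ip0r ipP) mulr0.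
  by eqr=> j _; rewrite !ffunE.
have FG : tip ip jp e F yG = \sum_i \sum_j jp (c i) (d j) * ip (f i) (y (g j)).
  rewrite /tip big_sumType /= [X in _ + X]big1 ?addr0; last first.
    by move=> i _; rewrite big1 // => j _; rewrite ffunE (ip0l ipP) mulr0.
  eqr=> i _.
  rewrite big_sumType /= [X in X + _]big1 ?add0r; last by move=> j _; rewrite !ffunE linear0 (ip0r ipP) mulr0.
  by eqr=> j _; rewrite !ffunE.
rewrite -FG -nF -nG mulrCA; apply: letr (CS eP _ _) _.
rewrite ler_wpM2l ?nrm_ge0 // -le_sq ?mulr_ge0 ?nrm_ge0 // exprMn !(nrm_sqr eP).
pose ep (u v : V) := (K ^+ 2)%:C * ip u v - ip (y u) (y v).
have epP : is_sip ep.
  split.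
  - by move=> u v w; rewrite /ep linearD !(ipDr ipP); ring.
  - by move=> u a v; rewrite /ep linearZ /= !(ipZr ipP); ring.
  - by move=> u v; rewrite /ep conjcD conjcN conjcM -!(ipC ipP) conjcR.
  - move=> v; rewrite /ep ReD ReN !(ip_self ipP) Re_realM /= subr_ge0.
    by rewrite -!(nrm_sqr ipP) -exprMn le_sq ?mulr_ge0 ?nrm_ge0.
have := ip_ge0 (tip_sip epP jpP e) G.
rewrite (_ : tip ep jp e G G = (K ^+ 2)%:C * tip ip jp e G G - tip ip jp e yG yG).
  by rewrite ReD ReN !(ip_self eP) Re_realM /= subr_ge0.
rewrite /tip mulr_sumr -sumrB; eqr=> i _; rewrite mulr_sumr -sumrB.
by eqr=> j _; rewrite /ep !ffunE; ring.
Qed.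

End SemiInnerProduct.

Section DirectSum.

Lemma normcN (z : C) : normc (- z) = normc z.
by case: z=> x y; rewrite /= !sqrrN. Qed.

Lemma rCS (J : finType) (u v : J -> R) :
  \sum_j u j * v j <= sqrt (\sum_j u j ^+ 2) * sqrt (\sum_j v j ^+ 2).
set S := \sum_j u j ^+ 2; set T := \sum_j v j ^+ 2; set Q := \sum_j u j * v j.
have S0 : 0 <= S by sge0=> j _; exact: sqr_ge0.
have T0 : 0 <= T by sge0=> j _; exact: sqr_ge0.
have key (t s : R) : 0 <= s ^+ 2 * S - 2 * s * t * Q + t ^+ 2 * T.
  suff -> : s ^+ 2 * S - 2 * s * t * Q + t ^+ 2 * T = \sum_j (s * u j - t * v j) ^+ 2.
    by sge0=> j _; exact: sqr_ge0.
  by rewrite !mulr_sumr -sumrB -big_split; eqr=> j _ /=; ring.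
have QS : Q ^+ 2 <= S * T.
  have [T00|Tn] := eqVneq T 0.
    rewrite T00 mulr0; have [->|Qn] := eqVneq Q 0; first by rewrite expr0n.
    have := key ((S + 1) / (2 * Q)) 1; rewrite T00. rewrite (_ : _ + _ = -1); first by rewrite lerNr oppr0 ler10.
    by field.
  have := key Q T; rewrite (_ : _ + _ = T * (S * T - Q ^+ 2)); last by ring.
  by rewrite pmulr_rge0 ?subr_ge0 // lt_def Tn.
rewrite -sqrtrM //; apply: (letr (ler_norm _)).
by rewrite -sqrtr_sqr ler_wsqrtr.
Qed.

Variables (V : lmodType C) (ip : V -> V -> C) (ipP : is_sip ip) (I : finType).

Definition dip (f g : {ffun I -> V}) : C := \sum_i ip (f i) (g i).

Lemma dip_sip : is_sip dip.
split.
- by move=> u v w; rewrite /dip -big_split; eqr=> i _; rewrite !ffunE (ipDr ipP).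
- by move=> u a v; rewrite /dip mulr_sumr; eqr=> i _; rewrite !ffunE (ipZr ipP).
- by move=> u v; rewrite /dip conj_sum; eqr=> i _; rewrite (ipC ipP).
- by move=> v; rewrite /dip Re_sum sumr_ge0 // => i _; exact: (ip_ge0 ipP).
Qed.

Lemma dip_n2 f : n2 dip f = \sum_i n2 ip (f i).
by rewrite /n2 /dip Re_sum. Qed.

End DirectSum.

(** * C*-algebras: square roots, and the norm as a GNS operator norm *)

Section CStar.
Variables (A : cstarAlgType R).
Implicit Types x y z : A.

Lemma starJ (c : C) x : star (c *: x) = conjc c *: star x.
exact: starZ. Qed.

Lemma star0 : star (0 : A) = 0.
by have := starJ 0 0; rewrite conjc0 !scale0r. Qed.

Lemma starN x : star (- x) = - star x.
by rewrite -scaleN1r starJ conjcN rmorph1 scaleN1r. Qed.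

Lemma starB x y : star (x - y) = star x - star y.
by rewrite starD starN. Qed.

Lemma star_sum (I : Type) (r : seq I) (P : pred I) (F : I -> A) :
  star (\sum_(i <- r | P i) F i) = \sum_(i <- r | P i) star (F i).
by apply: big_morph; [exact: starD|exact: star0]. Qed.

Lemma star1 : star (1 : A) = 1.
by rewrite -[star 1]mulr1 -{2}[1]starK -starM mulr1 starK.
Qed.

Lemma cnorm0 : cnorm (0 : A) = 0.
by rewrite -(scale0r 0) cnormZ Normc.normc0 mul0r. Qed.

Lemma cnormN x : cnorm (- x) = cnorm x.
by rewrite -scaleN1r cnormZ -[-1]/(- 1%:C)  (_ : normc _ = 1) ?mul1r // /= sqrrN expr1n oppr0 expr0n addr0 sqrtr1. Qed.

Lemma cnorm_ge0 x : 0 <= cnorm x.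
have := cnormD x (- x); rewrite subrr.
by rewrite cnorm0 cnormN=> h; lra.
Qed.

Lemma cnormB x y : cnorm (x - y) = cnorm (y - x).
by rewrite -cnormN opprB. Qed.

Lemma cnorm_starE x : cnorm (star x) = cnorm x.
suff le z : cnorm z <= cnorm (star z) by apply/eqP; rewrite eq_le le andbT -{2}[x]starK le.
have [z0|zp] := leP (cnorm z) 0; first exact: letr z0 (cnorm_ge0 _).
have := cnorm_star z; rewrite expr2=> h.
have := cnormM (star z) z; rewrite h ler_pM2r //.
Qed.

Lemma cnorm1 : cnorm (1 : A) = 1.
have h : cnorm (1 : A) ^+ 2 = cnorm (1 : A) by rewrite -cnorm_star star1 mulr1.
have n0 : cnorm (1 : A) != 0.
  by apply/negP=> /eqP /cnorm_eq0 /eqP; rewrite oner_eq0.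
by apply: (mulfI n0); rewrite mulr1 -expr2.
Qed.

Lemma cnorm_sum (I : Type) (r : seq I) (P : pred I) (F : I -> A) :
  cnorm (\sum_(i <- r | P i) F i) <= \sum_(i <- r | P i) cnorm (F i).
elim/big_rec2: _=> [|i y z _ h]; first by rewrite cnorm0.
by apply: (letr (cnormD _ _)); rewrite lerD2l.
Qed.

Lemma cnorm_real (c : R) x : cnorm (c%:C *: x) = `|c| * cnorm x.
by rewrite cnormZ normcR. Qed.

Lemma cnormM_sub x y : cnorm (x * x - y * y) <= (cnorm x + cnorm y) * cnorm (x - y).
have -> : x * x - y * y = x * (x - y) + (x - y) * y.
  by rewrite mulrBr mulrBl addrA subrK.
apply: letr (cnormD _ _) _; rewrite [leRHS]mulrDl; apply: lerD; first exact: cnormM.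
by rewrite mulrC; exact: cnormM.
Qed.

Lemma cvg_ge_bound (u : nat -> R) (c l : R) : u @ \oo --> l -> (forall n, c <= u n) -> c <= l.
move=> ul h; have <- : limn u = l by exact: cvg_lim.
by apply: limr_ge; [apply/cvg_ex; exists l|near=> n; exact: h].
Unshelve. all: by end_near. Qed.

Lemma clim_eq0 (u : nat -> A) l z (K : R) :
  (fun n=> cnorm (u n - l)) @ \oo --> (0 : R) ->
  (forall n, cnorm z <= K * cnorm (u n - l)) -> z = 0.
move=> ul zK; apply: cnorm_eq0; apply/eqP; rewrite eq_le cnorm_ge0 andbT.
have h : (fun n=> K * cnorm (u n - l)) @ \oo --> (K * 0 : R).
  by apply: cvgM=> //; exact: cvg_cst.
rewrite mulr0 in h.
exact: cvg_ge_bound h zK.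
Qed.

Section Sqrt.
Variables (x : A) (x1 : cnorm x <= 1).
Let h : R := 2^-1.

(** [sqbd] is the same iteration for the scalar 1. It dominates the norms and the increments of
    [sqit] and is monotone and bounded by 1, so [sqit] is Cauchy even for [cnorm x = 1], where the
    iteration does not contract. *)
Fixpoint sqit (n : nat) : A :=
  if n is m.+1 then h%:C *: (x + sqit m * sqit m) else 0.
Fixpoint sqbd (n : nat) : R :=
  if n is m.+1 then h * (1 + sqbd m ^+ 2) else 0.

Lemma sqrt_bound_itv n : 0 <= sqbd n <= 1.
by elim: n=> [|n /andP[h0 h1]] /=; [rewrite lexx ler01|rewrite /h; apply/andP; split; nra]. Qed.

Lemma sqrt_iter_le n : cnorm (sqit n) <= sqbd n.
elim: n=> [|n IH] /=; first by rewrite cnorm0.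
have h0 : 0 <= h by rewrite /h invr_ge0.
rewrite cnorm_real ger0_norm // ler_wpM2l //.
apply: letr (cnormD _ _) _; apply: lerD=> //.
apply: letr (cnormM _ _) _; rewrite -expr2 le_sq ?cnorm_ge0 //.
by case/andP: (sqrt_bound_itv n).
Qed.

Lemma sqrt_iter_step n :
  cnorm (sqit n.+1 - sqit n) <= sqbd n.+1 - sqbd n.
have h0 : 0 <= h by rewrite /h invr_ge0.
elim: n=> [|n IH].
  by rewrite /= mulr0 !addr0 !subr0 cnorm_real ger0_norm // expr0n addr0 mulr1 ler_piMr.
rewrite [sqit n.+2]/= [in X in _ - X]/= -/(sqit n.+1) -scalerBr.
rewrite opprD addrACA subrr add0r cnorm_real ger0_norm //.
rewrite (_ : sqbd n.+2 - _ = h * ((sqbd n.+1 + sqbd n) * (sqbd n.+1 - sqbd n))); last by rewrite /=; ring.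
rewrite ler_wpM2l //; apply: letr (cnormM_sub _ _) _.
apply: ler_pM; rewrite ?addr_ge0 ?cnorm_ge0 //.
by apply: lerD; apply: sqrt_iter_le.
Qed.

Lemma sqrt_iter_cauchy n m : (n <= m)%N ->
  cnorm (sqit m - sqit n) <= sqbd m - sqbd n.
move=> /subnKC <-; elim: (m - n)%N=> [|k IH]; first by rewrite addn0 !subrr cnorm0.
rewrite addnS (_ : sqit (n + k).+1 - sqit n = (sqit (n + k).+1 - sqit (n + k)) + (sqit (n + k) - sqit n)); last by rewrite addrA subrK.
apply: letr (cnormD _ _) _.
by have := sqrt_iter_step (n + k); lra.
Qed.

Lemma sqrt_bound_nd : nondecreasing_seq sqbd.
apply/nondecreasing_seqP=> n; rewrite -subr_ge0.
exact: letr (cnorm_ge0 _) (sqrt_iter_step n).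
Qed.

Lemma sqrt_limit : exists l : A, (fun n=> cnorm (sqit n - l)) @ \oo --> (0 : R).
apply: cnorm_complete=> e e0.
have cv : cvgn sqbd.
  apply: nondecreasing_is_cvgn; first exact: sqrt_bound_nd. by exists 1=> _ [n _ <-]; case/andP: (sqrt_bound_itv n).
have [N _ hN] : \forall n \near \oo, limn sqbd - sqbd n < e / 2.
  have : sqbd @ \oo --> limn sqbd by []. move=> /cvgrPdist_lt /(_ (e / 2)); rewrite divr_gt0 // => /(_ isT).
  apply: filterS=> n; apply: le_lt_trans; exact: ler_norm.
exists N=> i j Ni Nj.
have key k : (N <= k)%N -> cnorm (sqit k - sqit N) < e / 2.
  move=> Nk; apply: le_lt_trans (sqrt_iter_cauchy Nk) _. apply: le_lt_trans (hN N (leqnn N)); rewrite lerD2r.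
  exact: (nondecreasing_cvgn_le sqrt_bound_nd cv).
rewrite (_ : _ - _ = (sqit i - sqit N) + (sqit N - sqit j)); last by rewrite addrA subrK.
apply: le_lt_trans (cnormD _ _) _; rewrite (cnormB (sqit N)).
by have := key i Ni; have := key j Nj; lra.
Qed.

(* [s = 1 - l] where [l] is the limit of the increasing iteration
   [l -> (x + l^2) / 2]. *)
Lemma cstar_sqrt : star x = x -> exists s : A,
  [/\ star s = s, s * s = 1 - x, cnorm (1 - s) <= 1 &
      forall y, y * x = x * y -> y * s = s * y].
move=> xs; have [l ll] := sqrt_limit.
have n1 n : cnorm (sqit n) <= 1.
  by apply: letr (sqrt_iter_le n) _; case/andP: (sqrt_bound_itv n).
have l1 : cnorm l <= 1.
  have hh : (fun n=> cnorm (sqit n - l) + 1) @ \oo --> (0 + 1 : R).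
    by apply: cvgD=> //; exact: cvg_cst.
  rewrite add0r in hh; apply: (cvg_ge_bound hh)=> n. rewrite -[l in X in X <= _](subKr (sqit n)) addrC.
  apply: letr (cnormD _ _) _; rewrite cnormN. by rewrite lerD2l.
have ls : star l = l.
  apply/eqP; rewrite -subr_eq0; apply/eqP. have sn n : star (sqit n) = sqit n.
    elim: n=> [|n IH] /=; first exact: star0. by rewrite starJ conjcR starD starM IH xs.
  apply: (clim_eq0 (K := 2) ll)=> n. rewrite (_ : star l - l = (sqit n - l) - star (sqit n - l)); last first.
    by rewrite starB sn; lmodule R A.
  apply: letr (cnormD _ _) _; rewrite cnormN cnorm_starE; lra.
have lc y : y * x = x * y -> y * l = l * y.
  move=> yx; apply/eqP; rewrite -subr_eq0; apply/eqP. have sn n : y * sqit n = sqit n * y.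
    elim: n=> [|n IH] /=; first by rewrite mulr0 mul0r.
    by rewrite -scalerAr -scalerAl mulrDr mulrDl yx mulrA IH -mulrA IH mulrA.
  apply: (clim_eq0 (K := 2 * cnorm y) ll)=> n.
  rewrite (_ : y * l - l * y = (sqit n - l) * y - y * (sqit n - l)); last first.
    by rewrite mulrBl mulrBr sn; lmodule R A.
  apply: letr (cnormD _ _) _; rewrite cnormN. by have := cnormM (sqit n - l) y; have := cnormM y (sqit n - l); lra.
have le : l = h%:C *: (x + l * l).
  apply/eqP; rewrite -subr_eq0; apply/eqP.
  have ll' : (fun n=> cnorm (sqit n.+1 - l) + cnorm (sqit n - l)) @ \oo --> (0 + 0 : R).
    by apply: cvgD=> //; rewrite (cvg_shiftS (fun n=> cnorm (sqit n - l))).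
  rewrite addr0 in ll'. apply: cnorm_eq0; apply/eqP; rewrite eq_le cnorm_ge0 andbT. apply: (cvg_ge_bound ll')=> n.
  rewrite (_ : l - _ = - (sqit n.+1 - l) + h%:C *: (sqit n * sqit n - l * l)); last first.
    by rewrite [sqit n.+1]/=; lmodule R A.
  apply: letr (cnormD _ _) _; rewrite cnormN lerD2l cnorm_real ger0_norm ?invr_ge0 //.
  have := cnormM_sub (sqit n) l; have := n1 n; have := cnorm_ge0 (sqit n - l). rewrite /h; nra.
exists (1 - l); split.
- by rewrite starB star1 ls.
- have e2 : l * l = 2%:R *: l - x.
    apply: (@scalerI _ A h%:C); first by rewrite fmorph_eq0 /h invr_eq0.
    rewrite scalerBr scalerA (_ : h%:C * 2%:R = 1); last first.
      by rewrite -(rmorph_nat (real_complex R)) -realcM /h mulVf.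
    by rewrite scale1r {3}le; lmodule R A.
  by ncexpand; rewrite e2; lmodule R A.
- by rewrite subKr.
- by move=> y yx; rewrite mulrBr mulrBl mul1r mulr1 lc.
Qed.

End Sqrt.

Section UnitaryTrick.

(** For [u = g + i n] one has [star u * u = rho], so [cnorm u ^+ 2 = rho], and [g] is the real part
    of [u]. *)
Lemma cnorm_sum_squares (g n : A) (rho : R) : 0 <= rho -> star g = g -> star n = n -> g * n = n * g ->
  g * g + n * n = rho%:C *: 1 -> cnorm g ^+ 2 <= rho.
move=> r0 gs ns gn e; pose u := g + 'i%C *: n.
have su : star u = g - 'i%C *: n.
  by rewrite /u starD starJ gs ns; congr (_ + _); rewrite -scaleNr; congr (_ *: _); apply/eqP; rewrite eq_complex /= oppr0 !eqxx.
have uu : star u * u = rho%:C *: 1.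
  have ii : 'i%C * 'i%C = -1 :> C by rewrite -expr2 sqr_i.
  by rewrite su /u -e; ncexpand; rewrite gn scalerA ii; lmodule R A.
have nu : cnorm u ^+ 2 = rho by rewrite -cnorm_star uu cnorm_real cnorm1 mulr1 ger0_norm.
have gu : g = (2^-1)%:C *: (u + star u).
  have h2 : (2^-1)%:C = 2%:R^-1 :> C by rewrite fmorphV rmorph_nat.
  rewrite h2 (_ : u + star u = 2%:R *: g); last by rewrite su /u; lmodule R A.
  by rewrite scalerA mulVf ?pnatr_eq0 // scale1r.
have : cnorm g <= cnorm u.
  rewrite gu cnorm_real ger0_norm ?invr_ge0 //. by have := cnormD u (star u); rewrite cnorm_starE=> h; lra.
by rewrite -nu=> h; rewrite le_sq ?cnorm_ge0.
Qed.

(** The square root [s] of [1 - k^2] commutes with [k], and [s^2 + k^2 = 1]. The bound permits a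
    second extraction, from [k^2 = 1 - (1 - k^2)], which yields an absolute value of [k]. *)
Lemma cnorm_1_sub_sqr (k : A) : star k = k -> cnorm k <= 1 -> cnorm (1 - k * k) <= 1.
move=> ks k1.
have kk1 : cnorm (k * k) <= 1.
  by rewrite -{1}ks cnorm_star expr_le1 ?cnorm_ge0.
have kks : star (k * k) = k * k by rewrite starM ks.
have [s [ss s2 _ sc]] := cstar_sqrt kk1 kks.
have sk : s * k = k * s by rewrite sc // mulrA.
have : cnorm s ^+ 2 <= 1.
  apply: (@cnorm_sum_squares s k)=> //. by rewrite s2 subrK scale1r.
by rewrite -s2 -{2}ss=> h; rewrite cnorm_star.
Qed.

End UnitaryTrick.

Section FaithfulTrace.
Variables (tau : {scalar A}) (tauP : faithful_tracial_state tau).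

Definition tip_ (x y : A) : C := tau (star x * y).
Definition tnrm (x : A) : R := nrm tip_ x.

Lemma tauZ c x : tau (c *: x) = c * tau x.
exact: linearZ. Qed.

Lemma tau1 : tau 1 = 1. by case: tauP. Qed.
Lemma tauC x y : tau (x * y) = tau (y * x). by case: tauP. Qed.

(** Positivity makes the trace real on [star z * z]; [z = 1 + x] gives the imaginary part of the
    identity and [z = 1 + i x] the real part. *)
Lemma tau_star x : tau (star x) = conjc (tau x).
have [_ ge _ _] := tauP.
have im z : complex.Im (tau (star z * z)) = 0.
  by have := ge z; rewrite lecE /= => /andP[/eqP -> _].
have h1 := im (1 + x); have h2 := im (1 + 'i%C *: x).
move: h1 h2; rewrite !starD !star1 starJ.
rewrite !(mulrDl, mulrDr, mul1r, mulr1) -!scalerAl -!scalerAr !linearD !tauZ tau1.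
have := im x; case: (tau (star x * x))=> a b /= ->.
case: (tau (star x))=> c d /=; case: (tau x)=> e f /=.
move=> h1 h2; apply/eqP; rewrite eq_complex /=; apply/andP; split; apply/eqP; lra.
Qed.

Lemma tip_P : is_sip tip_.
split; rewrite /tip_.
- by move=> u v w; rewrite mulrDr linearD.
- by move=> u a v; rewrite -scalerAr tauZ.
- by move=> u v; rewrite -tau_star starM starK.
- by move=> v; have [_ ge _ _] := tauP; have := ge v; rewrite lecE /= => /andP[].
Qed.

Lemma tnrm_ge0 x : 0 <= tnrm x. exact: nrm_ge0. Qed.

Lemma tnrm_sqr x : tnrm x ^+ 2 = cRe (tau (star x * x)).
exact: (nrm_sqr tip_P). Qed.

Lemma tnrm_eq0 x : tnrm x = 0 -> x = 0.
move=> x0; have [_ _ _ f] := tauP; apply: f.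
by rewrite -/(tip_ x x) (ip_self tip_P) -(nrm_sqr tip_P) -/(tnrm x) x0 expr0n.
Qed.

Lemma tnrm_star x : tnrm (star x) = tnrm x.
by rewrite /tnrm /nrm /n2 /tip_ starK tauC. Qed.

(** For a contraction [z], [1 - star z * z] is the square of a self-adjoint [s], and the squared
    norm lost by [z] on [y] is that of [s * y]. *)
Lemma tnrmM x y : tnrm (x * y) <= cnorm x * tnrm y.
have key z : cnorm z <= 1 -> tnrm (z * y) <= tnrm y.
  move=> z1. have zz1 : cnorm (star z * z) <= 1 by rewrite cnorm_star expr_le1 ?cnorm_ge0.
  have [|s [ss s2 _ _]] := cstar_sqrt zz1; first by rewrite starM starK.
  rewrite -le_sq ?tnrm_ge0 // !tnrm_sqr -subr_ge0 -ReN -ReD -linearN -linearD.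
  rewrite (_ : _ - _ = star (s * y) * (s * y)); last first.
    by rewrite !starM ss !mulrA -(mulrA (star y) s s) s2; ncexpand.
  by rewrite -tnrm_sqr sqr_ge0.
have [x0|xp] := leP (cnorm x) 0.
  have -> : x = 0 by apply: cnorm_eq0; apply/eqP; rewrite eq_le x0 cnorm_ge0.
  by rewrite mul0r cnorm0 mul0r /tnrm nrm0 //; exact: tip_P.
have := key ((cnorm x)^-1%:C *: x).
rewrite cnorm_real gtr0_norm ?invr_gt0 // mulVf ?gt_eqF // lexx=> /(_ isT).
rewrite -scalerAl /tnrm (nrmZ tip_P) normcR gtr0_norm ?invr_gt0 //.
by rewrite ler_pdivrMl.
Qed.

Lemma tau_le x : normc (tau x) <= cnorm x.
have := CS tip_P 1 x; rewrite /tip_ star1 mul1r=> h.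
apply: letr h _; rewrite -/(tnrm x) -/(tnrm 1).
have t1 : tnrm 1 = 1 by rewrite /tnrm /nrm /n2 /tip_ star1 mulr1 tau1 sqrtr1.
by rewrite t1 mul1r; have := tnrmM x 1; rewrite !mulr1 t1 mulr1.
Qed.

(** A spectral argument carried out with square roots only. With [k] proportional to [g^2 - rho^2]
    and [m = |k|], the element [z = m + k] is twice the positive part of [k]. The hypothesis at [z]
    makes [tau (z k z)] nonpositive, yet it equals [tau (z m z)]; hence [z = 0], [k = - m], and
    [cnorm_sum_squares] concludes. *)
Lemma selfadjoint_norm (g : A) (rho : R) : star g = g -> 0 <= rho ->
  (forall z, tnrm (g * z) <= rho * tnrm z) -> cnorm g <= rho.
move=> gs r0 gz.
(* Normalization that makes [k] a contraction; the 1 keeps [M] positive. *)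
pose M := cnorm (g * g) + rho ^+ 2 + 1.
have M0 : 0 < M by rewrite ltr_wpDl // addr_ge0 ?cnorm_ge0 ?sqr_ge0.
pose k : A := (M^-1)%:C *: (g * g - (rho ^+ 2)%:C *: 1).
have ks : star k = k.
  by rewrite /k starJ conjcR starB starM starJ conjcR star1 gs.
have k1 : cnorm k <= 1.
  rewrite /k cnorm_real gtr0_norm ?invr_gt0 // ler_pdivrMl // mulr1.
  apply: letr (cnormD _ _) _; rewrite cnormN cnorm_real cnorm1 mulr1 ger0_norm ?sqr_ge0 //. by rewrite /M lerDl.
have kk1 := cnorm_1_sub_sqr ks k1.
(* [m] is the absolute value of [k], and [n] below is its square root; [m1], a bound on [1 - m], is
   what the second extraction requires. *)
have [|m [ms m2 m1 mc]] := cstar_sqrt kk1; first by rewrite starB star1 starM ks.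
rewrite subKr in m2.
have [|n [ns n2 _ nc]] := cstar_sqrt m1; first by rewrite starB star1 ms.
rewrite subKr in n2.
have kx y : y * k = k * y -> y * (1 - k * k) = (1 - k * k) * y.
  by move=> yk; rewrite mulrBr mulrBl mulr1 mul1r mulrA yk -mulrA yk mulrA.
have my y : y * k = k * y -> y * m = m * y by move=> /kx; exact: mc.
have mx y : y * m = m * y -> y * (1 - m) = (1 - m) * y.
  by move=> ym; rewrite mulrBr mulrBl mulr1 mul1r ym.
have ny y : y * k = k * y -> y * n = n * y by move=> /my /mx; exact: nc.
have km : k * m = m * k by apply: my.
have gk : g * k = k * g.
  by rewrite /k -scalerAr -scalerAl mulrBr mulrBl mulrA -scalerAr -scalerAl mulr1 mul1r.
pose z := m + k.
have zs : star z = z by rewrite /z starD ms ks.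
have z2m : z * z = 2%:R *: (m * z).
  have gen (a b : A) : b * b = a * a -> a * b = b * a -> (b + a) * (b + a) = 2%:R *: (b * (b + a)).
    by move=> bb ab; ncexpand; rewrite bb ab; lmodule R A.
  exact: gen.
have kz : k * z = m * z.
  by rewrite /z !mulrDr m2 km addrC.
have neg : cRe (tau (star z * (k * z))) <= 0.
  rewrite /k -!(scalerAl, scalerAr) tauZ Re_realM pmulr_rle0 ?invr_gt0 //.
  rewrite mulrBl mulrBr linearB /= -scalerAl mul1r -scalerAr tauZ ReD ReN Re_realM subr_le0.
  have : tnrm (g * z) ^+ 2 <= (rho * tnrm z) ^+ 2.
    by rewrite le_sq ?mulr_ge0 ?tnrm_ge0.
  by rewrite exprMn !tnrm_sqr starM gs !mulrA.
have nz : n * z = 0.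
  apply: tnrm_eq0; apply/eqP; rewrite -sqrf_eq0 eq_le sqr_ge0 andbT tnrm_sqr.
  by rewrite starM ns -!mulrA (mulrA n n) n2 -kz.
have mz : m * z = 0 by rewrite -n2 -mulrA nz mulr0.
have zz : z = 0.
  apply: cnorm_eq0; apply/eqP; rewrite -sqrf_eq0 -cnorm_star zs z2m mz scaler0. by rewrite cnorm0.
have ke : k = - (n * n) by rewrite n2; apply/eqP; rewrite -addr_eq0 addrC -/z zz.
have sM : 0 <= sqrt M by exact: sqrtr_ge0.
rewrite -le_sq ?cnorm_ge0 //.
apply: (@cnorm_sum_squares g ((sqrt M)%:C *: n))=> //.
- exact: sqr_ge0.
- by rewrite starJ conjcR ns.
- by rewrite -scalerAr -scalerAl ny.
have -> : (sqrt M)%:C *: n * ((sqrt M)%:C *: n) = M%:C *: (n * n).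
  have gen (c : R) (a : A) : 0 < c -> (sqrt c)%:C *: a * ((sqrt c)%:C *: a) = c%:C *: (a * a).
    by move=> c0; rewrite -scalerAr -scalerAl scalerA -realcM -expr2 sqr_sqrtr // ltW.
  exact: gen.
have -> : n * n = - k by rewrite ke opprK.
rewrite /k scalerN scalerA -realcM divff ?gt_eqF // scale1r.
by rewrite opprB addrC subrK.
Qed.

(* The norm of a C*-algebra is the operator norm in the GNS representation of a
   faithful trace. *)
Lemma cnorm_le_tnrm (b : A) (rho : R) : 0 <= rho ->
  (forall z, tnrm (b * z) <= rho * tnrm z) -> cnorm b <= rho.
move=> r0 bz; rewrite -le_sq ?cnorm_ge0 // -cnorm_star.
apply: selfadjoint_norm; rewrite ?sqr_ge0 //; first by rewrite starM starK.
move=> z; apply: (nrm_form tip_P); first by rewrite mulr_ge0 ?sqr_ge0 ?tnrm_ge0.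
have -> : tip_ (star b * b * z) (star b * b * z) = tip_ (b * (star b * b * z)) (b * z).
  by rewrite /tip_ !starM !starK !mulrA.
apply: letr (Re_normc _) _; apply: letr (CS tip_P _ _) _.
rewrite -!/(tnrm _) (_ : _ * _ * _ = rho * tnrm (star b * b * z) * (rho * tnrm z)); last by ring.
by apply: ler_pM; rewrite ?tnrm_ge0.
Qed.

Lemma cnorm_le_form (b : A) (rho : R) : 0 <= rho ->
  (forall c d, normc (tau (star c * b * d)) <= rho * (tnrm c * tnrm d)) ->
  cnorm b <= rho.
move=> r0 h; apply: cnorm_le_tnrm=> // z.
apply: (nrm_form tip_P); first by rewrite mulr_ge0 ?tnrm_ge0.
apply: letr (Re_normc _) _.
rewrite /tip_ mulrA; apply: letr (h _ _) _.
by rewrite -mulrA [X in _ * X]mulrC.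
Qed.

End FaithfulTrace.
End CStar.

(** * Operations on noncommutative polynomials *)

Section NcPoly.
Variables (I : Type).
Implicit Types p q : ncpoly R I.

Definition ncconst (c : C) : ncpoly R I := [:: (c, [::])].
Definition ncvar (i : I) : ncpoly R I := [:: (1, [:: (i, false)])].
Definition ncscale (c : C) p : ncpoly R I := [seq (c * m.1, m.2) | m <- p].
Definition ncmul p q : ncpoly R I := [seq (m.1 * n.1, m.2 ++ n.2) | m <- p, n <- q].
Definition ncstar p : ncpoly R I :=
  [seq (conjc m.1, rev [seq (l.1, ~~ l.2) | l <- m.2]) | m <- p].

Section Eval.
Variables (A : starAlgType R) (x : I -> A).

Definition ncletter (l : I * bool) : A := if l.2 then star (x l.1) else x l.1.

Lemma nce_const c : nceval (ncconst c) x = c *: 1.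
by rewrite /nceval /ncconst big_seq1 big_nil. Qed.

Lemma nce_var i : nceval (ncvar i) x = x i.
by rewrite /nceval /ncvar !big_seq1 scale1r. Qed.

Lemma nce_add p q : nceval (p ++ q) x = nceval p x + nceval q x.
exact: big_cat. Qed.

Lemma nce_cons m p : nceval (m :: p) x = m.1 *: \prod_(l <- m.2) ncletter l + nceval p x.
exact: big_cons. Qed.

Lemma nce_nil : nceval [::] x = 0.
exact: big_nil. Qed.

Lemma nce_scale c p : nceval (ncscale c p) x = c *: nceval p x.
by rewrite /nceval /ncscale big_map scaler_sumr; eqr=> m _; rewrite scalerA.
Qed.

Lemma nce_flatten (s : seq (ncpoly R I)) :
  nceval (flatten s) x = \sum_(p <- s) nceval p x.
by elim: s=> [|p s IH]; rewrite ?big_nil ?nce_nil //= nce_add IH big_cons.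
Qed.

Lemma nce_mul p q : nceval (ncmul p q) x = nceval p x * nceval q x.
elim: p=> [|m p IH]; first by rewrite /ncmul /= nce_nil mul0r.
rewrite [ncmul _ _]/= nce_add nce_cons mulrDl; congr (_ + _); last exact: IH.
rewrite /nceval big_map mulr_sumr; eqr=> n _ /=.
by rewrite big_cat /= -!scalerAl -scalerAr scalerA.
Qed.

Lemma star_s0 : star (0 : A) = 0.
apply: (addrI (star 0)); rewrite -starD !addr0; reflexivity.
Qed.

Lemma star_s1 : star (1 : A) = 1.
by rewrite -[star 1]mulr1 -{2}[1]starK -starM mulr1 starK.
Qed.

Lemma star_prod (w : seq (I * bool)) :
  star (\prod_(l <- w) ncletter l) = \prod_(l <- rev [seq (l.1, ~~ l.2) | l <- w]) ncletter l.
elim: w=> [|l w IH]; first by rewrite !big_nil star_s1.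
rewrite big_cons starM IH /= rev_cons -cats1 big_cat big_seq1 /ncletter.
by congr (_ * _); case: l=> i [] /=; rewrite ?starK.
Qed.

Lemma nce_star p : nceval (ncstar p) x = star (nceval p x).
rewrite /nceval big_map (big_morph (@star R A) (id1 := 0) (op1 := +%R)) ?star_s0 //.
  by eqr=> m _; rewrite starZ -star_prod.
exact: starD.
Qed.

End Eval.

End NcPoly.

Section StarGen.
Variables (A : cstarAlgType R) (x : A).
Lemma star_gen1 : star_gen x 1.
by exists (ncconst unit 1)=> //; rewrite nce_const scale1r. Qed.
Lemma star_genD g h : star_gen x g -> star_gen x h -> star_gen x (g + h).
by move=> [p _ <-] [q _ <-]; exists (p ++ q)=> //; rewrite nce_add. Qed.
Lemma star_genZ c g : star_gen x g -> star_gen x (c *: g).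
by move=> [p _ <-]; exists (ncscale c p)=> //; rewrite nce_scale. Qed.
Lemma star_genM g h : star_gen x g -> star_gen x h -> star_gen x (g * h).
by move=> [p _ <-] [q _ <-]; exists (ncmul p q)=> //; rewrite nce_mul. Qed.
Lemma star_gen_star g : star_gen x g -> star_gen x (star g).
by move=> [p _ <-]; exists (ncstar p)=> //; rewrite nce_star. Qed.
Lemma star_gen_self : star_gen x x.
by exists (ncvar tt)=> //; rewrite nce_var. Qed.
End StarGen.

(** * Moments of the semicircle law *)

Section Semicircle.
Notation lm := (@lebesgue_measure R).

Definition sc_mom (k : nat) : R :=
  \int[lm]_(t in `[(-2 : R), 2]) (t ^+ k * (sqrt (4 - t ^+ 2) / (2 * pi))).

Let w (t : R) : R := sqrt (4 - t ^+ 2) / (2 * pi).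
Let F (j : nat) (t : R) : R := t ^+ j * ((4 - t ^+ 2) * w t).
Let f (j : nat) (t : R) : R := (4 * j%:R) * (t ^+ j.-1 * w t) - (j + 3)%:R * (t ^+ j.+1 * w t).

Let cont_pow k : continuous (fun t : R=> t ^+ k).
by move=> t; exact: exprn_continuous. Qed.

Let cont_q : continuous (fun t : R=> 4 - t ^+ 2).
by move=> t; apply: cvgB; [exact: cvg_cst|exact: cont_pow]. Qed.

Let cont_w : continuous w.
move=> t; apply: cvgM; last exact: cvg_cst.
by apply: (continuous_comp (f := fun t : R=> 4 - t ^+ 2)); [exact: cont_q|exact: sqrt_continuous].
Qed.

Let cont_tw k : continuous (fun t : R=> t ^+ k * w t).
by move=> t; apply: cvgM; [exact: cont_pow|exact: cont_w]. Qed.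

Let cont_f j : continuous (f j).
by move=> t; apply: cvgB; apply: cvgM; try exact: cvg_cst; exact: cont_tw.
Qed.

Let cont_F j : continuous (F j).
move=> t; apply: cvgM; first exact: cont_pow.
by apply: cvgM; [exact: cont_q|exact: cont_w].
Qed.

Let deriv_F j (t : R) : -2 < t < 2 -> is_derive t (1 : R) (F j) (f j t).
move=> /andP[t1 t2].
have q0 : 0 < 4 - t ^+ 2 by nra.
have dX k : is_derive t (1 : R) (fun t : R=> t ^+ k) (k%:R * t ^+ k.-1).
  rewrite (_ : (fun t : R=> t ^+ k) = (@idfun R) ^+ k); last by apply/funext=> s; rewrite fctE.
  have h := @is_deriveX R R (@idfun R) k t 1 1 (is_derive_id t 1); apply: is_derive_eq.
  by rewrite /GRing.scale /= mulr1.
have dq : is_derive t (1 : R) (fun t : R=> 4 - t ^+ 2) (- (2 * t)).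
  rewrite (_ : (fun t : R=> 4 - t ^+ 2) = (cst (4 : R)) - (fun t : R=> t ^+ 2)) //.
  have h := is_deriveB (is_derive_cst (4 : R) t 1) (dX 2%N); apply: is_derive_eq. by rewrite sub0r expr1.
have ds := @is_derive1_comp _ sqrt (fun t : R=> 4 - t ^+ 2) t _ _ (is_derive1_sqrt q0) dq.
have dw : is_derive t (1 : R) w ((2 * pi)^-1 * ((2 * sqrt (4 - t ^+ 2))^-1 * - (2 * t))).
  rewrite (_ : w = (2 * pi)^-1 \*: (sqrt \o (fun t : R=> 4 - t ^+ 2))); last first.
    by apply/funext=> s; rewrite /w /GRing.scale /= mulrC.
  exact: is_deriveZ.
have dqw := is_deriveM dq dw.
have dp := dX j.
have h := is_deriveM dp dqw.
rewrite (_ : F j = (fun t : R=> t ^+ j) * ((fun t : R=> 4 - t ^+ 2) * w)) //.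
apply: is_derive_eq.
rewrite (_ : ((fun t : R=> 4 - t ^+ 2) * w) t = (4 - t ^+ 2) * w t) //.
rewrite /f /w /GRing.scale /= {h dp dqw dw ds}.
set s := sqrt _.
have s0 : s != 0 by rewrite gt_eqF // sqrtr_gt0.
have ss : 4 - t ^+ 2 = s ^+ 2 by rewrite sqr_sqrtr // ltW.
have t2s : s ^+ 2 = 4 - t ^+ 2 by rewrite ss.
have pi0 : (pi : R) != 0 by rewrite gt_eqF // pi_gt0.
rewrite ss.
transitivity ((- t ^+ j.+1 * s + (- t ^+ j.+1 * 2 * s + s ^+ 2 * s * (j%:R * t ^+ j.-1))) / (2 * pi)).
  by move: (pi : R) pi0=> p p0; rewrite (exprS t); field; rewrite s0 p0.
rewrite t2s; case: j=> [|j] /=; move: (pi : R) pi0=> p p0; first by field.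
by rewrite natrD !(exprS t); field.
Qed.

Let int_cont (g : R -> R) : continuous g -> lm.-integrable `[(-2 : R), 2] (EFin \o g).
move=> cg; apply: continuous_compact_integrable; first exact: segment_compact.
exact: continuous_subspaceT.
Qed.

Let int_tw k : lm.-integrable `[(-2 : R), 2] (EFin \o (fun t=> t ^+ k * w t)).
by apply: int_cont; exact: cont_tw. Qed.

(** Integral of the derivative of [t^j (4 - t^2)^(3/2) / (2 pi)], which vanishes at both endpoints.
    At [j = 0] it says that the first moment is 0. *)
Lemma sc_momSS j :
  (4 * j%:R) * sc_mom j.-1 = (j + 3)%:R * sc_mom j.+1.
have lt22 : (-2 : R) < 2 by lra.
have := @continuous_FTC2 R (f j) (F j) (-2) 2 lt22.
rewrite /F sqrrN (_ : 4 - 2 ^+ 2 = 0 :> R); last by ring.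
rewrite !mul0r !mulr0 -/(F j)=> /(_ _ _ _) H.
have {}H : (\int[lm]_(x in `[(-2)%R, 2%R]) (f j x)%:E = 0)%E.
  rewrite H ?subee //.
  - by apply: continuous_subspaceT; exact: cont_f.
  - split; last 2 first.
    + by apply: cvg_at_right_filter; exact: cont_F.
    + by apply: cvg_at_left_filter; exact: cont_F. by move=> x; rewrite in_itv /= => /(@deriv_F j) [].
  - move=> x; rewrite in_itv /= => /(@deriv_F j) [_ <-].
    by rewrite derive1E.
have : \int[lm]_(x in `[(-2 : R), 2]) f j x = 0 by rewrite /Rintegral H.
rewrite /f RintegralB //; first last.
- by apply: int_cont=> t; apply: cvgM; [exact: cvg_cst|exact: cont_tw].
- by apply: int_cont=> t; apply: cvgM; [exact: cvg_cst|exact: cont_tw].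
rewrite !RintegralZl //; try exact: int_tw.
by move/eqP; rewrite subr_eq0=> /eqP.
Qed.

(** The Catalan recursion follows from the linear one: by symmetry the index [i] may be replaced by
    [k / 2] inside the convolution [T k], and [(k + 4) T k] then reduces to [T (k - 2)]. The
    normalization is supplied later by [tau 1 = 1] rather than by computing an integral. *)
Lemma sc_conv k : sc_mom 0 = 1 ->
  \sum_(i < k.+1) sc_mom i * sc_mom (k - i) = sc_mom k.+2.
move=> m0; set m := sc_mom.
have rec j : (4 * j.+1%:R) * m j = (j.+1 + 3)%:R * m j.+2 by exact: (sc_momSS j.+1).
have m1 : m 1%N = 0.
  have := sc_momSS 0; rewrite mulr0 mul0r=> /eqP; rewrite eq_sym mulf_eq0.
  by rewrite pnatr_eq0=> /orP[//|/eqP].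
pose T k := \sum_(i < k.+1) m i * m (k - i)%N.
have sym k' : 2 * (\sum_(i < k'.+1) (i%:R * (m i * m (k' - i)%N))) = k'%:R * T k'.
  have e : \sum_(i < k'.+1) (i%:R * (m i * m (k' - i)%N)) = \sum_(i < k'.+1) ((k' - i)%:R * (m i * m (k' - i)%N)).
    rewrite (reindex_inj rev_ord_inj) /=; eqr=> i _. by rewrite subSS subKn ?(mulrC (m i)) // -ltnS.
  rewrite -[2]/(1 + 1) mulrDl mul1r {2}e -big_split mulr_sumr; eqr=> i _ /=.
  rewrite -mulrDl -natrD subnKC // -ltnS //.
rewrite -/(T k); elim/ltn_ind: k=> k IH.
suff : (k + 4)%:R * T k = (4 * k.+1%:R) * m k.
  rewrite rec addSnnS=> /mulfI; apply; by rewrite pnatr_eq0 addnS.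
(* The weight [i + 2] is the factor with which [rec] turns the moment of index [i] into the one of
   index [i - 2]. *)
have e2 : (k + 4)%:R * T k = 2 * \sum_(i < k.+1) ((i + 2)%:R * (m i * m (k - i)%N)).
  under [in RHS]eq_bigr do rewrite natrD mulrDl. by rewrite big_split mulrDr sym -mulr_sumr -/(T k) natrD; ring.
rewrite e2 big_ord_recl subn0 -[m 0%N]/(sc_mom 0) m0 mul1r.
case: k IH {e2} => [|k] IH; first by rewrite big_ord0 addr0 /=; ring.
rewrite big_ord_recl m1 !(mul0r, mulr0) add0r.
case: k IH=> [|k] IH; first by rewrite big_ord0 m1 !mulr0 addr0 mulr0.
have -> : \sum_(i < k.+1) (bump 0 (bump 0 i) + 2)%:R * (m (bump 0 (bump 0 i)) * m (k.+2 - bump 0 (bump 0 i))%N) = \sum_(i < k.+1) 4 * ((i%:R + 1) * (m i * m (k - i)%N)).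
  eqr=> i _; rewrite /bump /= !add1n !subSS mulrA. have := rec i; rewrite (_ : (i.+1 + 3 = i.+2 + 2)%N); last by lia.
  by move=> <-; rewrite -natr1; ring.
rewrite -mulr_sumr.
under eq_bigr do rewrite mulrDl mul1r.
rewrite big_split /= -/(T k) mulrDr.
have := sym k; rewrite (IH k) //; set X := \sum_(_ < _) _=> h.
transitivity (4 * m k.+2 + 4 * (2 * X) + 8 * m k.+2); first by rewrite /= add0n; ring.
by rewrite h -[k.+3]addn3 natrD; ring.
Qed.
End Semicircle.

(** * Freeness and the Schwinger-Dyson equation *)

Section Freeness.
Variables (A : cstarAlgType R) (tau : {scalar A}).
Variables (tauP : faithful_tracial_state tau) (I : eqType) (D : set I) (S : I -> set A)
  (fr : free_family tau D S) (S1 : forall i, D i -> S i 1)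
  (SD : forall i g h, D i -> S i g -> S i h -> S i (g + h)) (SZ : forall i c g, D i -> S i g -> S i (c *: g))
  (SM : forall i g h, D i -> S i g -> S i h -> S i (g * h)).
Let tauZ c x : tau (c *: x) = c * tau x := tauZ tau c x.
Let tau1 : tau 1 = 1 := tau1 tauP.

Lemma free_sub i g t : D i -> S i g -> S i (g - t *: 1).
by move=> Di Sg; have := SD Di Sg (SZ (- t) Di (S1 Di)); rewrite scaleNr.
Qed.

Inductive alternating : I -> A -> Prop :=
  | alternating1 i g : D i -> S i g -> tau g = 0 -> alternating i g
  | alternatingM j a i g : alternating j a -> j != i ->
      D i -> S i g -> tau g = 0 -> alternating i (a * g).

Lemma alternating_tau0 i a : alternating i a -> tau a = 0.
suff : alternating i a -> exists x p,
   [/\ a = \prod_(t <- x :: p) t.2, path (fun i j=> i != j) x.1 [seq t.1 | t <- p], last x.1 [seq t.1 | t <- p] = i &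
     forall k, (k < (size p).+1)%N -> let t := nth x (x :: p) k in [/\ D t.1, S t.1 t.2 & tau t.2 = 0]].
  move=> h /h [x [p [-> pp _ H]]].
  by apply: (fr (s := x :: p))=> // k /=; rewrite (tnth_nth x); apply: H; exact: ltn_ord.
elim=> [{}i g Di Sg tg|j {}a {}i g _ [x [p [-> pp lp H]]] ji Di Sg tg].
  by exists (i, g), [::]; split; rewrite //= ?big_seq1 // => -[|k].
exists x, (rcons p (i, g)); split.
- by rewrite -rcons_cons -cats1 big_cat big_seq1.
- by rewrite map_rcons rcons_path pp lp.
- by rewrite map_rcons last_rcons.
move=> k; rewrite size_rcons ltnS leq_eqVlt=> /orP[/eqP ->|kp].
  by rewrite -rcons_cons nth_rcons /= ltnn eqxx.
rewrite -rcons_cons nth_rcons kp; exact: H.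
Qed.

Lemma alternating_mul0 j a i g : alternating j a -> j != i -> D i -> S i g -> tau (a * g) = 0.
move=> aj ji Di Sg.
have -> : a * g = a * (g - tau g *: 1) + tau g *: a.
  by rewrite mulrBr -scalerAr mulr1 subrK.
rewrite linearD tauZ (alternating_tau0 aj) mulr0 addr0.
apply: (alternating_tau0 (i := i)); apply: (alternatingM aj ji Di).
  exact: free_sub.
by rewrite linearB /= tauZ tau1 mulr1 subrr.
Qed.

Variables (L : Type) (ix : L -> I) (ev : L -> A) (ixD : forall y, D (ix y)) (evS : forall y, S (ix y) (ev y)).

Definition wval (w : seq L) : A := \prod_(y <- w) ev y.

Lemma wval_cat u v : wval (u ++ v) = wval u * wval v.
exact: big_cat. Qed.
Lemma wval_cons y w : wval (y :: w) = ev y * wval w.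
exact: big_cons. Qed.

Variables (x : L) (kap : L -> C).

(** Free difference quotient of [w] followed by the trace on both legs: the sum over [w = w1 y w2]
    of [kap y * tau (a w1) * tau (w2 b)]. *)
Fixpoint wdel (a : A) (w : seq L) (b : A) : C :=
  if w is y :: w' then kap y * tau a * tau (wval w' * b) + wdel (a * ev y) w' b else 0.

Lemma wdel_cat a r w b : wdel a (r ++ w) b = wdel a r (wval w * b) + wdel (a * wval r) w b.
elim: r a=> [|y r IH] a /=; first by rewrite add0r /wval big_nil mulr1.
by rewrite IH addrA wval_cat wval_cons !mulrA.
Qed.

Lemma wdelDl a a' w b : wdel (a + a') w b = wdel a w b + wdel a' w b.
elim: w a a'=> [|y w IH] a a' /=; first by rewrite addr0.
by rewrite mulrDl IH linearD; ring.
Qed.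

Lemma wdelZl c a w b : wdel (c *: a) w b = c * wdel a w b.
elim: w a=> [|y w IH] a /=; first by rewrite mulr0.
by rewrite -(scalerAl c a (ev y)) IH tauZ; ring.
Qed.

Lemma wdelDr a w b b' : wdel a w (b + b') = wdel a w b + wdel a w b'.
elim: w a=> [|y w IH] a /=; first by rewrite addr0.
by rewrite mulrDr IH linearD; ring.
Qed.

Lemma wdelZr c a w b : wdel a w (c *: b) = c * wdel a w b.
elim: w a=> [|y w IH] a /=; first by rewrite mulr0.
by rewrite -(scalerAr c _ b) IH tauZ; ring.
Qed.

Variables (kap0 : forall y, ix y != ix x -> kap y = 0)
  (internal : forall w, all (fun y=> ix y == ix x) w -> tau (ev x * wval w) = wdel 1 w 1).

Let consis (l : seq (I * seq L)) :=
  all (fun t=> all (fun y=> ix y == t.1) t.2) l.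
Let flat (l : seq (I * seq L)) := flatten [seq t.2 | t <- l].
Let centred (w : seq L) : A := wval w - tau (wval w) *: 1.
Let cprA (l : seq (I * seq L)) : A := \prod_(t <- l) centred t.2.

(** The product of centred blocks as a combination of words: a block is kept or replaced by minus
    its trace, so every word but one has fewer blocks. *)
Fixpoint cprod (l : seq (I * seq L)) : seq (C * seq L) :=
  if l is t :: l' then
    [seq (q.1, t.2 ++ q.2) | q <- cprod l'] ++
    [seq (- tau (wval t.2) * q.1, q.2) | q <- cprod l']
  else [:: (1, [::])].

Lemma cprod_val l : \sum_(q <- cprod l) q.1 *: wval q.2 = cprA l.
elim: l=> [|[i r] l IH] /=; first by rewrite big_seq1 /cprA big_nil scale1r /wval big_nil.
rewrite big_cat !big_map /= /cprA big_cons -/(cprA l) -IH /centred /= mulrBl -scalerAl mul1r.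
rewrite mulr_sumr scaler_sumr -sumrB -big_split; eqr=> q _.
by rewrite wval_cat -scalerAr mulNr scaleNr scalerA.
Qed.

Lemma cprod_del l a i r :
  \sum_(q <- cprod ((i, r) :: l)) q.1 * wdel a q.2 1 =
  wdel a r (cprA l) + \sum_(q <- cprod l) q.1 * wdel (a * centred r) q.2 1.
rewrite /= big_cat !big_map /= -cprod_val.
have -> : wdel a r (\sum_(q <- cprod l) q.1 *: wval q.2) = \sum_(q <- cprod l) q.1 * wdel a r (wval q.2).
  elim: (cprod l)=> [|q s IH]; last by rewrite !big_cons wdelDr wdelZr IH.
  by rewrite !big_nil; have := wdelZr 0 a r 0; rewrite !scale0r mul0r.
rewrite -!big_split; eqr=> q _ /=.
have -> : a * centred r = a * wval r + (- tau (wval r)) *: a.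
  by rewrite /centred mulrBr -(scalerAr _ a 1) mulr1 scaleNr.
by rewrite wdel_cat mulr1 wdelDl wdelZl; ring.
Qed.

Lemma wval_S i r : D i -> all (fun y=> ix y == i) r -> S i (wval r).
move=> Di; elim: r=> [_|y r IH /= /andP[/eqP yi ri]]; first by rewrite /wval big_nil; apply: S1.
by rewrite wval_cons; apply: SM=> //; [rewrite -yi|exact: IH].
Qed.

Lemma centred_S i r : D i -> all (fun y=> ix y == i) r -> S i (centred r).
move=> Di ri; rewrite /centred -scaleNr.
by apply: SD=> //; [exact: wval_S|apply: SZ=> //; exact: S1].
Qed.

Lemma centred_tau r : tau (centred r) = 0.
by rewrite /centred linearB /= tauZ tau1 mulr1 subrr. Qed.

Let alt (l : seq (I * seq L)) := sorted (fun i j=> i != j) [seq t.1 | t <- l].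
Let inD (l : seq (I * seq L)) := forall i, i \in [seq t.1 | t <- l] -> D i.

Lemma alternating_cprod j a l : alternating j a -> consis l -> inD l ->
  path (fun i j=> i != j) j [seq t.1 | t <- l] -> tau (a * cprA l) = 0.
elim: l j a=> [|[i r] l IH] j a aj /= cl Dl pl.
  by rewrite /cprA big_nil mulr1 (alternating_tau0 aj).
case/andP: cl=> ri cl; case/andP: pl=> ji pl.
have Di : D i by apply: Dl; rewrite inE eqxx.
rewrite /cprA big_cons mulrA; apply: (IH i)=> //.
  exact: (alternatingM aj ji Di (centred_S Di ri) (centred_tau _)).
by move=> k kl; apply: Dl; rewrite inE kl orbT.
Qed.

(** A contracted letter leaves on its left an alternating product times an element of one further
    algebra, and such a trace is 0 even if the last element is not centred. *)
Lemma cprod_del_alternating j a l : alternating j a -> consis l -> inD l ->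
  path (fun i j=> i != j) j [seq t.1 | t <- l] ->
  \sum_(q <- cprod l) q.1 * wdel a q.2 1 = 0.
elim: l j a=> [|[i r] l IH] j a aj cl Dl pl; first by rewrite big_seq1 mulr0.
case/andP: cl=> ri cl; case/andP: pl=> ji pl.
have Di : D i by apply: Dl; rewrite inE eqxx.
rewrite cprod_del (IH i) ?addr0 //; last 2 first.
- exact: (alternatingM aj ji Di (centred_S Di ri) (centred_tau _)).
- by move=> k kl; apply: Dl; rewrite inE kl orbT.
rewrite -[a]mulr1; move: (S1 Di) ri; move: 1 (cprA l)=> /=.
rewrite /= in ji pl.
elim: r {Dl} => [//|y r IHr] g b Sg /= /andP[/eqP yi ri].
rewrite (alternating_mul0 aj ji Di Sg) mulr0 mul0r add0r -mulrA.
by apply: IHr=> //; apply: SM=> //; rewrite -yi.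
Qed.

(** Without blocks both sides are 0. If the first block avoids the algebra of [x], the left side is
    an alternating trace, and [kap0] and [cprod_del_alternating] kill the right side. A single block
    in the algebra of [x] is [internal]. Otherwise every trace contains the remaining centred blocks
    preceded by one element of the algebra of [x], and vanishes. *)
Lemma schwinger_dyson_cprod l : consis l -> inD l -> alt l ->
  tau (ev x * cprA l) = \sum_(q <- cprod l) q.1 * wdel 1 q.2 1.
have evx0 : tau (ev x) = 0 by rewrite -[ev x]mulr1; have := internal (w := [::]) isT; rewrite /wval big_nil.
have Ax : alternating (ix x) (ev x) by apply: alternating1.
case: l=> [|[i r] l] cl Dl al.
  by rewrite big_seq1 mulr0 /cprA big_nil mulr1.
case/andP: (cl)=> ri cl'.
have Di : D i by apply: Dl; rewrite inE eqxx.
have Dl' : inD l by move=> k kl; apply: Dl; rewrite inE kl orbT.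
rewrite cprod_del mul1r.
rewrite (@cprod_del_alternating i) ?addr0 //; last first.
  exact: (alternating1 _ (centred_S _ _) (centred_tau _)).
have [ix_i|ix_i] := eqVneq i (ix x); last first.
  rewrite (alternating_cprod Ax) //=; last by rewrite eq_sym ix_i.
  move: ri; move: 1 (cprA l); elim: r {cl Dl al} => [//|y r IHr] g b /= /andP[/eqP yi ri].
  by rewrite kap0 ?yi // !mul0r add0r -IHr.
case: l cl' al Dl' {cl Dl} => [|t l] cl al Dl.
  rewrite /cprA big_seq1 big_nil /centred mulrBr linearB /= -scalerAr tauZ mulr1 evx0 mulr0 subr0.
  by apply: internal; rewrite -ix_i.
have al1 g : S i g -> tau (g * cprA (t :: l)) = 0.
  have Dt : D t.1 by apply: Dl; rewrite inE eqxx. have P0 : tau (cprA (t :: l)) = 0.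
    rewrite /cprA big_cons; case/andP: (cl)=> tt cl'. apply: (@alternating_cprod t.1)=> //.
      exact: (alternating1 _ (centred_S _ _) (centred_tau _)). by move=> k kl; apply: Dl; rewrite inE kl orbT.
    by case/andP: al.
  move=> Sg; have -> : g = (g - tau g *: 1) + tau g *: 1 by rewrite subrK.
  rewrite mulrDl linearD -scalerAl mul1r tauZ P0 mulr0 addr0. apply: (@alternating_cprod i)=> //.
  apply: alternating1=> //; last by rewrite linearB /= tauZ tau1 mulr1 subrr. exact: free_sub.
rewrite /cprA big_cons mulrA -/(cprA _) al1; last first.
  by apply: SM=> //; [rewrite ix_i|exact: centred_S].
move: ri; move: 1; elim: r {al} => [//|y r IHr] g /= /andP[/eqP yi ri].
by rewrite al1 ?mulr0 ?add0r -?IHr //; exact: wval_S.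
Qed.

(** Freeness propagates the equation from the algebra of [x] to all words, by induction on the
    number of blocks. For alternating blocks the defect [E] vanishes on the product of the centred
    blocks and, by induction, on the shorter words of its expansion; other words have blocks that
    can be merged. *)
Lemma schwinger_dyson w : tau (ev x * wval w) = wdel 1 w 1.
pose E w := tau (ev x * wval w) - wdel 1 w 1.
suff H l : consis l -> inD l -> E (flat l) = 0.
  apply/eqP; rewrite -subr_eq0 -/(E w); apply/eqP. have -> : w = flat [seq (ix y, [:: y]) | y <- w].
    by rewrite /flat -map_comp; elim: w=> //= y w {1}->.
  apply: H.
    by rewrite /consis; elim: w=> //= y w ->; rewrite eqxx.
  by move=> i; elim: w=> //= y w IHw; rewrite inE=> /orP[/eqP -> //|].
have [n] := ubnP (size l); elim: n l=> // n IH l sl cl Dl.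
have [al|] := boolP (alt l).
  have : \sum_(q <- cprod l) q.1 * E q.2 = 0.
    transitivity (tau (ev x * cprA l) - \sum_(q <- cprod l) q.1 * wdel 1 q.2 1).
      rewrite -cprod_val mulr_sumr linear_sum -sumrB; eqr=> q _. by rewrite -scalerAr tauZ mulrBr.
    by rewrite schwinger_dyson_cprod // subrr.
  (* Blocks are peeled off one at a time: the terms in which a block is replaced by its trace have
     fewer blocks and drop out. *)
  suff gen pre : (forall l', consis l' -> inD l' -> (size l' < size l)%N -> E (pre ++ flat l') = 0) ->
      \sum_(q <- cprod l) q.1 * E (pre ++ q.2) = E (pre ++ flat l).
    rewrite (gen [::]) // => l' cl' Dl' sl'; apply: IH=> //. exact: leq_trans sl' _.
  move: pre cl Dl; clear -kap. elim: l=> [|[i r] l IHl] pre cl Dl H /=.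
    by rewrite big_seq1 mul1r.
  have Dl' : inD l by move=> k kl; apply: Dl; rewrite inE kl orbT. have Di : D i by apply: Dl; rewrite inE eqxx.
  case/andP: cl=> ri cl. rewrite big_cat !big_map /=. under eq_bigr do rewrite catA. rewrite IHl //; last first.
    move=> l' cl' Dll' sl'; rewrite -catA; apply: (H ((i, r) :: l'))=> //=.
      by apply/andP; split.
    by move=> k; rewrite inE=> /orP[/eqP -> //|]; exact: Dll'.
  under [X in _ + X]eq_bigr do rewrite -mulrA.
  rewrite -mulr_sumr IHl //; last by move=> l' cl' Dll' sl'; apply: H=> //; exact: ltnW.
  by rewrite (H l) // mulr0 addr0 catA.
move=> nal.
(* Two neighbours with the same index; merging them leaves the word unchanged and lowers the number
   of blocks. *)
have [l1 [i [r [r' [l2 e]]]]] : exists l1 i r r' l2, l = l1 ++ [:: (i, r), (i, r') & l2].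
  move: nal; rewrite /alt; clear; elim: l=> [//|[i r] [//|[j r'] l] IH] /=.
  rewrite negb_and negbK=> /orP[/eqP ->|/IH [l1 [k [s [s' [l2 ->]]]]]].
    by exists [::], j, r, r', l.
  by exists ((i, r) :: l1), k, s, s', l2.
have -> : flat l = flat (l1 ++ (i, r ++ r') :: l2).
  by rewrite e /flat !map_cat !flatten_cat /= -!catA.
apply: IH.
- by move: sl; rewrite e !size_cat /=; lia.
- by move: cl; rewrite e /consis !all_cat /= all_cat=> /and4P[-> -> -> ->].
- move=> k; rewrite map_cat mem_cat inE /= => kl; apply: Dl.
  by rewrite e map_cat mem_cat !inE /=; case/or3P: kl=> ->; rewrite ?orbT.
Qed.

End Freeness.

(** * Schwinger-Dyson equations of the sources and of letters built from them *)

Section SourceSD.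
Variables (A : cstarAlgType R) (tau : {scalar A}).
Variables (tauP : faithful_tracial_state tau).

Lemma tau_semicircular s k : std_semicircular tau s ->
  tau (s ^+ k) = (sc_mom k)%:C.
by move=> [_ ->]. Qed.

Lemma semicircle_moment0 s : std_semicircular tau s -> sc_mom 0 = 1.
move=> ss; have := tau_semicircular 0 ss; rewrite expr0 (tau1 tauP).
by move=> [<-].
Qed.

(* The Schwinger-Dyson equation of a semicircular element is the Catalan
   recursion. *)
Lemma semicircular_sd s (L : Type) (ev : L -> A) (kap : L -> C) (w : seq L) :
  std_semicircular tau s ->
  (forall n (w1 w2 : seq L) y, w = w1 ++ y :: w2 -> size w1 = n -> ev y = s /\ kap y = 1) ->
  tau (s * wval ev w) = wdel tau ev kap 1 w 1.
move=> ss ws.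
have {ws}[ev_s kap1] : all (fun b=> b) [seq `[< ev y = s /\ kap y = 1 >] | y <- w] /\ True.
  split=> //; move: ws; elim: w=> //= y w IH h; apply/andP; split.
    by apply/asboolP; exact: (h 0%N [::] w y).
  apply: IH=> n w1 w2 z e sz; apply: (h n.+1 (y :: w1) w2 z)=> //=; [by rewrite e|by rewrite sz].
have wv (v : seq L) : all (fun b=> b) [seq `[< ev y = s /\ kap y = 1 >] | y <- v] -> wval ev v = s ^+ size v.
  elim: v=> [|y v IH] /=; first by rewrite /wval big_nil.
  by move=> /andP[/asboolP[ey _]] /IH; rewrite wval_cons exprS ey=> ->.
pose m := sc_mom.
have del i (v : seq L) : all (fun b=> b) [seq `[< ev y = s /\ kap y = 1 >] | y <- v] ->
    wdel tau ev kap (s ^+ i) v 1 = (\sum_(j < size v) m (i + j)%N * m (size v - j.+1)%N)%:C.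
  elim: v i=> [|y v IH] i /=; first by rewrite big_ord0. move=> /andP[/asboolP[ey ky] hv].
  rewrite ky mul1r mulr1 ey -exprSr IH // wv // !tau_semicircular // -/m.
  rewrite -realcM -raddfD /= big_ord_recl addn0 subn1. congr (_ + _)%:C; eqr=> j _.
  by rewrite lift0 addnS addSn subSS.
rewrite -[1]/(s ^+ 0) del // wv // -exprS tau_semicircular //; congr (_%:C).
rewrite -/m; case: (size w)=> [|k].
  rewrite big_ord0; have := @sc_momSS 0.
  rewrite mulr0 mul0r -[m 1%N]/(sc_mom 1)=> /eqP; rewrite eq_sym mulf_eq0 pnatr_eq0=> /orP[//|/eqP ->//].
rewrite /m -(@sc_conv) ?(semicircle_moment0 ss) //.
Qed.

Lemma pair_sd (s : bool -> A) (b : bool) (w : seq bool) :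
  (forall b, std_semicircular tau (s b)) ->
  free_family tau [set: bool] (fun b=> star_gen (s b)) ->
  tau (s b * wval s w) = wdel tau s (fun y=> (y == b)%:R) 1 w 1.
move=> ss fr.
apply: (@schwinger_dyson _ _ tauP _ setT _ fr _ _ _ _ bool id s)=> //.
- by move=> i _; exact: star_gen1.
- by move=> i g h _; exact: star_genD.
- by move=> i c g _; exact: star_genZ.
- by move=> i g h _; exact: star_genM.
- by move=> y; exact: star_gen_self.
- by move=> y /negbTE ->.
move=> v vb; apply: semicircular_sd=> // n v1 v2 y e _.
move: vb; rewrite e all_cat /= => /and3P[_ /eqP -> _].
by rewrite eqxx.
Qed.

Section ChangeOfLetters.
Variables (L : Type) (ev : L -> A) (N X : Type) (nl : N -> L) (evX : X -> A)
  (rep : X -> seq (C * seq N * L * seq N)).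
Let nval (u : seq N) : A := wval (ev \o nl) u.
Variables (evXE : forall x, evX x = \sum_(t <- rep x) t.1.1.1 *: (nval t.1.1.2 * ev t.1.2 * nval t.2)).
Let evNX (z : N + X) : A := match z with inl n=> ev (nl n) | inr x=> evX x end.
Let val := wval evNX.

(** [wdel] after substituting for each letter of [X] its expression [rep]: only the source inside is
    differentiated, and its coefficients go to the two sides. *)
Fixpoint xdel (kap : L -> C) (a : A) (w : seq (N + X)) (b : A) : C :=
  match w with
  | [::]=> 0
  | inl n :: w'=> xdel kap (a * ev (nl n)) w' b
  | inr x :: w' =>
      \sum_(t <- rep x) t.1.1.1 * (kap t.1.2 * tau (a * nval t.1.1.2) *
         tau (nval t.2 * val w' * b)) + xdel kap (a * evX x) w' b
  end.

Lemma nval_map u : nval u = wval ev [seq nl n | n <- u].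
by rewrite /nval /wval big_map. Qed.

Lemma wdel_nl kap a u b : (forall n, kap (nl n) = 0) ->
  wdel tau ev kap a [seq nl n | n <- u] b = 0.
by move=> k0; elim: u a=> //= n u IH a; rewrite k0 !mul0r add0r IH. Qed.

Lemma xdelDl kap a a' w b : xdel kap (a + a') w b = xdel kap a w b + xdel kap a' w b.
elim: w a a'=> [|[n|x] w IH] a a' /=; rewrite ?addr0 //.
  by rewrite mulrDl IH.
rewrite mulrDl IH addrACA -big_split; congr (_ + _); eqr=> t _.
by rewrite (mulrDl a) (linearD tau) /=; ring.
Qed.

Lemma xdelZl kap c a w b : xdel kap (c *: a) w b = c * xdel kap a w b.
elim: w a=> [|[n|x] w IH] a /=; rewrite ?mulr0 //.
  by rewrite -(scalerAl c a) IH.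
rewrite -(scalerAl c a) IH mulrDr mulr_sumr; congr (_ + _); eqr=> t _.
by rewrite -(scalerAl c a) tauZ; ring.
Qed.

Lemma xdel_sum (T : Type) (r : seq T) (c : T -> C) (F : T -> A) kap w b :
  xdel kap (\sum_(t <- r) c t *: F t) w b = \sum_(t <- r) c t * xdel kap (F t) w b.
elim: r=> [|t r IH]; last by rewrite !big_cons xdelDl xdelZl IH.
by rewrite !big_nil; have := xdelZl kap 0 0 w b; rewrite scale0r mul0r.
Qed.

Lemma wdel_sum (T : Type) (r : seq T) (c : T -> C) (F : T -> A) kap a (u : seq L) :
  wdel tau ev kap a u (\sum_(t <- r) c t *: F t) =
  \sum_(t <- r) c t * wdel tau ev kap a u (F t).
elim: r=> [|t r IH]; last by rewrite !big_cons wdelDr wdelZr IH.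
by rewrite !big_nil; have := wdelZr tau ev kap 0 a u 0; rewrite scale0r mul0r.
Qed.

Lemma xdel_sd (y : L) (kap : L -> C) (w : seq (N + X)) (v : seq N) :
  (forall n, kap (nl n) = 0) ->
  (forall u, tau (ev y * wval ev u) = wdel tau ev kap 1 u 1) ->
  tau (ev y * (val w * nval v)) = xdel kap 1 w (nval v).
move=> k0 sd.
have key u : tau (ev y * (wval ev u * (val w * nval v))) =
    wdel tau ev kap 1 u (val w * nval v) + xdel kap (wval ev u) w (nval v).
  elim: w u=> [|[n|x] w IH] u.
  - rewrite /val /wval big_nil mul1r -/(wval ev u) nval_map -wval_cat sd wdel_cat mulr1 mul1r.
    by rewrite wdel_nl.
  - have := IH (u ++ [:: nl n]).
    have -> : wval ev (u ++ [:: nl n]) = wval ev u * ev (nl n) by rewrite wval_cat /wval big_seq1.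
    rewrite wdel_cat /= k0 !mul0r !addr0 {2}/wval big_seq1.
    rewrite -[val (inl n :: w)]/(wval evNX (inl n :: w)) wval_cons [evNX _]/= -/val -!mulrA. by move=> ->.
  rewrite [xdel _ _ _ _]/= -[val (inr x :: w)]/(wval evNX (inr x :: w)) wval_cons [evNX _]/=. rewrite -/val evXE.
  have e1 : (\sum_(t <- rep x) t.1.1.1 *: (nval t.1.1.2 * ev t.1.2 * nval t.2)) * val w * nval v =
      \sum_(t <- rep x) t.1.1.1 *: (nval t.1.1.2 * ev t.1.2 * nval t.2 * val w * nval v).
    by rewrite !mulr_suml; eqr=> t _; rewrite -!scalerAl.
  have e2 : wval ev u * (\sum_(t <- rep x) t.1.1.1 *: (nval t.1.1.2 * ev t.1.2 * nval t.2)) =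
      \sum_(t <- rep x) t.1.1.1 *: (wval ev u * (nval t.1.1.2 * ev t.1.2 * nval t.2)).
    by rewrite !mulr_sumr; eqr=> t _; rewrite -!scalerAr.
  rewrite e1 e2 wdel_sum xdel_sum -big_split -big_split mulr_sumr mulr_sumr linear_sum /=.
  eqr=> t _; rewrite -(scalerAr _ (wval ev u)) -(scalerAr _ (ev y)) tauZ -!mulrDr; congr (_ * _).
  have := IH (u ++ ([seq nl n | n <- t.1.1.2] ++ t.1.2 :: [seq nl n | n <- t.2])).
  rewrite !wval_cat wval_cons -!nval_map !wdel_cat /= !wdel_nl // addr0 add0r.
  by rewrite !wval_cat wval_cons -!nval_map mul1r !mulrA !addrA.
by have := key [::]; rewrite /wval big_nil mul1r add0r.
Qed.

(* The operator-valued covariance carried by the letters [X]. *)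
Definition xeta (kap : L -> L -> C) (x y : X) (a : A) : A :=
  \sum_(s <- rep x) \sum_(t <- rep y)
    (s.1.1.1 * t.1.1.1 * kap s.1.2 t.1.2 * tau (nval t.1.1.2 * nval s.2 * a)) *:
      (nval s.1.1.2 * nval t.2).

Fixpoint xann (eta : X -> X -> A -> A) (x : X) (a : A) (w : seq (N + X)) : A :=
  match w with
  | [::]=> 0
  | inl n :: w'=> xann eta x (a * ev (nl n)) w'
  | inr y :: w'=> eta x y a * val w' + xann eta x (a * evX y) w'
  end.

(** Cyclicity moves the left coefficients of the first letter to the end of the word. The scalar
    equation of its source then applies, and the coefficients surrounding the two contracted sources
    assemble into [xeta]. *)
Lemma letters_sd (kap : L -> L -> C) (x : X) (w : seq (N + X)) :
  (forall t, List.In t (rep x) -> (forall n, kap t.1.2 (nl n) = 0) /\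
     (forall u, tau (ev t.1.2 * wval ev u) = wdel tau ev (kap t.1.2) 1 u 1)) ->
  tau (evX x * val w) = tau (xann (xeta kap) x 1 w).
move=> H.
have tC := tauC tauP.
transitivity (\sum_(s <- rep x) s.1.1.1 * xdel (kap s.1.2) (nval s.2 * 1) w (nval s.1.1.2)).
  rewrite evXE mulr_suml linear_sum /=. elim: (rep x) H=> [|s r IH] H; first by rewrite !big_nil.
  rewrite !big_cons IH; last by move=> t tr; apply: H; right.
  congr (_ + _); rewrite -scalerAl tauZ mulr1; congr (_ * _). have [k0 sd] := H s (or_introl erefl).
  have := xdel_sd ([seq inl n | n <- s.2] ++ w) s.1.1.2 k0 sd.
  have -> : val ([seq inl n | n <- s.2] ++ w) = nval s.2 * val w.
    by rewrite /val wval_cat /nval /wval !big_map.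
  have xd a (u : seq N) : xdel (kap s.1.2) a ([seq inl n | n <- u] ++ w) (nval s.1.1.2) =
      xdel (kap s.1.2) (a * nval u) w (nval s.1.1.2).
    elim: u a=> [|n u IHu] a /=; first by rewrite /nval /wval big_nil mulr1. by rewrite IHu /nval wval_cons mulrA.
  rewrite xd mul1r=> <-. rewrite -!mulrA (tC (nval s.1.1.2)) -!mulrA. reflexivity.
elim: w {H} 1=> [|[n|y] w IH] a /=.
- by rewrite linear0 big1 // => s _; rewrite mulr0.
- by rewrite -IH; eqr=> s _; rewrite mulrA.
rewrite linearD /= -IH /xeta mulr_suml linear_sum /= -big_split; eqr=> s _ /=.
rewrite mulrDr mulrA; congr (_ + _).
rewrite mulr_suml linear_sum mulr_sumr; eqr=> t _ /=.
rewrite -(scalerAl _ (nval s.1.1.2 * nval t.2)) tauZ (tC (nval s.2 * a)) (tC (nval t.2 * val w)) !mulrA; ring.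
Qed.

End ChangeOfLetters.

Lemma conjc_i : conjc ('i%C : C) = - 'i%C.
by apply/eqP; rewrite eq_complex /= oppr0 !eqxx. Qed.

(** An instance of [letters_sd] without coefficient letters ([N] is [void]): [h^2 = 1/2] and
    [i^2 = -1] make [c] uncorrelated with itself and of covariance 1 with its adjoint. *)
Lemma circular_sd c (e : bool) (L : Type) (ev : L -> A) (eps : L -> bool) (w : seq L) :
  std_circular tau c ->
  (forall y, List.In y w -> ev y = if eps y then star c else c) ->
  tau ((if e then star c else c) * wval ev w) =
  wdel tau ev (fun y=> (eps y != e)%:R) 1 w 1.
move=> [s [ss fr cE]] evE.
pose h : C := ((sqrt (2 : R))^-1)%:C.
pose rep (b : bool) : seq (C * seq void * bool * seq void) :=
  [:: (h, [::], true, [::]); (if b then - (h * 'i%C) else h * 'i%C, [::], false, [::])].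
pose evX (b : bool) := if b then star c else c.
pose nl (n : void) : bool := match n with end.
have evXE b : evX b = \sum_(t <- rep b) t.1.1.1 *: (wval (s \o nl) t.1.1.2 * s t.1.2 * wval (s \o nl) t.2).
  have [s1 _] := ss true; have [s2 _] := ss false. rewrite !big_cons big_nil /wval !big_nil !mul1r !mulr1 addr0 /=.
  case: b=> /=; last by rewrite cE scalerDr scalerA.
  rewrite cE starJ starD s1 starJ s2 scalerDr scalerA; congr (_ *: _ + _ *: _).
    by rewrite /h /= oppr0.
  by rewrite conjcR conjc_i mulrN.
have := @letters_sd _ s void bool nl evX rep evXE (fun x y=> (y == x)%:R) e [seq inr (eps y) | y <- w].
have wv (v : seq L) : (forall y, List.In y v -> List.In y w) ->
    wval (fun z=> match z with inl n=> s (nl n) | inr x=> evX x end) [seq inr (eps y) | y <- v] = wval ev v.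
  elim: v=> [|y v IH] h' /=; first by rewrite /wval !big_nil.
  rewrite !wval_cons IH; last by move=> z zv; apply: h'; right. by rewrite (evE y) //; apply: h'; left.
rewrite wv // -/(evX e)=> -> //; last first.
  by move=> t _; split=> [[]|u]; exact: pair_sd.
have hh : h * h = 2%:R^-1.
  rewrite /h -realcM -invfM -expr2 sqr_sqrtr ?ler0n //. by rewrite fmorphV rmorph_nat.
have h2 : (2%:R^-1 : C) + 2%:R^-1 = 1 by field.
have ii : 'i%C * 'i%C = -1 :> C by rewrite -expr2 sqr_i.
have eta a x y : xeta s nl rep (fun x y=> (y == x)%:R) x y a = ((y != x)%:R * tau a) *: 1.
  rewrite /xeta !big_cons !big_nil /wval !big_nil !mul1r !addr0 /= !mulr1 !mulr0 !mul0r !scale0r.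
  rewrite addr0 add0r -scalerDl -mulrDl; congr ((_ * _) *: _).
  case: x y=> [] [] /=; rewrite ?mulrN ?mulNr ?opprK mulrACA hh ii ?mulrN1 ?opprK ?subrr ?h2 //.
suff gen v a : (forall y, List.In y v -> List.In y w) ->
    tau (xann s nl evX (xeta s nl rep (fun x y=> (y == x)%:R)) e a [seq inr (eps y) | y <- v]) =
    wdel tau ev (fun y=> (eps y != e)%:R) a v 1 by exact: gen.
elim: v a=> [|y v IH] a vw /=; first by rewrite linear0.
rewrite eta linearD /= -scalerAl mul1r tauZ wv; last by move=> z zv; apply: vw; right.
rewrite mulr1 IH; last by move=> z zv; apply: vw; right.
by rewrite (evE y) //; apply: vw; left.
Qed.

End SourceSD.

(** * The covariance map of the matched free family *)

Section MatchedCovariance.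
Variables (d r : nat) (K : matching_coefs R d r).
Notation xletter := ('I_d * bool)%type.

(* [inl (k, false)] stands for [x_k] and [(k, true)] for its adjoint; in the
   same way [(i, true)] is the adjoint of the source [i]. *)
Definition cross_fst (a b : 'I_r) (x : xletter) (l : nat) : C :=
  if x.2 then conjc (mcbeta K a b x.1 l) else mcalpha K a b x.1 l.
Definition cross_snd (a b : 'I_r) (x : xletter) (l : nat) : C :=
  if x.2 then conjc (mcalpha K a b x.1 l) else mcbeta K a b x.1 l.
Definition same_sym (a : 'I_r) (x : xletter) (l : nat) : C :=
  if x.2 then conjc (mcalphap K a x.1 l) else mcalphap K a x.1 l.
Definition asym (a : 'I_r) (x : xletter) (l : nat) : C :=
  if x.2 then - conjc (mcbetam K a x.1 l) else mcbetam K a x.1 l.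

(* [gam a b x y] is [E(xi^x_ij xi^y_ji)] for [i] of type [a] and [j] of type
   [b] under the matching Gaussian laws. *)
Definition gam (a b : 'I_r) (x y : xletter) : C :=
  if (a < b)%N then \sum_(l < mcL K a b) cross_fst a b x l * cross_snd a b y l
  else if (b < a)%N then \sum_(l < mcL K b a) cross_snd b a x l * cross_fst b a y l
  else 2%:R^-1 * (\sum_(l < mcLp K a) same_sym a x l * same_sym a y l -
                  \sum_(l < mcLm K a) asym a x l * asym a y l).

Definition xadj (x : xletter) : xletter := (x.1, ~~ x.2).

Lemma xadjK x : xadj (xadj x) = x.
by case: x=> k b; rewrite /xadj negbK. Qed.

Lemma conjcK_ (z : C) : conjc (conjc z) = z. exact: conjcK. Qed.

Lemma cross_fst_adj a b x l : cross_fst a b (xadj x) l = conjc (cross_snd a b x l).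
by case: x=> k [] /=; rewrite /cross_fst /cross_snd /= ?conjcK_. Qed.
Lemma cross_snd_adj a b x l : cross_snd a b (xadj x) l = conjc (cross_fst a b x l).
by case: x=> k [] /=; rewrite /cross_fst /cross_snd /= ?conjcK_. Qed.
Lemma same_sym_adj a x l : same_sym a (xadj x) l = conjc (same_sym a x l).
by case: x=> k [] /=; rewrite /same_sym /= ?conjcK_. Qed.
Lemma same_asym_adj a x l : asym a (xadj x) l = - conjc (asym a x l).
by case: x=> k [] /=; rewrite /asym /= ?conjcN ?conjcK_ ?opprK. Qed.

Lemma gamC a b x y : gam a b x y = gam b a y x.
rewrite /gam; case: (ltngtP a b)=> [ab|ab|/val_inj ->]; rewrite ?(ltnNge b a) ?(ltnW ab) //=.
- by eqr=> l _; rewrite mulrC.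
- by eqr=> l _; rewrite mulrC.
by congr (_ * (_ - _)); eqr=> l _; rewrite mulrC.
Qed.

Lemma gam_adj a b x y : gam a b (xadj x) (xadj y) = conjc (gam b a x y).
rewrite /gam; case: (ltngtP a b)=> [ab|ab|/val_inj ->]; rewrite ?(ltnNge b a) ?(ltnW ab) //=.
- rewrite conj_sum; eqr=> l _.
  by rewrite cross_fst_adj cross_snd_adj conjcM.
- rewrite conj_sum; eqr=> l _.
  by rewrite cross_fst_adj cross_snd_adj conjcM.
rewrite conjcM conjcD conjcN !conj_sum; congr (_ * (_ - _)).
- by rewrite -(rmorph_nat (real_complex R)) -fmorphV conjcR.
- by eqr=> l _; rewrite !same_sym_adj conjcM.
- by eqr=> l _; rewrite !same_asym_adj conjcM mulrN mulNr opprK.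
Qed.

(* Up to conjugation the covariance is a Gram matrix. *)
Lemma gam_gram a b : exists (n : nat) (h : xletter -> 'I_n -> C),
  forall x y, gam a b (xadj x) y = \sum_l conjc (h x l) * h y l.
rewrite /gam; case: (ltngtP a b)=> [ab|ab|_].
- exists (mcL K a b), (fun x l=> cross_snd a b x l)=> x y.
  by eqr=> l _; rewrite cross_fst_adj.
- exists (mcL K b a), (fun x l=> cross_fst b a x l)=> x y.
  by eqr=> l _; rewrite cross_snd_adj.
pose s : C := (sqrt (2^-1 : R))%:C.
have ss : conjc s * s = 2%:R^-1.
  rewrite /s conjcR -realcM -expr2 sqr_sqrtr ?invr_ge0 //. by rewrite fmorphV rmorph_nat.
exists (mcLp K a + mcLm K a)%N, (fun x l=> match fintype.split l with
  inl i=> s * same_sym a x i | inr i=> s * asym a x i end)=> x y.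
rewrite big_split_ord /= mulrDr mulrN -mulNr !mulr_sumr; congr (_ + _); eqr=> l _.
  by rewrite -[lshift _ _]/(unsplit (inl l)) unsplitK same_sym_adj conjcM -ss; ring.
by rewrite -[rshift _ _]/(unsplit (inr l)) unsplitK same_asym_adj conjcM -ss; ring.
Qed.

Section Letters.
Variables (A : cstarAlgType R) (tau : {scalar A}) (tauP : faithful_tracial_state tau) (B : cstarAlgType R)
  (emb : {lrmorphism B -> A}) (p : 'I_r -> B) (src : source_label r -> A)
  (p_star : forall a, star (emb (p a)) = emb (p a)) (p_orth : forall a b, p a * p b = if a == b then p a else 0)
  (src_free : free_sources tau (range emb) K src).

Let L : Type := (B + source_label r * bool)%type.
Let X : Type := xletter.
(** A label outside the index range is filed under [B] with value 0, so that every letter lies in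
    one of the free subalgebras. *)
Let ix (y : L) : option (source_label r) :=
  match y with inl _=> None | inr (i, _)=> if `[< is_source K i >] then Some i else None end.
Let ev (y : L) : A :=
  match y with inl b=> emb b
  | inr (i, e)=> if `[< is_source K i >] then (if e then star (src i) else src i) else 0 end.
Let circular (i : source_label r) : bool := if i is inl _ then true else false.
Let kap0 (s t : source_label r * bool) : bool :=
  (s.1 == t.1) && (if circular s.1 then t.2 != s.2 else true).
Let kap (x y : L) : C :=
  match x, y with inr s, inr t=> (kap0 s t)%:R | _, _=> 0 end.

Definition xelt (x : xletter) : A :=
  let y := matched_family (fun a=> emb (p a)) K src x.1 in if x.2 then star y else y.

Definition xcov (x y : xletter) (z : A) : A :=
  \sum_a \sum_b (gam a b x y * tau (emb (p b) * z)) *: emb (p a).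

Definition mixed (y : B + xletter) : A :=
  match y with inl b=> emb b | inr x=> xelt x end.

Fixpoint xannih (x : xletter) (z : A) (w : seq (B + xletter)) : A :=
  match w with
  | [::]=> 0
  | inl b :: w'=> xannih x (z * emb b) w'
  | inr y :: w'=> xcov x y z * wval mixed w' + xannih x (z * xelt y) w'
  end.

Let h : C := ((sqrt (2 : R))^-1)%:C.
(** Coefficients and sources of the corner [p_a x p_b]. For [b < a] the circular elements of the
    pair [(b, a)] enter through their adjoints; [- i h] is the factor of the antisymmetric part of a
    diagonal block. *)
Let blk (a b : 'I_r) (x : X) : seq (C * (source_label r * bool)) :=
  if (a < b)%N then [seq (cross_fst a b x l, (inl (a, b, l), false)) | l <- iota 0 (mcL K a b)]
  else if (b < a)%N then [seq (cross_snd b a x l, (inl (b, a, l), true)) | l <- iota 0 (mcL K b a)]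
  else [seq (h * same_sym a x l, (inr (a, true, l), false)) | l <- iota 0 (mcLp K a)] ++
       [seq (- ('i%C * h) * asym a x l, (inr (a, false, l), false)) | l <- iota 0 (mcLm K a)].

Let big_iota0 (n : nat) (F : nat -> A) : \sum_(l <- iota 0 n) F l = \sum_(l < n) F l.
by rewrite -[n in iota 0 n]subn0 -/(index_iota 0 n) big_mkord. Qed.

Let big_iota0C (n : nat) (F : nat -> C) : \sum_(l <- iota 0 n) F l = \sum_(l < n) F l.
by rewrite -[n in iota 0 n]subn0 -/(index_iota 0 n) big_mkord. Qed.

Let term (x : X) (a b : 'I_r) : A :=
  \sum_(t <- blk a b x) t.1 *: (emb (p a) * ev (inr t.2) * emb (p b)).

Let sum_pairs (F : 'I_r -> 'I_r -> A) :
  \sum_a \sum_b F a b = \sum_a F a a + \sum_(a < r) \sum_(b < r | (a < b)%N) (F a b + F b a).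
have e a : \sum_b F a b = F a a + (\sum_(b < r | (a < b)%N) F a b + \sum_(b < r | (b < a)%N) F a b).
  rewrite (bigD1 a) //=; congr (_ + _); rewrite (bigID (fun b : 'I_r=> (a < b)%N)) /=.
  congr (_ + _); apply: eq_bigl=> b; rewrite -val_eqE /=; case: ltngtP=> //.
rewrite (eq_bigr _ (fun a _=> e a)) big_split /=; congr (_ + _).
under [in RHS]eq_bigr do rewrite big_split.
rewrite big_split [RHS]big_split /=; congr (_ + _).
by rewrite (exchange_big_dep xpredT).
Qed.

Let term_same k a : term (k, false) a a = same_elt (fun a=> emb (p a)) K src a k.
rewrite /term /blk ltnn big_cat !big_map !big_iota0 /= /same_elt mulrBr mulrBl scalerBr; congr (_ + _).
  rewrite mulr_sumr mulr_suml scaler_sumr; eqr=> l _. by rewrite (asboolT (ltn_ord l)) -scalerAr -scalerAl scalerA.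
rewrite -scalerAr -scalerAl !scalerA -scaleNr mulr_sumr mulr_suml scaler_sumr; eqr=> l _.
rewrite (asboolT (ltn_ord l)) -scalerAr -scalerAl scalerA; congr (_ *: _).
by rewrite /asym /= -/h; ring.
Qed.

Let term_cross k (a b : 'I_r) : (a < b)%N ->
  term (k, false) a b + term (k, false) b a = cross_elt (fun a=> emb (p a)) K src a b k.
move=> ab; rewrite /term /blk ab ltnNge (ltnW ab) /= !big_map !big_iota0 /cross_elt -big_split.
by eqr=> l _ /=; rewrite (asboolT (conj ab (ltn_ord l))).
Qed.

Let src_semi a e l : is_source K (inr (a, e, l)) -> star (src (inr (a, e, l))) = src (inr (a, e, l)).
by case: src_free=> _ s _ /s []. Qed.

Let term_star k a b : star (term (k, false) a b) = term (k, true) b a.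
rewrite /term /blk.
have gen c' y' c0 y0 (a' b' : 'I_r) : conjc c' = c0 -> star y' = y0 ->
    star (c' *: (emb (p a') * y' * emb (p b'))) = c0 *: (emb (p b') * y0 * emb (p a')).
  by move=> <- <-; rewrite starJ !starM !p_star mulrA.
have ch : conjc h = h by rewrite /h conjcR.
case: (ltngtP a b)=> [ab|ab|/val_inj <-] /=; rewrite ?big_cat !big_map !big_iota0 /=.
- rewrite star_sum; eqr=> l _ /=.
  by apply: gen; rewrite // (asboolT (conj ab (ltn_ord l))).
- rewrite star_sum; eqr=> l _ /=.
  by apply: gen; rewrite // (asboolT (conj ab (ltn_ord l))) starK.
rewrite starD !star_sum; congr (_ + _); eqr=> l _; apply: gen.
- by rewrite conjcM ch.
- by rewrite asboolT ?src_semi //=.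
- by rewrite conjcM conjcN conjcM conjc_i ch /asym /=; ring.
- by rewrite asboolT ?src_semi //=.
Qed.

Let xeltE x : xelt x = \sum_a \sum_b term x a b.
have e k : xelt (k, false) = \sum_a \sum_b term (k, false) a b.
  rewrite /xelt /= /matched_family sum_pairs; congr (_ + _).
    by eqr=> a _; rewrite term_same.
  by eqr=> a _; eqr=> b ab; rewrite term_cross.
case: x=> k []; last exact: e.
rewrite -[xelt (k, true)]/(star (xelt (k, false))) e star_sum exchange_big.
eqr=> a _; rewrite star_sum; eqr=> b _; exact: term_star.
Qed.

Let rep (x : X) : seq (C * seq B * L * seq B) :=
  flatten [seq [seq (t.1, [:: p ab.1], inr t.2, [:: p ab.2]) | t <- blk ab.1 ab.2 x]
          | ab <- enum {: 'I_r * 'I_r}].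

Let big_rep (V : nmodType) x (F : C * seq B * L * seq B -> V) :
  \sum_(t <- rep x) F t =
  \sum_a \sum_b \sum_(t <- blk a b x) F (t.1, [:: p a], inr t.2, [:: p b]).
rewrite /rep big_flatten /= big_map big_enum /= pair_big /=.
by eqr=> -[a b] _; rewrite big_map.
Qed.

Let nval1 b : wval (ev \o inl) [:: b] = emb b.
by rewrite /wval big_seq1. Qed.

(** Distinct sources do not pair, and circular ones pair only with their adjoints; on the diagonal
    the squares of [h] and of [- i h] produce the two signs of [gam]. *)
Let blk_gam a b x y :
  \sum_(s <- blk a b x) \sum_(t <- blk b a y) s.1 * t.1 * (kap0 s.2 t.2)%:R = gam a b x y.
have delta (n : nat) (T : 'I_n -> 'I_n -> C) (F : 'I_n -> C) :
    (forall i j, T i j = (i == j)%:R * F i) -> \sum_(i < n) \sum_(j < n) T i j = \sum_(i < n) F i.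
  move=> Te; eqr=> i _; rewrite (bigD1 i) //= Te eqxx mul1r big1 ?addr0 //.
  by move=> j ji; rewrite Te eq_sym (negbTE ji) mul0r.
have keq (n : nat) (f : nat -> source_label r) (i j : 'I_n) (c c' : C) : injective f ->
    (i = j -> c = c') -> c * (f i == f j)%:R = (i == j)%:R * c'.
  move=> fi cc; rewrite (inj_eq fi) val_eqE; case: (eqVneq i j)=> [ij|_].
    by rewrite (cc ij) mulrC.
  by rewrite mulr0n mulr0 mul0r.
have hh : h * h = 2%:R^-1.
  rewrite /h -realcM -invfM -expr2 sqr_sqrtr ?ler0n //. by rewrite fmorphV rmorph_nat.
have ii : 'i%C * 'i%C = -1 :> C by rewrite -expr2 sqr_i.
have dbl (S T : Type) n m (f : nat -> S) (g : nat -> T) (F : S -> T -> C) :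
    \sum_(s <- [seq f l | l <- iota 0 n]) \sum_(t <- [seq g l | l <- iota 0 m]) F s t =
    \sum_(i < n) \sum_(j < m) F (f i) (g j).
  by rewrite big_map big_iota0C; eqr=> i _; rewrite big_map big_iota0C.
rewrite /blk /gam; case: (ltngtP a b)=> [ab|ab|/val_inj <-] /=.
- rewrite dbl; apply: delta=> i j; rewrite /kap0 /= andbT.
  by apply: (keq _ (fun l=> inl (a, b, l)))=> [u v []|->].
- rewrite dbl; apply: delta=> i j; rewrite /kap0 /= andbT.
  by apply: (keq _ (fun l=> inl (b, a, l)))=> [u v []|->].
under eq_bigr do rewrite big_cat.
have z (n n' : nat) (F : 'I_n -> 'I_n' -> C) (k k' : 'I_n -> 'I_n' -> source_label r * bool) :
    (forall i j, (k i j).1 != (k' i j).1) -> \sum_i \sum_j F i j * (kap0 (k i j) (k' i j))%:R = 0.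
  by move=> kk; rewrite big1 // => i _; rewrite big1 // => j _; rewrite /kap0 (negbTE (kk i j)) mulr0.
rewrite /= big_split !big_cat /= !dbl.
rewrite (z _ _ _ (fun i j=> (inr (a, true, i : nat), false)) (fun i j=> (inr (a, false, j : nat), false))) ?addr0; last by move=> i j; apply/eqP=> -[].
rewrite (z _ _ _ (fun i j=> (inr (a, false, i : nat), false))  (fun i j=> (inr (a, true, j : nat), false))) ?add0r; last by move=> i j; apply/eqP=> -[].
rewrite mulrBr -mulrN -sumrN !mulr_sumr; congr (_ + _); apply: delta=> i j; rewrite /kap0 /= andbT -hh.
  by apply: (keq _ (fun l=> inr (a, true, l)))=> [u v []//|->]; ring.
apply: (keq _ (fun l=> inr (a, false, l)))=> [u v []//|->].
transitivity (('i%C * 'i%C) * (h * h) * (asym a x j * asym a y j)); first by ring.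
by rewrite ii; ring.
Qed.

Let xetaE x y z : xeta tau ev inl rep kap x y z = xcov x y z.
rewrite /xeta big_rep; eqr=> a _; eqr=> b _.
under eq_bigr=> s _.
  rewrite big_rep (bigD1 b) //= [X in _ + X]big1 ?addr0; last first.
    move=> a' a'b; rewrite big1 // => b' _; rewrite big1 // => t _.
    by rewrite !nval1 -(rmorphM emb) p_orth (negbTE a'b) rmorph0 mul0r linear0 mulr0 scale0r.
  rewrite (bigD1 a) //= [X in _ + X]big1 ?addr0; last first.
    move=> b' b'a; rewrite big1 // => t _.
    by rewrite !nval1 -!(rmorphM emb) p_orth (p_orth a b') eq_sym (negbTE b'a) rmorph0 scaler0.
  under eq_bigr do rewrite !nval1 -!(rmorphM emb) !p_orth !eqxx mulrC. rewrite -scaler_suml -mulr_sumr; over.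
by rewrite -scaler_suml -mulr_sumr blk_gam mulrC.
Qed.

(** The Schwinger-Dyson equation of an operator-valued semicircular family over [B]. All moment
    information about the limit family used below enters through it. *)
Lemma xelt_sd x w :
  tau (xelt x * wval mixed w) = tau (xannih x 1 w).
have evXE z : xelt z = \sum_(t <- rep z) t.1.1.1 *: (wval (ev \o inl) t.1.1.2 * ev t.1.2 * wval (ev \o inl) t.2).
  rewrite xeltE big_rep; eqr=> a _; eqr=> b _. by eqr=> t _ /=; rewrite !nval1.
have := @letters_sd _ _ tauP L ev B X inl xelt rep evXE kap x w.
have -> : (fun z : B + X=> match z with inl n=> ev (inl n) | inr x0=> xelt x0 end) = mixed.
  by apply/funext=> -[].
move=> ->; last first.
  move=> t tx; have {tx} [s [tE sK]] : exists s, t.1.2 = inr s /\ is_source K s.1.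
    move: tx; rewrite /rep; elim: (enum _)=> //= -[a b] s IH.
    have split_in (T : Type) (u v : seq T) y : List.In y (u ++ v) -> List.In y u \/ List.In y v.
      by elim: u=> [|z u IHu] /=; [right|move=> [->|/IHu [h1|h1]]; auto].
    move=> /(split_in _ _ _ _) [|//] {IH}.
    have in_map (q : seq (C * (source_label r * bool))) : (forall z, List.In z q -> is_source K z.2.1) ->
        List.In t [seq (z.1, [:: p a], inr z.2, [:: p b]) | z <- q] -> exists s0, t.1.2 = inr s0 /\ is_source K s0.1.
      elim: q=> //= z q IHq qK [<-|]; first by exists z.2; split=> //; apply: qK; left.
      by apply: IHq=> y yq; apply: qK; right.
    apply: in_map=> z.
    have in_iota (f : nat -> C * (source_label r * bool)) n m : List.In z [seq f l | l <- iota m n] ->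
        exists l, (l < m + n)%N /\ z = f l.
      elim: n m=> //= n IHn m [<-|/IHn [l [lm ->]]]; first by exists m; split=> //; rewrite addnS ltnS leq_addr.
      by exists l; rewrite addnS -addSn.
    rewrite /blk /=; case: (ltngtP a b)=> [ab|ab|_].
    - by move=> /in_iota [l [ll ->]].
    - by move=> /in_iota [l [ll ->]]. by move=> /(split_in _ _ _ _) [] /in_iota [l [ll ->]].
  rewrite tE; case: s sK {tE t} => i e /= iK; split=> [//|u]. have [s1 s2 s3] := src_free.
  have ixi : ix (inr (i, e)) = Some i by rewrite /ix asboolT.
  have evi : ev (inr (i, e)) = if e then star (src i) else src i by rewrite /ev asboolT. rewrite -/(ev (inr (i, e))).
  apply: (@schwinger_dyson _ _ tauP _ _ _ s3 _ _ _ _ L ix ev).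
  - by move=> [j|] _; [exact: star_gen1|exists 1; rewrite ?rmorph1].
  - move=> [j|] g g' _; first exact: star_genD.
    by move=> [b _ <-] [b' _ <-]; exists (b + b')=> //; rewrite rmorphD.
  - move=> [j|] c g _; first exact: star_genZ.
    by move=> [b _ <-]; exists (c *: b)=> //; rewrite linearZ.
  - move=> [j|] g g' _; first exact: star_genM.
    by move=> [b _ <-] [b' _ <-]; exists (b * b')=> //; rewrite rmorphM.
  - by move=> [b|[j e']] //; rewrite /ix; case: asboolP.
  - move=> [b|[j e']] /=; first by exists b.
    case: asboolP=> jK; last by exists 0; rewrite ?rmorph0.
    by case: e'; [apply: star_gen_star|]; exact: star_gen_self.
  - move=> [b|[j e']] //; rewrite ixi /= /kap0 /=; case: asboolP=> jK ji.
      by rewrite (inj_eq Some_inj) in ji; rewrite eq_sym in ji; rewrite (negbTE ji).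
    by case: eqP jK=> // <-.
  move=> v; rewrite ixi=> vi. have vP y : List.In y v -> exists e', y = inr (i, e').
    move: vi; elim: v=> //= z v IH /andP[zi vi] [<-|/(IH vi)//].
    move: zi; case: z=> [//|[j e']]; rewrite /ix; case: asboolP=> // _ /eqP [->]. by exists e'.
  rewrite evi. case: i iK s1 s2 s3 ixi evi vi vP=> [[[a b] l]|[[a e0] l]] iK s1 s2 _ ixi evi _ vP.
    have cc := s1 a b l iK.
    have := @circular_sd _ _ tauP _ e L ev (fun y=> if y is inr s then s.2 else false) v cc.
    move=> ->; last by move=> y /vP [e' ->]; rewrite /ev asboolT.
    move: {1 3}(1 : A)=> z; elim: v z vP=> //= y v IH z vP; rewrite IH; last by move=> y' y'v; apply: vP; right.
    by have [|e' ->] := vP y; [left|rewrite /= /kap0 /= eqxx].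
  have cc := s2 a e0 l iK.
  have -> : (if e then star (src (inr (a, e0, l))) else src (inr (a, e0, l))) = src (inr (a, e0, l)).
    by case: (e)=> //; case: cc.
  apply: semicircular_sd=> // n w1 w2 y vE _.
  have [|e' ->] := vP y; first by rewrite vE; elim: w1 {vE} => [|z w1 IH]; [left|right].
  by rewrite /ev asboolT // /kap /kap0 /= eqxx; split=> //; case: e'=> //; case: cc.
elim: w 1=> [|[b|y] w IH] z //=.
rewrite !linearD /= IH xetaE; congr (tau (_ * wval _ _) + _).
Qed.

End Letters.
End MatchedCovariance.

(** * The operator norm of matrices *)

Section OperatorNorm.

Definition cip (x y : C^o) : C := conjc (x : C) * (y : C).

Lemma cip_sip : is_sip cip.
split.
- by move=> u v w; rewrite /cip mulrDr.
- by move=> u a v; rewrite /cip mulrCA.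
- by move=> u v; rewrite /cip conjcM conjcK mulrC.
- by move=> v; rewrite /cip mulJc /= sqr_ge0.
Qed.

Section Square.
Variables (n : nat).
Implicit Types (M N : 'M[C]_n) (u v : 'cV[C]_n).

Definition colfun v : {ffun 'I_n -> C^o} := [ffun i=> v i 0].
Notation vip := (@dip C^o cip 'I_n).
Let vipP : is_sip vip := dip_sip cip_sip _.

Lemma l2normE v : l2norm v = nrm vip (colfun v).
rewrite /l2norm /nrm dip_n2; congr sqrt; eqr=> i _.
by rewrite /n2 /cip ffunE mulJc.
Qed.

Lemma l2_ge0 v : 0 <= l2norm v. exact: sqrtr_ge0. Qed.

Lemma l2norm_sqr v : l2norm v ^+ 2 = \sum_i normc (v i 0) ^+ 2.
by rewrite sqr_sqrtr // sumr_ge0 // => i _; exact: sqr_ge0. Qed.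

Lemma l2normZ a v : l2norm (a *: v) = normc a * l2norm v.
rewrite !l2normE -(nrmZ vipP); congr nrm; apply/ffunP=> i.
by rewrite !ffunE mxE.
Qed.

Lemma l2normD u v : l2norm (u + v) <= l2norm u + l2norm v.
rewrite !l2normE; have -> : colfun (u + v) = colfun u + colfun v by apply/ffunP=> i; rewrite !ffunE mxE.
exact: nrmD.
Qed.

Lemma l2norm0_eq v : l2norm v = 0 -> v = 0.
move=> v0; apply/matrixP=> i j; rewrite ord1 mxE; apply: Normc.eq0_normc.
have := l2norm_sqr v; rewrite v0 expr0n /= => /esym/eqP.
rewrite psumr_eq0=> [/allP/(_ i)|k _]; last exact: sqr_ge0.
by rewrite mem_index_enum sqrf_eq0=> /(_ isT)/eqP.
Qed.

Definition frob M : R := sqrt (\sum_i \sum_j normc (M i j) ^+ 2).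

Lemma frob_bound M v : l2norm (M *m v) <= frob M * l2norm v.
rewrite -le_sq ?mulr_ge0 ?sqrtr_ge0 // exprMn l2norm_sqr sqr_sqrtr; last first.
  by sge0=> i _; sge0=> j _; exact: sqr_ge0.
rewrite mulr_suml; lers=> i _.
have := CS_sqr vipP [ffun j=> conjc (M i j)] (colfun v).
rewrite -!(nrm_sqr vipP) -l2normE (nrm_sqr vipP) dip_n2.
have -> : vip [ffun j=> conjc (M i j)] (colfun v) = (M *m v) i 0.
  by rewrite /dip mxE; eqr=> j _; rewrite !ffunE /cip conjcK.
move=> h; apply: letr h _; rewrite ler_wpM2r ?sqr_ge0 // ler_sum // => j _.
by rewrite /n2 /cip ffunE mulJc normcJ.
Qed.

Let opset M := [set l2norm (M *m v) | v in [set v | l2norm v <= 1]].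

Lemma opset_sup M : has_sup (opset M).
split; first by exists (l2norm (M *m 0)), 0=> //=; rewrite -(scale0r 0) l2normZ Normc.normc0 mul0r ler01.
exists (frob M)=> _ [v /= v1 <-]; apply: letr (frob_bound _ _) _.
by rewrite -[leRHS]mulr1 ler_wpM2l ?sqrtr_ge0.
Qed.

Lemma op_ge0 M : 0 <= opnorm M.
have := ub_le_sup (proj2 (opset_sup M)); apply.
exists 0=> /=; first by rewrite -(scale0r 0) l2normZ Normc.normc0 mul0r ler01.
by rewrite mulmx0 -(scale0r 0) l2normZ Normc.normc0 mul0r.
Qed.

Lemma op_ub M v : l2norm (M *m v) <= opnorm M * l2norm v.
have [v0|vn] := eqVneq (l2norm v) 0.
  by rewrite v0 mulr0 (l2norm0_eq v0) mulmx0 -(scale0r 0) l2normZ Normc.normc0 mul0r.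
have vp : 0 < l2norm v by rewrite lt_def vn l2_ge0.
rewrite -ler_pdivrMr // mulrC.
have -> : (l2norm v)^-1 * l2norm (M *m v) = l2norm (M *m ((l2norm v)^-1%:C *: v)).
  by rewrite -scalemxAr l2normZ normcR ger0_norm // invr_ge0 ltW.
apply: (ub_le_sup (proj2 (opset_sup M))); eexists=> //=.
by rewrite l2normZ normcR ger0_norm ?invr_ge0 ?(ltW vp) // mulVf.
Qed.

Lemma op_le M k : 0 <= k -> (forall v, l2norm (M *m v) <= k * l2norm v) -> opnorm M <= k.
move=> k0 h; apply: ge_sup; first exact: (proj1 (opset_sup M)).
by move=> _ [v /= v1 <-]; apply: letr (h v) _; rewrite -[leRHS]mulr1 ler_wpM2l.
Qed.

Lemma op_frob M : opnorm M <= frob M.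
by apply: op_le; [exact: sqrtr_ge0|exact: frob_bound]. Qed.

Lemma opnormM M N : opnorm (M *m N) <= opnorm M * opnorm N.
apply: op_le=> [|v]; first by rewrite mulr_ge0 ?op_ge0.
rewrite -mulmxA; apply: letr (op_ub _ _) _; rewrite -mulrA ler_wpM2l ?op_ge0 //.
exact: op_ub.
Qed.

Lemma opnormD M N : opnorm (M + N) <= opnorm M + opnorm N.
apply: op_le=> [|v]; first by rewrite addr_ge0 ?op_ge0.
rewrite mulmxDl mulrDl; apply: letr (l2normD _ _) _; apply: lerD; exact: op_ub.
Qed.

Lemma opnormZ_le a M : opnorm (a *: M) <= normc a * opnorm M.
apply: op_le=> [|v]; first by rewrite mulr_ge0 ?op_ge0 ?nc_ge0.
by rewrite -scalemxAl l2normZ -mulrA ler_wpM2l ?nc_ge0 // op_ub.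
Qed.

Lemma opnorm0 : opnorm (0 : 'M[C]_n) = 0.
apply/eqP; rewrite eq_le op_ge0 andbT; apply: op_le=> // v.
by rewrite mul0mx mul0r -(scale0r 0) l2normZ Normc.normc0 mul0r.
Qed.

Lemma op_conj_le M : opnorm (map_mx (@conjc R) M) <= opnorm M.
have lc v : l2norm (map_mx (@conjc R) v) = l2norm v.
  by rewrite /l2norm; congr sqrt; eqr=> i _; rewrite mxE normcJ.
apply: op_le=> [|v]; first exact: op_ge0.
rewrite -(lc v) -[leLHS]lc map_mxM -map_mx_comp.
have -> : map_mx (@conjc R \o @conjc R) M = M by apply/matrixP=> i j; rewrite mxE /= conjcK.
exact: op_ub.
Qed.

Definition hadj M : 'M[C]_n := (map_mx (@conjc R) M)^T.

Lemma l2norm_adj u M v : vip (colfun (M *m u)) (colfun v) = vip (colfun u) (colfun (hadj M *m v)).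
rewrite /dip /cip; under eq_bigr do rewrite !ffunE mxE conj_sum mulr_suml.
rewrite exchange_big; eqr=> j _; rewrite !ffunE mxE mulr_sumr; eqr=> i _.
by rewrite !mxE conjcM mulrCA mulrA.
Qed.

Lemma hadjK : involutive hadj.
by move=> M; apply/matrixP=> i j; rewrite !mxE conjcK. Qed.

Lemma op_hadj_le M : opnorm (hadj M) <= opnorm M.
apply: op_le=> [|v]; first exact: op_ge0.
rewrite l2normE; apply: (nrm_form vipP); rewrite -?l2normE ?mulr_ge0 ?op_ge0 ?l2_ge0 //.
rewrite -(hadjK M) -l2norm_adj hadjK; apply: letr (Re_normc _) _.
apply: letr (CS vipP _ _) _; rewrite -!l2normE mulrAC ler_wpM2r ?l2_ge0 //.
exact: op_ub.
Qed.

Lemma op_hadj M : opnorm (hadj M) = opnorm M.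
have h := op_hadj_le (hadj M); rewrite hadjK in h; exact: le_anti (introT andP (conj (op_hadj_le M) h)). Qed.

Lemma op_tr M : opnorm M^T <= opnorm M.
have -> : M^T = hadj (map_mx (@conjc R) M).
  by apply/matrixP=> i j; rewrite !mxE conjcK.
by rewrite op_hadj op_conj_le.
Qed.

Lemma op_sqr_le M : opnorm M ^+ 2 <= opnorm (hadj M *m M).
have : opnorm M <= sqrt (opnorm (hadj M *m M)).
  apply: op_le=> [|v]; first exact: sqrtr_ge0.
  rewrite -le_sq ?mulr_ge0 ?sqrtr_ge0 // exprMn [X in X * _]sqr_sqrtr ?op_ge0 //.
  rewrite {1}l2normE (nrm_sqr vipP) /n2 l2norm_adj mulmxA. apply: letr (Re_normc _) _; apply: letr (CS vipP _ _) _.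
  rewrite -!l2normE mulrC expr2 mulrA ler_wpM2r ?l2_ge0 //; exact: op_ub.
by rewrite -{2}[opnorm (_ *m _)]sqr_sqrtr ?op_ge0 // le_sq ?op_ge0 ?sqrtr_ge0.
Qed.

Lemma op_sqr M : opnorm (hadj M *m M) = opnorm M ^+ 2.
apply/eqP; rewrite eq_le op_sqr_le andbT; apply: letr (opnormM _ _) _.
by rewrite op_hadj expr2.
Qed.

Lemma delta_norm (j : 'I_n) : l2norm (delta_mx j 0 : 'cV[C]_n) = 1.
rewrite /l2norm (bigD1 j) //= mxE !eqxx big1 ?addr0=> [|i ij].
  by rewrite -[1%:R]/((1 : R)%:C) normcR normr1 expr1n sqrtr1.
by rewrite mxE (negbTE ij) Normc.normc0 expr0n.
Qed.

Lemma op_col M j : \sum_i normc (M i j) ^+ 2 <= opnorm M ^+ 2.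
have := op_ub M (delta_mx j 0); rewrite delta_norm mulr1 -le_sq ?op_ge0 ?l2_ge0 //.
by rewrite l2norm_sqr -colE; under eq_bigr do rewrite mxE.
Qed.

Lemma op_entry M i j : normc (M i j) <= opnorm M.
rewrite -le_sq ?op_ge0 ?nc_ge0 //; apply: letr (op_col M j).
by rewrite (bigD1 i) //= lerDl sumr_ge0 // => k _; exact: sqr_ge0.
Qed.

Lemma frob_le M : frob M <= sqrt n%:R * opnorm M.
rewrite -[X in _ * X]ger0_norm ?op_ge0 // -sqrtr_sqr -sqrtrM ?ler0n // ler_wsqrtr //.
rewrite exchange_big /=; apply: (@le_trans _ _ (\sum_(j < n) opnorm M ^+ 2)).
  by lers=> j _; exact: op_col.
by rewrite sumr_const card_ord mulr_natl.
Qed.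

Lemma ntrace_le M : normc (ntrace M) <= opnorm M.
rewrite /ntrace ncM.
have nE : normc (n%:R^-1 : C) = n%:R^-1.
  by rewrite -(rmorph_nat (real_complex R)) -fmorphV normcR ger0_norm // invr_ge0.
rewrite nE; case: (posnP n)=> [n0|n0].
  by rewrite (_ : n%:R = 0 :> R) ?n0 // invr0 mul0r op_ge0.
rewrite ler_pdivrMl ?ltr0n //; apply: letr (nc_sum _ _ _) _.
apply: (@le_trans _ _ (\sum_(i < n) opnorm M)); first by lers=> i _; exact: op_entry.
by rewrite sumr_const card_ord mulr_natl.
Qed.

End Square.

End OperatorNorm.

(** * Vectors with few excited sites *)

Section Sites.
Variables (K : lmodType R[i]) (ip : K -> K -> R[i]) (ipP : is_sip ip).
Variables (S : Type) (E : S -> {linear K -> K}) (E_idem : forall e v, E e (E e v) = E e v)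
  (E_sa : forall e u v, ip (E e u) v = ip u (E e v)) (E_comm : forall e f v, E e (E f v) = E f (E e v)).

(* [v] is a sum of vectors with at most [m] excited sites, i.e. killed by the
   projections [E e] of at most [m] sites [e] in [L]. *)
Fixpoint excited (L : seq S) (m : nat) (v : K) : Prop :=
  match L with
  | [::]=> True
  | e :: L'=> excited L' m (E e v) /\
      (if m is m'.+1 then excited L' m' (v - E e v) else v - E e v = 0)
  end.

Lemma excited_lin L m a u v : excited L m u -> excited L m v -> excited L m (a *: u + v).
elim: L m u v=> //= e L IH m u v [u1 u2] [v1 v2]; split.
  by rewrite linearP; exact: IH.
have -> : a *: u + v - E e (a *: u + v) = a *: (u - E e u) + (v - E e v).
  by rewrite linearP; lmodule R K.
by case: m u1 u2 v1 v2=> [|m] u1 u2 v1 v2; [rewrite u2 v2 scaler0 addr0|exact: IH].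
Qed.

Lemma excited0 L m : excited L m 0.
elim: L m=> //= e L IH m; rewrite linear0 subr0; split=> //.
by case: m.
Qed.

Lemma excitedD L m u v : excited L m u -> excited L m v -> excited L m (u + v).
by move=> hu hv; rewrite -[u]scale1r; apply: excited_lin. Qed.

Lemma excitedZ L m a u : excited L m u -> excited L m (a *: u).
by move=> hu; rewrite -[_ *: _]addr0; apply: excited_lin=> //; exact: excited0. Qed.

Lemma excitedB L m u v : excited L m u -> excited L m v -> excited L m (u - v).
by move=> hu hv; rewrite -scaleN1r addrC; exact: excited_lin. Qed.

Lemma excited_sum L m (I : Type) (s : seq I) (F : I -> K) :
  (forall i, excited L m (F i)) -> excited L m (\sum_(i <- s) F i).
move=> h; elim: s=> [|i s IH]; first by rewrite big_nil; exact: excited0.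
by rewrite big_cons; exact: excitedD.
Qed.

Lemma excitedS L m v : excited L m v -> excited L m.+1 v.
elim: L m v=> //= e L IH m v [v1 v2]; split; first exact: IH.
by case: m v1 v2=> [_ ->|m _]; [exact: excited0|exact: IH].
Qed.

Lemma excited_le L m n v : (m <= n)%N -> excited L m v -> excited L n v.
move=> /subnK <-; elim: (n - m)%N=> // k IH h; rewrite addSn; apply: excitedS; exact: IH.
Qed.

Lemma excited_behead e L m v : excited (e :: L) m v -> excited L m v.
move=> /= [v1 v2]; rewrite -(subrK (E e v) v) addrC; apply: excitedD=> //.
by case: m v1 v2=> [_ ->|m _ h]; [exact: excited0|exact: excitedS].
Qed.

Lemma excited_comm L m v (T : {linear K -> K}) :
  (forall e w, List.In e L -> E e (T w) = T (E e w)) -> excited L m v -> excited L m (T v).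
have T0 := linear0 T; have TB u w : T (u - w) = T u - T w by exact: linearB.
elim: L m v=> //= e L IH m v ET [v1 v2].
have IH' k w : excited L k w -> excited L k (T w).
  by apply: IH=> f u fL; apply: ET; right.
rewrite ET -?TB; last by left.
by split; [exact: IH'|case: m v1 v2=> [_ ->|m _]; [|exact: IH']].
Qed.

(** At the one site where [T] need not commute with the projection, the image is split by that
    projection and both pieces keep the bound [m] on the other sites; this costs one excitation. *)
Lemma excited_single L m v (T : {linear K -> K}) (P : pred S) :
  (forall e w, ~~ P e -> E e (T w) = T (E e w)) ->
  (count P L <= 1)%N -> excited L m v -> excited L m.+1 (T v).
have T0 := linear0 T; have TB u w : T (u - w) = T u - T w by exact: linearB.
move=> ET; elim: L m v=> //= e L IH m v cP [v1 v2].
case: (boolP (P e)) cP=> Pe cP; last first.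
  rewrite ET // -TB; split; first exact: IH. case: m v1 v2=> [_ ->|m _ v2]; first by rewrite T0; exact: excited0.
  exact: IH.
have nP f : List.In f L -> ~~ P f.
  move: cP; rewrite add1n ltnS leqn0=> cP fL; apply/negP=> Pf.
  by elim: L {IH v1 v2} cP fL=> //= g L IHL; rewrite addn_eq0=> /andP[gP gL] [gf|/(IHL gL)//]; rewrite gf Pf in gP.
have vL : excited L m v by exact: excited_behead (conj v1 v2).
have TvL : excited L m (T v) by apply: excited_comm=> // f w /nP; exact: ET.
have ETv : excited L m (E e (T v)).
  by apply: excited_comm=> // f w _; exact: E_comm.
by split; [exact: excitedS|exact: excitedB].
Qed.

Lemma proj_n2 e v : n2 ip v = n2 ip (E e v) + n2 ip (v - E e v).
have o : ip (E e v) (v - E e v) = 0 by rewrite (ipBr ipP) !E_sa E_idem subrr.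
have -> : n2 ip v = n2 ip (E e v + (v - E e v)) by rewrite addrC subrK.
by rewrite (n2D ipP (E e v) (v - E e v)) o /= mulr0 addr0.
Qed.

(** The sum of the [1 - E e] is the number operator, at most [m] on such vectors. Each projection
    splits the form orthogonally, which runs the induction over the sites. *)
Lemma excited_n2 L m v : excited L m v ->
  \sum_(e <- L) n2 ip (v - E e v) <= m%:R * n2 ip v.
elim: L m v=> [|e L IH] m v; first by rewrite big_nil mulr_ge0 ?(n2_ge0 ipP).
move=> /= [v1 v2]; rewrite big_cons.
have split_site : \sum_(f <- L) n2 ip (v - E f v) =
    \sum_(f <- L) n2 ip (E e v - E f (E e v)) + \sum_(f <- L) n2 ip (v - E e v - E f (v - E e v)).
  rewrite -big_split; eqr=> f _; rewrite (proj_n2 e) (linearB (E e)) E_comm; congr (_ + n2 _ _).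
  by rewrite (linearB (E f)) (E_comm e f); lmodule R K.
rewrite split_site (proj_n2 e v) mulrDr addrC -addrA lerD ?IH //.
case: m v1 v2=> [v1 v2|m v1 v2].
  rewrite v2 mul0r big1 ?add0r=> [|f _]; first by rewrite /n2 (ip0r ipP).
  by rewrite (linear0 (E f)) subr0 /n2 (ip0r ipP).
by rewrite -[m.+1]addn1 natrD mulrDl mul1r lerD2r; exact: IH.
Qed.

End Sites.

(** * Creation and annihilation by the entries of an array *)

Section Arrays.
Variables (d n : nat) (K : lmodType R[i]) (ip : K -> K -> R[i]) (ipP : is_sip ip).
Notation X := ('I_d * bool)%type.
Notation J := 'I_n.+1.
Notation xadj := (fun x : X=> (x.1, ~~ x.2)).

(** Interface of the random array: [E i j] averages over the pair of entries at [{i, j}], and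
    [mu x i j] multiplies by an entry of the letter [x]. The covariance [gam] with the transposed
    entry survives in the limit; [gam'], with the entry at the same position, is only bounded and
    costs [n^(-1/2)]. *)
Record site_algebra (E : J -> J -> {linear K -> K}) (mu : X -> J -> J -> {linear K -> K})
    (gam gam' : X -> X -> J -> J -> C) (sg t : R) : Prop := SiteAlgebra {
  sa_sym : forall i j v, E i j v = E j i v;
  sa_idem : forall i j v, E i j (E i j v) = E i j v;
  sa_self : forall i j u v, ip (E i j u) v = ip u (E i j v);
  sa_comm : forall i j k l v, E i j (E k l v) = E k l (E i j v);
  sa_adj : forall x i j u v, ip (mu x i j u) v = ip u (mu (xadj x) j i v);
  sa_Emu : forall x i j k l v, (i, j) != (k, l) -> (i, j) != (l, k) ->
    E i j (mu x k l v) = mu x k l (E i j v);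
  sa_mumu : forall x y i j k l v, (i, j) != (k, l) -> (i, j) != (l, k) ->
    mu x i j (mu y k l v) = mu y k l (mu x i j v);
  sa_mean : forall x i j v, E i j (mu x i j (E i j v)) = 0;
  sa_cov : forall x y i j v, E i j (mu x i j (mu y j i (E i j v))) = gam x y i j *: E i j v;
  sa_cov' : forall x y i j v, E i j (mu x i j (mu y i j (E i j v))) = gam' x y i j *: E i j v;
  sa_sg0 : 0 <= sg;
  sa_sg : forall x y i j, normc (gam x y i j) <= sg ^+ 2;
  sa_sg' : forall x y i j, normc (gam' x y i j) <= sg ^+ 2;
  sa_bound : forall x i j v, nrm ip (mu x i j v) <= t * nrm ip v;
  sa_mdiag : forall x i v, mu x i i v = 0;
  sa_Ediag : forall i v, E i i v = v;
  sa_amp : forall (c : 'M[C]_n.+1) (psi : {ffun J -> K}),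
    nrm (@dip K ip J) [ffun i=> \sum_j c i j *: psi j] <= opnorm c * nrm (@dip K ip J) psi }.

Variables (E : J -> J -> {linear K -> K}) (mu : X -> J -> J -> {linear K -> K})
  (gam gam' : X -> X -> J -> J -> C) (sg t : R) (saP : site_algebra E mu gam gam' sg t).
Notation H := {ffun J -> K}.
Notation hp := (@dip K ip J).
Let hpP : is_sip hp := dip_sip ipP J.

Definition s_ : R := (sqrt n.+1%:R)^-1.
Definition mact (c : 'M[C]_n.+1) (psi : H) : H := [ffun i=> \sum_j c i j *: psi j].
(** [Cr] averages the site out before multiplying by its centred entry, [An] afterwards: the parts
    of the multiplication that raise, respectively lower, the excitation of that site. *)
Definition Cr (x : X) (psi : H) : H := [ffun i=> s_%:C *: \sum_j mu x i j (E i j (psi j))].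
Definition An (x : X) (psi : H) : H := [ffun i=> s_%:C *: \sum_j E i j (mu x i j (psi j))].
Definition Xl (x : X) (psi : H) : H := [ffun i=> s_%:C *: \sum_j mu x i j (psi j)].

Definition sites : seq (J * J) := [seq e : J * J <- enum {: J * J} | (e.1 < e.2)%N].
Definition Vk (m : nat) (v : K) : Prop := excited (fun e=> E e.1 e.2) sites m v.
Definition Vh (m : nat) (psi : H) : Prop := forall i, Vk m (psi i).
Notation Dk i j v := (v - E i j v).

Lemma s_sqr : s_ ^+ 2 = n.+1%:R^-1.
by rewrite /s_ exprVn sqr_sqrtr ?ler0n. Qed.
Lemma s_ge0 : 0 <= s_. by rewrite invr_ge0 sqrtr_ge0. Qed.

Lemma Vk_n2 m v : Vk m v -> \sum_i \sum_j n2 ip (Dk i j v) <= 2 * m%:R * n2 ip v.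
move=> hv; have h := excited_n2 ipP (fun e=> sa_idem saP e.1 e.2) (fun e=> sa_self saP e.1 e.2)
  (fun e f=> sa_comm saP e.1 e.2 f.1 f.2) hv.
have -> : \sum_i \sum_j n2 ip (Dk i j v) = 2 * \sum_(e <- sites) n2 ip (v - E e.1 e.2 v).
  rewrite pair_big /= /sites big_filter big_enum_cond /= mulr_natl mulr2n.
  rewrite (bigID (fun e : J * J=> (e.1 < e.2)%N)) /=; congr (_ + _).
  rewrite (bigID (fun e : J * J=> (e.2 < e.1)%N)) /= [X in _ + X]big1 ?addr0; last first.
    move=> [i j] /= /andP[ij ji]; have -> : i = j by apply: val_inj=> /=; lia.
    by rewrite (sa_Ediag saP) subrr /n2 (ip0r ipP).
  rewrite (reindex_inj (h := fun e : J * J=> (e.2, e.1))) /=; last by move=> [a b] [a' b'] [-> ->].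
  apply: eq_big=> [[i j]|[i j] _] /=; last by rewrite (sa_sym saP). by rewrite -leqNgt; case: ltngtP.
by rewrite -mulrA ler_wpM2l.
Qed.

Lemma Vh_n2 m psi : Vh m psi -> \sum_l \sum_i \sum_j n2 ip (Dk i j (psi l)) <= 2 * m%:R * n2 hp psi.
by move=> hv; rewrite dip_n2 mulr_sumr; lers=> l _; apply: Vk_n2. Qed.

Lemma Vk_E m i j v : Vk m v -> Vk m (E i j v).
by move=> hv; apply: excited_comm=> // e w _; exact: (sa_comm saP).
Qed.

Lemma Vk_mu m x i j v : Vk m v -> Vk m.+1 (mu x i j v).
move=> hv; apply: (@excited_single _ _ (fun e=> E e.1 e.2) (fun e f=> sa_comm saP e.1 e.2 f.1 f.2)
  _ _ _ (mu x i j) (fun e=> (e == (i, j)) || (e == (j, i))))=> [[k l] w /=||//].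
  by rewrite negb_or=> /andP[e1 e2]; rewrite (sa_Emu saP).
have uq : uniq sites by rewrite filter_uniq ?enum_uniq.
rewrite -size_filter; set L := seq.filter _ _.
have uL : uniq L by rewrite filter_uniq.
have LP e : e \in L -> e = if (i < j)%N then (i, j) else (j, i).
  rewrite !mem_filter=> /andP[eij /andP[elt _]].
  by case/orP: eij elt=> /eqP -> /= ij; rewrite ?ij // ltnNge (ltnW ij).
case: L uL LP=> [|a [|b L]] //= /andP[]; rewrite inE negb_or=> /andP[ab _] _ LP.
have ea := LP a (mem_head _ _); have eb : b = _ := LP b (mem_behead (s := a :: _) (mem_head b L)).
by rewrite ea eb eqxx in ab.
Qed.

Lemma VkD m u v : Vk m u -> Vk m v -> Vk m (u + v). exact: excitedD. Qed.
Lemma VkZ m a u : Vk m u -> Vk m (a *: u). exact: excitedZ. Qed.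
Lemma Vk_sum m (I : Type) (s : seq I) (F : I -> K) : (forall i, Vk m (F i)) -> Vk m (\sum_(i <- s) F i).
exact: excited_sum. Qed.

Lemma Vh_Cr m x psi : Vh m psi -> Vh m.+1 (Cr x psi).
by move=> h i; rewrite ffunE; apply: VkZ; apply: Vk_sum=> j; apply: Vk_mu; apply: Vk_E. Qed.
Lemma Vh_An m x psi : Vh m psi -> Vh m.+1 (An x psi).
by move=> h i; rewrite ffunE; apply: VkZ; apply: Vk_sum=> j; apply: Vk_E; apply: Vk_mu. Qed.
Lemma Vh_Xl m x psi : Vh m psi -> Vh m.+1 (Xl x psi).
by move=> h i; rewrite ffunE; apply: VkZ; apply: Vk_sum=> j; apply: Vk_mu. Qed.
Lemma Vh_mact m c psi : Vh m psi -> Vh m (mact c psi).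
by move=> h i; rewrite ffunE; apply: Vk_sum=> j; apply: VkZ. Qed.
Lemma VhB m phi psi : Vh m phi -> Vh m psi -> Vh m (phi - psi).
by move=> h1 h2 i; rewrite !ffunE; exact: (excitedB (h1 i) (h2 i)). Qed.
Lemma Vh_le m m' psi : (m <= m')%N -> Vh m psi -> Vh m' psi.
by move=> mm h i; apply: excited_le (h i). Qed.

Let conjs : conjc s_%:C = s_%:C. exact: conjcR. Qed.

Lemma Cr_adj x phi psi : hp (Cr x phi) psi = hp phi (An (xadj x) psi).
rewrite /dip; under eq_bigr do rewrite ffunE (ipZl ipP) conjs (ip_suml ipP) mulr_sumr.
rewrite exchange_big; eqr=> j _; rewrite ffunE (ipZr ipP) (ip_sumr ipP) mulr_sumr.
by eqr=> i _; rewrite (sa_adj saP) (sa_self saP) (sa_sym saP).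
Qed.

Lemma Cr_adjr x phi psi : hp phi (Cr x psi) = hp (An (xadj x) phi) psi.
by rewrite (ipC hpP) Cr_adj -(ipC hpP). Qed.

Lemma mact_adj c phi psi : hp (mact c phi) psi = hp phi (mact (adjmx c) psi).
rewrite /dip; under eq_bigr do rewrite ffunE (ip_suml ipP).
rewrite exchange_big; eqr=> j _; rewrite ffunE (ip_sumr ipP).
by eqr=> i _; rewrite (ipZl ipP) (ipZr ipP) !mxE.
Qed.

(* Averaging out one site turns a multiplication into a contraction. *)
Lemma Emu_D x i j v : E i j (mu x i j v) = E i j (mu x i j (Dk i j v)).
by rewrite !linearB /= (sa_mean saP) subr0. Qed.

Lemma muE_n2 x i j v : n2 ip (mu x i j (E i j v)) <= sg ^+ 2 * n2 ip v.
have -> : n2 ip (mu x i j (E i j v)) = cRe (gam (xadj x) x j i * ip v (E i j v)).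
  rewrite /n2 (sa_adj saP) (sa_self saP) (sa_sym saP) -[E i j v](sa_idem saP).
  by rewrite [E i j (E i j v)](sa_sym saP) (sa_cov saP) (ipZr ipP) (sa_sym saP j i) (sa_idem saP).
apply: letr (Re_normc _) _; rewrite ncM.
apply: ler_pM; rewrite ?nc_ge0 ?(sa_sg saP) //.
apply: letr (CS ipP _ _) _; rewrite -(nrm_sqr ipP) expr2 ler_wpM2l ?nrm_ge0 //.
rewrite -le_sq ?nrm_ge0 // !(nrm_sqr ipP).
rewrite (proj_n2 ipP (fun e=> sa_idem saP e.1 e.2) (fun e=> sa_self saP e.1 e.2) (i, j) v) /=.
by rewrite lerDl (n2_ge0 ipP).
Qed.

(** Dual to [muE_n2]. Only the excited part of [v] at the site is seen, which lets sums over all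
    sites be bounded by the degree. *)
Lemma Emu_n2 x i j v : n2 ip (E i j (mu x i j v)) <= sg ^+ 2 * n2 ip (Dk i j v).
rewrite Emu_D; set w := Dk i j v; set z := E i j _.
suff h : nrm ip z <= sg * nrm ip w.
  rewrite -!(nrm_sqr ipP) -exprMn le_sq ?nrm_ge0 //. by rewrite mulr_ge0 ?nrm_ge0 ?(sa_sg0 saP).
apply: (nrm_form ipP); first by rewrite mulr_ge0 ?nrm_ge0 ?(sa_sg0 saP).
have -> : ip z z = ip w (mu (xadj x) j i (E j i z)).
  by rewrite {1}/z (sa_self saP) (sa_adj saP) (sa_sym saP).
apply: letr (Re_normc _) _; apply: letr (CS ipP _ _) _.
rewrite [X in _ <= X * _]mulrC -mulrA ler_wpM2l ?nrm_ge0 //.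
rewrite -le_sq ?mulr_ge0 ?nrm_ge0 ?(sa_sg0 saP) // exprMn !(nrm_sqr ipP).
exact: muE_n2.
Qed.

Lemma Vh_n2_fst m phi : Vh m phi -> \sum_(e : J * J) n2 ip (Dk e.1 e.2 (phi e.1)) <= 2 * m%:R * n2 hp phi.
move=> h; apply: letr (Vh_n2 h).
rewrite -(pair_big xpredT xpredT (fun i j=> n2 ip (Dk i j (phi i)))) /=; lers=> i _.
rewrite [leRHS](bigD1 i) //= lerDl sumr_ge0 // => k _; rewrite sumr_ge0 // => l _; exact: n2_ge0.
Qed.

Lemma Vh_n2_snd m phi : Vh m phi -> \sum_(e : J * J) n2 ip (Dk e.1 e.2 (phi e.2)) <= 2 * m%:R * n2 hp phi.
move=> h; apply: letr (Vh_n2_fst h).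
rewrite (reindex_inj (h := fun e : J * J=> (e.2, e.1))) /=; last by move=> [a b] [a' b'] [-> ->].
by rewrite le_eqVlt; apply/orP; left; apply/eqP; eqr=> e _; rewrite (sa_sym saP).
Qed.

Lemma excited_pairs (u v : J * J -> R) (c : R) phi psi : 0 <= c ->
  (\sum_e u e ^+ 2 <= c * n2 hp phi) -> (\sum_e v e ^+ 2 <= c * n2 hp psi) ->
  \sum_e u e * v e <= c * (nrm hp phi * nrm hp psi).
move=> c0 bu bv; apply: letr (rCS _ _) _.
have -> : c * (nrm hp phi * nrm hp psi) = sqrt (c * n2 hp phi) * sqrt (c * n2 hp psi).
  rewrite !sqrtrM // -[X in X * _]sqr_sqrtr // -/(nrm hp phi) -/(nrm hp psi); ring.
by apply: ler_pM; rewrite ?sqrtr_ge0 // ler_wsqrtr.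
Qed.

(* The remainder [X - C - A] is [n^{-1/2} D mu D], which is small because few
   sites are excited. *)
Lemma Xl_split m x psi : Vh m psi ->
  nrm hp (Xl x psi - Cr x psi - An x psi) <= s_ * `|t| * (2 * m.+1%:R) * nrm hp psi.
move=> hpsi; set phi := Xl x psi - _ - _.
(* The remainder is tested against itself, so that the scarcity of excited sites is used on both
   sides; hence [m.+1]. *)
have hphi : Vh m.+1 phi by apply: VhB; [apply: VhB|]; [exact: Vh_Xl|exact: Vh_Cr|exact: Vh_An].
apply: (nrm_form hpP); first by rewrite !mulr_ge0 ?nrm_ge0 ?s_ge0.
have phiE i : phi i = s_%:C *: \sum_j Dk i j (mu x i j (Dk i j (psi j))).
  rewrite !ffunE -!scalerBr -!sumrB; congr (_ *: _); eqr=> j _. by rewrite !linearB /= (sa_mean saP); lmodule R K.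
have -> : hp phi phi = s_%:C * \sum_i \sum_j ip (Dk i j (phi i)) (mu x i j (Dk i j (psi j))).
  rewrite /dip mulr_sumr; eqr=> i _; rewrite {2}phiE (ipZr ipP) (ip_sumr ipP).
  by congr (_ * _); eqr=> j _; rewrite (ipBr ipP) (ipBl ipP) (sa_self saP).
apply: letr (Re_normc _) _; rewrite ncM normcR ger0_norm ?s_ge0 //.
rewrite -!mulrA ler_wpM2l ?s_ge0 //; apply: letr (nc_sum _ _ _) _.
apply: (@le_trans _ _ (`|t| * \sum_(e : J * J) nrm ip (Dk e.1 e.2 (phi e.1)) * nrm ip (Dk e.1 e.2 (psi e.2)))).
  rewrite -(pair_big xpredT xpredT (fun i j=> nrm ip (Dk i j (phi i)) * nrm ip (Dk i j (psi j)))) /=.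
  rewrite mulr_sumr; lers=> i _; rewrite mulr_sumr. apply: letr (nc_sum _ _ _) _; lers=> j _.
  apply: letr (CS ipP _ _) _; rewrite mulrCA ler_wpM2l ?nrm_ge0 //.
  apply: letr (sa_bound saP _ _ _ _) _; rewrite ler_wpM2r ?nrm_ge0 //; exact: ler_norm.
rewrite ler_wpM2l //.
rewrite (_ : 2 * _ = 2 * m.+1%:R * (nrm hp phi * nrm hp psi)); last by ring.
apply: excited_pairs; rewrite ?mulr_ge0 //.
  by under eq_bigr do rewrite (nrm_sqr ipP); exact: Vh_n2_fst.
by under eq_bigr do rewrite (nrm_sqr ipP); apply: Vh_n2_snd=> i; apply: excitedS; exact: hpsi.
Qed.

Lemma op_adjmx (c : 'M[C]_n.+1) : opnorm (adjmx c) = opnorm c.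
exact: op_hadj. Qed.

(** What remains of [X c X] after averaging when only transposed entries are paired. *)
Definition etan (x y : X) (c : 'M[C]_n.+1) : 'M[C]_n.+1 :=
  diag_mx (\row_i (n.+1%:R^-1 * \sum_j c j j * gam x y i j)).

Let sC2 : s_%:C * s_%:C = n.+1%:R^-1 :> C.
by rewrite -realcM -expr2 s_sqr fmorphV rmorph_nat. Qed.

Section Contraction.
Variables (x y : X) (c : 'M[C]_n.+1) (m : nat) (phi psi : H) (hphi : Vh m phi) (hpsi : Vh m psi).
(** In [T] the annihilation at [{i, j}] acts after the creation at [{k, l}], in [Th] before it; the
    two agree for distinct sites. *)
Let T i j k l := ip (phi i) (E i j (mu x i j (mu y k l (E k l (psi l))))).
Let Th i j k l := ip (phi i) (mu y k l (E k l (E i j (mu x i j (psi l))))).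
Let c0 := op_ge0 c.
Let sg2 : 0 <= sg ^+ 2 := sqr_ge0 sg.
Let m20 : 0 <= 2 * m%:R :> R. by rewrite mulr_ge0. Qed.

Let pairs_sum (F : J -> J -> C) i j : (forall k l, (i, j) != (k, l) -> (i, j) != (l, k) -> F k l = 0) ->
  i != j -> \sum_k \sum_l F k l = F j i + F i j.
move=> F0 ij; rewrite pair_big (bigD1 (j, i)) //=; congr (_ + _).
rewrite (bigD1 (i, j)) /=; last by rewrite xpair_eqE (negbTE ij).
rewrite big1 ?addr0 // => -[k l] /= /andP[h1 h2]; apply: F0; rewrite eq_sym //.
by move: h1; rewrite !xpair_eqE andbC.
Qed.

Let expand : hp phi (An x (mact c (Cr y psi))) =
  n.+1%:R^-1 * \sum_i \sum_j \sum_k \sum_l c j k * T i j k l.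
rewrite /dip mulr_sumr; eqr=> i _; rewrite ffunE (ipZr ipP) -sC2 -mulrA; congr (_ * _).
rewrite (ip_sumr ipP) mulr_sumr; eqr=> j _.
rewrite ffunE !linear_sum (ip_sumr ipP) mulr_sumr; eqr=> k _.
rewrite !linearZ /= (ipZr ipP) ffunE !linearZ /= (ipZr ipP) mulrCA; congr (_ * _).
by rewrite -mulr_sumr !linear_sum (ip_sumr ipP).
Qed.

Let b_ i l : H := [ffun k=> E k l (mu (xadj y) l k (phi i))].
Let a_ i l : H := [ffun j=> E i j (mu x i j (psi l))].

Let ThE i j k l : Th i j k l = ip (b_ i l k) (a_ i l j).
by rewrite !ffunE (sa_self saP) (sa_adj saP) /= negbK -surjective_pairing. Qed.

Let a_n2 i l j : n2 ip (a_ i l j) <= sg ^+ 2 * n2 ip (Dk i j (psi l)).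
by rewrite ffunE Emu_n2. Qed.
Let b_n2 i l k : n2 ip (b_ i l k) <= sg ^+ 2 * n2 ip (Dk l k (phi i)).
by rewrite ffunE (sa_sym saP) Emu_n2. Qed.

Let Th_le i j k l : normc (Th i j k l) <= sg ^+ 2 * (nrm ip (Dk l k (phi i)) * nrm ip (Dk i j (psi l))).
have h (u v : K) : n2 ip u <= sg ^+ 2 * n2 ip v -> nrm ip u <= sg * nrm ip v.
  by rewrite -!(nrm_sqr ipP) -exprMn le_sq ?mulr_ge0 ?nrm_ge0 ?(sa_sg0 saP).
rewrite ThE; apply: letr (CS ipP _ _) _.
rewrite expr2 mulrACA; apply: ler_pM; rewrite ?nrm_ge0 // h ?a_n2 ?b_n2 //.
Qed.

(** In the commuted order both operators annihilate at excited sites, of [phi] and of [psi], so the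
    sum over four indices is of order [m] only. The matrix [c] acts through its transpose. *)
Let through_sites : normc (\sum_i \sum_j \sum_k \sum_l c j k * Th i j k l) <=
  opnorm c * (sg ^+ 2 * (2 * m%:R) * (nrm hp phi * nrm hp psi)).
have -> : \sum_i \sum_j \sum_k \sum_l c j k * Th i j k l = \sum_(e : J * J) hp (b_ e.1 e.2) (mact c^T (a_ e.1 e.2)).
  rewrite -(pair_big xpredT xpredT (fun i l=> hp (b_ i l) (mact c^T (a_ i l)))) /=.
  eqr=> i _; rewrite exchange_big /=. under eq_bigr do rewrite exchange_big /=.
  rewrite exchange_big /=; eqr=> l _; eqr=> k _. rewrite [mact _ _ _]ffunE (ip_sumr ipP); eqr=> j _.
  by rewrite (ipZr ipP) mxE ThE.
apply: letr (nc_sum _ _ _) _.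
apply: (@le_trans _ _ (opnorm c * \sum_(e : J * J) nrm hp (b_ e.1 e.2) * nrm hp (a_ e.1 e.2))).
  rewrite mulr_sumr; lers=> e _. apply: letr (CS hpP _ _) _; rewrite mulrCA ler_wpM2l ?nrm_ge0 //.
  apply: letr (sa_amp saP _ _) _; apply: ler_wpM2r; [exact: nrm_ge0|exact: op_tr].
rewrite ler_wpM2l //; apply: excited_pairs; first by apply: mulr_ge0.
  under eq_bigr do rewrite (nrm_sqr hpP) dip_n2.
  rewrite -(pair_big xpredT xpredT (fun i l=> \sum_k n2 ip (b_ i l k))) /= -mulrA.
  apply: letr (_ : _ <= sg ^+ 2 * \sum_i \sum_l \sum_k n2 ip (Dk l k (phi i))) _.
    rewrite mulr_sumr; lers=> i _; rewrite mulr_sumr; lers=> l _. by rewrite mulr_sumr; lers=> k _; exact: b_n2.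
  by rewrite ler_wpM2l // Vh_n2.
under eq_bigr do rewrite (nrm_sqr hpP) dip_n2.
rewrite -(pair_big xpredT xpredT (fun i l=> \sum_k n2 ip (a_ i l k))) /= -mulrA exchange_big.
apply: letr (_ : _ <= sg ^+ 2 * \sum_l \sum_i \sum_j n2 ip (Dk i j (psi l))) _.
  rewrite mulr_sumr; lers=> i _; rewrite mulr_sumr; lers=> l _. by rewrite mulr_sumr; lers=> k _; exact: a_n2.
by rewrite ler_wpM2l // Vh_n2.
Qed.

Let r1 i j := - (gam x y i j * ip (phi i) (Dk i j (psi i))) - Th i j j i.

(** For given [i] and [j] only [(k, l) = (j, i)] and [(k, l) = (i, j)] distinguish [T] from [Th].
    The first gives [gam], up to corrections collected in [r1]; the second is the term governed by
    [gam']. *)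
Let same_site i j : \sum_k \sum_l c j k * T i j k l = \sum_k \sum_l c j k * Th i j k l +
  c j j * gam x y i j * ip (phi i) (psi i) + c j j * r1 i j + c j i * T i j i j - c j i * Th i j i j.
have [ij|nij] := eqVneq i j.
  rewrite -ij; have g0 : gam x y i i * ip (phi i) (psi i) = 0.
    by rewrite -(ipZr ipP) -[psi i](sa_Ediag saP i) -(sa_cov saP) (sa_mdiag saP) linear0 (ip0r ipP).
  have T0 k l : T i i k l = 0 by rewrite /T (sa_mdiag saP) linear0 (ip0r ipP).
  have Th0 k l : Th i i k l = 0 by rewrite /Th (sa_mdiag saP) !linear0 (ip0r ipP).
  rewrite /r1 !T0 !Th0 (sa_Ediag saP) subrr (ip0r ipP) !(mulr0, oppr0, addr0) -mulrA g0 mulr0 addr0.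
  rewrite !big1 // => k _; rewrite big1 // => l _; by rewrite ?T0 ?Th0 mulr0.
have := @pairs_sum (fun k l=> c j k * T i j k l - c j k * Th i j k l) i j.
have -> : \sum_k \sum_l (c j k * T i j k l - c j k * Th i j k l) =
    \sum_k \sum_l c j k * T i j k l - \sum_k \sum_l c j k * Th i j k l.
  by rewrite -sumrB; eqr=> k _; rewrite sumrB.
set S1 := \sum_k _ - _; move: @S1.
set S1 := (\sum_k \sum_l c j k * T i j k l); set S2 := (\sum_k \sum_l c j k * Th i j k l)=> S h.
have -> : S1 = S2 + S by rewrite /S; ring.
rewrite h //; last first.
  move=> k l h1 h2; rewrite -mulrBr /T /Th (sa_mumu saP) // (sa_Emu saP) // -(sa_Emu saP x (i := k)).
  - by rewrite (sa_comm saP) subrr mulr0.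
  - by rewrite eq_sym. by apply: contra h2=> /eqP [-> ->].
have -> : T i j j i = gam x y i j * (ip (phi i) (psi i) - ip (phi i) (Dk i j (psi i))).
  rewrite /T [E j i _](sa_sym saP) (sa_cov saP) (ipZr ipP) (ipBr ipP); congr (_ * _); ring.
rewrite /r1; ring.
Qed.

Let Dphi_psi : \sum_(e : J * J) nrm ip (Dk e.1 e.2 (phi e.1)) * nrm ip (Dk e.1 e.2 (psi e.1)) <=
  2 * m%:R * (nrm hp phi * nrm hp psi).
by apply: excited_pairs=> //; under eq_bigr do rewrite (nrm_sqr ipP); exact: Vh_n2_fst. Qed.

Let Dphi_psi' : \sum_(e : J * J) nrm ip (Dk e.2 e.1 (phi e.1)) * nrm ip (Dk e.1 e.2 (psi e.2)) <=
  2 * m%:R * (nrm hp phi * nrm hp psi).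
apply: excited_pairs=> //; under eq_bigr do rewrite (nrm_sqr ipP); last exact: Vh_n2_snd.
by under eq_bigr do rewrite (sa_sym saP); exact: Vh_n2_fst.
Qed.

Let flat (F : J -> J -> C) (G : J * J -> R) M : (forall i j, normc (F i j) <= G (i, j)) ->
  \sum_e G e <= M -> normc (\sum_i \sum_j F i j) <= M.
move=> FG GM; rewrite pair_big /=; apply: letr (nc_sum _ _ _) _; apply: letr GM.
by lers=> -[i j] _; exact: FG.
Qed.

Let nE i j v : nrm ip (E i j v) <= nrm ip v.
rewrite -le_sq ?nrm_ge0 // !(nrm_sqr ipP).
rewrite (proj_n2 ipP (fun e=> sa_idem saP e.1 e.2) (fun e=> sa_self saP e.1 e.2) (i, j) v) /=.
by rewrite lerDl (n2_ge0 ipP).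
Qed.

Let nD i j v w : normc (ip v (Dk i j w)) <= nrm ip (Dk i j v) * nrm ip (Dk i j w).
have -> : ip v (Dk i j w) = ip (Dk i j v) (Dk i j w).
  rewrite [RHS](ipBl ipP) (sa_self saP) linearB /= (sa_idem saP) subrr (ip0r ipP) subr0 //.
exact: (CS ipP).
Qed.

(** The constant 8 is [2 + 4 + 2], from [through_sites], [b1] and [b2]. The summand [s_] comes from
    [b3], where all entries of [c] occur and are controlled by its Frobenius norm, at most
    [sqrt n.+1%:R * opnorm c]. *)
Lemma An_Cr_form : normc (hp phi (An x (mact c (Cr y psi))) - hp phi (mact (etan x y c) psi)) <=
  opnorm c * sg ^+ 2 * (8 * m%:R / n.+1%:R + s_) * (nrm hp phi * nrm hp psi).
have eta : hp phi (mact (etan x y c) psi) = n.+1%:R^-1 * \sum_i \sum_j c j j * gam x y i j * ip (phi i) (psi i).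
  rewrite /dip mulr_sumr; eqr=> i _; rewrite [mact _ _ _]ffunE (bigD1 i) //= big1=> [|j ji].
    by rewrite addr0 !mxE eqxx mulr1n (ipZr ipP) -mulrA mulr_suml.
  by rewrite !mxE eq_sym (negbTE ji) mulr0n scale0r.
rewrite expand eta; under eq_bigr do under eq_bigr do rewrite same_site.
set S0 := \sum_i \sum_j \sum_k \sum_l c j k * Th i j k l.
have -> : \sum_i \sum_j (\sum_k \sum_l c j k * Th i j k l +
  c j j * gam x y i j * ip (phi i) (psi i) + c j j * r1 i j + c j i * T i j i j - c j i * Th i j i j) =
  S0 + \sum_i \sum_j c j j * gam x y i j * ip (phi i) (psi i) + \sum_i \sum_j c j j * r1 i j +
  \sum_i \sum_j c j i * T i j i j - \sum_i \sum_j c j i * Th i j i j. rewrite /S0 -!big_split -sumrB; eqr=> i _ /=.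
  by rewrite -!big_split -sumrB; eqr=> j _ /=.
set S1 := \sum_i \sum_j c j j * gam x y i j * ip (phi i) (psi i).
set N2 := nrm hp phi * nrm hp psi.
have N20 : 0 <= N2 by rewrite mulr_ge0 ?nrm_ge0.
have b1 : normc (\sum_i \sum_j c j j * r1 i j) <= opnorm c * (2 * sg ^+ 2) * (2 * m%:R * N2).
  apply: (flat (G := fun e=> opnorm c * (2 * sg ^+ 2) * (nrm ip (Dk e.1 e.2 (phi e.1)) * nrm ip (Dk e.1 e.2 (psi e.1))))).
    move=> i j /=; rewrite ncM -mulrA; apply: ler_pM; rewrite ?nc_ge0 ?op_entry //.
    apply: letr (le_normcD _ _) _; rewrite !normcN ncM -mulrA mulr_natl mulr2n; apply: lerD.
      by apply: ler_pM; rewrite ?nc_ge0 ?(sa_sg saP).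
    exact: Th_le.
  rewrite -mulr_sumr; apply: ler_wpM2l=> //; apply: mulr_ge0=> //; exact: mulr_ge0.
have b2 : normc (\sum_i \sum_j c j i * Th i j i j) <= opnorm c * sg ^+ 2 * (2 * m%:R * N2).
  apply: (flat (G := fun e=> opnorm c * sg ^+ 2 * (nrm ip (Dk e.2 e.1 (phi e.1)) * nrm ip (Dk e.1 e.2 (psi e.2))))).
    move=> i j /=; rewrite ncM -mulrA; apply: ler_pM; rewrite ?nc_ge0 ?op_entry //.
  by rewrite -mulr_sumr; apply: ler_wpM2l=> //; exact: mulr_ge0.
have b3 : normc (\sum_i \sum_j c j i * T i j i j) <= sg ^+ 2 * (sqrt n.+1%:R * opnorm c * N2).
  apply: (flat (G := fun e=> sg ^+ 2 * (normc (c e.2 e.1) * (nrm ip (phi e.1) * nrm ip (psi e.2))))).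
    move=> i j /=; rewrite ncM /T (sa_cov' saP) (ipZr ipP) ncM mulrCA.
    apply: ler_pM; rewrite ?mulr_ge0 ?nc_ge0 ?(sa_sg' saP) //; rewrite ler_wpM2l ?nc_ge0 //.
    by apply: letr (CS ipP _ _) _; rewrite ler_wpM2l ?nrm_ge0.
  rewrite -mulr_sumr ler_wpM2l //; apply: letr (rCS _ _) _. apply: ler_pM; rewrite ?sqrtr_ge0 //.
    apply: letr (frob_le c); rewrite ler_wsqrtr // exchange_big pair_big /=.
    by rewrite le_eqVlt; apply/orP; left; apply/eqP.
  rewrite -[leRHS]ger0_norm // -sqrtr_sqr ler_wsqrtr // exprMn !(nrm_sqr hpP) !dip_n2 mulr_suml.
  under [leRHS]eq_bigr do rewrite mulr_sumr. rewrite pair_big /=; lers=> e _. by rewrite exprMn !(nrm_sqr ipP).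
have -> : n.+1%:R^-1 * (S0 + S1 + \sum_i \sum_j c j j * r1 i j + \sum_i \sum_j c j i * T i j i j -
    \sum_i \sum_j c j i * Th i j i j) - n.+1%:R^-1 * S1 =
    n.+1%:R^-1 * (S0 + \sum_i \sum_j c j j * r1 i j + \sum_i \sum_j c j i * T i j i j -
    \sum_i \sum_j c j i * Th i j i j) by ring.
rewrite ncM -(rmorph_nat (real_complex R)) -fmorphV normcR ger0_norm ?invr_ge0 //.
have -> : opnorm c * sg ^+ 2 * (8 * m%:R / n.+1%:R + s_) * N2 =
    n.+1%:R^-1 * (opnorm c * sg ^+ 2 * (8 * m%:R + sqrt n.+1%:R) * N2).
  have -> : s_ = n.+1%:R^-1 * sqrt n.+1%:R.
    by rewrite -s_sqr expr2 -mulrA mulVf ?mulr1 // sqrtr_eq0 -ltNge ltr0n.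
  ring.
rewrite ler_wpM2l ?invr_ge0 //.
apply: letr (le_normcD _ _) _; rewrite normcN.
apply: letr (lerD (letr (le_normcD _ _) (lerD (letr (le_normcD _ _) (lerD through_sites b1)) b3)) b2) _.
rewrite -/N2 le_eqVlt; apply/orP; left; apply/eqP; ring.
Qed.
End Contraction.

(** [m.+2] is a degree of the difference itself, against which it is tested. *)
Lemma An_Cr x y c m psi : Vh m psi ->
  nrm hp (An x (mact c (Cr y psi)) - mact (etan x y c) psi) <=
  opnorm c * sg ^+ 2 * (8 * m.+2%:R / n.+1%:R + s_) * nrm hp psi.
move=> h; apply: (nrm_form hpP).
  apply: mulr_ge0; last exact: nrm_ge0. apply: mulr_ge0; first by rewrite mulr_ge0 ?op_ge0 ?sqr_ge0.
  by rewrite addr_ge0 ?s_ge0 // divr_ge0 // mulr_ge0.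
set phi := _ - _; rewrite {2}/phi (ipBr hpP); apply: letr (Re_normc _) _.
set k := (X in X * nrm hp psi); rewrite -mulrA [X in _ <= k * X]mulrC {}/k; apply: An_Cr_form; last by apply: Vh_le h; lia.
apply: VhB; first by apply: Vh_An; apply: Vh_mact; exact: Vh_Cr.
by apply: Vh_le (Vh_mact _ h); lia.
Qed.

Lemma op_etan x y c : opnorm (etan x y c) <= opnorm c * sg ^+ 2.
have k0 : 0 <= opnorm c * sg ^+ 2 by rewrite mulr_ge0 ?op_ge0 ?sqr_ge0.
apply: op_le=> // v.
suff: l2norm (etan x y c *m v) ^+ 2 <= (opnorm c * sg ^+ 2 * l2norm v) ^+ 2.
  by rewrite ler_sqr // nnegrE ?l2_ge0 // mulr_ge0 ?l2_ge0.
rewrite [leRHS]exprMn !l2norm_sqr mulr_sumr.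
lers=> i _; rewrite mul_diag_mx !mxE ncM exprMn.
apply: ler_wpM2r; first exact: sqr_ge0.
rewrite le_sq ?nc_ge0 //.
rewrite ncM -(rmorph_nat (real_complex R)) -fmorphV normcR ger0_norm ?invr_ge0 //.
rewrite ler_pdivrMl ?ltr0n //; apply: letr (nc_sum _ _ _) _.
apply: (@le_trans _ _ (\sum_(j < n.+1) opnorm c * sg ^+ 2)).
  lers=> j _; rewrite ncM; apply: ler_pM; rewrite ?nc_ge0 ?op_entry //. exact: (sa_sg saP).
by rewrite sumr_const card_ord mulr_natl.
Qed.

Definition conc (j : J) (v : K) : H := [ffun i=> if i == j then v else 0].
(** Normalized partial trace over the matrix index: for the multiplication by a random matrix it is
    the multiplication by its normalized trace. *)
Definition trv (T : H -> H) (v : K) : K := n.+1%:R^-1%:C *: \sum_j T (conc j v) j.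

Lemma conc_nrm j v : nrm hp (conc j v) = nrm ip v.
rewrite /nrm dip_n2 (bigD1 j) //= big1 ?addr0 ?ffunE ?eqxx // => i ij.
by rewrite ffunE (negbTE ij) /n2 (ip0r ipP).
Qed.

Lemma conc_Vh m j v : Vk m v -> Vh m (conc j v).
by move=> h i; rewrite ffunE; case: eqP=> // _; exact: excited0. Qed.

Lemma ip_conc j v psi : hp (conc j v) psi = ip v (psi j).
rewrite /dip (bigD1 j) //= big1 ?addr0 ?ffunE ?eqxx // => i ij.
by rewrite ffunE (negbTE ij) (ip0l ipP).
Qed.

Lemma An_conc x c m v : Vk m v ->
  \sum_j n2 hp (An x (mact c (conc j v))) <= s_ ^+ 2 * opnorm c ^+ 2 * sg ^+ 2 * (2 * m%:R) * n2 ip v.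
move=> hv.
have E1 j i : An x (mact c (conc j v)) i = s_%:C *: mact c^T [ffun l=> E i l (mu x i l v)] j.
  rewrite !ffunE; congr (_ *: _); eqr=> l _.
  rewrite !ffunE mxE (bigD1 j) //= big1=> [|k kj]; last by rewrite ffunE (negbTE kj) scaler0.
  by rewrite addr0 ffunE eqxx !linearZ.
under eq_bigr do rewrite dip_n2; rewrite exchange_big /=.
apply: (@le_trans _ _ (\sum_i s_ ^+ 2 * opnorm c ^+ 2 * sg ^+ 2 * \sum_l n2 ip (Dk i l v))).
  lers=> i _; under eq_bigr do rewrite E1 (n2Z ipP) normcR ger0_norm ?s_ge0 //.
  set z := [ffun l=> E i l (mu x i l v)]. rewrite (_ : \sum_i0 _ = s_ ^+ 2 * nrm hp (mact c^T z) ^+ 2); last first.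
    by rewrite (nrm_sqr hpP) dip_n2 mulr_sumr.
  set D := \sum_l _; have -> : s_ ^+ 2 * opnorm c ^+ 2 * sg ^+ 2 * D = s_ ^+ 2 * (opnorm c ^+ 2 * (sg ^+ 2 * D)) by ring.
  rewrite /D; apply: ler_wpM2l; first exact: sqr_ge0. apply: (@le_trans _ _ ((opnorm c * nrm hp z) ^+ 2)).
    rewrite le_sq ?mulr_ge0 ?op_ge0 ?nrm_ge0 //.
    by apply: letr (sa_amp saP _ _) _; apply: ler_wpM2r; [exact: nrm_ge0|exact: op_tr].
  rewrite exprMn ler_wpM2l ?sqr_ge0 // (nrm_sqr hpP) dip_n2 mulr_sumr ler_sum // => l _. by rewrite ffunE Emu_n2.
rewrite -mulr_sumr -[X in _ <= X]mulrA; apply: ler_wpM2l; last exact: Vk_n2.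
by apply: mulr_ge0; [apply: mulr_ge0|]; exact: sqr_ge0.
Qed.

(** Moved to the other side, the creation becomes an annihilation of the copies of [w] concentrated
    at each position; [An_conc] makes the sum of their squared norms of order [m / n] rather than
    [n]. *)
Lemma trv_Cr x c m (T : H -> H) (k : R) v w : Vk m v -> Vk m w -> 0 <= k ->
  (forall psi, Vh m psi -> nrm hp (T psi) <= k * nrm hp psi) ->
  normc (ip w (trv (fun psi=> mact c (Cr x (T psi))) v)) <=
  s_ ^+ 2 * opnorm c * sg * sqrt (2 * m%:R) * k * (nrm ip w * nrm ip v).
move=> hv hw k0 Tk.
have -> : ip w (trv (fun psi=> mact c (Cr x (T psi))) v) =
    (n.+1%:R^-1)%:C * \sum_j hp (An (xadj x) (mact (adjmx c) (conc j w))) (T (conc j v)).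
  rewrite /trv (ipZr ipP) (ip_sumr ipP); congr (_ * _); eqr=> j _.
  rewrite -ip_conc -[X in hp _ X]/(mact c (Cr x (T (conc j v)))) -(adjmxK c) -mact_adj adjmxK. by rewrite Cr_adjr.
rewrite ncM normcR ger0_norm ?invr_ge0 // -s_sqr.
apply: (@le_trans _ _ (s_ ^+ 2 * \sum_j nrm hp (An (xadj x) (mact (adjmx c) (conc j w))) * (k * nrm ip v))).
  rewrite ler_wpM2l ?sqr_ge0 //; apply: letr (nc_sum _ _ _) _; lers=> j _.
  apply: letr (CS hpP _ _) _; rewrite ler_wpM2l ?nrm_ge0 //. by rewrite -(conc_nrm j); apply: Tk; exact: conc_Vh.
rewrite -mulr_suml.
have cs : \sum_j nrm hp (An (xadj x) (mact (adjmx c) (conc j w))) <=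
    sqrt n.+1%:R * (s_ * opnorm c * sg * sqrt (2 * m%:R) * nrm ip w).
  apply: (@le_trans _ _ (\sum_j 1 * nrm hp (An (xadj x) (mact (adjmx c) (conc j w))))).
    by lers=> j _; rewrite mul1r.
  apply: letr (rCS _ _) _.
  rewrite [X in sqrt X * _](_ : _ = n.+1%:R); last by under eq_bigr do rewrite expr1n; rewrite sumr_const card_ord.
  rewrite ler_wpM2l ?sqrtr_ge0 //. have z0 : 0 <= s_ * opnorm c * sg * sqrt (2 * m%:R) * nrm ip w.
    by rewrite !(mulr_ge0, sqrtr_ge0, s_ge0, op_ge0, sa_sg0 saP).
  rewrite -[leRHS]ger0_norm // -sqrtr_sqr ler_wsqrtr //. under eq_bigr do rewrite (nrm_sqr hpP).
  by apply: letr (An_conc _ _ hw) _; rewrite op_adjmx !exprMn (nrm_sqr ipP) sqr_sqrtr.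
rewrite (_ : _ * k * _ = s_ ^+ 2 * (opnorm c * sg * sqrt (2 * m%:R) * nrm ip w * (k * nrm ip v))); last by ring.
rewrite ler_wpM2l ?sqr_ge0 // ler_wpM2r ?mulr_ge0 ?nrm_ge0 //.
apply: letr cs _; rewrite !mulrA.
by rewrite /s_ divff ?mul1r // sqrtr_eq0 -ltNge ltr0n.
Qed.

End Arrays.

(** * Asymptotic calculus for operators on vectors of growing degree *)

Section Eventually.
Implicit Types P Q : nat -> Prop.

Definition evt P := exists n0 : nat, forall n, (n0 <= n)%N -> P n.

Lemma evtS P Q : (forall n, P n -> Q n) -> evt P -> evt Q.
by move=> PQ [n0 h]; exists n0=> n /h /PQ. Qed.

Lemma evtI P Q : evt P -> evt Q -> evt (fun n=> P n /\ Q n).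
move=> [n0 h] [n1 h']; exists (maxn n0 n1)=> n; rewrite geq_max=> /andP[a b].
by split; [exact: h|exact: h'].
Qed.

Lemma evt_near P : evt P <-> \forall n \near \oo, P n.
by split=> [[n0 h]|[n0 _ h]]; exists n0. Qed.

Lemma evt_true P : (forall n, P n) -> evt P. by exists 0%N. Qed.

Lemma evt_all (I : Type) (s : seq I) (P : I -> nat -> Prop) :
  (forall i, evt (P i)) -> evt (fun n=> forall i, List.In i s -> P i n).
move=> h; elim: s=> [|i s IH]; first exact: evt_true.
apply: evtS (evtI (h i) IH)=> n [hi hs] j /= [<-//|]; exact: hs.
Qed.

Lemma evt_allfin (I : finType) (P : I -> nat -> Prop) :
  (forall i, evt (P i)) -> evt (fun n=> forall i, P i n).
move=> h; apply: evtS (evt_all (enum I) h)=> n hn i; apply: hn.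
have := mem_enum I i; elim: (enum I)=> //= j s IH; rewrite !inE=> /orP[/eqP ->|/IH]; first by left.
by right.
Qed.
End Eventually.

Section AsymptoticBounds.
Variables (Hn : nat -> lmodType R[i]) (hp : forall n, Hn n -> Hn n -> R[i])
  (hpP : forall n, is_sip (hp (n := n))) (V : forall n, nat -> Hn n -> Prop)
  (VD : forall n m u v, V m u -> V m v -> V m (u + v : Hn n))
  (VZ : forall n m a u, V m u -> V m (a *: u : Hn n))
  (Vle : forall n m m' (u : Hn n), (m <= m')%N -> V m u -> V m' u) (N : nat -> nat).
Notation ops := (forall n, Hn n -> Hn n).
Notation nr := (nrm (@hp _)).
Implicit Types T : ops.

(* Asymptotic norms, on vectors of degree at most [N n] up to a constant. *)
Definition ub T (c : R) := forall (k : nat) (e : R), 0 < e ->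
  evt (fun n=> forall psi : Hn n, V (N n + k) psi -> nr (T n psi) <= (c + e) * nr psi).
Definition lin T := forall n a (u v : Hn n), T n (a *: u + v) = a *: T n u + T n v.
Definition graded T := exists t : nat, forall n m (psi : Hn n), V m psi -> V (m + t) (T n psi).
Definition nice T := [/\ lin T, graded T & exists c, 0 <= c /\ ub T c].

Definition ocomp T T' : ops := fun n psi=> T n (T' n psi).
Definition oadd T T' : ops := fun n psi=> T n psi + T' n psi.
Definition osub T T' : ops := fun n psi=> T n psi - T' n psi.
Definition oscal (a : R[i]) T : ops := fun n psi=> a *: T n psi.
Definition oid : ops := fun n psi=> psi.
Definition ozero : ops := fun n psi=> 0.
Definition osum (I : Type) (s : seq I) (F : I -> ops) : ops := fun n psi=> \sum_(i <- s) F i n psi.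
Definition eqv T T' := ub (osub T T') 0.

Lemma ub_ext T T' c : (forall n psi, T n psi = T' n psi) -> ub T c -> ub T' c.
by move=> TT h k e e0; apply: evtS (h k e e0)=> n hn psi /hn; rewrite TT. Qed.

Lemma ub_le T c c' : c <= c' -> ub T c -> ub T c'.
move=> cc h k e e0; apply: evtS (h k e e0)=> n hn psi /hn /letr; apply.
by rewrite ler_wpM2r ?nrm_ge0 // lerD2r.
Qed.

(** The degree shift of [T'] is absorbed by the quantification over [k] in [ub]. *)
Lemma ub_comp T T' c c' : 0 <= c -> 0 <= c' -> graded T' -> ub T c -> ub T' c' ->
  ub (ocomp T T') (c * c').
move=> c0 c0' [t gT'] h h' k e e0.
pose d := Num.min 1 (e / (c + c' + 1)).
have s0 : 0 < c + c' + 1 by rewrite ltr_wpDl ?addr_ge0.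
have d0 : 0 < d by rewrite lt_min ltr01 divr_gt0.
have d1 : d <= 1 by rewrite ge_min lexx.
have de : d * (c + c' + 1) <= e by rewrite -ler_pdivlMr // ge_min lexx orbT.
apply: evtS (evtI (h (k + t)%N d d0) (h' k d d0))=> n [h1 h2] psi hpsi.
have h3 : V (N n + (k + t)) (T' n psi) by rewrite addnA; exact: gT'.
apply: letr (h1 _ h3) _.
apply: (@le_trans _ _ ((c + d) * ((c' + d) * nr psi))).
  by apply: ler_wpM2l; [rewrite addr_ge0 // ltW|exact: h2].
rewrite mulrA ler_wpM2r ?nrm_ge0 //.
have dd : d * d <= d by rewrite -[leRHS]mulr1 ler_wpM2l // ltW.
have -> : (c + d) * (c' + d) = c * c' + (d * (c + c') + d * d) by ring.
by rewrite lerD2l; apply: letr de; rewrite [leRHS]mulrDr mulr1 lerD2l.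
Qed.

Lemma ub_add T T' c c' : ub T c -> ub T' c' -> ub (oadd T T') (c + c').
move=> h h' k e e0; have e2 : 0 < e / 2 by rewrite divr_gt0.
apply: evtS (evtI (h k _ e2) (h' k _ e2))=> n [h1 h2] psi hpsi.
apply: letr (nrmD (hpP n) _ _) _; apply: letr (lerD (h1 _ hpsi) (h2 _ hpsi)) _.
by rewrite -mulrDl ler_wpM2r ?nrm_ge0 // le_eqVlt; apply/orP; left; apply/eqP; field.
Qed.

Lemma ub_scal a T c : 0 <= c -> ub T c -> ub (oscal a T) (normc a * c).
move=> c0 h k e e0; have a0 : 0 < normc a + 1 by rewrite ltr_wpDl ?nc_ge0.
have e2 : 0 < e / (normc a + 1) by rewrite divr_gt0.
apply: evtS (h k _ e2)=> n h1 psi hpsi.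
rewrite /oscal (nrmZ (hpP n)); apply: (@le_trans _ _ (normc a * ((c + e / (normc a + 1)) * nr psi))).
  by rewrite ler_wpM2l ?nc_ge0 // h1.
rewrite mulrA ler_wpM2r ?nrm_ge0 // mulrDr lerD2l mulrCA.
rewrite -[leRHS]mulr1; apply: ler_wpM2l; first exact: ltW.
by rewrite ler_pdivrMr // mul1r lerDl.
Qed.

Lemma ub0 : ub ozero 0.
by move=> k e e0; apply: evt_true=> n psi _; rewrite (nrm0 (hpP n)) add0r mulr_ge0 ?nrm_ge0 ?ltW. Qed.

Lemma ub_sum (I : Type) (s : seq I) (F : I -> ops) (c : I -> R) :
  (forall i, List.In i s -> ub (F i) (c i)) -> ub (osum s F) (\sum_(i <- s) c i).
elim: s=> [|i s IH] h.
  by rewrite big_nil; apply: ub_ext ub0=> n psi; rewrite /osum big_nil.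
rewrite big_cons; apply: (ub_ext (T := oadd (F i) (osum s F)))=> [n psi|].
  by rewrite /osum big_cons.
apply: ub_add; first by apply: h; left.
by apply: IH=> j js; apply: h; right.
Qed.

Lemma linB T n u v : lin T -> T n (u - v) = T n u - T n v.
by move=> h; rewrite addrC -scaleN1r h scaleN1r addrC.
Qed.

Lemma lin_sum T (I : Type) (s : seq I) n (F : I -> Hn n) : lin T ->
  T n (\sum_(i <- s) F i) = \sum_(i <- s) T n (F i).
move=> h; elim: s=> [|i s IH]; first by rewrite !big_nil -{1}(subrr (0 : Hn n)) (linB _ _ h) subrr.
by rewrite !big_cons -[F i]scale1r h IH !scale1r.
Qed.

Lemma graded_comp T T' : graded T -> graded T' -> graded (ocomp T T').
move=> [t h] [t' h']; exists (t' + t)%N=> n m psi hpsi; rewrite addnA; apply: h; exact: h'.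
Qed.

Lemma graded_add T T' : graded T -> graded T' -> graded (oadd T T').
move=> [t h] [t' h']; exists (t + t')%N=> n m psi hpsi; apply: VD.
  by apply: Vle (h _ _ _ hpsi); rewrite addnA leq_addr.
by apply: Vle (h' _ _ _ hpsi); lia.
Qed.

Lemma graded_scal a T : graded T -> graded (oscal a T).
by move=> [t h]; exists t=> n m psi hpsi; apply: VZ; exact: h. Qed.

Lemma graded_ext T T' : (forall n psi, T n psi = T' n psi) -> graded T -> graded T'.
by move=> TT [t h]; exists t=> n m psi hpsi; rewrite -TT; exact: h. Qed.

Lemma graded_sub T T' : graded T -> graded T' -> graded (osub T T').
move=> h h'; apply: (graded_ext (T := oadd T (oscal (-1) T')))=> [n psi|].
  by rewrite /oadd /oscal scaleN1r.
by apply: graded_add=> //; exact: graded_scal.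
Qed.

Lemma nice_ext T T' : (forall n psi, T n psi = T' n psi) -> nice T -> nice T'.
move=> TT [h1 h2 [c [c0 h3]]]; split; last by exists c; split=> //; exact: ub_ext h3.
  by move=> n a u v; rewrite -!TT.
exact: graded_ext h2.
Qed.

Lemma niceM T T' : nice T -> nice T' -> nice (ocomp T T').
move=> [h1 h2 [c [c0 h3]]] [h1' h2' [c' [c0' h3']]]; split; last first.
- by exists (c * c'); split; [rewrite mulr_ge0|exact: ub_comp].
- exact: graded_comp.
by move=> n a u v; rewrite /ocomp h1' h1.
Qed.

Lemma nice_add T T' : nice T -> nice T' -> nice (oadd T T').
move=> [h1 h2 [c [c0 h3]]] [h1' h2' [c' [c0' h3']]]; split; last first.
- by exists (c + c'); split; [rewrite addr_ge0|exact: ub_add].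
- exact: graded_add.
by move=> n a u v; rewrite /oadd h1' h1 scalerDr addrACA.
Qed.

Lemma nice_scal a T : nice T -> nice (oscal a T).
move=> [h1 h2 [c [c0 h3]]]; split; last first.
- by exists (normc a * c); split; [rewrite mulr_ge0 ?nc_ge0|exact: ub_scal].
- exact: graded_scal.
by move=> n b u v; rewrite /oscal h1 scalerDr !scalerA mulrC.
Qed.

Lemma nice_id : nice oid.
split=> //; first by exists 0%N=> n m psi; rewrite addn0.
by exists 1; split=> // k e e0; apply: evt_true=> n psi _; rewrite ler_peMl ?nrm_ge0 // lerDl ltW.
Qed.

Lemma nice_zero : nice ozero.
apply: (nice_ext (T := oscal 0 oid))=> [n psi|]; first exact: scale0r.
exact: nice_scal nice_id.
Qed.

Lemma nice_sum (I : Type) (s : seq I) (F : I -> ops) :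
  (forall i, List.In i s -> nice (F i)) -> nice (osum s F).
elim: s=> [|i s IH] h.
  by apply: nice_ext nice_zero=> n psi; rewrite /osum big_nil.
apply: (nice_ext (T := oadd (F i) (osum s F)))=> [n psi|]; first by rewrite /osum big_cons.
apply: nice_add; first by apply: h; left.
by apply: IH=> j js; apply: h; right.
Qed.

Lemma eqvE T T' : (forall n psi, T n psi = T' n psi) -> eqv T T'.
by move=> TT; apply: ub_ext ub0=> n psi; rewrite /osub TT subrr. Qed.

Lemma eqv_refl T : eqv T T. exact: eqvE. Qed.

Lemma eqvT T T' T'' : eqv T T' -> eqv T' T'' -> eqv T T''.
move=> h h'; rewrite /eqv -[0](addr0); apply: ub_ext (ub_add h h')=> n psi.
by rewrite /oadd /osub addrA subrK.
Qed.

Lemma eqv_add T1 T2 T1' T2' : eqv T1 T1' -> eqv T2 T2' -> eqv (oadd T1 T2) (oadd T1' T2').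
move=> h h'; rewrite /eqv -[0](addr0); apply: ub_ext (ub_add h h')=> n psi.
by rewrite /oadd /osub opprD addrACA.
Qed.

Lemma eqv_sum (I : Type) (s : seq I) (F F' : I -> ops) :
  (forall i, List.In i s -> eqv (F i) (F' i)) -> eqv (osum s F) (osum s F').
move=> h; have := ub_sum h; rewrite big1 // => h'; apply: ub_ext h'=> n psi.
by rewrite /osum /osub sumrB.
Qed.

Lemma eqv_comp T1 T2 T1' T2' : nice T1 -> nice T2 -> nice T2' -> eqv T1 T1' -> eqv T2 T2' ->
  eqv (ocomp T1 T2) (ocomp T1' T2').
move=> [l1 g1 [c1 [c10 u1]]] [l2 g2 [c2 [c20 u2]]] [l2' g2' [c2' [c20' u2']]] h h'.
have h1 : ub (ocomp T1 (osub T2 T2')) 0.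
  by rewrite -(mulr0 c1); apply: ub_comp=> //; exact: graded_sub.
have h2 : ub (ocomp (osub T1 T1') T2') 0.
  by rewrite -(mul0r c2'); exact: ub_comp.
rewrite /eqv -[0](addr0); apply: ub_ext (ub_add h1 h2)=> n psi.
by rewrite /oadd /ocomp /osub (linB _ _ l1) addrA subrK.
Qed.

Lemma eqv_ub T T' c : eqv T T' -> ub T' c -> ub T c.
move=> h h'; rewrite -[c](add0r); apply: ub_ext (ub_add h h')=> n psi.
by rewrite /oadd /osub subrK.
Qed.

(** [H k] is the [2^k]-th power of [T' T]. Iterated Cauchy-Schwarz bounds [T] by the root of order
    [2^(k+1)] of a bound on [H k], in which prefactors are lost. *)
Lemma ub_of_powers T T' (H : nat -> ops) (rho : R) : 0 <= rho -> graded T ->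
  (forall n phi psi, hp (T n phi) psi = hp phi (T' n psi)) ->
  (forall n psi, H 0%N n psi = T' n (T n psi)) ->
  (forall k n psi, H k.+1 n psi = H k n (H k n psi)) ->
  (forall e, 0 < e -> exists k c, [/\ 0 <= c, c < (rho + e) ^+ (2 ^ k.+1) & ub (H k) c]) ->
  ub T rho.
move=> rho0 gT adj H0 HS hub.
have H_sa k n phi psi : hp (H k n phi) psi = hp phi (H k n psi).
  elim: k phi psi=> [|k IH] phi psi; last by rewrite !HS !IH. by rewrite !H0 (ipC (hpP n)) -adj -(ipC (hpP n)) adj.
have iter k n psi : nr (T n psi) ^+ (2 ^ k.+1) <= nr psi ^+ (2 ^ k.+1).-1 * nr (H k n psi).
  elim: k=> [|k IH].
    rewrite expn1 expr1 (nrm_sqr (hpP n)) /n2 adj -H0. exact: letr (Re_normc _) (CS (hpP n) _ _).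
  rewrite expnSr exprM; apply: (@le_trans _ _ ((nr psi ^+ (2 ^ k.+1).-1 * nr (H k n psi)) ^+ 2)).
    by rewrite le_sq ?exprn_ge0 ?mulr_ge0 ?exprn_ge0 ?nrm_ge0.
  have -> : ((2 ^ k.+1 * 2).-1 = (2 ^ k.+1).-1 * 2 + 1)%N by have := expn_gt0 2 k.+1; lia.
  rewrite exprMn exprD exprM expr1 -mulrA ler_wpM2l ?exprn_ge0 ?nrm_ge0 //. rewrite (nrm_sqr (hpP n)) /n2 H_sa -HS.
  exact: letr (Re_normc _) (CS (hpP n) _ _).
move=> k e e0; have [l [c [c0 ce uH]]] := hub e e0.
have e1 : 0 < (rho + e) ^+ (2 ^ l.+1) - c by rewrite subr_gt0.
apply: evtS (uH k _ e1)=> n hn psi hpsi.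
have := iter l n psi; rewrite addrCA subrr addr0 in hn.
move=> h; have h2 := letr h (ler_wpM2l (exprn_ge0 _ (nrm_ge0 _ _)) (hn psi hpsi)).
rewrite -(ler_pXn2r (n := 2 ^ l.+1)) ?nnegrE ?nrm_ge0 ?expn_gt0 ?mulr_ge0 ?addr_ge0 ?nrm_ge0 ?(ltW e0) //.
rewrite exprMn; apply: letr h2 _.
by rewrite mulrCA -exprSr prednK // expn_gt0.
Qed.

End AsymptoticBounds.

Section Powers.

Lemma real_cvg_evt (u : nat -> R) (l : R) (e : R) : 0 < e ->
  u @ \oo --> l -> evt (fun n=> `|u n - l| <= e).
move=> e0 /cvgrPdist_le /(_ e e0) [n0 _ h]; exists n0=> n nn.
by have := h n nn; rewrite distrC.
Qed.

(** At a high power the gap between [rho] and [rho + e] beats the prefactor [L] and compensates the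
    missing factor [rho^2]. *)
Lemma power_gap (rho e L : R) : 0 <= rho -> 0 < e -> 0 <= L ->
  exists k, L * rho ^+ (2 * (2 ^ k).-1) < (rho + e) ^+ (2 ^ k.+1).
move=> r0 e0 L0; set b := rho + e; have b0 : 0 < b by rewrite ltr_wpDl.
have x1 : `|(rho / b) ^+ 2| < 1.
  rewrite ger0_norm ?sqr_ge0 // expr_lt1 // ?divr_ge0 ?(ltW b0) //. by rewrite ltr_pdivrMr // mul1r ltrDl.
have d0 : 0 < b ^+ 2 / (L + 1) / 2 by rewrite !divr_gt0 ?exprn_gt0 // ltr_wpDl.
have [m0 hm] := real_cvg_evt d0 (cvg_expr x1).
exists m0.+1; set m := (2 ^ m0.+1).-1.
have mm : (m0 <= m)%N by have := ltn_expl m0.+1 (ltnSn 1); rewrite /m; lia.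
have := hm m mm; rewrite subr0 ger0_norm; last by rewrite exprn_ge0 // sqr_ge0.
move=> {}hm.
have -> : (2 ^ m0.+2 = 2 * m + 2)%N by rewrite expnS /m; have := expn_gt0 2 m0.+1; lia.
have -> : rho ^+ (2 * m) = ((rho / b) ^+ 2) ^+ m * b ^+ (2 * m).
  by rewrite -exprM expr_div_n mulfVK // expf_neq0 // gt_eqF.
rewrite exprD mulrA mulrC ltr_pM2l ?exprn_gt0 //.
have L1 : 0 < L + 1 by rewrite ltr_wpDl.
apply: (@le_lt_trans _ _ ((L + 1) * (b ^+ 2 / (L + 1) / 2))).
  apply: ler_pM=> //; first by rewrite exprn_ge0 ?sqr_ge0. by rewrite lerDl.
rewrite (_ : (L + 1) * _ = b ^+ 2 / 2); last by move: (lt0r_neq0 L1)=> ?; field.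
by have := exprn_gt0 2 b0; lra.
Qed.

(** The fourth power of the Bernoulli-type bound [m (1 - w) w^m <= 1] absorbs [m^4]: two powers pay
    for the polynomial and two for the constants. *)
Lemma poly_exp (x c : R) D : 0 <= x -> x < 1 -> 0 <= c ->
  evt (fun m=> c * (m * D).+1%:R ^+ 2 * x ^+ m < 1).
(* The choice gives [1 - w = (1 - x) / 4], whence [x <= w^4], again a Bernoulli inequality. *)
move=> x0 x1 c0; pose w := (3 + x) / 4; pose g := 1 - w.
have w0 : 0 < w by rewrite /w; lra.
have w1 : w < 1 by rewrite /w; lra.
have g0 : 0 < g by rewrite /g; lra.
have xw : x <= w ^+ 4.
  have -> : w = x + 3 * g by rewrite /g /w; field. have -> : x = 1 - 4 * g by rewrite /g /w; field.
  have : g <= 1 by rewrite /g; lra. rewrite (_ : _ ^+ 4 = (1 - g) ^+ 2 * (1 - g) ^+ 2); last by ring. nra.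
have key m : w ^+ m * (m%:R * g) <= 1.
  suff : w ^+ m * (m%:R * g) <= 1 - w ^+ m by move=> /letr; apply; rewrite lerBlDr lerDl exprn_ge0 // ltW.
  elim: m=> [|m IH]; first by rewrite mul0r mulr0 subrr.
  rewrite exprS -[m.+1%:R]natr1; have W0 : 0 <= w ^+ m by rewrite exprn_ge0 // ltW.
  have W1 : w ^+ m <= 1 by rewrite exprn_ile1 // ltW. move: (w ^+ m) (m%:R) W0 W1 IH=> W M W0 W1 IH.
  have : w * (W * (M * g)) <= w * (1 - W) by rewrite ler_wpM2l // ltW. have : w * W <= 1 by nra. rewrite /g; nra.
pose L := c * D.+1%:R ^+ 2 / g ^+ 4 + 1.
have L0 : 0 <= L by rewrite addr_ge0 // divr_ge0 // ?exprn_ge0 ?(ltW g0) // mulr_ge0 // sqr_ge0.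
have [M hM] : exists M : nat, L < M%:R by exists (Num.bound L); exact: archi_boundP.
exists M.+1=> m mM.
have m0 : 0 < m%:R :> R by rewrite ltr0n (leq_ltn_trans (leq0n M) mM).
have Lm : c * D.+1%:R ^+ 2 < m%:R ^+ 2 * g ^+ 4.
  rewrite -ltr_pdivrMr ?exprn_gt0 //; apply: (@lt_le_trans _ _ m%:R).
    apply: lt_trans (_ : _ < L) _; first by rewrite ltrDl. by apply: lt_le_trans hM _; rewrite ler_nat ltnW.
  by rewrite expr2 ler_peMr ?(ltW m0) // ler1n (leq_ltn_trans (leq0n M) mM).
have G0 : 0 < (m%:R * g) ^+ 4 by rewrite exprn_gt0 // mulr_gt0.
rewrite -(ltr_pM2r G0) mul1r -[_ * x ^+ m * _]mulrA.
apply: (@le_lt_trans _ _ (c * (m * D).+1%:R ^+ 2)).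
  rewrite -[leRHS]mulr1; apply: ler_wpM2l; first by rewrite mulr_ge0 // sqr_ge0.
  apply: (@le_trans _ _ ((w ^+ m * (m%:R * g)) ^+ 4)); last first.
    have W0 : 0 <= w ^+ m by rewrite exprn_ge0 // ltW. have P0 : 0 <= m%:R * g by rewrite mulr_ge0 // ltW.
    by rewrite exprn_ile1 // mulr_ge0.
  rewrite [leRHS]exprMn; apply: ler_wpM2r; first exact: ltW.
  by rewrite -exprM mulnC exprM leX2 ?exprn_ge0 // ltW.
apply: (@le_lt_trans _ _ (c * D.+1%:R ^+ 2 * m%:R ^+ 2)).
  rewrite -mulrA ler_wpM2l // -exprMn leX2 // -natrM ler_nat.
  by rewrite mulSn mulnC -{1}[(D * m)%N]add0n ltn_add2r (leq_ltn_trans (leq0n M) mM).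
rewrite exprMn (_ : m%:R ^+ 4 * g ^+ 4 = m%:R ^+ 2 * g ^+ 4 * m%:R ^+ 2); last by ring.
by rewrite ltr_pM2r ?exprn_gt0.
Qed.

End Powers.

(** * Functions on finite product spaces *)

Section Sites.
Variables (T S : finType) (w : T -> S -> R) (w_ge0 : forall e s, 0 <= w e s)
  (w_sum : forall e, \sum_s w e s = 1).
Notation Om := {ffun T -> S}.
Notation K := {ffun Om -> C^o}.

Definition cweight (om : Om) : R := \prod_e w e (om e).
Definition fip (u v : K) : C := \sum_om (cweight om)%:C * (conjc (u om) * v om).

Lemma cweight_ge0 om : 0 <= cweight om.
by apply: prodr_ge0. Qed.

Lemma fip_sip : is_sip fip.
split.
- by move=> u v x; rewrite /fip -big_split; eqr=> om _; rewrite ffunE !mulrDr.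
- move=> u a v; rewrite /fip mulr_sumr; eqr=> om _.
  by transitivity ((cweight om)%:C * (conjc (u om) * (a * (v om : C)))); [rewrite ffunE|ring].
- move=> u v; rewrite /fip conj_sum; eqr=> om _.
  by rewrite !conjcM conjcR conjcK [_ * v om]mulrC.
move=> u; rewrite /fip Re_sum; sge0=> om _.
by rewrite mulJc -realcM mulr_ge0 ?cweight_ge0 ?sqr_ge0.
Qed.

Lemma fip_n2 u : n2 fip u = \sum_om cweight om * normc (u om) ^+ 2.
by rewrite /n2 /fip Re_sum; eqr=> om _; rewrite mulJc -realcM.
Qed.

Definition upd (om : Om) (e : T) (s : S) : Om := [ffun f=> if f == e then s else om f].

Lemma upd_same om e s s' : upd (upd om e s) e s' = upd om e s'.
by apply/ffunP=> f; rewrite !ffunE; case: eqP. Qed.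

Lemma upd_id om e : upd om e (om e) = om.
by apply/ffunP=> f; rewrite !ffunE; case: eqP=> // ->. Qed.

Lemma upd_comm om e f s s' : e != f -> upd (upd om e s) f s' = upd (upd om f s') e s.
move=> ef; apply/ffunP=> g; rewrite !ffunE; case: (g =P f)=> // ->.
by rewrite eq_sym (negbTE ef).
Qed.

Lemma cweight_upd om e s : cweight (upd om e s) * w e (om e) = cweight om * w e s.
pose P := \prod_(f | f != e) w f (om f).
have -> : cweight om = w e (om e) * P by rewrite /cweight (bigD1 e).
have -> : cweight (upd om e s) = w e s * P.
  rewrite /cweight (bigD1 e) //= ffunE eqxx; congr (_ * _). by eqr=> f fe; rewrite ffunE (negbTE fe).
by ring.
Qed.

(** Conditional expectation: the coordinate [e] is resampled independently. *)
Definition avg_fun (e : T) (f : K) : K := [ffun om : Om=> \sum_s (w e s)%:C * f (upd om e s)].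

Lemma avg_linear e : linear (avg_fun e).
move=> a u v; apply/ffunP=> om; rewrite !ffunE [in RHS]scaler_sumr -big_split; eqr=> s _.
by rewrite !ffunE mulrDr; congr (_ + _); rewrite -[RHS]/(_ * _) -[a *: _]/(a * _); ring.
Qed.
HB.instance Definition _ e := GRing.isLinear.Build C K K _ (avg_fun e) (avg_linear e).
Definition avg e : {linear K -> K} := avg_fun e.

Definition fmul_fun (e : T) (g : S -> C) (f : K) : K := [ffun om : Om=> g (om e) * f om].

Lemma fmul_linear e g : linear (fmul_fun e g).
move=> a u v; apply/ffunP=> om; rewrite !ffunE mulrDr; congr (_ + _).
by rewrite -[RHS]/(_ * _) -[a *: _]/(a * _); ring.
Qed.
HB.instance Definition _ e g := GRing.isLinear.Build C K K _ (fmul_fun e g) (fmul_linear e g).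
Definition fmul e g : {linear K -> K} := fmul_fun e g.

Lemma w_sumC e : \sum_s (w e s)%:C = 1.
by rewrite -(rmorph_sum (real_complex R)) w_sum. Qed.

Lemma avg_cst e (f : K) om : (forall s, f (upd om e s) = f om) -> avg e f om = f om.
by move=> h; rewrite ffunE; under eq_bigr do rewrite h; rewrite -mulr_suml w_sumC mul1r.
Qed.

Lemma avg_idem e f : avg e (avg e f) = avg e f.
apply/ffunP=> om; apply: avg_cst=> s; rewrite !ffunE; eqr=> s' _.
by rewrite upd_same.
Qed.

Lemma avg_comm e e' f : avg e (avg e' f) = avg e' (avg e f).
have [->//|ee] := eqVneq e e'; apply/ffunP=> om; rewrite !ffunE.
under eq_bigr do rewrite ffunE mulr_sumr.
under [RHS]eq_bigr do rewrite ffunE mulr_sumr.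
rewrite exchange_big; eqr=> s _; eqr=> s' _.
by rewrite upd_comm //; ring.
Qed.

(* The change of variables exchanging the value at [e] with an independent one. *)
Lemma avg_self e u v : fip (avg e u) v = fip u (avg e v).
pose h (z : Om * S) := (upd z.1 e z.2, z.1 e).
have hK : involutive h by move=> [om s]; rewrite /h /= upd_same upd_id ffunE eqxx.
transitivity (\sum_(z : Om * S) (cweight z.1 * w e z.2)%:C * (conjc (u (upd z.1 e z.2)) * v z.1)).
  rewrite /fip -(pair_big xpredT xpredT (fun om s=> (cweight om * w e s)%:C * (conjc (u (upd om e s)) * v om))) /=.
  eqr=> om _; rewrite ffunE conj_sum mulr_suml mulr_sumr; eqr=> s _. by rewrite conjcM conjcR realcM; ring.
rewrite (reindex_inj (inv_inj hK)) /=.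
rewrite /fip -(pair_big xpredT xpredT (fun om s=> (cweight (upd om e s) * w e (om e))%:C * (conjc (u (upd (upd om e s) e (om e))) * v (upd om e s)))) /=.
eqr=> om _; rewrite ffunE mulr_sumr mulr_sumr; eqr=> s _.
by rewrite upd_same upd_id cweight_upd realcM; ring.
Qed.

Lemma fmul_adj e g u v : fip (fmul e g u) v = fip u (fmul e (fun s=> conjc (g s)) v).
by eqr=> om _; rewrite !ffunE conjcM; ring. Qed.

Lemma avg_fmul e e' g f : e != e' -> avg e (fmul e' g f) = fmul e' g (avg e f).
move=> ee; apply/ffunP=> om; rewrite !ffunE mulr_sumr; eqr=> s _.
by rewrite !ffunE eq_sym (negbTE ee); ring.
Qed.

Lemma fmul_comm e e' g g' f : fmul e g (fmul e' g' f) = fmul e' g' (fmul e g f).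
by apply/ffunP=> om; rewrite !ffunE; ring. Qed.

Lemma fmul_fmul e g g' f : fmul e g (fmul e g' f) = fmul e (fun s=> g s * g' s) f.
by apply/ffunP=> om; rewrite !ffunE; ring. Qed.

Lemma avg_fmul_avg e g f : avg e (fmul e g (avg e f)) = (\sum_s (w e s)%:C * g s) *: avg e f.
apply/ffunP=> om; rewrite [LHS]ffunE [RHS]ffunE -[RHS]/(_ * _) mulr_suml; eqr=> s _.
rewrite ffunE [upd _ _ _ e]ffunE eqxx mulrA; congr (_ * _).
by rewrite !ffunE; eqr=> s' _; rewrite upd_same.
Qed.

Lemma fmul_nrm e g (t : R) f : 0 <= t -> (forall s, normc (g s) <= t) -> nrm fip (fmul e g f) <= t * nrm fip f.
move=> t0 h; rewrite -le_sq ?mulr_ge0 ?nrm_ge0 // exprMn !(nrm_sqr fip_sip) !fip_n2 mulr_sumr.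
lers=> om _; rewrite ffunE ncM exprMn [leRHS]mulrCA; apply: ler_wpM2l; first exact: cweight_ge0.
by apply: ler_wpM2r; rewrite ?sqr_ge0 // le_sq ?nc_ge0.
Qed.

Lemma famp n (c : 'I_n.+1 -> 'I_n.+1 -> C) (k : R) (psi : {ffun 'I_n.+1 -> K}) :
  0 <= k -> (forall v : 'I_n.+1 -> C, \sum_i normc (\sum_j c i j * v j) ^+ 2 <= k ^+ 2 * \sum_j normc (v j) ^+ 2) ->
  nrm (@dip K fip 'I_n.+1) [ffun i=> \sum_j c i j *: psi j] <= k * nrm (@dip K fip 'I_n.+1) psi.
move=> k0 h; have hpP := dip_sip fip_sip 'I_n.+1.
rewrite -le_sq ?mulr_ge0 ?nrm_ge0 // exprMn !(nrm_sqr hpP) !dip_n2.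
under eq_bigr do rewrite fip_n2.
under [X in _ <= _ * X]eq_bigr do rewrite fip_n2.
rewrite exchange_big [X in _ <= _ * X]exchange_big mulr_sumr /=; lers=> om _.
rewrite -!mulr_sumr mulrCA ler_wpM2l ?cweight_ge0 //.
apply: letr (h (fun j=> psi j om)); lers=> i _.
by rewrite ffunE sum_ffunE le_eqVlt; apply/orP; left; apply/eqP; congr (normc _ ^+ 2); eqr=> j _; rewrite ffunE.
Qed.

End Sites.

Section ArrayModel.
Variables (d n : nat) (S : finType) (s0 : S).
Notation X := ('I_d * bool)%type.
Notation J := 'I_n.+1.
Notation xadj := (fun x : X=> (x.1, ~~ x.2)).
Variables (w : J -> J -> S -> R) (G : X -> J -> J -> S -> C) (sg t : R)
  (w_ge0 : forall (i j : J) s, (i < j)%N -> 0 <= w i j s)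
  (w_sum : forall i j : J, (i < j)%N -> \sum_s w i j s = 1).

(** Sites are all ordered pairs; those on or below the diagonal carry no entry and are frozen at
    [s0]. *)
Definition wt (e : J * J) (s : S) : R := if (e.1 < e.2)%N then w e.1 e.2 s else (s == s0)%:R.
Definition key (i j : J) : J * J := if (i < j)%N then (i, j) else (j, i).

Lemma wt_ge0 e s : 0 <= wt e s.
by rewrite /wt; case: ifP=> // h; exact: w_ge0. Qed.

Lemma wt_sum e : \sum_s wt e s = 1.
rewrite /wt; case h: (e.1 < e.2)%N; first exact: w_sum.
by rewrite (bigD1 s0) //= eqxx big1 ?addr0 // => s /negbTE ->.
Qed.

Lemma key_sym i j : key i j = key j i.
by rewrite /key; case: ltngtP=> // /val_inj ->. Qed.

Lemma key_neq i j k l : (i, j) != (k, l) -> (i, j) != (l, k) -> key i j != key k l.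
rewrite /key !xpair_eqE; do 2 case: ifP=> _; rewrite xpair_eqE // andbC // => h h' //.
by rewrite andbC.
Qed.

Notation K := {ffun {ffun J * J -> S} -> C^o}.
Notation ip := (@fip _ S wt).

Definition siteE (i j : J) : {linear K -> K} := if i == j then (idfun : {linear K -> K}) else avg wt (key i j).
Definition siteM (x : X) (i j : J) : {linear K -> K} :=
  if i == j then (\0 : {linear K -> K}) else fmul (key i j) (G x i j).
Definition gamG (x y : X) (i j : J) : C :=
  if i == j then 0 else \sum_s (wt (key i j) s)%:C * (G x i j s * G y j i s).
Definition gamG' (x y : X) (i j : J) : C :=
  if i == j then 0 else \sum_s (wt (key i j) s)%:C * (G x i j s * G y i j s).

Variables (G_adj : forall x i j s, i != j -> conjc (G x i j s) = G (xadj x) j i s)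
  (G_mean : forall x i j, i != j -> \sum_s (wt (key i j) s)%:C * G x i j s = 0) (sg_ge0 : 0 <= sg)
  (gam_sg : forall x y i j, normc (gamG x y i j) <= sg ^+ 2)
  (gam_sg' : forall x y i j, normc (gamG' x y i j) <= sg ^+ 2) (t_ge0 : 0 <= t)
  (G_bound : forall x i j s, i != j -> normc (G x i j s) <= t).

Lemma array_site_algebra : site_algebra ip siteE siteM gamG gamG' sg t.
have ipP : is_sip ip := fip_sip wt_ge0.
split=> //.
- by move=> i j v; rewrite /siteE eq_sym key_sym.
- by move=> i j v; rewrite /siteE; case: eqP=> // _; exact: (avg_idem wt_sum).
- by move=> i j u v; rewrite /siteE; case: eqP=> // _; exact: avg_self.
- by move=> i j k l v; rewrite /siteE; case: (i == j); case: (k == l); [by []|by []|by []|exact: avg_comm].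
- move=> x i j u v; rewrite /siteM [j == i]eq_sym; case: eqP=> [_|/eqP ij] /=.
    by rewrite (ip0l ipP) (ip0r ipP).
  rewrite fmul_adj key_sym; congr (ip _ (fmul_fun _ _ _)). by apply/funext=> s; exact: G_adj.
- move=> x i j k l v h1 h2; rewrite /siteM; case: (k =P l)=> [_|_] /=; first by rewrite linear0.
  by rewrite /siteE; case: eqP=> // _; apply: avg_fmul; exact: key_neq.
- move=> x y i j k l v h1 h2; rewrite /siteM; do 2 case: eqP=> _ /=; rewrite ?linear0 //.
  by rewrite fmul_comm.
- move=> x i j v; rewrite /siteM /siteE; case: (i =P j)=> [_|/eqP ij] //.
  by rewrite avg_fmul_avg G_mean // scale0r.
- move=> x y i j v; rewrite /siteM /siteE /gamG [j == i]eq_sym; case: (i =P j)=> [_|/eqP ij] /=; first by rewrite scale0r.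
  by rewrite [key j i]key_sym fmul_fmul avg_fmul_avg.
- move=> x y i j v; rewrite /siteM /siteE /gamG'; case: (i =P j)=> [_|/eqP ij] /=; first by rewrite scale0r.
  by rewrite fmul_fmul avg_fmul_avg.
- move=> x i j v; rewrite /siteM; case: (i =P j)=> [_|/eqP ij] /=.
    by rewrite (nrm0 ipP) mulr_ge0 ?nrm_ge0.
  by apply: fmul_nrm=> // [e s|s]; [exact: wt_ge0|exact: G_bound].
- by move=> x i v; rewrite /siteM eqxx.
- by move=> i v; rewrite /siteE eqxx.
move=> c psi; apply: famp; [exact: wt_ge0|exact: op_ge0|move=> v].
have -> : \sum_i normc (\sum_j c i j * v j) ^+ 2 = l2norm (c *m \col_j v j) ^+ 2.
  rewrite l2norm_sqr; eqr=> i _; rewrite mxE; congr (normc _ ^+ 2). by eqr=> j _; rewrite mxE.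
have -> : \sum_j normc (v j) ^+ 2 = l2norm (\col_j v j) ^+ 2.
  by rewrite l2norm_sqr; eqr=> i _; rewrite mxE.
by rewrite -exprMn le_sq ?mulr_ge0 ?op_ge0 ?l2_ge0 // op_ub.
Qed.

Definition Xmx (x : X) (om : {ffun J * J -> S}) : 'M[C]_n.+1 :=
  (s_ n)%:C *: \matrix_(i, j) (if i == j then 0 else G x i j (om (key i j))).

Lemma Xl_mx x (psi : {ffun J -> K}) i om :
  Xl siteM x psi i om = \sum_j Xmx x om i j * psi j om.
transitivity ((s_ n)%:C * \sum_j (siteM x i j (psi j) om : C)).
  by rewrite /Xl ffunE [LHS]ffunE sum_ffunE.
rewrite mulr_sumr; eqr=> j _.
rewrite !mxE -mulrA; congr (_ * _); rewrite /siteM; case: eqP=> _ /=; first by rewrite ffunE mul0r.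
by rewrite ffunE.
Qed.

End ArrayModel.

Section OpnormPowers.
Variables (n : nat).
Implicit Types h : 'M[C]_n.+1.

Lemma adjmx_exp h k : adjmx h = h -> adjmx (h ^+ k) = h ^+ k.
move=> hh; elim: k=> [|k IH].
  by rewrite expr0; exact: (star_s1 'M[C]_n.+1).
by rewrite {1}exprS adjmxM IH hh -exprSr.
Qed.

Lemma op_exp2 h k : adjmx h = h -> opnorm (h ^+ (2 ^ k)) = opnorm h ^+ (2 ^ k).
move=> hh; elim: k=> [|k IH]; first by rewrite !expr1.
rewrite expnSr !exprM -IH expr2 -{1}(adjmx_exp (2 ^ k) hh).
exact: op_sqr.
Qed.

Lemma op_exp_le h k : opnorm (h ^+ k) <= opnorm h ^+ k.
elim: k=> [|k IH]; first by rewrite !expr0; apply: op_le=> // v; rewrite mul1mx mul1r.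
by rewrite !exprS; apply: letr (opnormM _ _) _; rewrite ler_wpM2l ?op_ge0.
Qed.

(** The C*-identity gives equality at the power [2^k]; by submultiplicativity no smaller power can
    lose anything. *)
Lemma op_exp_ge h k : adjmx h = h -> opnorm h ^+ k <= opnorm (h ^+ k).
move=> hh; have [->|h0] := eqVneq (opnorm h) 0.
  case: k=> [|k]; last by rewrite expr0n op_ge0. rewrite !expr0; have := op_ub 1 (delta_mx 0 0 : 'cV[C]_n.+1).
  by rewrite mul1mx delta_norm mulr1.
have hp : 0 < opnorm h by rewrite lt_def h0 op_ge0.
have kl : (k <= 2 ^ k)%N by apply: ltnW; exact: ltn_expl.
have := op_exp2 k hh; rewrite -(subnK kl) exprD=> e.
have : opnorm h ^+ (2 ^ k - k) * opnorm h ^+ k <= opnorm h ^+ (2 ^ k - k) * opnorm (h ^+ k).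
  rewrite -exprD -e; apply: letr (opnormM _ _) _. by rewrite ler_wpM2r ?op_ge0 // op_exp_le.
by rewrite ler_pM2l // exprn_gt0.
Qed.
End OpnormPowers.

Lemma iter_bound (V : lmodType R[i]) (ip : V -> V -> R[i]) (P : nat -> V -> Prop)
    (T : V -> V) (c : R) t N : 0 <= c -> (forall m v, P m v -> P (m + t)%N (T v)) ->
  (forall m m' v, (m <= m')%N -> P m v -> P m' v) ->
  (forall v, P N v -> nrm ip (T v) <= c * nrm ip v) ->
  forall j v, P 0%N v -> (j * t <= N)%N -> nrm ip (iter j T v) <= c ^+ j * nrm ip v.
move=> c0 PT Ple h j v Pv jN.
suff [] : P (j * t)%N (iter j T v) /\ nrm ip (iter j T v) <= c ^+ j * nrm ip v by [].
elim: j jN=> [|j IH] jN; first by rewrite mul1r.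
have jN' : (j * t <= N)%N by apply: leq_trans jN; rewrite leq_mul2r leqnSn orbT.
have [Pj bj] := IH jN'; split; first by rewrite mulSn addnC; exact: PT.
rewrite /= exprS -mulrA; apply: letr (h _ _) _; first exact: Ple jN' Pj.
exact: ler_wpM2l.
Qed.

(** * Normal ordering with abstract coefficients *)

Section NormalOrdering.
Variables (X T : Type) (adj : X -> X) (t0 t1 : T) (tm : T -> T -> T) (ts : T -> T) (te : X -> X -> T -> T).
Notation fock := (seq (T * X)).

(* The coefficient-valued form of the elementary tensors [f] and [g], with
   [e] inserted in the middle. *)
Fixpoint gram (f : fock) (e : T) (g : fock) : T :=
  match f, g with
  | [::], [::]=> e
  | (b, x) :: f', (b', y) :: g'=> gram f' (te (adj x) y (tm (ts b) (tm e b'))) g'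
  | _, _=> t0
  end.

(* [(u, c, v)] stands for the product of the creation operators of [u], of the
   coefficient [c], and of the adjoint of the creation operators of [v]. *)
Definition noterm := (fock * T * fock)%type.

Definition head_mul (e : T) (f : fock) (c : T) : fock * T :=
  if f is (b, x) :: f' then ((tm e b, x) :: f', c) else ([::], tm e c).

Definition pushc (b : T) (t : noterm) : noterm :=
  (head_mul b t.1.1 t.1.2, t.2).

(** A letter acts as creation plus annihilation. The annihilation is contracted with the first
    creation factor; if there is none, it joins the annihilation part together with the adjoint of
    the coefficient, and the coefficient 1 remains. *)
Definition pushx (x : X) (t : noterm) : seq noterm :=
  [:: ((t1, x) :: t.1.1, t.1.2, t.2);
      if t.1.1 is (b, y) :: u' then pushc (te x y b) (u', t.1.2, t.2)
      else ([::], t1, rcons t.2 (ts t.1.2, adj x))].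

Fixpoint nord (w : seq (T + X)) : seq noterm :=
  match w with
  | [::]=> [:: ([::], t1, [::])]
  | inl b :: w'=> [seq pushc b t | t <- nord w']
  | inr x :: w'=> flatten [seq pushx x t | t <- nord w']
  end.

Lemma gram_rcons f e g b b' x y :
  size f = size g ->
  gram (rcons f (b, x)) e (rcons g (b', y)) = te (adj x) y (tm (ts b) (tm (gram f e g) b')).
by elim: f e g=> [|[b1 x1] f IH] e [|[b2 y2] g] //= [/IH ->]. Qed.

Lemma gram_size f e g : size f != size g -> gram f e g = t0.
by elim: f e g=> [|[b x] f IH] e [|[b' y] g] //= ?; apply: IH. Qed.

(* If [Z] is the sum of the [tr s], then [(Z* Z)^(2^k)] is the sum over [s] and
   [t] of (creation of [(tr s).2]) [pcoef k s t] (annihilation of [(tr t).2]). *)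
Variables (tsum : seq T -> T) (q : nat) (tr : 'I_q -> noterm).

Fixpoint pcoef (k : nat) (s t : 'I_q) : T :=
  match k with
  | 0%N=> tm (ts (tr s).1.2) (tm (gram (tr s).1.1 t1 (tr t).1.1) (tr t).1.2)
  | k'.+1=> tsum [seq tsum [seq tm (pcoef k' s a)
      (tm (gram (tr a).2 t1 (tr b).2) (pcoef k' b t)) | b <- enum 'I_q] | a <- enum 'I_q]
  end.

End NormalOrdering.

Definition ntmap (X T T' : Type) (h : T -> T') (t : noterm X T) : noterm X T' :=
  ([seq (h z.1, z.2) | z <- t.1.1], h t.1.2, [seq (h z.1, z.2) | z <- t.2]).

Section Homomorphism.
Variables (X T T' : Type) (adj : X -> X) (t0 t1 : T) (tm : T -> T -> T) (ts : T -> T) (te : X -> X -> T -> T)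
  (tsum : seq T -> T) (t0' t1' : T') (tm' : T' -> T' -> T') (ts' : T' -> T') (te' : X -> X -> T' -> T')
  (tsum' : seq T' -> T') (h : T -> T') (h0 : h t0 = t0') (h1 : h t1 = t1')
  (hm : forall a b, h (tm a b) = tm' (h a) (h b)) (hs : forall a, h (ts a) = ts' (h a))
  (he : forall x y a, h (te x y a) = te' x y (h a)) (hsum : forall s, h (tsum s) = tsum' (map h s)).

(** Applied to the evaluation of polynomial coefficients in [B]: one symbolic computation, valid for
    all matrix sizes, is compared with the one in the limit. *)
Lemma gram_hom f g e : h (gram adj t0 tm ts te f e g) =
  gram adj t0' tm' ts' te' [seq (h z.1, z.2) | z <- f] (h e) [seq (h z.1, z.2) | z <- g].
elim: f e g=> [|[b x] f IH] e [|[b' y] g] //=.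
by rewrite IH he !hm hs.
Qed.

Lemma power_coef_hom q (tr : 'I_q -> noterm X T) k s t :
  h (pcoef adj t0 t1 tm ts te tsum tr k s t) =
  pcoef adj t0' t1' tm' ts' te' tsum' (fun s=> ntmap h (tr s)) k s t.
elim: k s t=> [|k IH] s t /=; first by rewrite !hm hs gram_hom h1.
rewrite hsum -map_comp; congr tsum'; apply: eq_map=> a /=.
by rewrite hsum -map_comp; congr tsum'; apply: eq_map=> b /=; rewrite !hm !IH gram_hom h1.
Qed.

Lemma normal_order_hom w :
  [seq ntmap h t | t <- nord adj t1 tm ts te w] =
  nord adj t1' tm' ts' te' [seq match y with inl b=> inl (h b) | inr x=> inr x end | y <- w].
have pc b t : ntmap h (pushc tm b t) = pushc tm' (h b) (ntmap h t).
  by case: t=> -[[|[b' y] u] c] v; rewrite /ntmap /pushc /= hm.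
elim: w=> [|[b|x] w IH] /=; first by rewrite /ntmap /= h1.
  by rewrite -IH -!map_comp; apply: eq_map=> t /=.
rewrite map_flatten -IH -!map_comp; congr flatten; apply: eq_map=> -[[u c] v] /=.
congr [:: _; _]; first by rewrite /ntmap /= h1.
by case: u=> [|[b y] u] /=; rewrite ?pc /ntmap /= ?he // map_rcons hs h1.
Qed.

End Homomorphism.

(** * Wick products in the limit algebra *)

Section LimitFock.
Variables (d r : nat) (K : matching_coefs R d r) (A : cstarAlgType R) (tau : {scalar A})
  (tauP : faithful_tracial_state tau) (B : cstarAlgType R) (tauB : {scalar B}) (emb : {lrmorphism B -> A})
  (tauBP : faithful_tracial_state tauB) (p : 'I_r -> B) (src : source_label r -> A)
  (emb_star : forall z, emb (star z) = star (emb z)) (emb_tau : forall z, tau (emb z) = tauB z)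
  (p_star : forall a, star (p a) = p a) (p_orth : forall a b, p a * p b = if a == b then p a else 0)
  (src_free : free_sources tau (range emb) K src).
Notation X := ('I_d * bool)%type.
Notation fock := (seq (B * X)).
Notation xelt := (xelt K emb p src).
Notation ml := (mixed K emb p src).
Notation gam := (gam K).

Let emb_p_star a : star (emb (p a)) = emb (p a).
by rewrite -emb_star p_star. Qed.

Lemma xelt_adj x : xelt (xadj x) = star (xelt x).
by case: x=> k [] //=; rewrite /xelt /= starK. Qed.

Definition etaA_def (x y : X) (z : A) : B :=
  \sum_a \sum_b (gam a b x y * tau (emb (p b) * z)) *: p a.
(** The lock keeps conversion from unfolding the double sum. *)
Fact etaA_key : unit. by []. Qed.
Definition etaA := locked_with etaA_key etaA_def.
Lemma etaAE : etaA = etaA_def. by rewrite /etaA unlock. Qed.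
Definition etaB (x y : X) (z : B) : B := etaA x y (emb z).

Lemma etaAD x y z z' : etaA x y (z + z') = etaA x y z + etaA x y z'.
rewrite etaAE /etaA_def -big_split; eqr=> a _; rewrite -big_split; eqr=> b _.
by rewrite mulrDr linearD mulrDr scalerDl.
Qed.

Lemma etaA0 x y : etaA x y 0 = 0.
by have := etaAD x y 0 0; rewrite addr0=> /eqP; rewrite eq_sym -subr_eq0 addrK=> /eqP. Qed.

Lemma etaBD x y z z' : etaB x y (z + z') = etaB x y z + etaB x y z'.
by rewrite /etaB rmorphD etaAD. Qed.

Lemma etaB0 x y : etaB x y 0 = 0.
by rewrite /etaB rmorph0 etaA0. Qed.

Lemma etaB_sum x y (I : Type) (s : seq I) (P : pred I) (F : I -> B) :
  etaB x y (\sum_(i <- s | P i) F i) = \sum_(i <- s | P i) etaB x y (F i).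
exact: (big_morph _ (etaBD x y) (etaB0 x y)). Qed.

Lemma xcovE x y z : xcov K tau emb p x y z = emb (etaA x y z).
rewrite /xcov etaAE linear_sum; eqr=> a _; rewrite linear_sum; eqr=> b _.
by rewrite linearZ.
Qed.

Lemma etaB_star x y z : star (etaB x y z) = etaB (xadj y) (xadj x) (star z).
rewrite /etaB etaAE star_sum; eqr=> a _; rewrite star_sum; eqr=> b _.
rewrite starJ p_star conjcM; congr (_ * _ *: _).
  by rewrite gamC gam_adj.
by rewrite -(tau_star tauP) starM emb_p_star emb_star (tauC tauP).
Qed.

Definition gramB := gram (@xadj d) 0 *%R (@star R B) etaB.

(** The Wick product of the tensor [f] with right coefficient [c]: each letter multiplies, minus its
    contraction with the next factor. These elements of [A] serve as the elementary tensors of a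
    Fock space. *)
Fixpoint fval (f : fock) (c : B) : A :=
  match f with
  | [::]=> emb c
  | (b, x) :: f'=> emb b * (xelt x * fval f' c -
      match f' with [::]=> 0 | (b', y) :: f''=> emb (etaB x y b') * fval f'' c end)
  end.

Definition ctr (x : X) (f : fock) (c : B) : A :=
  match f with [::]=> 0 | (b, y) :: f'=> emb (etaB x y b) * fval f' c end.

Lemma fval_cons b x f c : fval ((b, x) :: f) c = emb b * (xelt x * fval f c - ctr x f c).
by case: f. Qed.

Lemma fval_letter x f c : xelt x * fval f c = fval ((1, x) :: f) c + ctr x f c.
by rewrite fval_cons rmorph1 mul1r subrK. Qed.

(** Two-step induction, because [fval] refers to the tail of a list and to the tail of its tail. *)
Lemma fval_ind (P : fock -> Prop) : P [::] -> (forall z, P [:: z]) ->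
  (forall z z' f, P f -> P (z' :: f) -> P (z :: z' :: f)) -> forall f, P f.
move=> P0 P1 P2 f; suff [] : P f /\ forall z, P (z :: f) by [].
by elim: f=> [|z f [Pf Pz]]; split=> // z'; apply: P2.
Qed.

Lemma fval_mulr f c e : fval f c * emb e = fval f (c * e).
elim/fval_ind: f=> [|[b x]|[b x] [b' y] f IH1 IH2]; first by rewrite /= rmorphM.
  by rewrite /= !subr0 rmorphM !mulrA.
by rewrite fval_cons -mulrA mulrBl -mulrA IH2 /ctr -mulrA IH1 fval_cons.
Qed.

Lemma ctr_mulr x f c e : ctr x f c * emb e = ctr x f (c * e).
by case: f=> [|[b y] f] /=; rewrite ?mul0r // -mulrA fval_mulr. Qed.

Lemma fval_head_mul e f c :
  fval (head_mul *%R e f c).1 (head_mul *%R e f c).2 = emb e * fval f c.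
by case: f=> [|[b x] f]; rewrite /= rmorphM ?mulrA. Qed.

Fixpoint fwords (f : fock) (c : B) : seq (seq (B + X)) :=
  match f with
  | [::]=> [:: [:: inl c]]
  | (b, x) :: f'=> [seq inl b :: inr x :: w | w <- fwords f' c] ++
      match f' with [::]=> [::]
      | (b', y) :: f''=> [seq inl (- (b * etaB x y b')) :: w | w <- fwords f'' c] end
  end.

Lemma fwordsE f c : \sum_(w <- fwords f c) wval ml w = fval f c.
have w1 b w : wval ml (inl b :: w) = emb b * wval ml w by rewrite wval_cons.
have w2 x w : wval ml (inr x :: w) = xelt x * wval ml w by rewrite wval_cons.
elim/fval_ind: f=> [|[b x]|[b x] [b' y] f IH1 IH2].
- by rewrite big_seq1 w1 /wval big_nil mulr1.
- by rewrite /= !big_cons big_nil !w1 w2 w1 /wval big_nil !mulr1 addr0 subr0.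
have -> : fwords [:: (b, x), (b', y) & f] c = [seq inl b :: inr x :: w | w <- fwords ((b', y) :: f) c] ++
  [seq inl (- (b * etaB x y b')) :: w | w <- fwords f c] by [].
rewrite big_cat big_map big_map fval_cons mulrBr -IH2.
rewrite (_ : ctr x ((b', y) :: f) c = emb (etaB x y b') * \sum_(w <- fwords f c) wval ml w) ?IH1 // -IH1 !mulr_sumr.
by rewrite -sumrN; congr (_ + _); eqr=> w _; rewrite w1 ?w2 // rmorphN mulNr rmorphM mulrA.
Qed.

(* Sum over the letters [y] of [w = w1 y w2] of [Psi] at the contraction of
   [x] with [y] across [z w1] and at [w2]. *)
Fixpoint contr (Psi : B -> seq (B + X) -> A) (x : X) (z : A) (w : seq (B + X)) : A :=
  match w with
  | [::]=> 0
  | inl b :: w'=> contr Psi x (z * emb b) w'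
  | inr y :: w'=> Psi (etaA x y z) w' + contr Psi x (z * xelt y) w'
  end.

Definition additiveP (Psi : B -> seq (B + X) -> A) :=
  forall b b' w, Psi (b + b') w = Psi b w + Psi b' w.

Lemma contrD Psi x z z' w : additiveP Psi ->
  contr Psi x (z + z') w = contr Psi x z w + contr Psi x z' w.
move=> PD; elim: w z z'=> [|[b|y] w IH] z z' /=; rewrite ?addr0 // mulrDl IH //.
by rewrite etaAD PD addrACA.
Qed.

Lemma contractions0 Psi x w : additiveP Psi -> contr Psi x 0 w = 0.
move=> PD; have := contrD x 0 0 w PD.
by rewrite addr0=> /eqP; rewrite eq_sym -subr_eq0 addrK=> /eqP.
Qed.

Lemma contractionsN Psi x z w : additiveP Psi ->
  contr Psi x (- z) w = - contr Psi x z w.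
move=> PD; apply/eqP; rewrite -addr_eq0 -contrD //.
by rewrite addNr contractions0.
Qed.

Lemma contractions_add Psi Psi' x z w :
  contr (fun e v=> Psi e v + Psi' e v) x z w = contr Psi x z w + contr Psi' x z w.
by elim: w z=> [|[b|y] w IH] z /=; rewrite ?addr0 // IH addrACA. Qed.

Lemma eq_contractions Psi Psi' x z w : (forall e v, Psi e v = Psi' e v) ->
  contr Psi x z w = contr Psi' x z w.
by move=> PP; elim: w z=> [|[b|y] w IH] z //=; rewrite IH ?PP. Qed.

Lemma contr_rcons_c Psi x z w b :
  contr Psi x z (rcons w (inl b)) = contr (fun e v=> Psi e (rcons v (inl b))) x z w.
by elim: w z=> [|[b'|y] w IH] z //=; rewrite IH. Qed.

Lemma contr_rcons_l Psi x z w y :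
  contr Psi x z (rcons w (inr y)) =
  contr (fun e v=> Psi e (rcons v (inr y))) x z w + Psi (etaA x y (z * wval ml w)) [::].
elim: w z=> [|[b'|y'] w IH] z /=; first by rewrite addr0 add0r /wval big_nil mulr1.
  by rewrite IH wval_cons mulrA.
by rewrite IH wval_cons mulrA addrA.
Qed.

Lemma tau_contr x b w :
  tau (emb b * contr (fun e v=> emb e * wval ml v) x 1 w) =
  tau (xelt x * (wval ml w * emb b)).
have -> : wval ml w * emb b = wval ml (rcons w (inl b)).
  by rewrite -cats1 wval_cat wval_cons /wval big_nil mulr1.
rewrite (xelt_sd tauP emb_p_star p_orth src_free).
have -> : forall z v, xannih K tau emb p src x z v = contr (fun e v=> emb e * wval ml v) x z v.
  by move=> z v; elim: v z=> [|[b1|y] v IH] z //=; rewrite IH ?xcovE.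
rewrite contr_rcons_c (tauC tauP); congr (tau _).
elim: w 1=> [|[b1|y] w IH] z /=; rewrite ?mul0r // ?mulrDl IH //.
by rewrite -cats1 wval_cat wval_cons /wval big_nil mulr1 mulrA.
Qed.

(* The contractions of [x] after the letter [y], when the arguments of the
   covariance are themselves contracted with [y]. *)
Lemma contr_nested Psi x y b u w : additiveP Psi ->
  contr Psi x (emb b * xelt y * wval ml u) w =
  contr (fun e v=> contr Psi x (emb (b * e) * wval ml v) w) y 1 u +
  contr (fun e v=> contr Psi x (emb (b * e)) v) y (wval ml u) w.
move=> PD; elim: w u=> [|[b'|z] w IH] u /=.
- by rewrite addr0; elim: u 1=> [|[b1|y1] u IHu] z //=; rewrite ?add0r -?IHu.
- have wb : wval ml u * emb b' = wval ml (rcons u (inl b')).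
    by rewrite -cats1 wval_cat wval_cons /wval big_nil mulr1.
  rewrite -mulrA wb IH contr_rcons_c; congr (_ + _); apply: eq_contractions=> e v.
  by rewrite -mulrA -cats1 wval_cat wval_cons /wval big_nil mulr1.
have wb : wval ml u * xelt z = wval ml (rcons u (inr z)).
  by rewrite -cats1 wval_cat wval_cons /wval big_nil mulr1.
rewrite -[X in Psi _ _ + contr _ _ X _]mulrA wb IH contr_rcons_l mul1r.
rewrite [wval ml [::]]big_nil mulr1 contractions_add -!addrA addrA; congr (_ + _).
rewrite -(_ : etaA x z (contr (fun e v=> emb (b * e) * wval ml v) y 1 u) = etaA x z (emb b * xelt y * wval ml u)).
  have P0 v : Psi 0 v = 0.
    by have := PD 0 0 v; rewrite addr0=> /eqP; rewrite eq_sym -subr_eq0 addrK=> /eqP.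
  have : forall s, contr (fun e v=> Psi (etaA x z (emb (b * e) * wval ml v)) w) y s u
      = Psi (etaA x z (contr (fun e v=> emb (b * e) * wval ml v) y s u)) w.
    by elim: u {IH wb} => [|[b1|y1] u IHu] s /=; rewrite ?etaA0 ?P0 ?IHu // etaAD PD.
  by move=> ->.
have cb s : contr (fun e v=> emb (b * e) * wval ml v) y s u = emb b * contr (fun e v=> emb e * wval ml v) y s u.
  by elim: u s {IH wb} => [|[b1|y1] u IHu] s /=; rewrite ?mulr0 ?mulrDr ?IHu // rmorphM mulrA.
rewrite cb etaAE; eqr=> a _; eqr=> a' _; congr (_ * _ *: _).
have -> : tau (emb (p a') * (emb b * xelt y * wval ml u)) = tau (xelt y * (wval ml u * emb (p a' * b))).
  by rewrite rmorphM (tauC tauP) -!mulrA (tauC tauP) -!mulrA.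
by rewrite -tau_contr rmorphM mulrA.
by rewrite addrA; congr (_ + _ + _); apply: eq_contractions=> e v;
  rewrite -cats1 wval_cat wval_cons [wval ml [::]]big_nil mulr1 mulrA.
Qed.

(** Only the contraction with the first factor survives: by [contr_nested] the contractions with
    deeper letters cancel against the ones subtracted in [fval]. *)
Lemma contractions_fwords Psi x f c : additiveP Psi ->
  \sum_(w <- fwords f c) contr Psi x 1 w =
  if f is (b, y) :: f' then \sum_(w <- fwords f' c) Psi (etaB x y b) w else 0.
elim: f Psi x=> [|[b y] f IH] Psi x PD; first by rewrite big_seq1.
pose Psi' e v := contr Psi x (emb (b * e)) v.
have PD' : additiveP Psi' by move=> e e' v; rewrite /Psi' mulrDr rmorphD contrD.
have nest w : contr Psi x (1 * emb b * xelt y) w = contr Psi' y 1 w.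
  by rewrite mul1r -[_ * xelt y]mulr1 -[X in _ * X](_ : wval ml [::] = 1) ?contr_nested //= ?add0r /wval big_nil.
rewrite [fwords _ _]/(_ ++ _) big_cat big_map /=.
under eq_bigr do rewrite nest mul1r.
rewrite big_split /= IH // -addrA -[RHS]addr0; congr (_ + _).
case: f {IH} => [|[b' y'] f]; first by rewrite big_nil addr0.
rewrite big_map -big_split big1 // => w _ /=.
by rewrite mul1r rmorphN contractionsN // subrr.
Qed.

Lemma tau_letter x f c : tau (xelt x * fval f c) = tau (ctr x f c).
rewrite -fwordsE mulr_sumr linear_sum.
pose Psi e v := emb e * wval ml v.
have PD : additiveP Psi by move=> e e' v; rewrite /Psi rmorphD mulrDl.
have e w : tau (xelt x * wval ml w) = tau (contr Psi x 1 w).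
  by have := tau_contr x 1 w; rewrite rmorph1 mulr1 mul1r.
under eq_bigr do rewrite e.
rewrite -linear_sum contractions_fwords //; case: f=> [|[b y] f] //=.
by rewrite -fwordsE mulr_sumr.
Qed.

Lemma tau_fval b x f c : tau (fval ((b, x) :: f) c) = 0.
rewrite fval_cons (tauC tauP) mulrBl -mulrA fval_mulr ctr_mulr linearB /=.
by rewrite tau_letter subrr.
Qed.

Lemma gramB0 f g : gramB f 0 g = 0.
by elim: f g=> [|[b x] f IH] [|[b' y] g] //=; rewrite mul0r mulr0 etaB0 IH.
Qed.

Lemma gramB_size f e g : size f != size g -> gramB f e g = 0.
exact: gram_size. Qed.

(** Orthogonality of Wick products. The first letter of [f] is moved to the other side, where it
    creates or annihilates; the creating part cancels, by induction, against the contraction in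
    [fval], and the annihilating part is one step of [gramB]. *)
Lemma tau_fval_fval f c e g c' :
  tau (star (fval f c) * (emb e * fval g c')) = tau (emb (star c * gramB f e g * c')).
have [n] := ubnP (size f); elim: n f c e g c'=> // n IH [|[b x] f] c e g c' sf.
  case: g=> [|[b y] g]; first by rewrite /= -emb_star -!rmorphM !mulrA.
  rewrite mulr0 mul0r rmorph0 linear0 mulrA -emb_star -rmorphM. by rewrite -(fval_head_mul _ ((b, y) :: g)) tau_fval.
set z := star b * e.
have -> : star (fval ((b, x) :: f) c) * (emb e * fval g c') =
    (star (fval f c) * xelt (xadj x) - star (ctr x f c)) * (emb z * fval g c').
  by rewrite fval_cons starM starB starM xelt_adj -emb_star rmorphM !mulrA.
rewrite -fval_head_mul; set g1 := (_.1); set c1 := (_.2).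
rewrite mulrBl -[star (fval f c) * _ * _]mulrA fval_letter mulrDr linearB linearD.
have -> : tau (star (fval f c) * fval ((1, xadj x) :: g1) c1) = tau (star (ctr x f c) * fval g1 c1).
  rewrite -[fval (_ :: g1) c1]mul1r -(rmorph1 emb) IH //.
  case: f sf=> [|[b2 y] f] sf /=; first by rewrite mulr0 mul0r rmorph0 star0 mul0r.
  rewrite starM -emb_star -[star _ * _ * fval g1 c1]mulrA IH ?etaB_star; last by rewrite -ltnS ltnW.
  by rewrite !mulr1.
rewrite addrAC subrr add0r /g1 /c1 /z; case: g {g1 c1} => [|[b1 y] g].
  by rewrite /= !mulr0 mul0r rmorph0 linear0.
by rewrite [ctr _ _ _]/(emb _ * _) IH // /= mulrA.
Qed.

Notation hmul := (head_mul *%R).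
Notation norm_order := (nord (@xadj d) 1 *%R (@star R B) etaB).
Notation push_c := (pushc *%R).
Notation term := (noterm X B).

(* The coefficient-valued matrix element of the normally ordered term [t]. *)
Definition tgram (f : fock) (e : B) (t : term) (g : fock) : B :=
  gramB (drop (size t.1.1) f)
    (gramB (take (size t.1.1) f) e t.1.1 * t.1.2 * gramB t.2 1 (take (size t.2) g))
    (drop (size t.2) g).

Lemma tgram_push_coef f e b t g : tgram f e (push_c b t) g = tgram f (e * b) t g.
case: t=> -[[|[b' y] u] c] v; rewrite /tgram /=; first by rewrite !take0 /= mulrA.
by case: f=> [|[b1 y1] f] //=; rewrite !mulrA.
Qed.

Lemma tgram_head f e t g c :
  star (hmul (star e) f c).2 * tgram (hmul (star e) f c).1 1 t g = star c * tgram f e t g.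
case: f=> [|[b x] f]; rewrite /tgram /=.
  case: (drop _ g)=> [|z g']; rewrite ?mulr0 //; case: t=> -[[|z u] c0] v /=.
    by rewrite starM starK mul1r !mulrA.
  by rewrite !mul0r !mulr0.
case: t=> -[[|[b' y] u] c0] v /=.
  by case: (drop _ g)=> [|[b' y] g'] /=; rewrite ?mulr0 // starM starK !mul1r !mulrA.
by rewrite starM starK mul1r !mulrA.
Qed.

Lemma tgram_create f x t g : tgram f 1 ((1, x) :: t.1.1, t.1.2, t.2) g =
  if f is (b, y) :: f' then tgram f' (star (etaB (xadj x) y b)) t g else 0.
case: f=> [|[b y] f]; rewrite /tgram /=; first by rewrite !mul0r; case: drop.
by rewrite !mulr1 etaB_star xadjK.
Qed.

Lemma tgram_annih f x t g :
  tgram f 1 (if t.1.1 is (b, y) :: u' then push_c (etaB x y b) (u', t.1.2, t.2)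
      else ([::], 1, rcons t.2 (star t.1.2, xadj x))) g = tgram ((1, xadj x) :: f) 1 t g.
case: t=> -[[|[b y] u] c] v /=; last first.
  by rewrite tgram_push_coef /tgram /= xadjK star1 !mul1r.
rewrite /tgram /= size_rcons !mul1r take0 drop0.
have [sg|sg] := ltnP (size v) (size g).
  have [g0 [[b y] [g' [-> sv]]]] : exists g0 z g', g = g0 ++ z :: g' /\ size g0 = size v.
    exists (take (size v) g); have := size_drop (size v) g.
    case E: (drop (size v) g)=> [|z g'] /= sz; first by move: sg; rewrite -subn_gt0 -sz.
    by exists z, g'; rewrite -E cat_take_drop size_takel // ltnW.
  rewrite [take (size v) _]take_cat [drop (size v) _]drop_cat sv ltnn subnn take0 drop0 cats0.
  rewrite -cat_rcons take_cat drop_cat size_rcons sv ltnn subnn take0 drop0 cats0.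
  by rewrite /gramB gram_rcons //= star1 xadjK !mul1r starK mulrA.
rewrite (@drop_oversize _ (size v)) // (@drop_oversize _ (size v).+1) ?leqW //.
rewrite [gramB (rcons _ _) _ _]gramB_size ?mulr0 ?gramB0 /=; last first.
  by rewrite size_rcons take_oversize ?(leqW sg) // neq_ltn ltnS sg orbT.
by case: f.
Qed.

(** The Fock space computation done with traces alone: letters of [w] are moved onto the left vector
    one by one. Annihilation there corresponds to [tgram_create], creation there to
    [tgram_annih]. *)
Lemma tgram_sum w f e g c c' :
  tau (star (fval f c) * (emb e * (wval ml w * fval g c'))) =
  tau (emb (star c * (\sum_(t <- norm_order w) tgram f e t g) * c')).
elim: w f e c=> [|[b|x] w IH] f e c /=.
- rewrite big_seq1 /tgram /= take0 drop0 take0 drop0 !mulr1 /wval big_nil mul1r.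
  exact: tau_fval_fval.
- rewrite wval_cons !mulrA -[_ * emb e * emb b]mulrA -rmorphM -!mulrA IH big_map.
  rewrite [in RHS]mulrA; congr (tau (emb (_ * _ * _))); eqr=> t _. by rewrite tgram_push_coef.
rewrite big_flatten big_map wval_cons.
have -> : star (fval f c) * (emb e * (xelt x * wval ml w * fval g c')) =
    star (xelt (xadj x) * (emb (star e) * fval f c)) * (emb 1 * (wval ml w * fval g c')).
  by rewrite !starM xelt_adj starK emb_star starK rmorph1 mul1r !mulrA.
rewrite -fval_head_mul mulr_sumr; under [in RHS]eq_bigr do rewrite mulr_sumr.
under [in RHS]eq_bigr do under eq_bigr do rewrite -tgram_head.
set f1 := (_.1); set c1 := (_.2); rewrite fval_letter starD mulrDl linearD IH /=.
rewrite (_ : tau (star (ctr _ _ _) * _) = tau (emb (star c1 * (\sum_(t <- norm_order w)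
    tgram f1 1 ((1, x) :: t.1.1, t.1.2, t.2) g) * c'))).
  rewrite -linearD -rmorphD -mulrDl -mulrDr -big_split mulr_sumr; congr (tau (emb (_ * _))).
  eqr=> t _; by rewrite !big_cons big_nil addr0 tgram_annih mulrDr addrC.
case: f1=> [|[b y] f1]; rewrite /ctr.
  rewrite star0 mul0r linear0 big1 ?mulr0 ?mul0r ?rmorph0 ?linear0 // => t _. by rewrite tgram_create.
rewrite starM -emb_star rmorph1 mul1r -[_ * _ * (_ * _)]mulrA IH.
by under [in RHS]eq_bigr do rewrite tgram_create.
Qed.

(* Only the terms of maximal size survive in the difference with the matrix
   element of the tensors without their last factors. *)
Definition tmax (f : fock) (t : term) (g : fock) : B := gramB f 1 t.1.1 * t.1.2 * gramB t.2 1 g.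

(** A term either uses up both tensors or leaves both last factors to be paired with each other; if
    it uses up exactly one of them, all three expressions vanish by size. *)
Lemma tgram_rcons f b x t g b' y :
  tgram (rcons f (b, x)) 1 t (rcons g (b', y)) = tmax (rcons f (b, x)) t (rcons g (b', y)) +
  etaB (xadj x) y (star b * tgram f 1 t g * b').
case: t=> -[u c] v; rewrite /tgram /tmax /=.
have sr (h : fock) z : size (rcons h z) = (size h).+1 by rewrite size_rcons.
have ro (h : fock) n z : (n <= size h)%N ->
    (take n (rcons h z) = take n h) * (drop n (rcons h z) = rcons (drop n h) z).
  move=> nh; rewrite -cats1 take_cat drop_cat cats1; case: ltnP=> // hn.
  have -> : n = size h by apply/eqP; rewrite eqn_leq nh hn. by rewrite subnn take0 drop0 cats0 take_size drop_size.
have ov (h : fock) n z : (size h < n)%N -> (take n (rcons h z) = rcons h z) * (drop n (rcons h z) = [::]) *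
    (take n h = h) * (drop n h = [::]).
  by move=> nh; rewrite !take_oversize ?drop_oversize ?sr // ltnW.
have [uf|uf] := leqP (size u) (size f).
  rewrite !(ro f) //.
  rewrite [gramB (rcons f _) 1 u]gramB_size ?mul0r ?add0r; last by rewrite sr neq_ltn ltnS uf orbT.
  have [vg|vg] := leqP (size v) (size g).
    rewrite !(ro g) //; have [fg|fg] := eqVneq (size (drop (size u) f)) (size (drop (size v) g)).
      by rewrite /gramB gram_rcons // mulrA.
    by rewrite !gramB_size ?mulr0 ?mul0r ?etaB0 // !sr eqSS.
  rewrite !(ov g) // [gramB v 1 g]gramB_size ?mulr0 ?gramB0 ?mulr0 ?mul0r ?etaB0; last by rewrite neq_ltn vg orbT.
  by case: (drop _ f)=> [|[? ?] ?].
rewrite !(ov f) // [gramB f 1 u]gramB_size ?mul0r ?gramB0 ?mulr0 ?mul0r ?etaB0 ?addr0; last by rewrite neq_ltn uf.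
have [vg|vg] := leqP (size v) (size g).
  rewrite !(ro g) // [gramB v _ (rcons _ _)]gramB_size ?mulr0; last by rewrite sr neq_ltn ltnS vg.
  by case: (drop _ g).
by rewrite !(ov g).
Qed.

Lemma tgram_nil_l t g : tgram [::] 1 t g = tmax [::] t g.
case: t=> -[u c] v; rewrite /tgram /tmax /=.
have [vg|vg] := leqP (size g) (size v); first by rewrite take_oversize ?drop_oversize.
rewrite [gramB v 1 g]gramB_size ?mulr0 ?neq_ltn ?vg //.
have : (0 < size (drop (size v) g))%N by rewrite size_drop subn_gt0.
by case: (drop _ g).
Qed.

Lemma tgram_nil_r f t : tgram f 1 t [::] = tmax f t [::].
case: t=> -[u c] v; rewrite /tgram /tmax /=.
have [vg|vg] := leqP (size f) (size u); first by rewrite take_oversize ?drop_oversize.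
rewrite [gramB f 1 u]gramB_size ?mul0r ?neq_ltn ?vg ?orbT //.
have : (0 < size (drop (size u) f))%N by rewrite size_drop subn_gt0.
by case: (drop _ f)=> [|[? ?] ?].
Qed.

(* The covariance as a sum of positive kernels on the last factors. *)
Lemma tau_etaB x y b b' k c c' :
  tau (emb (star c * etaB (xadj x) y (star b * k * b') * c')) =
  \sum_a \sum_a' gam a a' (xadj x) y * tau (emb (star (p a * c) * (p a * c'))) *
     tau (emb (star (b * p a') * k * (b' * p a'))).
rewrite /etaB etaAE mulr_sumr mulr_suml !linear_sum; eqr=> a _.
rewrite mulr_sumr mulr_suml !linear_sum; eqr=> a' _.
set z := gam a a' _ _ * tau _.
have -> : star c * (z *: p a) * c' = z *: (star c * p a * c').
  by rewrite -(scalerAr z) -(scalerAl z).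
rewrite !linearZ /= mulrAC; congr (_ * _ * _).
  by rewrite starM p_star !mulrA -[star c * p a * p a]mulrA p_orth eqxx.
have -> : star (b * p a') * k * (b' * p a') = p a' * (star b * k * b') * p a'.
  by rewrite starM p_star !mulrA.
have pp : p a' * p a' = p a' by rewrite p_orth eqxx.
move: (star b * k * b')=> Q; have e : tau (emb (p a' * (p a' * Q))) = tau (emb (p a' * Q * p a')).
  by rewrite rmorphM (tauC tauP) -rmorphM.
by rewrite -rmorphM -e mulrA pp.
Qed.

Section ThroughTerms.
Variables (ws : seq (seq (B + X))).
Let Y : A := \sum_(w <- ws) wval ml w.
Let nos : seq term := flatten [seq norm_order w | w <- ws].

Lemma tgram_Y f g c c' : tau (star (fval f c) * (Y * fval g c')) =
  tau (emb (star c * (\sum_(t <- nos) tgram f 1 t g) * c')).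
rewrite /Y /nos big_flatten big_map mulr_suml mulr_sumr linear_sum.
rewrite mulr_sumr mulr_suml rmorph_sum linear_sum; eqr=> w _ /=.
by rewrite -tgram_sum rmorph1 mul1r.
Qed.

(** A Haagerup-type inequality. The terms of maximal size are the whole of [Y] minus [Y] acting on
    the tensors without their last factors, which are paired through the covariance. As this pairing
    is a sum of positive kernels, the second part is an amplification of [Y]. Each part has norm at
    most [cnorm Y], whence the factor 2. *)
Lemma max_terms_bound (I : finType) (f g : I -> fock) i j (x y : I -> B) :
  (forall s, size (f s) = i) -> (forall t, size (g t) = j) ->
  normc (\sum_s \sum_t tau (emb (star (x s) * (\sum_(T <- nos) tmax (f s) T (g t)) * y t))) <=
  2 * cnorm Y * (tnrm tau (\sum_s fval (f s) (x s)) * tnrm tau (\sum_t fval (g t) (y t))).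
move=> sf sg; set om := \sum_s fval _ _; set ze := \sum_t fval _ _.
have full : tau (star om * (Y * ze)) =
    \sum_s \sum_t tau (emb (star (x s) * (\sum_(T <- nos) tgram (f s) 1 T (g t)) * y t)).
  rewrite /om star_sum mulr_suml linear_sum; eqr=> s _.
  rewrite /ze !mulr_sumr linear_sum; eqr=> t _; exact: tgram_Y.
have fullB : normc (tau (star om * (Y * ze))) <= cnorm Y * (tnrm tau om * tnrm tau ze).
  apply: (letr (CS (tip_P tauP) _ _)); rewrite mulrCA ler_wpM2l ?nrm_ge0 //. exact: tnrmM.
have Y2 : cnorm Y * (tnrm tau om * tnrm tau ze) <= 2 * cnorm Y * (tnrm tau om * tnrm tau ze).
  by rewrite -mulrA ler_peMl ?mulr_ge0 ?cnorm_ge0 ?nrm_ge0 // ler1n.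
(* If one of the sizes is 0, no last factor can be left over and the terms of maximal size exhaust
   [Y]. *)
have triv : (forall s t, \sum_(T <- nos) tgram (f s) 1 T (g t) = \sum_(T <- nos) tmax (f s) T (g t)) ->
    normc (\sum_s \sum_t tau (emb (star (x s) * (\sum_(T <- nos) tmax (f s) T (g t)) * y t))) <=
    2 * cnorm Y * (tnrm tau om * tnrm tau ze).
  move=> e; apply: letr Y2; apply: letr fullB; rewrite full. by under eq_bigr do under eq_bigr do rewrite -e.
case: i sf=> [|i] sf.
  by apply: triv=> s t; rewrite (size0nil (sf s)); eqr=> T _; rewrite tgram_nil_l.
case: j sg=> [|j] sg.
  by apply: triv=> s t; rewrite (size0nil (sg t)); eqr=> T _; rewrite tgram_nil_r.
have split_last (h : fock) n : size h = n.+1 -> exists z : fock * (B * X), h = rcons z.1 (z.2.1, z.2.2).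
  by case/lastP: h=> // h [b z] _; exists (h, (b, z)).
have [F FE] := choice (fun s=> split_last _ _ (sf s)).
have [G GE] := choice (fun t=> split_last _ _ (sg t)).
pose through s t := star (F s).2.1 * (\sum_(T <- nos) tgram (F s).1 1 T (G t).1) * (G t).2.1.
have dec : \sum_s \sum_t tau (emb (star (x s) * (\sum_(T <- nos) tmax (f s) T (g t)) * y t)) =
    tau (star om * (Y * ze)) - \sum_s \sum_t tau (emb (star (x s) * etaB (xadj (F s).2.2) (G t).2.2 (through s t) * y t)).
  rewrite full -sumrB; eqr=> s _; rewrite -sumrB; eqr=> t _.
  rewrite -linearB -rmorphB -mulrBl -mulrBr; congr (tau (emb (_ * _ * _))).
  rewrite /through mulr_sumr mulr_suml etaB_sum -sumrB; eqr=> T _. by rewrite FE GE tgram_rcons addrK.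
rewrite dec.
(* [q z] is the kernel on last factors attached to the pair of types [z], a Gram kernel by
   [gam_gram]. [N] measures the corresponding vector of the tensor product, and the squares over [z]
   add up to that of the whole vector. *)
pose q z u v b b' := gam z.1 z.2 (xadj u) v * tau (emb (star (p z.1 * b) * (p z.1 * b'))).
pose fz (z : 'I_r * 'I_r) (h : fock * (B * X)) : A := fval h.1 (h.2.1 * p z.2).
pose S (I' : finType) (H : I' -> fock * (B * X)) (x' : I' -> B) z :=
  \sum_s \sum_t q z (H s).2.2 (H t).2.2 (x' s) (x' t) * tip_ tau (fz z (H s)) (fz z (H t)).
pose N (I' : finType) H x' z := sqrt (cRe (S I' H x' z)).
have -> : \sum_s \sum_t tau (emb (star (x s) * etaB (xadj (F s).2.2) (G t).2.2 (through s t) * y t)) =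
    \sum_z \sum_s \sum_t q z (F s).2.2 (G t).2.2 (x s) (y t) * tip_ tau (fz z (F s)) (Y * fz z (G t)).
  rewrite [RHS]exchange_big; eqr=> s _; rewrite [RHS]exchange_big; eqr=> t _.
  rewrite /through tau_etaB pair_big; eqr=> z _ /=; congr (_ * _). by rewrite /tip_ tgram_Y.
have expand (I' : finType) (h : I' -> fock) (H : I' -> fock * (B * X)) (x' : I' -> B) n :
    (forall s, size (h s) = n) -> (forall s, h s = rcons (H s).1 ((H s).2.1, (H s).2.2)) ->
    tnrm tau (\sum_s fval (h s) (x' s)) ^+ 2 = cRe (\sum_z S _ H x' z).
  move=> sh hE; rewrite (tnrm_sqr tauP); congr (cRe _).
  rewrite star_sum mulr_suml linear_sum [RHS]exchange_big; eqr=> s _.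
  rewrite mulr_sumr linear_sum [RHS]exchange_big; eqr=> t _.
  rewrite -[fval (h t) _]mul1r -(rmorph1 emb) tau_fval_fval (hE s) (hE t) /gramB gram_rcons; last first.
    by have := sh s; rewrite -(sh t) (hE s) (hE t) !size_rcons=> -[].
  rewrite mulrA tau_etaB pair_big; eqr=> z _ /=; congr (_ * _). by rewrite /tip_ -tau_fval_fval rmorph1 mul1r.
have kern z : exists (n : nat) (cc : X -> B -> {ffun 'I_n -> A}), forall u v b b',
    dip (tip_ tau) (cc u b) (cc v b') = q z u v b b'.
  have [n [h hE]] := gam_gram K z.1 z.2. exists n, (fun u b=> [ffun l=> h u l *: emb (p z.1 * b)])=> u v b b'.
  rewrite /dip /q hE mulr_suml; eqr=> l _; rewrite !ffunE.
  rewrite (ipZl (tip_P tauP)) (ipZr (tip_P tauP)) mulrA; congr (_ * _). by rewrite /tip_ -emb_star -rmorphM.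
pose fH (I' : finType) H z : {ffun I' -> A} := [ffun s=> fz z (H s)].
have nN (I' : finType) H x' z n (cc : X -> B -> {ffun 'I_n -> A}) :
    (forall u v b b', dip (tip_ tau) (cc u b) (cc v b') = q z u v b b') ->
    nrm (tip (tip_ tau) (@dip A (tip_ tau) 'I_n) (fun s : I'=> cc (H s).2.2 (x' s))) (fH I' H z) = N _ H x' z.
  move=> ccE; rewrite /nrm /n2 /tip /N; congr (sqrt (cRe _)).
  by eqr=> s _; eqr=> t _; rewrite ccE !ffunE.
have Nsq (I' : finType) H x' z : N I' H x' z ^+ 2 = cRe (S _ H x' z).
  have [n [cc ccE]] := kern z.
  rewrite -(nN _ _ _ _ _ _ ccE) (nrm_sqr (tip_sip (tip_P tauP) (dip_sip (tip_P tauP) _) _)).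
  rewrite /n2 /tip; congr (cRe _). by eqr=> s _; eqr=> t _; rewrite ccE !ffunE.
have Ylin : linear (fun v : A=> Y * v) by move=> k u v; rewrite mulrDr scalerAr.
pose Yl : {linear A -> A} := HB.pack (fun v : A=> Y * v) (GRing.isLinear.Build _ _ _ _ _ Ylin).
have zb z : normc (\sum_s \sum_t q z (F s).2.2 (G t).2.2 (x s) (y t) * tip_ tau (fz z (F s)) (Y * fz z (G t))) <=
    cnorm Y * (N _ F x z * N _ G y z).
  have [n [cc ccE]] := kern z.
  have := tensor_bound (tip_P tauP) (dip_sip (tip_P tauP) 'I_n) (fun s=> cc (F s).2.2 (x s))
    (fun t=> cc (G t).2.2 (y t)) (fH _ F z) (fH _ G z) (y := Yl) (cnorm_ge0 Y) (fun v=> tnrmM tauP Y v).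
  rewrite !(nN _ _ _ _ _ _ ccE); apply: letr; rewrite le_eqVlt; apply/orP; left; apply/eqP; congr normc.
  by eqr=> s _; eqr=> t _; rewrite ccE !ffunE.
have sumN (I' : finType) (h : I' -> fock) (H : I' -> fock * (B * X)) (x' : I' -> B) n :
    (forall s, size (h s) = n) -> (forall s, h s = rcons (H s).1 ((H s).2.1, (H s).2.2)) ->
    sqrt (\sum_z N _ H x' z ^+ 2) = tnrm tau (\sum_s fval (h s) (x' s)).
  move=> sh hE; rewrite -[RHS]ger0_norm ?nrm_ge0 // -sqrtr_sqr (expand _ _ _ _ _ sh hE) Re_sum.
  by congr sqrt; eqr=> z _; rewrite Nsq.
apply: (letr (le_normcD _ _)); rewrite normcN -mulrA mulr_natl mulr2n lerD //.
apply: (letr (nc_sum _ _ _)); apply: (@le_trans _ _ (\sum_z cnorm Y * (N _ F x z * N _ G y z))).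
  by lers=> z _; exact: zb.
rewrite -mulr_sumr ler_wpM2l ?cnorm_ge0 //; apply: (letr (rCS _ _)).
by rewrite (sumN _ _ _ _ _ sf FE) (sumN _ _ _ _ _ sg GE).
Qed.


(** * Coefficients of the powers of a block of terms *)

Section Powers.
Variables (i j : nat) (q : nat) (tr : 'I_q -> term).
Definition sumB (s : seq B) : B := \sum_(z <- s) z.
Notation M := (pcoef (@xadj d) 0 1 *%R (@star R B) etaB sumB tr).

Variables (sizes : forall s, (size (tr s).1.1 = i) * (size (tr s).2 = j))
  (big_L : forall F : term -> B, (forall t, ~~ ((size t.1.1 == i) && (size t.2 == j)) -> F t = 0) -> \sum_(t <- nos) F t = \sum_s F (tr s)).

(** For the formal sum [Z] of the terms [tr s], [W] and [V] parametrize vectors built on its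
    creation and annihilation tensors: [Z] sends [V b] to [W (act N b)], and its adjoint sends [W a]
    to [V (act (M 0) a)]. The operator [Z] itself is never formed. *)
Let W (a : 'I_q -> B) : A := \sum_s fval (tr s).1.1 ((tr s).1.2 * a s).
Let V (a : 'I_q -> B) : A := \sum_s fval (tr s).2 (a s).
Let act (k : 'I_q -> 'I_q -> B) (a : 'I_q -> B) s := \sum_t k s t * a t.
Let N s t := gramB (tr s).2 1 (tr t).2.
Let form (a : 'I_q -> B) (k : 'I_q -> 'I_q -> B) b := \sum_s \sum_t tauB (star (a s) * k s t * b t).

Let formE a k b : form a k b = \sum_s tauB (star (a s) * act k b s).
eqr=> s _; rewrite /act mulr_sumr linear_sum; eqr=> t _.
by rewrite mulrA.
Qed.

Let WW a b : tip_ tau (W a) (W b) = form a (M 0) b.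
rewrite /tip_ /W star_sum mulr_suml linear_sum; eqr=> s _.
rewrite mulr_sumr linear_sum; eqr=> t _.
rewrite -[fval (tr t).1.1 _]mul1r -(rmorph1 emb) tau_fval_fval emb_tau starM.
by rewrite /= !mulrA.
Qed.

Let VV a b : tip_ tau (V a) (V b) = form a N b.
rewrite /tip_ /V star_sum mulr_suml linear_sum; eqr=> s _.
rewrite mulr_sumr linear_sum; eqr=> t _.
by rewrite -[fval (tr t).2 _]mul1r -(rmorph1 emb) tau_fval_fval emb_tau.
Qed.

Notation rho := (2 * cnorm Y).

Let rho0 : 0 <= rho. by rewrite mulr_ge0 ?cnorm_ge0. Qed.

Let bound a b : normc (tip_ tau (W a) (W (act N b))) <= rho * (tnrm tau (W a) * tnrm tau (V b)).
have := max_terms_bound (f := fun s=> (tr s).1.1) (g := fun t=> (tr t).2)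
  (fun s=> (tr s).1.2 * a s) b (fun s=> (sizes s).1) (fun s=> (sizes s).2).
apply: letr; rewrite le_eqVlt; apply/orP; left; apply/eqP; congr normc.
rewrite WW formE; eqr=> s _.
under [RHS]eq_bigr do rewrite emb_tau.
rewrite -linear_sum; congr (tauB _).
have tE t : \sum_(T <- nos) tmax (tr s).1.1 T (tr t).2 = \sum_u gramB (tr s).1.1 1 (tr u).1.1 * (tr u).1.2 * N u t.
  rewrite big_L // => T; rewrite negb_and=> /orP[] Ts; rewrite /tmax.
    by rewrite [gramB _ 1 T.1.1]gramB_size ?mul0r // (sizes s).1 eq_sym.
  by rewrite [gramB T.2 1 _]gramB_size ?mulr0 // (sizes t).2.
under [RHS]eq_bigr do rewrite tE starM mulr_sumr mulr_suml.
rewrite /act mulr_sumr exchange_big; eqr=> u _ /=.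
rewrite !mulr_sumr; eqr=> t _.
by rewrite !mulrA.
Qed.

Let gramB_star f e g : star (gramB f e g) = gramB g (star e) f.
elim: f g e=> [|[b x] f IH] [|[b' y] g] e //=; rewrite ?star0 // IH etaB_star xadjK.
by rewrite !starM starK mulrA.
Qed.

Let M0_star s t : star (M 0 s t) = M 0 t s.
by rewrite /= !starM starK gramB_star star1 mulrA. Qed.

Let adjE a b : tip_ tau (W a) (W (act N b)) = tip_ tau (V (act (M 0) a)) (V b).
rewrite WW VV !formE -!linear_sum; congr (tauB _).
under eq_bigr do rewrite /act mulr_sumr.
under [RHS]eq_bigr do rewrite /act star_sum mulr_suml.
rewrite exchange_big; eqr=> t _; eqr=> s _.
by rewrite starM M0_star mulrA.
Qed.

Let WN b : tnrm tau (W (act N b)) <= rho * tnrm tau (V b).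
apply: (nrm_form (tip_P tauP)); first by rewrite mulr_ge0 ?nrm_ge0.
by apply: letr (Re_normc _) _; apply: letr (bound _ _) _; rewrite (mulrC (tnrm tau (W _))) mulrA.
Qed.

Let VM a : tnrm tau (V (act (M 0) a)) <= rho * tnrm tau (W a).
apply: (nrm_form (tip_P tauP)); first by rewrite mulr_ge0 ?nrm_ge0.
by apply: letr (Re_normc _) _; rewrite -adjE; apply: letr (bound _ _) _; rewrite mulrA.
Qed.

Let step a := act N (act (M 0) a).

Let W_iter n a : tnrm tau (W (iter n step a)) <= rho ^+ (2 * n) * tnrm tau (W a).
elim: n=> [|n IH] /=; first by rewrite mul1r.
rewrite (_ : _ * tnrm tau (W a) = rho * (rho * (rho ^+ (2 * n) * tnrm tau (W a)))); last first.
  by rewrite mulnS exprD expr2 !mulrA.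
apply: letr (WN _) _; rewrite ler_wpM2l //.
by apply: letr (VM _) _; rewrite ler_wpM2l.
Qed.

Let actM k a : act (M k) a =1 act (M 0) (iter (2 ^ k).-1 step a).
have act_ext (f : 'I_q -> 'I_q -> B) a1 a2 : a1 =1 a2 -> act f a1 =1 act f a2.
  by move=> e s; eqr=> t _; rewrite e.
have MS l s t : M l.+1 s t = \sum_u \sum_v M l s u * (N u v * M l v t).
  by rewrite /= /sumB big_map big_enum; eqr=> u _; rewrite big_map big_enum.
elim: k a=> [//|k IH] a s.
have -> : act (M k.+1) a s = act (M k) (act N (act (M k) a)) s.
  rewrite /act; under eq_bigr do rewrite MS mulr_suml. rewrite exchange_big; eqr=> u _ /=; rewrite mulr_sumr.
  under eq_bigr do rewrite mulr_suml. rewrite exchange_big; eqr=> v _ /=; rewrite !mulr_sumr.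
  by eqr=> t _; rewrite !mulrA.
rewrite IH; apply: (act_ext (M 0))=> t.
have iter_ext n a1 a2 : a1 =1 a2 -> iter n step a1 =1 iter n step a2.
  by elim: n=> //= n IHn e; apply: (act_ext N); apply: (act_ext (M 0)); apply: IHn.
rewrite (iter_ext _ _ (step (iter (2 ^ k).-1 step a))); last by move=> u; apply: act_ext; exact: IH.
rewrite -iterS -iterD; congr (iter _ step a t).
by rewrite expnS; have := expn_gt0 2 k; lia.
Qed.

(** [M k s t] is a matrix coefficient, between vectors [W] supported at [s] and at [t], of the power
    [2^k - 1] of [Z] times its adjoint; hence the exponent. [kap] pays for these two vectors and
    does not depend on [k]. *)
Lemma power_coef_bound : exists kap : R, 0 <= kap /\
  forall k s t, cnorm (M k s t) <= kap * rho ^+ (2 * (2 ^ k).-1).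
pose g s := cnorm (star (tr s).1.2 * gramB (tr s).1.1 1 (tr s).1.1 * (tr s).1.2).
pose kap := \sum_s sqrt (g s); exists (kap ^+ 2).
have g0 s : 0 <= sqrt (g s) by exact: sqrtr_ge0.
have kap0 : 0 <= kap by exact: sumr_ge0.
pose del s (b : B) (t : 'I_q) : B := if t == s then b else 0.
have Wdel s b : tnrm tau (W (del s b)) <= kap * tnrm tauB b.
  have -> : W (del s b) = fval (tr s).1.1 ((tr s).1.2 * b).
    rewrite /W (bigD1 s) //= /del eqxx big1 ?addr0 // => t /negbTE ->.
    by rewrite mulr0; have := fval_mulr (tr t).1.1 0 0; rewrite rmorph0 !mulr0.
  apply: (@le_trans _ _ (sqrt (g s) * tnrm tauB b)); last first.
    by rewrite ler_wpM2r ?nrm_ge0 // /kap (bigD1 s) //= lerDl sumr_ge0.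
  rewrite -le_sq ?mulr_ge0 ?nrm_ge0 // exprMn (tnrm_sqr tauP) sqr_sqrtr ?cnorm_ge0 //.
  rewrite -[X in star _ * X]mul1r -(rmorph1 emb) tau_fval_fval emb_tau starM. apply: letr (Re_normc _) _.
  have := CS (tip_P tauBP) b (star (tr s).1.2 * gramB (tr s).1.1 1 (tr s).1.1 * (tr s).1.2 * b).
  rewrite /tip_ -!mulrA=> cs; apply: letr cs _.
  rewrite (_ : g s * _ = tnrm tauB b * (g s * tnrm tauB b)); last by ring. apply: ler_wpM2l; first exact: nrm_ge0.
  rewrite !mulrA /g. exact: tnrmM.
split=> [|k s t]; first exact: sqr_ge0.
apply: (cnorm_le_form tauBP); first by rewrite mulr_ge0 ?sqr_ge0 ?exprn_ge0.
move=> c e; have -> : tauB (star c * M k s t * e) = tip_ tau (W (del s c)) (W (iter (2 ^ k).-1 step (del t e))).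
  rewrite WW formE (bigD1 s) //= [X in _ + X]big1=> [|u /negbTE us]; last first.
    by rewrite /del us star0 mul0r linear0.
  rewrite addr0 -actM {1}/del eqxx /act (bigD1 t) //= [X in _ + X]big1=> [|u /negbTE ut].
    by rewrite addr0 /del eqxx mulrA.
  by rewrite /del ut mulr0.
apply: letr (CS (tip_P tauP) _ _) _.
rewrite (_ : kap ^+ 2 * _ * _ = (kap * tnrm tauB c) * (rho ^+ (2 * (2 ^ k).-1) * (kap * tnrm tauB e))); last by ring.
apply: ler_pM; rewrite ?nrm_ge0 ?Wdel //.
by apply: letr (W_iter _ _) _; rewrite ler_wpM2l ?exprn_ge0.
Qed.
End Powers.
End ThroughTerms.

(** * Polynomial coefficients and their evaluations *)

Variables (Jc : Type) (ac : Jc -> B) (theta : nat -> 'I_r) (PA : forall n, 'I_r + Jc -> 'M[R[i]]_n.+1).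
Arguments PA : clear implicits.
Variables (PA_P : forall n b, PA n (inl b) = type_proj R theta n.+1 b)
  (PA_cvg : strong_cvg PA tauB (join_vars p ac)).
Notation poly := (ncpoly R ('I_r + Jc)).

Definition cB (c : poly) : B := nceval c (join_vars p ac).
Definition cn n (c : poly) : 'M[C]_n.+1 := nceval c (PA n).
(** The covariance map takes values in the span of the [p_b], here with limiting traces as
    coefficients, so it sends polynomials to polynomials that do not depend on [n]. *)
Definition etap (x y : X) (c : poly) : poly :=
  flatten [seq ncscale (gam e.1 e.2 x y * tauB (p e.2 * cB c)) (ncvar (inl e.1))
          | e <- enum {: 'I_r * 'I_r}].
Notation one := (ncconst ('I_r + Jc) (1 : C)).
Notation pfock := (seq (poly * X)).
Notation pterm := (noterm X poly).
Notation gramp := (gram (@xadj d) [::] (@ncmul _) (@ncstar _) etap).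

Lemma cB_etap x y c : cB (etap x y c) = etaB x y (cB c).
rewrite /cB /etap nce_flatten big_map big_enum_cond /etaB etaAE /etaA_def pair_big.
eqr=> -[b b'] _; rewrite nce_scale nce_var /=.
by rewrite -rmorphM emb_tau.
Qed.

Lemma cn_etap n x y c : cn n (etap x y c) =
  \sum_b \sum_b' (gam b b' x y * tauB (p b' * cB c)) *: type_proj R theta n.+1 b.
rewrite /cn /etap nce_flatten big_map big_enum_cond pair_big.
by eqr=> -[b b'] _; rewrite nce_scale nce_var PA_P.
Qed.

Lemma cB0 : cB [::] = 0. exact: nce_nil. Qed.
Lemma cB1 : cB one = 1. by rewrite /cB nce_const scale1r. Qed.
Lemma cBM c c' : cB (ncmul c c') = cB c * cB c'. exact: nce_mul. Qed.
Lemma cBs c : cB (ncstar c) = star (cB c). exact: nce_star. Qed.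
Lemma cB_sum s : cB (flatten s) = sumB (map cB s).
by rewrite /cB nce_flatten /sumB big_map. Qed.
Lemma cn1 n : cn n one = 1. by rewrite /cn nce_const scale1r. Qed.
Lemma cnM n c c' : cn n (ncmul c c') = cn n c * cn n c'. exact: nce_mul. Qed.
Lemma cns n c : cn n (ncstar c) = adjmx (cn n c). exact: nce_star. Qed.
Lemma cn_flatten n s : cn n (flatten s) = \sum_(c <- s) cn n c. exact: nce_flatten. Qed.

Lemma complex_cvg_evt (u : nat -> C^o) (l : C^o) (e : R) : 0 < e ->
  u @ \oo --> l -> evt (fun n=> normc ((u n : C) - l) <= e).
move=> e0 /cvgrPdist_le /(_ e%:C); rewrite ltcR=> /(_ e0) [n0 _ h]; exists n0=> n nn.
have := h n nn; rewrite -opprB normrN; have -> : `|(u n : C) - l| = (normc ((u n : C) - l))%:C by [].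
by rewrite lecR.
Qed.

Lemma cn_norm c (e : R) : 0 < e -> evt (fun n=> opnorm (cn n c) <= cnorm (cB c) + e).
move=> e0; have [_ h] := PA_cvg c; apply: evtS (real_cvg_evt e0 h)=> n.
by rewrite ler_norml=> /andP[_]; rewrite lerBlDl.
Qed.

Lemma cn_trace c (e : R) : 0 < e -> evt (fun n=> normc (ntrace (cn n c) - tauB (cB c)) <= e).
by move=> e0; have [h _] := PA_cvg c; exact: complex_cvg_evt h. Qed.

(** * Asymptotic norms of words in the array *)

Section StrongUpperBound.
Variables (Kn : nat -> lmodType C) (ipn : forall n, Kn n -> Kn n -> C) (ipnP : forall n, is_sip (ipn (n := n)))
  (E : forall n, 'I_n.+1 -> 'I_n.+1 -> {linear Kn n -> Kn n})
  (mu : forall n, X -> 'I_n.+1 -> 'I_n.+1 -> {linear Kn n -> Kn n})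
  (gamn gamn' : forall n, X -> X -> 'I_n.+1 -> 'I_n.+1 -> C) (sg : R) (tn : nat -> R) (N : nat -> nat).
Arguments ipn : clear implicits.
Arguments E : clear implicits.
Arguments mu : clear implicits.
Variables (saP : forall n, site_algebra (ipn n) (E n) (mu n) (@gamn n) (@gamn' n) sg (tn n))
  (N_small : forall (k : nat) (e : R), 0 < e -> evt (fun n=> (N n + k)%:R / n.+1%:R <= e))
  (t_small : forall (k : nat) (e : R), 0 < e -> evt (fun n=> s_ n * `|tn n| * (2 * (N n + k)%:R) <= e))
  (gam_small : forall e : R, 0 < e -> evt (fun n=> forall x y (i j : 'I_n.+1), i != j -> normc (gamn x y i j - gam (theta i) (theta j) x y) <= e)).

Notation H n := {ffun 'I_n.+1 -> Kn n}.
Notation hp := (fun n=> @dip (Kn n) (ipn n) 'I_n.+1).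
Let hpP n : is_sip (hp n) := dip_sip (ipnP n) _.
Notation Vn := (fun n=> Vh (E n)).
Notation ops := (forall n, H n -> H n).
Let Hn (n : nat) : lmodType C := H n.

Let VD n m (u v : H n) : Vh (E n) m u -> Vh (E n) m v -> Vh (E n) m (u + v).
by move=> hu hv i; rewrite ffunE; exact: (VkD (hu i) (hv i)). Qed.
Let VZ n m c (u : H n) : Vh (E n) m u -> Vh (E n) m (c *: u).
by move=> hu i; rewrite ffunE; exact: (VkZ c (hu i)). Qed.
Let Vle n m m' (u : H n) : (m <= m')%N -> Vh (E n) m u -> Vh (E n) m' u.
exact: Vh_le. Qed.

Notation ubb := (@ub Hn hp Vn N).
Notation nicee := (@nice Hn hp Vn N).
Notation eqvv := (@eqv Hn hp Vn N).
Notation cmp := (@ocomp Hn).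

Definition Mc (c : poly) : ops := fun n psi=> mact (cn n c) psi.
Definition Crs (x : X) : ops := fun n psi=> Cr (E n) (mu n) x psi.
Definition Ans (x : X) : ops := fun n psi=> An (E n) (mu n) x psi.
Definition Xls (x : X) : ops := fun n psi=> Xl (mu n) x psi.

Lemma s_small (e : R) : 0 < e -> evt (fun n=> s_ n <= e).
move=> e0; have [n0 h] := N_small 1 (e := e ^+ 2) (exprn_gt0 _ e0).
exists n0=> n nn; rewrite -le_sq ?s_ge0 ?(ltW e0) // s_sqr.
apply: letr (h n nn); rewrite -[leLHS]mul1r ler_wpM2r ?invr_ge0 //.
by rewrite ler1n addn1.
Qed.

Lemma mact_lin n c k (u v : H n) : mact c (k *: u + v) = k *: mact c u + mact c v.
apply/ffunP=> i; rewrite !ffunE scaler_sumr -big_split; eqr=> j _.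
by rewrite !ffunE scalerDr !scalerA mulrC.
Qed.

Lemma mactM n c c' (u : H n) : mact (c * c') u = mact c (mact c' u).
apply/ffunP=> i; rewrite !ffunE.
under eq_bigr do rewrite mxE scaler_suml.
rewrite exchange_big; eqr=> k _; rewrite ffunE scaler_sumr.
by eqr=> j _; rewrite scalerA.
Qed.

Lemma mact1 n (u : H n) : mact 1 u = u.
apply/ffunP=> i; rewrite ffunE (bigD1 i) //= mxE eqxx scale1r big1 ?addr0 // => j ji.
by rewrite mxE eq_sym (negbTE ji) scale0r.
Qed.

Lemma mactB n c c' (u : H n) : mact (c - c') u = mact c u - mact c' u.
apply/ffunP=> i; rewrite !ffunE -sumrB; eqr=> j _.
by rewrite !mxE scalerBl.
Qed.

Lemma mact_sum n (I : Type) (s : seq I) F (u : H n) :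
  mact (\sum_(i <- s) F i) u = \sum_(i <- s) mact (F i) u.
elim: s=> [|i s IH].
  by rewrite !big_nil -(subrr 0) mactB subrr.
rewrite !big_cons -IH; apply/ffunP=> k; rewrite !ffunE -big_split; eqr=> j _.
by rewrite !mxE scalerDl.
Qed.

Lemma Mc_ub c : ubb (Mc c) (cnorm (cB c)).
move=> k e e0; apply: evtS (cn_norm c e0)=> n hn psi _.
by apply: letr (sa_amp (saP n) _ _) _; rewrite ler_wpM2r ?nrm_ge0.
Qed.

Lemma Mc_nice c : nicee (Mc c).
split; last by exists (cnorm (cB c)); split; [exact: cnorm_ge0|exact: Mc_ub].
  by move=> n k u v; exact: mact_lin.
by exists 0%N=> n m psi; rewrite addn0; exact: Vh_mact.
Qed.

Lemma Crs_lin x : @lin Hn (Crs x).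
move=> n k u v; apply/ffunP=> i; rewrite !ffunE.
pose f (w : H n) := \sum_j mu n x i j (E n i j (w j)).
have -> : \sum_j mu n x i j (E n i j ((k *: u + v) j)) = k *: f u + f v.
  by rewrite /f scaler_sumr -big_split; eqr=> j _; rewrite !ffunE !linearP.
by rewrite scalerDr !scalerA mulrC.
Qed.

Lemma Ans_lin x : @lin Hn (Ans x).
move=> n k u v; apply/ffunP=> i; rewrite !ffunE.
pose f (w : H n) := \sum_j E n i j (mu n x i j (w j)).
have -> : \sum_j E n i j (mu n x i j ((k *: u + v) j)) = k *: f u + f v.
  by rewrite /f scaler_sumr -big_split; eqr=> j _; rewrite !ffunE !linearP.
by rewrite scalerDr !scalerA mulrC.
Qed.

Lemma err_small (e : R) : 0 < e -> forall k, evt (fun n=> 8 * (N n + k).+2%:R / n.+1%:R + s_ n <= e).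
move=> e0 k; have e2 : 0 < e / 16 by rewrite divr_gt0.
apply: evtS (evtI (N_small (k + 2) e2) (s_small e2))=> n [h1 h2].
have -> : (N n + k).+2 = (N n + (k + 2))%N by lia.
rewrite -mulrA; apply: letr (lerD (ler_wpM2l _ h1) h2) _=> //.
have -> : 8 * (e / 16) + e / 16 = (9 / 16) * e by field.
by apply: ler_piMl; [exact: ltW|rewrite ler_pdivrMr // mul1r ler_nat].
Qed.

Lemma An_Cr_eta x y c k (e : R) : 0 < e -> evt (fun n=> forall psi, Vh (E n) (N n + k) psi ->
  nrm (hp n) (An (E n) (mu n) x (mact (cn n c) (Cr (E n) (mu n) y psi)) - mact (etan (@gamn n) x y (cn n c)) psi) <=
  e * nrm (hp n) psi).
move=> e0; pose M := (cnorm (cB c) + 1) * (sg ^+ 2 + 1).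
have c1 : 0 < cnorm (cB c) + 1 by rewrite ltr_wpDl ?cnorm_ge0.
have s1 : 0 < sg ^+ 2 + 1 by rewrite ltr_wpDl ?sqr_ge0.
have M0 : 0 < M by rewrite mulr_gt0.
apply: evtS (evtI (cn_norm c ltr01) (err_small (divr_gt0 e0 M0) k))=> n [h1 h2] psi hpsi.
apply: letr (An_Cr (ipnP n) (saP n) _ _ _ hpsi) _.
rewrite ler_wpM2r ?nrm_ge0 //; apply: (@le_trans _ _ (M * (e / M))); last first.
  by rewrite mulrCA divff ?mulr1 ?gt_eqF.
apply: ler_pM=> //; first by rewrite mulr_ge0 ?op_ge0 ?sqr_ge0.
  by rewrite addr_ge0 ?s_ge0 // divr_ge0 // mulr_ge0.
by apply: ler_pM; rewrite ?op_ge0 ?sqr_ge0 // lerDl.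
Qed.

Lemma Crs_ub x : ubb (Crs x) (sg + 1).
move=> k e e0; have e1 : 0 < (1 : R) by [].
apply: evtS (An_Cr_eta (xadj x) x one k e1)=> n hn psi hpsi.
have := hn psi hpsi; rewrite cn1 mact1=> {}hn.
apply: (@le_trans _ _ ((sg + 1) * nrm (hp n) psi)); last by rewrite ler_wpM2r ?nrm_ge0 // lerDl ltW.
have sg0 := sa_sg0 (saP n).
rewrite -le_sq ?nrm_ge0 ?mulr_ge0 ?addr_ge0 ?nrm_ge0 // (nrm_sqr (hpP n)) /n2 (Cr_adj (ipnP n) (saP n)).
rewrite -/(xadj x); set z := An _ _ _ _.
have hz : nrm (hp n) z <= (1 + sg ^+ 2) * nrm (hp n) psi.
  rewrite -(subrK (mact (etan (@gamn n) (xadj x) x 1) psi) z) mulrDl.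
  apply: letr (nrmD (hpP n) _ _) _; apply: lerD; first exact: hn.
  apply: letr (sa_amp (saP n) _ _) _; rewrite ler_wpM2r ?nrm_ge0 //.
  apply: letr (op_etan (saP n) _ _ _) _; rewrite -[leRHS]mul1r ler_wpM2r ?sqr_ge0 //.
  by apply: op_le=> // v; rewrite mul1mx mul1r.
apply: letr (Re_normc _) _; apply: letr (CS (hpP n) _ _) _.
apply: (@le_trans _ _ (nrm (hp n) psi * ((1 + sg ^+ 2) * nrm (hp n) psi))); first by rewrite ler_wpM2l ?nrm_ge0.
rewrite mulrCA -expr2 exprMn ler_wpM2r ?sqr_ge0 //; nra.
Qed.

Lemma Crs_nice x : nicee (Crs x).
split; [exact: Crs_lin| |exists (sg + 1); split; [by rewrite addr_ge0 ?(sa_sg0 (saP 0))|exact: Crs_ub]].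
by exists 1%N=> n m psi; rewrite addn1; apply: (Vh_Cr (saP n)).
Qed.

Lemma Ans_ub x : ubb (Ans x) (sg + 1).
move=> k e e0; apply: evtS (Crs_ub (xadj x) k.+1 e0)=> n hn psi hpsi.
have hA : Vh (E n) (N n + k.+1) (Ans x psi) by rewrite addnS; apply: (Vh_An (saP n)).
have sg0 := sa_sg0 (saP n).
apply: (nrm_form (hpP n)); first by rewrite mulr_ge0 ?nrm_ge0 // !addr_ge0 // ltW.
have -> : hp n (Ans x psi) (Ans x psi) = hp n (Crs (xadj x) (Ans x psi)) psi.
  by rewrite {1}/Crs (Cr_adj (ipnP n) (saP n)) -/(xadj (xadj x)) xadjK.
apply: letr (Re_normc _) _; apply: letr (CS (hpP n) _ _) _.
by rewrite mulrAC ler_wpM2r ?nrm_ge0 //; exact: hn.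
Qed.

Lemma Ans_nice x : nicee (Ans x).
split; [exact: Ans_lin| |exists (sg + 1); split; [by rewrite addr_ge0 ?(sa_sg0 (saP 0))|exact: Ans_ub]].
by exists 1%N=> n m psi; rewrite addn1; apply: (Vh_An (saP n)).
Qed.

Lemma Xls_eqv x : eqvv (Xls x) (@oadd Hn (Crs x) (Ans x)).
move=> k e e0; have e1 : 0 < e by [].
apply: evtS (t_small k.+1 e0)=> n hn psi hpsi; rewrite add0r /osub /oadd opprD addrA.
apply: letr (Xl_split (ipnP n) (saP n) _ hpsi) _; rewrite ler_wpM2r ?nrm_ge0 //.
by rewrite addnS in hn.
Qed.

Lemma diag_opnorm n (D : 'rV[C]_n.+1) (k : R) : 0 <= k -> (forall i, normc (D 0 i) <= k) ->
  opnorm (diag_mx D) <= k.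
move=> k0 h; apply: op_le=> // v; rewrite -le_sq ?mulr_ge0 ?l2_ge0 //.
rewrite exprMn !l2norm_sqr mulr_sumr; lers=> i _; rewrite mul_diag_mx !mxE ncM exprMn.
by apply: ler_wpM2r; [exact: sqr_ge0|rewrite le_sq ?nc_ge0].
Qed.

Lemma type_projE n b : type_proj R theta n b = diag_mx (\row_i (theta i == b)%:R).
apply/matrixP=> i j; rewrite /type_proj summxE !mxE.
under eq_bigr do rewrite mxE.
have [<-|ij] := eqVneq i j.
  rewrite mulr1n; have [ti|ti] := eqVneq (theta i) b.
    rewrite (bigD1 i) ?ti //= eqxx big1 ?addr0 // => l /andP[_ li]. by rewrite eq_sym (negbTE li).
  rewrite big1 // => l tl; have [il|//] := eqVneq i l. by rewrite -il in tl; rewrite tl in ti.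
rewrite mulr0n big1 // => l _; have [il|//] := eqVneq i l.
by rewrite -il /= eq_sym (negbTE ij).
Qed.

(* The empirical covariance map converges to the limiting one. *)
Lemma etan_etap x y c (e : R) : 0 < e -> evt (fun n=> opnorm (etan (@gamn n) x y (cn n c) - cn n (etap x y c)) <= e).
move=> e0.
pose G := \sum_b \sum_b' normc (gam b b' x y).
have G0 : 0 <= G by sge0=> b _; sge0=> b' _; exact: nc_ge0.
pose M := cnorm (cB c) + 1.
have M0 : 0 < M by rewrite ltr_wpDl ?cnorm_ge0.
(* The three coefficients of [e / Q] in the final estimate, plus 1 for positivity. *)
pose Q := M + M * (sg ^+ 2 + G) + G + 1.
have Q0 : 0 < Q by rewrite /Q; have := sqr_ge0 sg; nra.
have e1 : 0 < e / Q by rewrite divr_gt0.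
have trs : evt (fun n=> forall b', normc (ntrace (cn n (ncmul (ncvar (inl b')) c)) - tauB (p b' * cB c)) <= e / Q).
  apply: evt_allfin=> b'; apply: evtS (cn_trace (ncmul (ncvar (inl b')) c) e1)=> n. by rewrite cBM /cB nce_var.
apply: evtS (evtI (evtI (cn_norm c ltr01) trs) (evtI (gam_small e1) (N_small 1 e1)))=> n [[h1 h2] [h3 h4]].
have n1 : n.+1%:R^-1 <= e / Q.
  by apply: letr h4; rewrite -[leLHS]mul1r ler_wpM2r ?invr_ge0 // ler1n addn1.
rewrite cn_etap; under eq_bigr do under eq_bigr do rewrite type_projE.
have -> : \sum_b \sum_b' (gam b b' x y * tauB (p b' * cB c)) *: diag_mx (\row_(i < n.+1) (theta i == b)%:R) =
    diag_mx (\row_(i < n.+1) \sum_b' gam (theta i) b' x y * tauB (p b' * cB c)).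
  apply/matrixP=> i j; rewrite summxE !mxE; under eq_bigr do rewrite summxE. have [<-|ij] := eqVneq i j; last first.
    by rewrite mulr0n big1 // => b _; rewrite big1 // => b' _; rewrite !mxE (negbTE ij) mulr0n mulr0.
  rewrite mulr1n (bigD1 (theta i)) //= [X in _ + X]big1 ?addr0=> [|b bt].
    by eqr=> b' _; rewrite !mxE !eqxx mulr1n mulr1.
  by rewrite big1 // => b' _; rewrite !mxE eqxx mulr1n eq_sym (negbTE bt) mulr0.
rewrite /etan -raddfB /=; apply: diag_opnorm; first exact: ltW.
move=> i; rewrite !mxE.
have trE b' : ntrace (cn n (ncmul (ncvar (inl b')) c)) = n.+1%:R^-1 * \sum_(j < n.+1 | theta j == b') cn n c j j.
  rewrite cnM /cn nce_var PA_P type_projE /ntrace /mxtrace; congr (_ * _). rewrite [RHS]big_mkcond; eqr=> j _.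
  transitivity ((diag_mx (\row_(i < n.+1) (theta i == b')%:R) *m nceval c (PA n)) j j); first by [].
  rewrite mul_diag_mx !mxE. by case: eqP=> _; rewrite ?mul1r ?mul0r.
have split_types : \sum_j cn n c j j * gamn x y i j =
    \sum_j cn n c j j * (gamn x y i j - gam (theta i) (theta j) x y) +
    \sum_b' gam (theta i) b' x y * \sum_(j < n.+1 | theta j == b') cn n c j j.
  have -> : \sum_b' gam (theta i) b' x y * \sum_(j < n.+1 | theta j == b') cn n c j j =
      \sum_j cn n c j j * gam (theta i) (theta j) x y.
    rewrite [RHS](partition_big (fun j : 'I_n.+1=> theta j) xpredT) //=; eqr=> b' _.
    by rewrite mulr_sumr; eqr=> j /eqP ->; rewrite mulrC.
  by rewrite -big_split; eqr=> j _ /=; ring.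
rewrite split_types mulrDr [X in _ + X - _]mulr_sumr -addrA -sumrB.
have -> : \sum_b' (n.+1%:R^-1 * (gam (theta i) b' x y * \sum_(j < n.+1 | theta j == b') cn n c j j) -
    gam (theta i) b' x y * tauB (p b' * cB c)) =
    \sum_b' gam (theta i) b' x y * (ntrace (cn n (ncmul (ncvar (inl b')) c)) - tauB (p b' * cB c)).
  by eqr=> b' _; rewrite trE; ring.
have Gb b b' : normc (gam b b' x y) <= G.
  rewrite /G (bigD1 b) //= (bigD1 b') //= -addrA lerDl addr_ge0 ?sumr_ge0 // => u _; rewrite ?nc_ge0 //.
  by rewrite sumr_ge0 // => v _; exact: nc_ge0.
have b1 : normc (\sum_b' gam (theta i) b' x y * (ntrace (cn n (ncmul (ncvar (inl b')) c)) - tauB (p b' * cB c))) <= G * (e / Q).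
  apply: letr (nc_sum _ _ _) _;  have -> : G = \sum_b' normc (gam (theta i) b' x y) +
      \sum_(b | b != theta i) \sum_b' normc (gam b b' x y) by rewrite /G (bigD1 (theta i)).
  rewrite mulrDl; apply: ler_wpDr; first by rewrite mulr_ge0 ?(ltW e1) // sumr_ge0 // => b _; rewrite sumr_ge0 // => b' _; exact: nc_ge0.
  by rewrite mulr_suml; lers=> b' _; rewrite ncM ler_wpM2l ?nc_ge0.
have cj j : normc (cn n c j j) <= M by apply: letr (op_entry _ _ _) h1.
(* The index [j = i] is set apart: [gam_small] does not cover it, and one bounded term is negligible
   after division by [n.+1]. *)
have b2 : normc (\sum_j cn n c j j * (gamn x y i j - gam (theta i) (theta j) x y)) <=
    n.+1%:R * (M * (e / Q)) + M * (sg ^+ 2 + G).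
  rewrite (bigD1 i) //= addrC; apply: letr (le_normcD _ _) _; apply: lerD.
    apply: letr (nc_sum _ _ _) _. apply: (@le_trans _ _ (\sum_(j < n.+1 | j != i) M * (e / Q))).
      by lers=> j ji; rewrite ncM; apply: ler_pM; rewrite ?nc_ge0 // h3 // eq_sym.
    rewrite sumr_const -(mulr_natl (M * (e / Q))); apply: ler_wpM2r.
      by rewrite mulr_ge0 ?(ltW M0) ?(ltW e1).
    by rewrite ler_nat; apply: leq_trans (max_card _) _; rewrite card_ord.
  rewrite ncM; apply: ler_pM; rewrite ?nc_ge0 //.
  by apply: letr (le_normcD _ _) _; rewrite normcN lerD ?(sa_sg (saP n)).
have nE : normc (n.+1%:R^-1 : C) = n.+1%:R^-1.
  by rewrite -(rmorph_nat (real_complex R)) -fmorphV normcR ger0_norm // invr_ge0.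
apply: letr (le_normcD _ _) _; rewrite ncM nE.
apply: (@le_trans _ _ (M * (e / Q) + M * (sg ^+ 2 + G) * (e / Q) + G * (e / Q))).
  apply: lerD=> //; apply: (@le_trans _ _ (n.+1%:R^-1 * (n.+1%:R * (M * (e / Q)) + M * (sg ^+ 2 + G)))).
    by rewrite ler_wpM2l ?invr_ge0.
  rewrite mulrDr mulKf ?pnatr_eq0 // lerD2l mulrC ler_wpM2l //. by rewrite mulr_ge0 ?(ltW M0) // addr_ge0 ?sqr_ge0.
apply: (@le_trans _ _ (Q * (e / Q))); last by rewrite mulrCA divff ?mulr1 ?gt_eqF.
by rewrite -!mulrDl ler_wpM2r ?(ltW e1) // /Q lerDl.
Qed.

Notation norder := (nord (@xadj d) one (@ncmul _) (@ncstar _) etap).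

Lemma An_Cr_eqv x y c : eqvv (cmp (Ans x) (cmp (Mc c) (Crs y))) (Mc (etap x y c)).
move=> k e e0; have e2 : 0 < e / 2 by rewrite divr_gt0.
apply: evtS (evtI (An_Cr_eta x y c k e2) (etan_etap x y c e2))=> n [h1 h2] psi hpsi.
rewrite add0r /osub /ocomp /Ans /Crs {1}/Mc.
rewrite -(subrK (mact (etan (@gamn n) x y (cn n c)) psi) (An _ _ _ _)) -addrA.
apply: letr (nrmD (hpP n) _ _) _.
have -> : e * nrm (hp n) psi = e / 2 * nrm (hp n) psi + e / 2 * nrm (hp n) psi by field.
apply: lerD; first exact: h1.
rewrite /Mc -mactB; apply: letr (sa_amp (saP n) _ _) _.
by rewrite ler_wpM2r ?nrm_ge0.
Qed.

Fixpoint So (u : pfock) : ops :=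
  if u is (b, x) :: u' then cmp (Mc b) (cmp (Crs x) (So u')) else @oid Hn.
Fixpoint Sa (u : pfock) : ops :=
  if u is (b, x) :: u' then cmp (Sa u') (cmp (Ans (xadj x)) (Mc (ncstar b))) else @oid Hn.
Definition Op (t : pterm) : ops := cmp (So t.1.1) (cmp (Mc t.1.2) (Sa t.2)).
Definition Opa (t : pterm) : ops := cmp (So t.2) (cmp (Mc (ncstar t.1.2)) (Sa t.1.1)).
Fixpoint Wop (w : seq (poly + X)) : ops :=
  match w with
  | [::]=> @oid Hn
  | inl b :: w'=> cmp (Mc b) (Wop w')
  | inr x :: w'=> cmp (Xls x) (Wop w')
  end.

Lemma So_nice u : nicee (So u).
elim: u=> [|[b x] u IH] /=; first exact: nice_id.
by apply: niceM; [exact: Mc_nice|apply: niceM IH; exact: Crs_nice].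
Qed.

Lemma Sa_nice u : nicee (Sa u).
elim: u=> [|[b x] u IH] /=; first exact: nice_id.
by apply: niceM=> //; apply: niceM; [exact: Ans_nice|exact: Mc_nice].
Qed.

Lemma Op_nice z : nicee (Op z).
by apply: niceM; [exact: So_nice|apply: niceM; [exact: Mc_nice|exact: Sa_nice]]. Qed.

Lemma So_adj u n phi psi : hp n (So u phi) psi = hp n phi (Sa u psi).
elim: u phi psi=> //= -[b x] u IH phi psi; rewrite /ocomp /Mc /Crs (mact_adj (ipnP n)).
by rewrite (Cr_adj (ipnP n) (saP n)) IH /Mc cns.
Qed.

Lemma Sa_adj u n phi psi : hp n (Sa u phi) psi = hp n phi (So u psi).
by rewrite /= (ipC (hpP n)) -So_adj -(ipC (hpP n)). Qed.

Lemma Op_adj z n phi psi : hp n (Op z phi) psi = hp n phi (Opa z psi).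
by rewrite /Op /Opa /ocomp So_adj /Mc (mact_adj (ipnP n)) Sa_adj cns.
Qed.

Lemma Mc_mul b c n psi : Mc (ncmul b c) psi = Mc b (Mc c psi) :> H n.
by rewrite /Mc cnM mactM. Qed.

Lemma Mc_one n psi : Mc one psi = psi :> H n.
by rewrite /Mc cn1 mact1. Qed.

(** Annihilations meet creations pair by pair, from the middle outwards, and each pair becomes the
    covariance map. *)
Lemma So_gram u e v : size u = size v ->
  eqvv (cmp (Sa u) (cmp (Mc e) (So v))) (Mc (gramp u e v)).
elim: u e v=> [|[b x] u IH] e [|[b' y] v] //= => [_|[uv]].
  exact: eqv_refl.
apply: (eqvT hpP (T' := cmp (Sa u) (cmp (Mc (etap (xadj x) y (ncmul (ncstar b) (ncmul e b')))) (So v)))); last exact: IH.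
apply: (eqvT hpP (T' := cmp (Sa u) (cmp (cmp (Ans (xadj x)) (cmp (Mc (ncmul (ncstar b) (ncmul e b'))) (Crs y))) (So v)))).
  by apply: eqvE=> // n psi; rewrite /ocomp !Mc_mul.
apply: (eqv_comp hpP VD VZ Vle).
- exact: Sa_nice.
- apply: niceM (So_nice v); apply: niceM; first exact: Ans_nice.
  by apply: niceM; [exact: Mc_nice|exact: Crs_nice].
- by apply: niceM; [exact: Mc_nice|exact: So_nice].
- exact: eqv_refl.
apply: (eqv_comp hpP VD VZ Vle).
- by apply: niceM; [exact: Ans_nice|apply: niceM; [exact: Mc_nice|exact: Crs_nice]].
- exact: So_nice.
- exact: So_nice.
- exact: An_Cr_eqv.
- exact: eqv_refl.
Qed.

Lemma Xls_nice x : nicee (@oadd Hn (Crs x) (Ans x)).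
by apply: nice_add=> //; [exact: Crs_nice|exact: Ans_nice]. Qed.

Lemma Sa_rcons u b x n psi : Sa (rcons u (b, x)) psi = Ans (xadj x) (Mc (ncstar b) (Sa u psi)) :> H n.
by elim: u psi=> [|[b' y] u IH] psi //=; rewrite /ocomp IH. Qed.

Lemma Op_push_coef b z n psi : Mc b (Op z psi) = Op (pushc (@ncmul _) b z) psi :> H n.
by case: z=> -[[|[b' y] u] c] v; rewrite /Op /ocomp /= /ocomp /oid /= Mc_mul. Qed.

Lemma Op_create x z n psi : Crs x (Op z psi) = Op ((one, x) :: z.1.1, z.1.2, z.2) psi :> H n.
by rewrite /Op /= /ocomp Mc_one. Qed.

Lemma Op_annih x z : eqvv (cmp (Ans x) (Op z))
  (Op (if z.1.1 is (b, y) :: u' then pushc (@ncmul _) (etap x y b) (u', z.1.2, z.2)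
      else ([::], one, rcons z.2 (ncstar z.1.2, xadj x)))).
case: z=> -[[|[b y] u] c] v /=.
  apply: eqvE=> // n psi; rewrite /Op /ocomp /= /oid /= Mc_one Sa_rcons xadjK.
  congr (Ans x _); rewrite /Mc !cns -[in RHS]/(adjmx _); congr (mact _ _). by rewrite [RHS]adjmxK.
apply: (eqvT hpP (T' := cmp (cmp (Ans x) (cmp (Mc b) (Crs y))) (Op (u, c, v)))).
  by apply: eqvE.
apply: (eqvT hpP (T' := cmp (Mc (etap x y b)) (Op (u, c, v)))).
  apply: (eqv_comp hpP VD VZ Vle); [|exact: Op_nice|exact: Op_nice|exact: An_Cr_eqv|exact: eqv_refl].
  by apply: niceM; [exact: Ans_nice|apply: niceM; [exact: Mc_nice|exact: Crs_nice]].
by apply: eqvE=> // n psi; rewrite /ocomp Op_push_coef.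
Qed.

Definition Os (s : seq pterm) : ops := @osum Hn _ s Op.

Lemma Os_nice s : nicee (Os s).
by apply: nice_sum=> // z _; exact: Op_nice. Qed.

Lemma Os_flatten (I : Type) (s : seq I) (F : I -> seq pterm) n psi :
  Os (flatten [seq F i | i <- s]) psi = \sum_(i <- s) Os (F i) psi :> H n.
by rewrite /Os /osum big_flatten big_map. Qed.

Let comp_r T T' T'' : nicee T -> nicee T' -> nicee T'' -> eqvv T' T'' -> eqvv (cmp T T') (cmp T T'').
by move=> h1 h2 h3 h; apply: (eqv_comp hpP VD VZ Vle)=> //; exact: eqv_refl. Qed.
Let comp_l T T' T'' : nicee T -> nicee T' -> eqvv T T'' -> eqvv (cmp T T') (cmp T'' T').
by move=> h1 h2 h; apply: (eqv_comp hpP VD VZ Vle)=> //; exact: eqv_refl. Qed.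

Lemma Mc_Os b s n psi : Mc b (Os s psi) = Os [seq pushc (@ncmul _) b z | z <- s] psi :> H n.
rewrite /Os /osum big_map; have [l _ _] := Mc_nice b; rewrite (lin_sum _ _ l).
by eqr=> z _; rewrite Op_push_coef.
Qed.

Lemma Xls_Os x s : eqvv (cmp (@oadd Hn (Crs x) (Ans x)) (Os s))
  (Os (flatten [seq pushx (@xadj d) one (@ncmul _) (@ncstar _) etap x z | z <- s])).
pose F z := @oadd Hn (cmp (Crs x) (Op z)) (cmp (Ans x) (Op z)).
apply: (eqvT hpP (T' := @osum Hn _ s F)).
  apply: eqvE=> // n psi; rewrite /ocomp /Os /osum /F /oadd.
  have [l _ _] := Crs_nice x; have [l' _ _] := Ans_nice x. by rewrite (lin_sum _ _ l) (lin_sum _ _ l') -big_split.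
pose G z := Os (pushx (@xadj d) one (@ncmul _) (@ncstar _) etap x z).
apply: (eqvT hpP (T' := @osum Hn _ s G)); last first.
  by apply: eqvE=> // n psi; rewrite Os_flatten.
apply: eqv_sum=> // z _; rewrite /F /G.
apply: (eqvT hpP (T' := @oadd Hn (Op ((one, x) :: z.1.1, z.1.2, z.2))
  (Op (if z.1.1 is (b, y) :: u' then pushc (@ncmul _) (etap x y b) (u', z.1.2, z.2)
      else ([::], one, rcons z.2 (ncstar z.1.2, xadj x)))))).
  apply: eqv_add=> //; last exact: Op_annih. by apply: eqvE=> // n psi; rewrite /ocomp Op_create.
by apply: eqvE=> // n psi; rewrite /Os /osum !big_cons big_nil addr0.
Qed.

Lemma Wop_norder w : eqvv (Wop w) (Os (norder w)) /\ nicee (Wop w).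
elim: w=> [|[b|x] w [IH1 IH2]] /=.
- split; last exact: nice_id.
  by apply: eqvE=> // n psi; rewrite /Os /osum big_seq1 /Op /ocomp /= /oid Mc_one.
- split; last by apply: niceM=> //; exact: Mc_nice.
  apply: (eqvT hpP (T' := cmp (Mc b) (Os (norder w)))).
    by apply: comp_r=> //; [exact: Mc_nice|exact: Os_nice].
  by apply: eqvE=> // n psi; rewrite /ocomp Mc_Os.
have nX : nicee (Xls x).
  have [l g [c [c0 h]]] := Xls_nice x; split.
  - move=> n k u v; apply/ffunP=> i; rewrite !ffunE.
    have -> : \sum_j mu n x i j ((k *: u + v) j) = k *: (\sum_j mu n x i j (u j)) + \sum_j mu n x i j (v j).
      by rewrite scaler_sumr -big_split; eqr=> j _; rewrite !ffunE linearP.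
    by rewrite scalerDr !scalerA mulrC.
  - by exists 1%N=> n m psi; rewrite addn1; apply: (Vh_Xl (saP n)).
  by exists c; split=> //; exact: (eqv_ub hpP (Xls_eqv x)).
split; last exact: niceM.
apply: (eqvT hpP (T' := cmp (Xls x) (Os (norder w)))).
  by apply: comp_r=> //; exact: Os_nice.
apply: (eqvT hpP _ (Xls_Os x _)).
by apply: comp_l=> //; [exact: Os_nice|exact: Xls_eqv].
Qed.

Lemma Op_comp v c u u' c' v' : size u = size u' ->
  eqvv (cmp (Op (v, c, u)) (Op (u', c', v')))
       (Op (v, ncmul c (ncmul (gramp u one u') c'), v')).
move=> uu.
pose M := cmp (Sa u) (cmp (Mc one) (So u')).
apply: (eqvT hpP (T' := cmp (So v) (cmp (Mc c) (cmp M (cmp (Mc c') (Sa v')))))).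
  by apply: eqvE=> // n psi; rewrite /Op /M /ocomp /= Mc_one.
apply: (eqvT hpP (T' := cmp (So v) (cmp (Mc c) (cmp (Mc (gramp u one u')) (cmp (Mc c') (Sa v')))))).
  have nM : nicee M.
    by apply: niceM; [exact: Sa_nice|apply: niceM; [exact: Mc_nice|exact: So_nice]].
  have nS : nicee (cmp (Mc c') (Sa v')) by apply: niceM; [exact: Mc_nice|exact: Sa_nice].
  have nG : nicee (Mc (gramp u one u')) := Mc_nice _. apply: comp_r; [exact: So_nice| | |].
  - by apply: niceM; [exact: Mc_nice|exact: niceM].
  - by apply: niceM; [exact: Mc_nice|exact: niceM]. apply: comp_r; [exact: Mc_nice|exact: niceM|exact: niceM|].
  by apply: comp_l=> //; exact: So_gram.
by apply: eqvE=> // n psi; rewrite /Op /ocomp /= !Mc_mul.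
Qed.

Lemma Op_flatten u s v n psi : Op (u, flatten s, v) psi = \sum_(c <- s) Op (u, c, v) psi :> H n.
rewrite /Op /ocomp /= /Mc cn_flatten mact_sum; have [l _ _] := So_nice u.
exact: (lin_sum _ _ l).
Qed.

Lemma nice_common (I : finType) (F : I -> ops) : (forall i, nicee (F i)) ->
  exists c, 0 <= c /\ forall i, ubb (F i) c.
move=> nF; have h i : exists c, 0 <= c /\ ubb (F i) c by have [] := nF i.
have [c hc] := choice h; exists (\sum_i c i); split; first by sge0=> i _; have [] := hc i.
move=> i; have [_] := hc i; apply: ub_le=> //; rewrite (bigD1 i) //= lerDl sumr_ge0 // => j _.
by have [] := hc j.
Qed.

Definition blocks q (v : 'I_q -> pfock) (m : 'I_q -> 'I_q -> poly) : ops :=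
  @osum Hn _ (enum 'I_q) (fun a=> @osum Hn _ (enum 'I_q) (fun b=> Op (v a, m a b, v b))).

Lemma blocks_comp q (v : 'I_q -> pfock) m m' : (forall a b, size (v a) = size (v b)) ->
  eqvv (cmp (blocks v m) (blocks v m')) (blocks v (fun a d =>
    flatten [seq flatten [seq ncmul (m a b) (ncmul (gramp (v b) one (v c)) (m' c d)) | c <- enum 'I_q] | b <- enum 'I_q])).
move=> sv; pose F a d b c := cmp (Op (v a, m a b, v b)) (Op (v c, m' c d, v d)).
pose sm := @osum Hn _ (enum 'I_q).
apply: (eqvT hpP (T' := sm (fun a=> sm (fun d=> sm (fun b=> sm (fun c=> F a d b c)))))).
  apply: eqvE=> // n psi; rewrite /ocomp /blocks /sm /osum. eqr=> a _; rewrite [RHS]exchange_big; eqr=> b _.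
  have [l _ _] := Op_nice (v a, m a b, v b). rewrite (lin_sum _ _ l) [RHS]exchange_big; eqr=> c _.
  by rewrite (lin_sum _ _ l); eqr.
pose G a d b c := Op (v a, ncmul (m a b) (ncmul (gramp (v b) one (v c)) (m' c d)), v d).
apply: (eqvT hpP (T' := sm (fun a=> sm (fun d=> sm (fun b=> sm (fun c=> G a d b c)))))).
  by do 4 (apply: eqv_sum=> // ? _); apply: Op_comp; exact: sv.
apply: eqvE=> // n psi; rewrite /sm /osum; eqr=> a _; eqr=> a' _.
rewrite [RHS]Op_flatten [RHS]big_map.
eqr=> b _; rewrite [RHS]Op_flatten [RHS]big_map //.
Qed.

(** A crude estimate whose constant depends on the number of terms and on the outer factors but not
    on the coefficients, hence not on the power considered in [block_ub]. *)
Lemma eqv_blocks_ub q (v : 'I_q -> pfock) : exists c, 0 <= c /\ forall m (k : R), 0 <= k ->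
  (forall a b, cnorm (cB (m a b)) <= k) -> ubb (blocks v m) (c * k).
have [c1 [c10 h1]] := nice_common (fun a=> So_nice (v a)).
have [c2 [c20 h2]] := nice_common (fun a=> Sa_nice (v a)).
exists (q%:R * (q%:R * (c1 * c2))); split; first by rewrite !mulr_ge0.
move=> m k k0 hk.
have e (z : R) : q%:R * z = \sum_(a <- enum 'I_q) z by rewrite big_enum sumr_const card_ord mulr_natl.
rewrite -!mulrA e; apply: ub_sum=> // a _; rewrite e; apply: ub_sum=> // b _.
rewrite [c2 * k]mulrC; have [_ g _] := Sa_nice (v b); have [_ g' _] := Mc_nice (m a b).
apply: ub_comp; [by []|exact: mulr_ge0|exact: graded_comp|exact: h1|].
by apply: ub_comp=> //; [exact: ub_le (hk a b) (Mc_ub _)|exact: h2].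
Qed.

Definition wB (w : seq (poly + X)) : seq (B + X) :=
  [seq match y with inl b=> inl (cB b) | inr x=> inr x end | y <- w].
Definition Yv (ws : seq (seq (poly + X))) : A :=
  \sum_(w <- ws) wval (mixed K emb p src) (wB w).
Definition Wsum (ws : seq (seq (poly + X))) : ops := @osum Hn _ ws Wop.
Definition nos (ws : seq (seq (poly + X))) : seq pterm := flatten [seq norder w | w <- ws].

Lemma Wsum_nice ws : nicee (Wsum ws).
by apply: nice_sum=> // w _; have [] := Wop_norder w. Qed.

Lemma Wsum_Os ws : eqvv (Wsum ws) (Os (nos ws)).
apply: (eqvT hpP (T' := @osum Hn _ ws (fun w=> Os (norder w)))).
  by apply: eqv_sum=> // w _; have [] := Wop_norder w.
by apply: eqvE=> // n psi; rewrite Os_flatten.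
Qed.

(** Transfers [max_terms_bound] to the matrices without repeating its proof there: the powers of the
    block are normally ordered with coefficients [pcoef], these are bounded in [B] by
    [power_coef_bound], and the constant of [eqv_blocks_ub] disappears in [ub_of_powers]. *)
Lemma block_ub ws i j :
  ubb (Os [seq z <- nos ws | (size z.1.1 == i) && (size z.2 == j)]) (2 * cnorm (Yv ws)).
pose P z := (size (z : pterm).1.1 == i) && (size z.2 == j).
set s := [seq z <- _ | _]; pose tr z := tnth (in_tuple s) z; pose v a := (tr a).2.
have sP a : P (tr a).
  have : all P s by apply: filter_all. by move=> h; exact: (elimT (@all_tnthP _ _ P (in_tuple s)) h a).
have sz a : (size (tr a).1.1 = i) * (size (tr a).2 = j) by have /andP[/eqP -> /eqP ->] := sP a.
pose T' := @osum Hn _ s Opa.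
pose Hk := fix Hk k : ops := if k is k'.+1 then cmp (Hk k') (Hk k') else cmp T' (Os s).
pose pc := pcoef (@xadj d) [::] one (@ncmul _) (@ncstar _) etap flatten tr.
have eH k : eqvv (Hk k) (blocks v (pc k)) /\ nicee (Hk k).
  elim: k=> [|k [IH nH]] /=; last first.
    split; last exact: niceM. have nB : nicee (blocks v (pc k)).
      by apply: nice_sum=> // a _; apply: nice_sum=> // b _; exact: Op_nice.
    apply: (eqvT hpP (T' := cmp (blocks v (pc k)) (blocks v (pc k)))).
      exact: (eqv_comp hpP VD VZ Vle).
    by apply: blocks_comp=> a b; rewrite !sz.
  have nT' : nicee T' by apply: nice_sum=> // z _; exact: (Op_nice (z.2, _, _)).
  split; last by apply: niceM=> //; exact: Os_nice.
  pose F a b := cmp (Op (v a, ncstar (tr a).1.2, (tr a).1.1)) (Op (tr b)).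
  apply: (eqvT hpP (T' := @osum Hn _ (enum 'I_(size s)) (fun a=> @osum Hn _ (enum 'I_(size s)) (F a)))).
    apply: eqvE=> // n psi; rewrite /ocomp /T' /Os /osum big_tnth big_enum; eqr=> a _.
    have [l _ _] := Op_nice (v a, ncstar (tr a).1.2, (tr a).1.1).
    rewrite -[Opa _ _]/(Op (v a, ncstar (tr a).1.2, (tr a).1.1) _) [X in Op _ X]big_tnth (lin_sum _ _ l) big_enum.
    by eqr.
  do 2 (apply: eqv_sum=> // ? _). rewrite /F [tr _]surjective_pairing [(tr _).1]surjective_pairing; apply: Op_comp.
  by rewrite !sz.
apply: (ub_of_powers (H := Hk) hpP (T' := T'))=> //.
- by rewrite mulr_ge0 ?cnorm_ge0.
- by have [] := Os_nice s.
- move=> n phi psi; rewrite /Os /T' /osum (ip_suml (hpP n)) (ip_sumr (hpP n)).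
  by eqr=> z _; exact: Op_adj.
move=> e e0.
have [kap [kap0 hkap]] : exists kap : R, 0 <= kap /\
    forall k a b, cnorm (cB (pc k a b)) <= kap * (2 * cnorm (Yv ws)) ^+ (2 * (2 ^ k).-1).
  have hom k a b : cB (pc k a b) =
      pcoef (@xadj d) 0 1 *%R (@star R B) etaB sumB (fun a=> ntmap cB (tr a)) k a b.
    apply: power_coef_hom; [exact: cB0|exact: cB1|exact: cBM|exact: cBs| |exact: cB_sum]. exact: cB_etap.
  have Yw : Yv ws = \sum_(w <- map wB ws) wval (mixed K emb p src) w by rewrite big_map.
  have nosE : flatten [seq nord (@xadj d) 1 *%R (@star R B) etaB w | w <- map wB ws] = map (ntmap cB) (nos ws).
    rewrite /nos map_flatten -!map_comp; congr flatten; apply: eq_map=> w /=.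
    by symmetry; apply: normal_order_hom; [exact: cB1|exact: cBM|exact: cBs|exact: cB_etap].
  have [|F F0|kap [kap0 hk]] := power_coef_bound (ws := map wB ws) (i := i) (j := j) (tr := fun a=> ntmap cB (tr a)).
  - by move=> a; rewrite /= !size_map !sz.
  - rewrite nosE big_map -[RHS](big_tnth _ _ s xpredT (fun z=> F (ntmap cB z))) big_filter.
    rewrite [LHS](bigID P) /= [X in _ + X]big1 ?addr0 // => z; rewrite /P=> h; apply: F0. by rewrite /= !size_map.
  by exists kap; split=> // k a b; rewrite hom Yw.
have [c [c0 hc]] := eqv_blocks_ub v.
have Y0 : 0 <= 2 * cnorm (Yv ws) by rewrite mulr_ge0 ?cnorm_ge0.
have [k hk] := power_gap Y0 e0 (mulr_ge0 c0 kap0).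
exists k, (c * (kap * (2 * cnorm (Yv ws)) ^+ (2 * (2 ^ k).-1))); split.
- by rewrite !mulr_ge0 // exprn_ge0.
- by rewrite mulrA.
apply: (eqv_ub hpP (eH k).1); apply: hc=> [|a b]; last exact: hkap.
by rewrite mulr_ge0 // exprn_ge0.
Qed.

Lemma norder_size w : all (fun z : pterm=> (size z.1.1 + size z.2 <= size w)%N) (norder w).
elim: w=> //= -[b|x] w IH /=.
  by rewrite all_map; apply: sub_all IH=> -[[[|[b' y] u] c] v] /=; lia.
elim: (norder w) IH=> //= -[[u c] v] s IHs /= /andP[h /IHs ->].
rewrite andbT; case: u h=> [|[b y] [|[b' y'] u]] /=; rewrite ?size_rcons /= => h; apply/andP; split; lia.
Qed.

Lemma nos_size ws D : all (fun w=> size w <= D)%N ws ->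
  all (fun z : pterm=> (size z.1.1 + size z.2 <= D)%N) (nos ws).
elim: ws=> //= w ws IH /andP[h /IH h']; rewrite /nos /= all_cat; apply/andP; split=> //.
by apply: sub_all (norder_size w)=> z hz; apply: leq_trans hz h.
Qed.

Definition ofsize i j (z : pterm) := (size z.1.1 == i) && (size z.2 == j).

Lemma Os_blocks s D : all (fun z : pterm=> (size z.1.1 + size z.2 <= D)%N) s -> forall n psi,
  Os s psi = \sum_(i <- enum 'I_D.+1) \sum_(j <- enum 'I_D.+1) Os (seq.filter (ofsize i j) s) psi :> H n.
rewrite /Os /osum=> h n psi; elim: s h=> [_|z s IH /= /andP[hz /IH {}IH]].
  by rewrite big_nil big1 // => i _; rewrite big1 // => j _; rewrite big_nil.
rewrite big_cons IH.
pose F (i j : 'I_D.+1) : H n := if ofsize i j z then Op z psi else 0.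
have -> : Op z psi = \sum_(i <- enum 'I_D.+1) \sum_(j <- enum 'I_D.+1) F i j.
  have h1 : (size z.1.1 < D.+1)%N by lia. have h2 : (size z.2 < D.+1)%N by lia.
  rewrite big_enum (bigD1 (Ordinal h1)) //= big_enum (bigD1 (Ordinal h2)) //= {1}/F /ofsize !eqxx.
  rewrite big1 ?addr0=> [|j jn].
    rewrite big1 ?addr0 // => i ni; rewrite big1 // => j _; rewrite /F /ofsize.
    by case: eqP=> // e; case/eqP: ni; apply: val_inj.
  rewrite /F /ofsize; case: (size z.2 =P _)=> [e|]; rewrite ?andbF //. by case/eqP: jn; apply: val_inj.
rewrite -big_split; eqr=> i _; rewrite -big_split; eqr=> j _ /=.
by rewrite /F; case: (ofsize i j z); rewrite ?add0r // big_cons.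
Qed.

(** There are [D + 1] possible numbers of creations and as many of annihilations; each block costs
    [2 * cnorm (Yv ws)]. *)
Lemma Wsum_weak ws D : all (fun w=> size w <= D)%N ws ->
  ubb (Wsum ws) (D.+1%:R ^+ 2 * (2 * cnorm (Yv ws))).
move=> h; apply: (eqv_ub hpP (Wsum_Os ws)).
have e (z : R) : D.+1%:R * z = \sum_(i <- enum 'I_D.+1) z by rewrite big_enum sumr_const card_ord mulr_natl.
apply: (ub_ext (T := @osum Hn _ (enum 'I_D.+1) (fun i=> @osum Hn _ (enum 'I_D.+1)
  (fun j=> Os (seq.filter (ofsize i j) (nos ws))))))=> [n psi|]. by rewrite (Os_blocks (nos_size h)).
rewrite expr2 -mulrA e; apply: ub_sum=> // i _; rewrite e; apply: ub_sum=> // j _.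
exact: block_ub.
Qed.

Definition wstar (w : seq (poly + X)) : seq (poly + X) :=
  rev [seq match y with inl b=> inl (ncstar b) | inr x=> inr (xadj x) end | y <- w].

Lemma Xl_adj x n phi psi : hp n (Xls x phi) psi = hp n phi (Xls (xadj x) psi).
have cs : conjc (s_ n)%:C = (s_ n)%:C by exact: conjcR.
rewrite /= /dip; under eq_bigr do rewrite ffunE (ipZl (ipnP n)) cs (ip_suml (ipnP n)) mulr_sumr.
rewrite exchange_big; eqr=> j _; rewrite ffunE (ipZr (ipnP n)) (ip_sumr (ipnP n)) mulr_sumr.
by eqr=> i _; rewrite (sa_adj (saP n)).
Qed.

Lemma Wop_cat u v n psi : Wop (u ++ v) psi = Wop u (Wop v psi) :> H n.
by elim: u psi=> //= -[b|x] u IH psi; rewrite /ocomp IH. Qed.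

Lemma Wop_adj w n phi psi : hp n (Wop w phi) psi = hp n phi (Wop (wstar w) psi).
elim: w phi psi=> //= -[b|x] w IH phi psi; rewrite /wstar /= rev_cons -cats1 Wop_cat -IH.
  by rewrite /ocomp /= /ocomp /Mc (mact_adj (ipnP n)) cns.
by rewrite /ocomp /= /ocomp Xl_adj.
Qed.

Fixpoint pws (ws : seq (seq (poly + X))) k : seq (seq (poly + X)) :=
  if k is k'.+1 then [seq w ++ w' | w <- pws ws k', w' <- pws ws k']
  else [seq w ++ w' | w <- map wstar ws, w' <- ws].

Lemma Wsum_prod s s' n psi : Wsum [seq w ++ w' | w <- s, w' <- s'] psi = Wsum s (Wsum s' psi) :> H n.
rewrite /Wsum /osum big_allpairs_dep; eqr=> w _.
have [_ [l _ _]] := Wop_norder w; rewrite (lin_sum _ _ l).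
by eqr=> w' _; rewrite Wop_cat.
Qed.

Lemma Yv_prod s s' : Yv [seq w ++ w' | w <- s, w' <- s'] = Yv s * Yv s'.
rewrite /Yv big_allpairs_dep mulr_suml; eqr=> w _.
by rewrite mulr_sumr; eqr=> w' _; rewrite /wB map_cat wval_cat.
Qed.

Lemma Yv_star s : Yv (map wstar s) = star (Yv s).
rewrite /Yv big_map star_sum; eqr=> w _.
elim: w=> [|y w IH]; first by rewrite /wval !big_nil star1.
rewrite /wstar /= rev_cons -cats1 /wB map_cat wval_cat -/(wstar w) -/(wB _) IH.
rewrite /= !wval_cons starM /wval big_nil mulr1; congr (_ * _).
by case: y=> [b|x] /=; rewrite /mixed /= ?cBs ?emb_star // xelt_adj.
Qed.

Lemma pws_size ws D k : all (fun w=> size w <= D)%N ws -> all (fun w=> size w <= 2 ^ k.+1 * D)%N (pws ws k).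
move=> h; have pr s s' n : all (fun w : seq (poly + X)=> size w <= n)%N s ->
    all (fun w : seq (poly + X)=> size w <= n)%N s' ->
    all (fun w=> size w <= 2 * n)%N [seq w ++ w' | w <- s, w' <- s'].
  move=> hs hs'; elim: s hs=> //= w s IH /andP[hw /IH hs]; rewrite all_cat hs andbT all_map.
  by apply: sub_all hs'=> w' hw' /=; rewrite size_cat mul2n -addnn leq_add.
elim: k=> [|k IH] /=; last by rewrite expnS -mulnA; exact: pr.
by apply: pr=> //; rewrite all_map; apply: sub_all h=> w hw /=; rewrite size_rev size_map.
Qed.

Lemma pws_norm ws k : cnorm (Yv (pws ws k)) <= cnorm (Yv ws) ^+ (2 ^ k.+1).
elim: k=> [|k IH] /=; first by rewrite Yv_prod Yv_star cnorm_star.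
rewrite Yv_prod; apply: letr (cnormM _ _) _.
by rewrite expnSr exprM expr2; apply: ler_pM; rewrite ?cnorm_ge0.
Qed.

(** The weak bound is applied to the words of [(star Y * Y)^(2^k)], of length at most [2^(k+1) D].
    The loss is polynomial in the length and vanishes in the root of order [2^(k+1)]. *)
Theorem Wsum_ub ws : ubb (Wsum ws) (cnorm (Yv ws)).
have [D hD] : exists D, all (fun w : seq (poly + X)=> size w <= D)%N ws.
  elim: ws=> [|w ws [D IH]]; first by exists 0%N. exists (maxn D (size w))=> /=; rewrite leq_maxr /=.
  by apply: sub_all IH=> w' /= h; rewrite leq_max h.
apply: (ub_of_powers (H := fun k=> Wsum (pws ws k)) hpP (T' := Wsum (map wstar ws)))=> //.
- exact: cnorm_ge0.
- by have [] := Wsum_nice ws.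
- move=> n phi psi; rewrite /Wsum /osum (ip_suml (hpP n)) (ip_sumr (hpP n)) big_map.
  by eqr=> w _; exact: Wop_adj.
- by move=> n psi; rewrite /= Wsum_prod.
- by move=> k n psi; rewrite /= Wsum_prod.
move=> e e0; set rho := cnorm _; have r0 : 0 <= rho := cnorm_ge0 _.
pose b := rho + e; have b0 : 0 < b by rewrite ltr_wpDl.
have [||k0 hk] := @poly_exp (rho / b) 2 D _ _ (ler0n _ 2).
- by rewrite divr_ge0 // ltW.
- by rewrite ltr_pdivrMr // mul1r ltrDl.
have {hk} := hk (2 ^ k0.+1)%N; set m := (2 ^ k0.+1)%N=> hk.
exists k0, ((m * D).+1%:R ^+ 2 * (2 * cnorm (Yv (pws ws k0)))); split.
- by rewrite mulr_ge0 ?sqr_ge0 // mulr_ge0 ?cnorm_ge0.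
- apply: (@le_lt_trans _ _ (2 * (m * D).+1%:R ^+ 2 * rho ^+ m)).
    rewrite mulrA [_ * 2]mulrC; apply: ler_wpM2l; first by rewrite mulr_ge0 ?sqr_ge0. exact: pws_norm.
  have -> : rho ^+ m = (rho / b) ^+ m * b ^+ m.
    by rewrite expr_div_n mulfVK // expf_neq0 // gt_eqF.
  rewrite mulrA -[ltRHS]mul1r ltr_pM2r ?exprn_gt0 //; apply: hk. by have := ltn_expl k0.+1 (ltnSn 1); rewrite /m; lia.
by apply: Wsum_weak; exact: pws_size.
Qed.

(** * Asymptotic traces *)

Definition tro (T : ops) n (v : Kn n) : Kn n := trv (T n) v.

(** The partial trace is asymptotically the scalar [l] as an operator on all vectors of the given
    degree. A statement about the expected trace alone could not be iterated. *)
Definition evtr (T : ops) (l : C) := forall (k : nat) (e : R), 0 < e ->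
  evt (fun n=> forall v, Vk (E n) (N n + k) v -> nrm (ipn n) (tro T v - l *: v) <= e * nrm (ipn n) v).

Lemma nrm_coord n (psi : H n) j : nrm (ipn n) (psi j) <= nrm (hp n) psi.
rewrite -le_sq ?nrm_ge0 // (nrm_sqr (ipnP n)) (nrm_sqr (hpP n)) dip_n2 (bigD1 j) //= lerDl.
by sge0=> i _; exact: n2_ge0.
Qed.

Lemma tro_bound T n m (c : R) v : 0 <= c -> Vk (E n) m v ->
  (forall psi, Vh (E n) m psi -> nrm (hp n) (T n psi) <= c * nrm (hp n) psi) ->
  nrm (ipn n) (tro T v) <= c * nrm (ipn n) v.
move=> c0 hv h; rewrite /tro /trv (nrmZ (ipnP n)) normcR ger0_norm ?invr_ge0 //.
rewrite ler_pdivrMl ?ltr0n //.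
have ns (s : seq 'I_n.+1) : nrm (ipn n) (\sum_(j <- s) T n (conc j v) j) <= \sum_(j <- s) c * nrm (ipn n) v.
  elim: s=> [|j s IH]; first by rewrite !big_nil (nrm0 (ipnP n)).
  rewrite !big_cons; apply: letr (nrmD (ipnP n) _ _) _; apply: lerD=> //.
  apply: letr (nrm_coord _ _) _; rewrite -(conc_nrm (ipnP n) j v). by apply: h; exact: conc_Vh.
apply: letr (ns _) _.
by rewrite sumr_const card_ord mulr_natl.
Qed.

Lemma tro_sub T T' n v : tro (@osub Hn T T') v = tro T v - tro T' v :> Kn n.
rewrite /tro /trv -scalerBr -sumrB; congr (_ *: _); eqr=> j _.
by rewrite /osub !ffunE.
Qed.

Lemma evtr_eqv T T' l : eqvv T T' -> evtr T' l -> evtr T l.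
move=> h h' k e e0; have e2 : 0 < e / 2 by rewrite divr_gt0.
apply: evtS (evtI (h k _ e2) (h' k _ e2))=> n [h1 h2] v hv.
rewrite -(subrK (tro T' v) (tro T v)) -addrA; apply: letr (nrmD (ipnP n) _ _) _.
have -> : e * nrm (ipn n) v = e / 2 * nrm (ipn n) v + e / 2 * nrm (ipn n) v by field.
apply: lerD; last exact: h2.
rewrite -tro_sub; apply: (tro_bound _ hv); first exact: ltW.
by move=> psi hpsi; have := h1 psi hpsi; rewrite add0r.
Qed.

Lemma evtr_sum (I : Type) (s : seq I) (F : I -> ops) l :
  (forall i, List.In i s -> evtr (F i) (l i)) -> evtr (@osum Hn _ s F) (\sum_(i <- s) l i).
elim: s=> [|i s IH] h k e e0.
  apply: evt_true=> n v _; rewrite big_nil scale0r subr0 /tro /trv big1 ?scaler0.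
    by rewrite (nrm0 (ipnP n)) mulr_ge0 ?nrm_ge0 // ltW.
  by move=> j _; rewrite /osum big_nil ffunE.
have e2 : 0 < e / 2 by rewrite divr_gt0.
have hi := h i (or_introl erefl) k _ e2.
have hs := IH (fun j js=> h j (or_intror js)) k _ e2.
apply: evtS (evtI hi hs)=> n [h1 h2] v hv.
have -> : tro (@osum Hn _ (i :: s) F) v = tro (F i) v + tro (@osum Hn _ s F) v.
  rewrite /tro /trv -scalerDr -big_split; congr (_ *: _); eqr=> j _. by rewrite /osum big_cons ffunE.
rewrite big_cons scalerDl opprD addrACA; apply: letr (nrmD (ipnP n) _ _) _.
have -> : e * nrm (ipn n) v = e / 2 * nrm (ipn n) v + e / 2 * nrm (ipn n) v by field.
by apply: lerD; [exact: h1|exact: h2].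
Qed.

Definition lterm (z : pterm) : C :=
  if (size z.1.1 == 0%N) && (size z.2 == 0%N) then tauB (cB z.1.2) else 0.

Lemma tro_Vk T n m s v : (forall psi, Vh (E n) m psi -> Vh (E n) (m + s) (T n psi)) ->
  Vk (E n) m v -> Vk (E n) (m + s) (tro T v).
move=> h hv; apply: VkZ; apply: Vk_sum=> j; apply: h; exact: conc_Vh.
Qed.

(** [trv_Cr] bounds the partial trace by a multiple of [sqrt m / n]; it is tested against itself,
    whence the degree shift [s']. *)
Lemma evtr_create b x u c v : evtr (Op ((b, x) :: u, c, v)) 0.
move=> k e e0; pose T := Op (u, c, v).
have [lT [s gT] [c1 [c10 uT]]] := Op_nice (u, c, v).
have [_ [s' gO] _] := Op_nice ((b, x) :: u, c, v).
have sg0 := sa_sg0 (saP 0).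
pose M := (cnorm (cB b) + 1) * sg * 2 * (c1 + 1) + 1.
have M0 : 0 < M by rewrite ltr_wpDl // !mulr_ge0 // addr_ge0 ?cnorm_ge0.
have eM : 0 < e / M by rewrite divr_gt0.
apply: evtS (evtI (evtI (cn_norm b ltr01) (N_small (k + s').+1 eM)) (uT (k + s')%N 1 ltr01)).
move=> n [[h1 h2] h3] w hw; rewrite scale0r subr0.
set z := tro _ w; have hz : Vk (E n) (N n + k + s') z by apply: tro_Vk=> // psi; exact: gO.
apply: (nrm_form (ipnP n)); first by rewrite mulr_ge0 ?nrm_ge0 // ltW.
apply: letr (Re_normc _) _; rewrite {2}/z.
have hw' : Vk (E n) (N n + (k + s')) w by apply: excited_le hw; lia.
rewrite -addnA in hz.
have -> : tro (Op ((b, x) :: u, c, v)) w = trv (fun psi=> mact (cn n b) (Cr (E n) (mu n) x (T n psi))) w by [].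
apply: letr (trv_Cr (ipnP n) (saP n) x (cn n b) hw' hz (k := c1 + 1) _ h3) _.
  by rewrite addr_ge0.
rewrite -[leRHS]mulrA [X in _ <= _ * X]mulrC.
apply: ler_wpM2r; first by rewrite mulr_ge0 ?nrm_ge0.
set m := (N n + (k + s'))%N; pose y : R := 2 * m%:R.
have y0 : 0 <= y by rewrite mulr_ge0.
have sy : sqrt y <= 2 * m.+1%:R.
  rewrite -[leRHS]ger0_norm ?mulr_ge0 // -sqrtr_sqr ler_wsqrtr // -natr1 /y. have := ler0n R m; nra.
apply: (@le_trans _ _ (s_ n ^+ 2 * (cnorm (cB b) + 1) * sg * (2 * m.+1%:R) * (c1 + 1))).
  apply: ler_wpM2r; first by rewrite addr_ge0.
  have p0 : 0 <= s_ n ^+ 2 * opnorm (cn n b) by rewrite mulr_ge0 ?sqr_ge0 ?op_ge0.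
  apply: ler_pM=> //; first by rewrite mulr_ge0.
  apply: ler_wpM2r=> //; apply: ler_wpM2l; [exact: sqr_ge0|exact: h1].
have h4 : s_ n ^+ 2 * m.+1%:R <= e / M.
  by rewrite s_sqr mulrC; apply: letr h2; rewrite /m addnS.
rewrite (_ : _ * (c1 + 1) = (s_ n ^+ 2 * m.+1%:R) * ((cnorm (cB b) + 1) * sg * 2 * (c1 + 1))); last by ring.
apply: (@le_trans _ _ ((e / M) * M)); last by rewrite mulfVK // gt_eqF.
apply: ler_pM=> //; first by rewrite mulr_ge0 ?sqr_ge0.
  by rewrite !mulr_ge0 // addr_ge0 ?cnorm_ge0.
by rewrite /M lerDl.
Qed.

Lemma tro_adj T T' n v w : (forall phi psi, hp n (T' n phi) psi = hp n phi (T n psi)) ->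
  ipn n w (tro T v) = ipn n (tro T' w) v.
move=> h; rewrite /tro /trv (ipZr (ipnP n)) (ipZl (ipnP n)) conjcR (ip_sumr (ipnP n)) (ip_suml (ipnP n)).
congr (_ * _); eqr=> j _.
rewrite -(ip_conc (ipnP n)) -h [RHS](ipC (ipnP n)) -(ip_conc (ipnP n)).
by rewrite -(ipC (hpP n)).
Qed.

(** A term with annihilations but no creation is adjoint to the preceding case. Pure coefficients
    contribute their limiting trace. *)
Lemma evtr_term z : evtr (Op z) (lterm z).
case: z=> -[[|[b x] u] c] v; last by exact: evtr_create.
case: v=> [|[b x] v]; rewrite /lterm /=.
  move=> k e e0; apply: evtS (cn_trace c e0)=> n hn v hv.
  have -> : tro (Op ([::], c, [::])) v = ntrace (cn n c) *: v.
    rewrite /tro /trv /ntrace -scalerA; congr (_ *: _); first by rewrite fmorphV rmorph_nat.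
    rewrite /mxtrace scaler_suml; eqr=> j _.
    rewrite /Op /ocomp /= /oid /Mc ffunE (bigD1 j) //= big1 ?addr0 ?ffunE ?eqxx // => i ij.
    by rewrite ffunE (negbTE ij) scaler0.
  by rewrite -scalerBl (nrmZ (ipnP n)) ler_wpM2r ?nrm_ge0.
move=> k e e0; have [_ [s' gO] _] := Op_nice ([::], c, (b, x) :: v).
apply: evtS (evtr_create b x v (ncstar c) [::] (k + s') e0)=> n hn w hw.
rewrite scale0r subr0; set z := tro _ w.
have hz : Vk (E n) (N n + (k + s')) z by rewrite addnA; apply: tro_Vk=> // psi; exact: gO.
apply: (nrm_form (ipnP n)); first by rewrite mulr_ge0 ?nrm_ge0 // ltW.
rewrite {2}/z (tro_adj (T' := Op ((b, x) :: v, ncstar c, [::]))); last first.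
  move=> phi psi; rewrite [RHS](ipC (hpP n)) (Op_adj ([::], c, (b, x) :: v)) -(ipC (hpP n)). by [].
apply: letr (Re_normc _) _; apply: letr (CS (ipnP n) _ _) _.
have := hn z hz; rewrite scale0r subr0=> h.
by rewrite mulrAC ler_wpM2r ?nrm_ge0.
Qed.

(** The vacuum coefficient of [Yv ws]: at empty tensors only the terms without creations and
    annihilations count. *)
Lemma tau_Yv ws : tau (Yv ws) = \sum_(z <- nos ws) lterm z.
have := tgram_Y (map wB ws) [::] [::] 1 1.
rewrite /= rmorph1 !star1 !mul1r !mulr1 big_map=> ->.
have -> : flatten [seq nord (@xadj d) 1 *%R (@star R B) etaB w | w <- map wB ws] = map (ntmap cB) (nos ws).
  rewrite /nos map_flatten -!map_comp; congr flatten; apply: eq_map=> w /=.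
  by symmetry; apply: normal_order_hom; [exact: cB1|exact: cBM|exact: cBs|exact: cB_etap].
rewrite emb_tau big_map linear_sum; eqr=> -[[u c] v] _.
rewrite tgram_nil_l /tmax /lterm /=; case: u=> [|[? ?] ?] /=; last by rewrite !mul0r linear0.
by case: v=> [|[? ?] ?] /=; rewrite ?mulr0 ?linear0 // mul1r mulr1.
Qed.

Theorem Wsum_trace ws : evtr (Wsum ws) (tau (Yv ws)).
apply: (evtr_eqv (Wsum_Os ws)); rewrite tau_Yv.
by apply: evtr_sum=> z _; exact: evtr_term.
Qed.

End StrongUpperBound.

(** * From operator bounds to tail probabilities *)

Section FiniteMoments.
Variables (S : nat -> finType) (s0 : forall n, S n) (w : forall n, 'I_n.+1 -> 'I_n.+1 -> S n -> R)
  (G : forall n, X -> 'I_n.+1 -> 'I_n.+1 -> S n -> C) (sg : R) (tn : nat -> R) (N : nat -> nat).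
Arguments w : clear implicits.
Arguments G : clear implicits.
Variables (w_ge0 : forall n (i j : 'I_n.+1) s, (i < j)%N -> 0 <= w n i j s)
  (w_sum : forall n (i j : 'I_n.+1), (i < j)%N -> \sum_s w n i j s = 1)
  (G_adj : forall n x (i j : 'I_n.+1) s, i != j -> conjc (G n x i j s) = G n (xadj x) j i s)
  (G_mean : forall n x (i j : 'I_n.+1), i != j -> \sum_s (wt (s0 n) (w n) (key i j) s)%:C * G n x i j s = 0)
  (sg_ge0 : 0 <= sg) (gam_sg : forall n x y i j, normc (gamG (s0 n) (w n) (G n) x y i j) <= sg ^+ 2)
  (gam_sg' : forall n x y i j, normc (gamG' (s0 n) (w n) (G n) x y i j) <= sg ^+ 2)
  (tn_ge0 : forall n, 0 <= tn n) (G_bound : forall n x (i j : 'I_n.+1) s, i != j -> normc (G n x i j s) <= tn n)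
  (N_small : forall (k : nat) (e : R), 0 < e -> evt (fun n=> (N n + k)%:R / n.+1%:R <= e))
  (t_small : forall (k : nat) (e : R), 0 < e -> evt (fun n=> s_ n * `|tn n| * (2 * (N n + k)%:R) <= e))
  (gam_small : forall e : R, 0 < e -> evt (fun n=> forall x y (i j : 'I_n.+1), i != j -> normc (gamG (s0 n) (w n) (G n) x y i j - gam (theta i) (theta j) x y) <= e)).

Let ipn (n : nat) := @fip _ (S n) (wt (s0 n) (w n)).
Let Kn n : lmodType C := {ffun {ffun 'I_n.+1 * 'I_n.+1 -> S n} -> C^o}.
Let wge n := @wt_ge0 n (S n) (s0 n) (w n) (@w_ge0 n).
Let wsum n := @wt_sum n (S n) (s0 n) (w n) (@w_sum n).
Let ipnP n : is_sip (@ipn n) := fip_sip (@wge n).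
Let E (n : nat) := siteE (s0 n) (w n).
Let M (n : nat) := siteM (d := d) (G n).
Let saP n : site_algebra (@ipn n) (@E n) (@M n) (gamG (s0 n) (w n) (G n)) (gamG' (s0 n) (w n) (G n)) sg (tn n) :=
  array_site_algebra (@w_ge0 n) (@w_sum n) (@G_adj n) (@G_mean n) sg_ge0 (@gam_sg n) (@gam_sg' n) (tn_ge0 n) (@G_bound n).


Definition Wmx n (v : seq (poly + X)) om : 'M[C]_n.+1 :=
  \prod_(l <- v) match l with inl b=> nceval b (PA n) | inr x=> Xmx (d := d) (G n) x om end.
Arguments Wmx : clear implicits.
Definition Ymx n (vs : seq (seq (poly + X))) om : 'M[C]_n.+1 := \sum_(v <- vs) Wmx n v om.
Arguments Ymx : clear implicits.
Definition fprob n (F : {ffun 'I_n.+1 * 'I_n.+1 -> S n} -> bool) : R :=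
  \sum_(om | F om) cweight (wt (s0 n) (w n)) om.

Lemma Wop_mx n v psi i om : (Wop M v psi) i om = \sum_j Wmx n v om i j * psi j om.
elim: v psi i=> [|[b|x] v IH] psi i.
- rewrite /Wmx big_nil (bigD1 i) //= mxE eqxx mul1r big1 ?addr0 // => j ji.
  by rewrite mxE eq_sym (negbTE ji) mul0r.
- rewrite /= /ocomp /Mc /mact ffunE sum_ffunE /Wmx big_cons -/(Wmx n v om).
  under [RHS]eq_bigr do rewrite mxE mulr_suml.
  rewrite exchange_big; eqr=> k _; rewrite ffunE -[LHS]/(_ * _) IH mulr_sumr. by eqr=> j _; rewrite mulrA.
rewrite /= /ocomp /Xls Xl_mx /Wmx big_cons -/(Wmx n v om).
under [RHS]eq_bigr do rewrite mxE mulr_suml.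
rewrite exchange_big; eqr=> k _; rewrite IH mulr_sumr.
by eqr=> j _; rewrite mulrA.
Qed.

Lemma Wsum_mx n vs psi i om : (Wsum M vs psi) i om = \sum_j Ymx n vs om i j * psi j om.
rewrite /Wsum /osum !sum_ffunE; under eq_bigr do rewrite Wop_mx.
rewrite exchange_big; eqr=> j _.
by rewrite /Ymx summxE mulr_suml.
Qed.

Notation Om n := {ffun 'I_n.+1 * 'I_n.+1 -> S n}.
Notation W n := (cweight (wt (s0 n) (w n))).
Notation hp n := (@dip (Kn n) (@ipn n) 'I_n.+1).

Lemma Xmx_adj n x (om : Om n) : Xmx (G n) (xadj x) om = adjmx (Xmx (G n) x om).
apply/matrixP=> i j; rewrite !mxE conjcM conjcR; congr (_ * _); rewrite [j == i]eq_sym.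
case: eqP=> [_|/eqP ij]; first by rewrite conjc0.
by rewrite key_sym G_adj 1?eq_sym // xadjK.
Qed.

Lemma Ymx_prod n s s' om : Ymx n [seq v ++ v' | v <- s, v' <- s'] om = Ymx n s om * Ymx n s' om.
rewrite /Ymx big_allpairs_dep mulr_suml; eqr=> v _.
by rewrite mulr_sumr; eqr=> v' _; rewrite /Wmx big_cat.
Qed.

Lemma Ymx_star n s om : Ymx n (map wstar s) om = adjmx (Ymx n s om).
rewrite /Ymx big_map (big_morph (@adjmx R n) (id1 := 0) (op1 := +%R)); last exact: (star_s0 'M[C]_n.+1).
  eqr=> v _; elim: v=> [|y v IH]; first by rewrite /Wmx !big_nil; symmetry; exact: (star_s1 'M[C]_n.+1).
  have -> : Wmx n (y :: v) om = Wmx n [:: y] om * Wmx n v om by rewrite /Wmx -big_cat.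
  rewrite adjmxM -IH /wstar /= rev_cons -cats1 /Wmx big_cat /=.
  congr (_ * _); rewrite !big_seq1; case: y=> [b|x] /=; first by rewrite nce_star. exact: Xmx_adj.
exact: adjmxD.
Qed.

Lemma W_ge0 n om : 0 <= W n om.
by apply: cweight_ge0; exact: wge. Qed.

Lemma W_sum n : \sum_om W n om = 1.
rewrite /cweight -(bigA_distr_bigA (fun e s=> wt (s0 n) (w n) e s)) big1 // => e _.
Qed.

Definition cst1 n : Kn n := [ffun=> 1].

Lemma nrm_cst1 n : nrm (@ipn n) (cst1 n) = 1.
rewrite /nrm fip_n2 (eq_bigr (fun om=> W n om)) ?W_sum ?sqrtr1 // => om _.
by rewrite ffunE normcR normr1 expr1n mulr1.
Qed.

Lemma cst1_Vk n : Vk (@E n) 0 (cst1 n).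
rewrite /Vk; elim: (sites n)=> //= e L IH.
have -> : E e.1 e.2 (cst1 n) = cst1 n.
  rewrite /E /siteE; case: eqP=> // _; apply/ffunP=> om. by apply: (avg_cst (@wsum n))=> s; rewrite !ffunE.
by rewrite subrr.
Qed.

Lemma markov n (F : Om n -> bool) (g : Om n -> R) (a : R) : (forall om, 0 <= g om) ->
  (forall om, F om -> a <= g om) -> a * fprob F <= \sum_om W n om * g om.
move=> g0 h; rewrite /fprob mulr_sumr [leRHS](bigID F) /=.
rewrite -[leLHS]addr0; apply: lerD; last by sge0=> om _; rewrite mulr_ge0 ?W_ge0.
by lers=> om Fo; rewrite mulrC ler_wpM2l ?W_ge0 ?h.
Qed.

(** The operator bound is iterated [N n %/ t] times, which keeps the degree within [N n], starting
    from the constant function placed at each coordinate. The squared norms sum to the expected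
    squared Frobenius norm of a power of [star Y * Y], and Markov's inequality gives the geometric
    tail; [n.+1] counts the coordinates. *)
Theorem norm_tail vs (e : R) : 0 < e -> exists (q : R) (t : nat), [/\ 0 <= q, q < 1, (0 < t)%N &
  evt (fun n=> fprob (fun om=> cnorm (Yv vs) + e < opnorm (Ymx n vs om)) <= n.+1%:R * q ^+ (N n %/ t))].
move=> e0; set rho := cnorm (Yv vs); have r0 : 0 <= rho := cnorm_ge0 _.
pose ws := pws vs 0.
have ub_ws := Wsum_ub ipnP saP N_small t_small gam_small ws.
have [_ [t0 gT] _] := Wsum_nice ipnP saP N_small t_small gam_small ws.
pose b := rho + e; have b0 : 0 < b by rewrite ltr_wpDl.
pose e' := e ^+ 2 / 2; have e'0 : 0 < e' by rewrite divr_gt0 // exprn_gt0.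
have nw : cnorm (Yv ws) <= rho ^+ 2 by apply: letr (pws_norm vs 0) _.
(* With [e' = e^2 / 2] the numerator stays below [b^2 = (rho + e)^2]; [t0.+1] is the degree shift of
   one application, made positive for the division. *)
exists (((rho ^+ 2 + e') / b ^+ 2) ^+ 2), t0.+1; split=> //.
- exact: sqr_ge0.
- rewrite expr_lt1 // ?divr_ge0 ?exprn_ge0 ?addr_ge0 ?sqr_ge0 ?(ltW b0) ?(ltW e'0) ?(ltW e0) //.
  rewrite ltr_pdivrMr ?exprn_gt0 // mul1r /e' /b. by have := exprn_gt0 2 e0; nra.
have := ub_ws 0%N e' e'0; apply: evtS=> n hn.
set j := (N n %/ t0.+1)%N; set c := rho ^+ 2 + e'.
have c0 : 0 <= c by rewrite addr_ge0 ?sqr_ge0 ?ltW.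
have mx_iter a i om k : (iter k (@Wsum Kn M ws n) (conc a (cst1 n))) i om = (Ymx n ws om ^+ k) i a.
  elim: k i=> [|k IH] i /=.
    by rewrite ffunE mxE; case: eqP=> _; rewrite ffunE.
  rewrite Wsum_mx exprS mxE; eqr=> l _; by rewrite IH.
have it a : nrm (hp n) (iter j (@Wsum Kn M ws n) (conc a (cst1 n))) <= c ^+ j.
  rewrite -[leRHS]mulr1 -(nrm_cst1 n) -(conc_nrm (@ipnP n) a).
  apply: (iter_bound (P := Vh (@E n)) (t := t0.+1) (N := N n))=> //.
  - by move=> m v hv; apply: Vh_le (gT n m v hv); rewrite leq_add2l leqnSn.
  - by move=> m m' v; exact: Vh_le.
  - move=> v hv; have := hn v; rewrite addn0=> /(_ hv) /letr; apply.
    by apply: ler_wpM2r; [exact: nrm_ge0|rewrite lerD2r].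
  - exact: conc_Vh (cst1_Vk n). by rewrite leq_trunc_div.
have bj : 0 < b ^+ (4 * j) by rewrite exprn_gt0.
have h := @markov n (fun om=> b < opnorm (Ymx n vs om)) (fun om=> opnorm (Ymx n ws om ^+ j) ^+ 2) (b ^+ (4 * j)).
rewrite -(ler_pM2l bj); apply: letr (h _ _) _.
- by move=> om; exact: sqr_ge0.
- move=> om ho; have -> : Ymx n ws om = adjmx (Ymx n vs om) * Ymx n vs om by rewrite /ws /= Ymx_prod Ymx_star.
  set h0 := _ * _; have hh : adjmx h0 = h0 by rewrite /h0 adjmxM adjmxK.
  rewrite (mulnC 4) (mulnA j 2 2) exprM (le_sq (exprn_ge0 _ (ltW b0)) (op_ge0 _)).
  apply: letr (op_exp_ge j hh); rewrite mulnC exprM; apply: leX2; [by rewrite exprn_ge0 ?(ltW b0)|exact: op_ge0|].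
  rewrite [opnorm h0](op_sqr (Ymx n vs om)) le_sq ?op_ge0 ?(ltW b0) //; exact: ltW.
have -> : b ^+ (4 * j) * (n.+1%:R * ((c / b ^+ 2) ^+ 2) ^+ j) = n.+1%:R * (c ^+ j) ^+ 2.
  have -> : ((c / b ^+ 2) ^+ 2) ^+ j = (c ^+ j) ^+ 2 / b ^+ (4 * j).
    by rewrite -(exprM (c / _)) expr_div_n -(exprM b) mulnA -(exprM c) [(j * 2)%N]mulnC.
  by rewrite mulrCA [b ^+ _ * _]mulrC divfK // gt_eqF.
apply: (@le_trans _ _ (\sum_(a < n.+1) nrm (hp n) (iter j (@Wsum Kn M ws n) (conc a (cst1 n))) ^+ 2)).
  under [leRHS]eq_bigr do rewrite (nrm_sqr (dip_sip (@ipnP n) _)) dip_n2.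
  under [leRHS]eq_bigr do under eq_bigr do rewrite fip_n2.
  rewrite exchange_big; under [leRHS]eq_bigr do rewrite exchange_big. rewrite exchange_big; lers=> om _.
  under [leRHS]eq_bigr do rewrite -mulr_sumr. rewrite -mulr_sumr; apply: ler_wpM2l; first exact: W_ge0.
  have f0 : 0 <= \sum_i \sum_a normc ((Ymx n ws om ^+ j) i a) ^+ 2.
    by sge0=> i _; sge0=> a _; exact: sqr_ge0.
  apply: (@le_trans _ _ (frob (Ymx n ws om ^+ j) ^+ 2)).
    by rewrite le_sq ?op_ge0 ?sqrtr_ge0 // op_frob.
  rewrite [X in X <= _]sqr_sqrtr //; rewrite le_eqVlt; apply/orP; left; apply/eqP.
  by eqr=> i _; eqr=> a _; rewrite mx_iter.
apply: (@le_trans _ _ (\sum_(a < n.+1) (c ^+ j) ^+ 2)).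
  by lers=> a _; rewrite le_sq ?nrm_ge0 ?exprn_ge0.
by rewrite sumr_const card_ord mulr_natl.
Qed.

(** On functions the centred partial trace is multiplication by the deviation [f], so iterating its
    bound [e / 2] on the constant 1 bounds the moment of order [2 j] of [f]. Markov's inequality at
    level [e] leaves [4^-j]; the factor [n.+1] gives the estimate the shape of [norm_tail]. *)
Theorem trace_tail vs (e : R) : 0 < e -> exists (q : R) (t : nat), [/\ 0 <= q, q < 1, (0 < t)%N &
  evt (fun n=> fprob (fun om=> e < normc (ntrace (Ymx n vs om) - tau (Yv vs))) <= n.+1%:R * q ^+ (N n %/ t))].
move=> e0; have tr := Wsum_trace ipnP saP N_small t_small gam_small vs.
have [_ [t0 gT] _] := Wsum_nice ipnP saP N_small t_small gam_small vs.
set l := tau (Yv vs) in tr *.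
have e2 : 0 < e / 2 by rewrite divr_gt0.
exists (4^-1), t0.+1; split=> //; first by rewrite invf_lt1 // ltr1n.
apply: evtS (tr 0%N _ e2)=> n hn; set j := (N n %/ t0.+1)%N.
pose T (v : Kn n) : Kn n := trv (@Wsum Kn M vs n) v - l *: v.
pose f om : C := ntrace (Ymx n vs om) - l.
have Tf v om : T v om = f om * v om.
  rewrite /T ffunE [X in _ + X]ffunE /f mulrBl; congr (_ + _); last by rewrite ffunE.
  rewrite /trv ffunE sum_ffunE /ntrace /mxtrace -mulrA mulr_suml -[LHS]/(_ * _); congr (_ * _).
    by rewrite fmorphV rmorph_nat.
  eqr=> i _; rewrite Wsum_mx (bigD1 i) //= ffunE eqxx big1 ?addr0 // => k ki.
  by rewrite ffunE (negbTE ki) ffunE mulr0.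
have it_f k om : iter k T (cst1 n) om = f om ^+ k.
  elim: k=> [|k IH] /=; first by rewrite ffunE. by rewrite Tf IH exprS.
have b : nrm (@ipn n) (iter j T (cst1 n)) <= (e / 2) ^+ j.
  rewrite -[leRHS]mulr1 -[X in _ <= _ * X](nrm_cst1 n).
  apply: (iter_bound (P := Vk (@E n)) (t := t0.+1) (N := N n))=> //; first exact: ltW.
  - move=> m v hv; apply: excitedB; last by apply: VkZ; apply: excited_le hv; rewrite leq_addr.
    by apply: excited_le (tro_Vk (gT n m) hv); rewrite leq_add2l leqnSn.
  - by move=> m m' v; exact: excited_le.
  - by move=> v hv; have := hn v; rewrite addn0; apply.
  - exact: cst1_Vk. by rewrite leq_trunc_div.
have h := @markov n (fun om=> e < normc (f om)) (fun om=> normc (f om ^+ j) ^+ 2) ((e ^+ j) ^+ 2).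
have ej : 0 < (e ^+ j) ^+ 2 by rewrite !exprn_gt0.
have nX (z : C) k : normc (z ^+ k) = normc z ^+ k.
  elim: k=> [|k IH]; first by rewrite !expr0 normcR normr1. by rewrite !exprS ncM IH.
rewrite -(ler_pM2l ej); apply: letr (h _ _) _.
- by move=> om; exact: sqr_ge0.
- move=> om ho; rewrite nX le_sq ?exprn_ge0 ?nc_ge0 ?(ltW e0) //.
  by rewrite leX2 ?nc_ge0 ?(ltW e0) // ltW.
apply: (@le_trans _ _ (((e / 2) ^+ j) ^+ 2)).
  rewrite (_ : \sum_om _ = nrm (@ipn n) (iter j T (cst1 n)) ^+ 2); last first.
    by rewrite (nrm_sqr (@ipnP n)) fip_n2; eqr=> om _; rewrite it_f.
  by rewrite le_sq ?nrm_ge0 ?exprn_ge0 // ltW.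
have -> : ((e / 2) ^+ j) ^+ 2 = (e ^+ j) ^+ 2 * 4^-1 ^+ j.
  by rewrite (_ : 4^-1 = 2^-1 ^+ 2); [rewrite -(exprM 2^-1) mulnC exprM -!exprMn|field].
rewrite ler_pM2l // -[leLHS]mul1r; apply: ler_wpM2r; first by rewrite exprn_ge0.
by rewrite ler1n.
Qed.

End FiniteMoments.

End LimitFock.

(** * Expectations and the standard normal law *)

Section NormalMoments.
Notation lam := (@lebesgue_measure R).

Lemma normal_ge0E (m s : R) (f : R -> R) :
  mfunT f -> (forall x, 0 <= f x) ->
  (\int[normal_prob m s]_x (f x)%:E = \int[lam]_x (f x * normal_pdf m s x)%:E)%E.
move=> mf f0; have mEf : mfunT (EFin \o f) by exact/measurable_EFinP.
under [RHS]eq_integral do rewrite EFinM.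
have dom := normal_prob_dominates m s.
rewrite -(Radon_Nikodym_SigmaFinite.change_of_variables dom) //.
apply: ae_eq_integral=> //.
- apply: emeasurable_funM=> //; apply: (measurable_int lam).
  exact: Radon_Nikodym_SigmaFinite.f_integrable.
- apply: emeasurable_funM=> //; apply/measurable_EFinP; exact: measurable_normal_pdf.
apply: ae_eqe_mul2l=> /=; apply: integral_ae_eq=> //=.
- exact: Radon_Nikodym_SigmaFinite.f_integrable.
- by apply/measurable_EFinP; exact: measurable_normal_pdf.
by move=> E E01 mE; rewrite -Radon_Nikodym_SigmaFinite.f_integral.
Qed.

End NormalMoments.

Section Expectation.
Context {dd : measure_display} {T : measurableType dd} (P : probability T R).
Implicit Types f g : T -> R.
Notation ig f := (P.-integrable [set: T] (EFin \o f)).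

Definition Ex f : R := (\int[P]_x f x)%R.

Lemma ExE f : ig f -> (\int[P]_x (f x)%:E = (Ex f)%:E)%E.
by move=> h; rewrite /Ex /Rintegral fineK //; exact: integrable_fin_num. Qed.

Lemma ig_meas f : ig f -> mfunT f.
by move=> /integrableP[/measurable_EFinP]. Qed.

Lemma ig_cst c : ig (fun _ => c).
exact: finite_measure_integrable_cst. Qed.

Lemma igD f g : ig f -> ig g -> ig (fun x=> f x + g x).
by move=> hf hg; exact: (integrableD measurableT hf hg). Qed.

Lemma igZ c f : ig f -> ig (fun x=> c * f x).
by move=> hf; exact: (integrableZl measurableT c hf). Qed.

Lemma ig_eq f g : f =1 g -> ig f -> ig g.
by move=> /funext ->. Qed.

Lemma igB f g : ig f -> ig g -> ig (fun x=> f x - g x).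
by move=> hf hg; apply: ig_eq (igD hf (igZ (-1) hg))=> x; rewrite mulN1r. Qed.

Lemma ig_sum (I : Type) (s : seq I) (F : I -> T -> R) : (forall i, ig (F i)) ->
  ig (fun x=> \sum_(i <- s) F i x).
move=> h; elim: s=> [|i s IH].
  by apply: ig_eq (ig_cst 0)=> x; rewrite big_nil.
by apply: ig_eq (igD (h i) IH)=> x; rewrite big_cons.
Qed.

Lemma ig_le f g : mfunT f -> (forall x, `|f x| <= g x) -> ig g -> ig f.
move=> mf h; apply: le_integrable=> //; first exact/measurable_EFinP.
by move=> x _; rewrite /= lee_fin (letr (h x)) // ler_norm.
Qed.

Lemma ig_ge0 f : mfunT f -> (forall x, 0 <= f x) ->
  (\int[P]_x (f x)%:E < +oo)%E -> ig f.
move=> mf f0 h; apply/integrableP; split; first exact/measurable_EFinP.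
by under eq_integral do rewrite /= ger0_norm //.
Qed.

Lemma ExD f g : ig f -> ig g -> Ex (fun x=> f x + g x) = Ex f + Ex g.
by move=> hf hg; exact: (RintegralD measurableT hf hg). Qed.

Lemma ExZ c f : ig f -> Ex (fun x=> c * f x) = c * Ex f.
by move=> hf; exact: (RintegralZl c measurableT hf). Qed.

Lemma ExB f g : ig f -> ig g -> Ex (fun x=> f x - g x) = Ex f - Ex g.
by move=> hf hg; exact: (RintegralB measurableT hf hg). Qed.

Lemma eq_Ex f g : f =1 g -> Ex f = Ex g.
by move=> /funext ->. Qed.

Lemma Ex_cst c : Ex (fun _ => c) = c.
rewrite /Ex Rintegral_cst // -[RHS]mulr1; congr (_ * _).
transitivity (fine (1%E : \bar R))=> //; congr fine; exact: probability_setT.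
Qed.

Lemma Ex_sum (I : Type) (s : seq I) (F : I -> T -> R) : (forall i, ig (F i)) ->
  Ex (fun x=> \sum_(i <- s) F i x) = \sum_(i <- s) Ex (F i).
move=> h; elim: s=> [|i s IH].
  by rewrite big_nil -[RHS](Ex_cst 0); apply: eq_Ex=> x; rewrite big_nil.
rewrite big_cons -IH -ExD //; last exact: ig_sum.
by apply: eq_Ex=> x; rewrite big_cons.
Qed.

Lemma Ex_le f g : ig f -> ig g -> (forall x, f x <= g x) -> Ex f <= Ex g.
by move=> hf hg h; apply: (le_Rintegral measurableT hf hg). Qed.

Lemma Ex_dist f g h : ig f -> ig g -> ig h -> (forall x, `|f x - g x| <= h x) -> `|Ex f - Ex g| <= Ex h.
move=> hf hg hh b; rewrite ler_norml -ExB // -[- Ex h]mulN1r -ExZ //.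
apply/andP; split.
  apply: Ex_le; [exact: igZ|exact: igB|move=> x]. by have := b x; rewrite mulN1r ler_norml=> /andP[].
by apply: Ex_le=> [|//|x]; [exact: igB|have := b x; rewrite ler_norml=> /andP[]].
Qed.

End Expectation.
Notation ig P f := (P.-integrable [set: _] (EFin \o f)).

Section Transfer.
Context {d1 d2 : measure_display} {T : measurableType d1} {T' : measurableType d2}.
Variables (P : probability T R) (Q : probability T' R) (phi : T -> T') (mphi : mfunT phi)
  (law : forall U, measurable U -> P (phi @^-1` U) = Q U).
Implicit Types f : T' -> R.

Let EQ f : (\int[Q]_x (f x)%:E = \int[pushforward P phi]_x (f x)%:E)%E.
by apply: eq_measure_integral=> U mU _; exact/esym/law. Qed.

Lemma ig_tr f : mfunT f -> ig P (f \o phi) <-> ig Q f.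
move=> mf; have e : (\int[Q]_x `|(f x)%:E| = \int[P]_x `|(f (phi x))%:E|)%E.
  rewrite (EQ (fun x=> `|f x|)) (ge0_integral_pushforward mphi) //; by apply/measurable_EFinP; exact: measurableT_comp.
split=> /integrableP[_ h]; apply/integrableP; rewrite /= -?e in h *; rewrite ?e in h *.
  by split=> //; apply/measurable_EFinP.
by split=> //; apply/measurable_EFinP; exact: measurableT_comp.
Qed.

Lemma Ex_tr f : ig Q f -> Ex Q f = Ex P (f \o phi).
move=> hf; rewrite /Ex /Rintegral EQ (integral_pushforward mphi (f := EFin \o f)) //.
  exact/measurable_EFinP/(ig_meas hf).
exact: (ig_tr (ig_meas hf)).2.
Qed.

End Transfer.

Section Independence.
Context {d1 : measure_display} {T : measurableType d1}.
Variables (P : probability T R) (X Y : T -> R) (mX : mfunT X) (mY : mfunT Y)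
  (indep : forall U V : set R, measurable U -> measurable V -> (P (X @^-1` U `&` Y @^-1` V) = P (X @^-1` U) * P (Y @^-1` V))%E).

(** The joint law is the product of the two marginals, where Fubini applies. *)
Lemma Ex_mul_indep : ig P X -> ig P Y -> ig P (fun w=> X w * Y w) ->
  Ex P (fun w=> X w * Y w) = Ex P X * Ex P Y.
move=> iX iY iXY.
have mZ : mfunT (fun w=> (X w, Y w)) by exact: measurable_fun_pair.
pose X' : {mfun T >-> R} := HB.pack X (isMeasurableFun.Build _ _ _ _ _ mX).
pose Y' : {mfun T >-> R} := HB.pack Y (isMeasurableFun.Build _ _ _ _ _ mY).
pose Z' : {mfun T >-> (R * R)%type} := HB.pack (fun w=> (X w, Y w)) (isMeasurableFun.Build _ _ _ _ _ mZ).
pose QX := distribution P X'; pose QY := distribution P Y'; pose QZ := distribution P Z'.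
have QE U : measurable U -> (QX \x QY)%E U = QZ U.
  apply: product_measure_unique=> A B mA mB; exact: indep.
have mp : mfunT (fun z : R * R=> z.1 * z.2).
  by apply: measurable_funM; [exact: measurable_fst|exact: measurable_snd].
have iZ : ig QZ (fun z : R * R=> z.1 * z.2) by exact: (ig_tr (P := P) (Q := QZ) mZ (fun U mU=> erefl) mp).1.
have iprod : (QX \x QY)%E.-integrable setT (EFin \o (fun z : R * R=> z.1 * z.2)).
  move: iZ=> /integrableP[h1 h2]; apply/integrableP; split=> //.
  rewrite (eq_measure_integral QZ) // => A mA _; exact: QE.
have iQX : ig QX (fun x : R=> x).
  exact: ((ig_tr (P := P) (Q := QX) mX (fun U mU=> erefl) (f := fun x=> x) (@measurable_id _ _ _)).1 iX).
have iQY : ig QY (fun x : R=> x).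
  exact: ((ig_tr (P := P) (Q := QY) mY (fun U mU=> erefl) (f := fun x=> x) (@measurable_id _ _ _)).1 iY).
have tX : Ex QX (fun x=> x) = Ex P X := Ex_tr (P := P) (Q := QX) mX (fun U mU=> erefl) iQX.
have tY : Ex QY (fun x=> x) = Ex P Y := Ex_tr (P := P) (Q := QY) mY (fun U mU=> erefl) iQY.
have tZ : Ex QZ (fun z : R * R=> z.1 * z.2) = Ex P (fun w=> X w * Y w) := Ex_tr (P := P) (Q := QZ) mZ (fun U mU=> erefl) iZ.
rewrite -tZ -tX -tY /Ex /Rintegral.
have -> : (\int[QZ]_z (z.1 * z.2)%:E = \int[QX \x QY]_z (z.1 * z.2)%:E)%E.
  by apply: eq_measure_integral=> A mA _; exact/esym/QE.
rewrite -(integral12_prod_meas1 iprod).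
have inn (x : R) : (\int[QY]_y (x * y)%:E = (x * Ex QY id)%:E)%E.
  by under eq_integral do rewrite EFinM; rewrite integralZl // (ExE iQY).
transitivity (Ex QX (fun x=> Ex QY id * x)); last by rewrite ExZ // mulrC.
apply: (congr1 fine); apply: eq_integral=> x _.
exact: (etrans (inn x) (congr1 EFin (mulrC _ _))).
Qed.
End Independence.

Section StandardNormal.
Notation lam := (@lebesgue_measure R).
Notation nu := (normal_prob (0 : R) 1).
Notation phi := (normal_pdf (0 : R) 1).

Let pdf_tilt (m s : R) x : 0 < s ->
  s * normal_pdf m s x = phi x * expR (x ^+ 2 / 2 - (x - m) ^+ 2 / (s ^+ 2 *+ 2)).
move=> s0; rewrite !normal_pdfE ?gt_eqF ?oner_neq0 //.
have pk : normal_peak s = s^-1 * normal_peak (1 : R).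
  rewrite /normal_peak expr1n mul1r -invfM; congr (_^-1).
  by rewrite -mulrnAr sqrtrM ?sqr_ge0 // sqrtr_sqr ger0_norm ?(ltW s0).
rewrite pk /normal_fun expr1n subr0 !mulrA divff ?gt_eqF // mul1r -!(mulrA (normal_peak 1)); congr (_ * _).
rewrite -expRD; congr expR; rewrite -[s ^+ 2 *+ 2]mulr_natr; field.
by rewrite gt_eqF.
Qed.

Let mpdf (m s : R) : mfunT (normal_pdf m s) := measurable_normal_pdf m s.
Let msqr : mfunT (fun x : R=> x ^+ 2).
exact: measurable_funX. Qed.

(* Integrating the tangent inequality [1 + u <= exp u] against the density. *)
Let tangent (m s : R) (q : R -> R) : 0 < s -> mfunT q -> (forall x, 0 <= q x) ->
  (forall x, q x <= 1 + (x ^+ 2 / 2 - (x - m) ^+ 2 / (s ^+ 2 *+ 2)) + x ^+ 2) ->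
  (\int[nu]_x (q x)%:E <= s%:E + \int[nu]_x (x ^+ 2)%:E)%E.
move=> s0 mq q0 h; rewrite !normal_ge0E //; last by move=> x; exact: sqr_ge0.
have -> : s%:E = (\int[lam]_x (s * normal_pdf m s x)%:E)%E.
  under eq_integral do rewrite EFinM. rewrite ge0_integralZl ?integral_normal_pdf ?mule1 ?lee_fin ?(ltW s0) //.
    by apply/measurable_EFinP; exact: mpdf.
  by move=> x _; rewrite lee_fin normal_pdf_ge0.
rewrite -ge0_integralD //; last 4 first.
- by move=> x _; rewrite lee_fin mulr_ge0 ?normal_pdf_ge0 // ltW.
- by apply/measurable_EFinP; apply: measurable_funM=> //; exact: mpdf.
- by move=> x _; rewrite lee_fin mulr_ge0 ?normal_pdf_ge0 // sqr_ge0.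
- by apply/measurable_EFinP; apply: measurable_funM; [exact: msqr|exact: mpdf].
apply: ge0_le_integral=> //.
- by move=> x _; rewrite lee_fin mulr_ge0 ?normal_pdf_ge0.
- by apply/measurable_EFinP; apply: measurable_funM=> //; exact: mpdf.
- apply/measurable_EFinP; apply: measurable_funD; apply: measurable_funM=> //; exact: mpdf.
move=> x _; rewrite -EFinD lee_fin pdf_tilt // [X in _ <= _ + X]mulrC -mulrDr mulrC.
apply: ler_wpM2l; first exact: normal_pdf_ge0.
by apply: letr (h x) _; rewrite lerD2r expR_ge1Dx.
Qed.

(** Comparison with standard deviation 2: [3 x^2 / 8 <= exp (3 x^2 / 8)], and this exponential times
    the standard density is twice a probability density. *)
Lemma nsqr_ig : ig nu (fun x=> x ^+ 2).
apply: ig_ge0; [exact: msqr|by move=> x; exact: sqr_ge0|].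
have pos x : 0 <= 3 / 8 * x ^+ 2 :> R by rewrite mulr_ge0 ?sqr_ge0.
have le2 : (\int[nu]_x (3 / 8 * x ^+ 2)%:E <= 2%:E)%E.
  rewrite normal_ge0E //; last by apply: measurable_funM. have -> : 2%:E = (\int[lam]_x (2 * normal_pdf 0 2 x)%:E)%E.
    under eq_integral do rewrite EFinM. rewrite ge0_integralZl ?integral_normal_pdf ?mule1 ?lee_fin //.
      by apply/measurable_EFinP; exact: mpdf.
    by move=> x _; rewrite lee_fin normal_pdf_ge0.
  apply: ge0_le_integral=> //.
  - by move=> x _; rewrite lee_fin mulr_ge0 ?normal_pdf_ge0.
  - by apply/measurable_EFinP; apply: measurable_funM; [apply: measurable_funM|exact: mpdf].
  - by apply/measurable_EFinP; apply: measurable_funM=> //; exact: mpdf.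
  move=> x _; rewrite lee_fin pdf_tilt // mulrC; apply: ler_wpM2l; first exact: normal_pdf_ge0.
  have -> : x ^+ 2 / 2 - (x - 0) ^+ 2 / (2 ^+ 2 *+ 2) = 3 / 8 * x ^+ 2 :> R by rewrite subr0; field.
  by apply: letr (expR_ge1Dx _); rewrite lerDr.
move: le2; under eq_integral do rewrite EFinM.
rewrite ge0_integralZl ?lee_fin //; last 2 first.
- by apply/measurable_EFinP; exact: msqr.
- by move=> x _; rewrite lee_fin sqr_ge0.
case: (\int[nu]_x (x ^+ 2)%:E)%E=> [r _||_]; rewrite ?ltry ?ltNyr //.
by rewrite gt0_muley ?lte_fin ?divr_gt0.
Qed.

Lemma nid_ig : ig nu (fun x=> x).
apply: ig_le (igD (ig_cst nu 1) nsqr_ig)=> //.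
by move=> x; rewrite ler_norml; have := sqr_ge0 (x - 1); have := sqr_ge0 (x + 1); nra.
Qed.

Let e1 := Ex nu (fun x=> x).
Let e2 := Ex nu (fun x=> x ^+ 2).

Let tangent_ex (m s : R) a b c : 0 < s ->
  (forall x, 0 <= a + b * x + c * x ^+ 2) ->
  (forall x, a + b * x + c * x ^+ 2 <= 1 + (x ^+ 2 / 2 - (x - m) ^+ 2 / (s ^+ 2 *+ 2)) + x ^+ 2) ->
  a + b * e1 + c * e2 <= s + e2.
move=> s0 q0 h.
have iq : ig nu (fun x=> a + b * x + c * x ^+ 2).
  by apply: igD; [apply: igD; [exact: ig_cst|exact: igZ nid_ig]|exact: igZ nsqr_ig].
have := tangent s0 (ig_meas iq) q0 h.
rewrite (ExE iq) (ExE nsqr_ig) -EFinD lee_fin -/e2; apply: letr.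
rewrite ExD ?ExD ?Ex_cst ?ExZ //; [exact: nsqr_ig|exact: nid_ig|exact: ig_cst|..].
- exact: igZ nid_ig.
- by apply: igD; [exact: ig_cst|exact: igZ nid_ig].
- exact: igZ nsqr_ig.
Qed.

(** With [s = 1] the tangent inequality reads [m e1 <= m^2 / 2]; a small [m] of the sign of [e1]
    forces [e1 = 0]. *)
Lemma normal_mean : e1 = 0.
have h (m : R) : `|m| <= 1 -> m * e1 <= m ^+ 2 / 2.
  rewrite ler_norml=> /andP[m1 m2].
  (* The summand [1 * x ^+ 2] is the [x^2] added on both sides in [tangent], which keeps the
     integrand nonnegative. *)
  have H1 x : 0 <= (1 - m ^+ 2 / 2) + m * x + 1 * x ^+ 2 by have := sqr_ge0 (x + m / 2); nra.
  have H2 x : (1 - m ^+ 2 / 2) + m * x + 1 * x ^+ 2 <= 1 + (x ^+ 2 / 2 - (x - m) ^+ 2 / (1 ^+ 2 *+ 2)) + x ^+ 2.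
    by rewrite expr1n; have -> : 1 *+ 2 = 2 :> R by []; lra.
  have := tangent_ex ltr01 H1 H2; lra.
apply/eqP; rewrite -normr_eq0; apply/negP=> /negP e0.
pose k := Num.min 1 `|e1|; have k0 : 0 < k by rewrite lt_min ltr01 lt_def e0 normr_ge0.
have k1 : k <= 1 by rewrite ge_min lexx.
have ke : k <= `|e1| by rewrite ge_min lexx orbT.
have := h (Num.sg e1 * k); rewrite normrM normr_sg -normr_eq0 e0 mul1r ger0_norm ?(ltW k0) // => /(_ k1).
rewrite -mulrA mulrCA -normrEsg exprMn sqr_sg -normr_eq0 e0 mul1r; nra.
Qed.

(** With [m = 0] the inequality is [1 + (1 - s^-2) e2 / 2 <= s], an equality at [s = 1]; comparing
    both sides for [s] slightly below and slightly above 1 gives [e2 = 1]. *)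
Lemma normal_variance : e2 = 1.
have h (s : R) : 2 / 3 < s -> 1 + (1 - s ^- 2) * e2 / 2 <= s.
  move=> s1; have s0 : 0 < s by lra. have s2 : 0 < s ^+ 2 by rewrite exprn_gt0. have k3 : s ^- 2 <= 9 / 4.
    rewrite -[leRHS]invrK lef_pV2 ?posrE ?invr_gt0 //. by rewrite invf_div; nra.
  have H1 x : 0 <= 1 + 0 * x + ((1 - s ^- 2) / 2 + 1) * x ^+ 2.
    by rewrite mul0r addr0 addr_ge0 // mulr_ge0 ?sqr_ge0 //; lra.
  have H2 x : 1 + 0 * x + ((1 - s ^- 2) / 2 + 1) * x ^+ 2 <= 1 + (x ^+ 2 / 2 - (x - 0) ^+ 2 / (s ^+ 2 *+ 2)) + x ^+ 2.
    rewrite subr0 -[s ^+ 2 *+ 2]mulr_natr (_ : x ^+ 2 / (s ^+ 2 * 2) = x ^+ 2 * s ^- 2 / 2); first lra.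
    by field; rewrite gt_eqF.
  have := tangent_ex s0 H1 H2; lra.
have h' (s : R) : 2 / 3 < s -> (s ^+ 2 - 1) * e2 <= 2 * s ^+ 2 * (s - 1).
  move=> s1; have s0 : 0 < s by lra. have := h s s1; rewrite -(ler_pM2l (_ : 0 < 2 * s ^+ 2)) ?mulr_gt0 ?exprn_gt0 //.
  rewrite (_ : 2 * s ^+ 2 * (1 + (1 - s ^- 2) * e2 / 2) = 2 * s ^+ 2 + (s ^+ 2 - 1) * e2).
    by lra.
  by field; rewrite gt_eqF.
case: (ltgtP e2 1)=> // e.
- pose t := Num.min (1 / 4) ((1 - e2) / 4).
  have t0 : 0 < t by rewrite lt_min; apply/andP; split; lra. have t1 : t <= 1 / 4 by rewrite ge_min lexx.
  have t2 : t <= (1 - e2) / 4 by rewrite ge_min lexx orbT.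
  have := h' (1 - t) ltac:(lra); rewrite (_ : ((1 - t) ^+ 2 - 1) * e2 = t * (- (2 - t) * e2)); last by ring.
  rewrite (_ : 2 * (1 - t) ^+ 2 * (1 - t - 1) = t * (- 2 * (1 - t) ^+ 2)); last by ring.
  rewrite ler_pM2l // => k; nra.
- pose t := Num.min (1 / 4) ((e2 - 1) / 4).
  have t0 : 0 < t by rewrite lt_min; apply/andP; split; lra. have t1 : t <= 1 / 4 by rewrite ge_min lexx.
  have t2 : t <= (e2 - 1) / 4 by rewrite ge_min lexx orbT.
  have := h' (1 + t) ltac:(lra); rewrite (_ : ((1 + t) ^+ 2 - 1) * e2 = t * ((2 + t) * e2)); last by ring.
  rewrite (_ : 2 * (1 + t) ^+ 2 * (1 + t - 1) = t * (2 * (1 + t) ^+ 2)); last by ring. rewrite ler_pM2l // => k; nra.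
Qed.

End StandardNormal.

Section StandardFamily.
Context {dG : measure_display} {G : measurableType dG} (PG : probability G R).
Variables (I : eqType) (D : set I) (g : I -> G -> R) (g_std : iid_std_normal PG D g).

Let mg i : D i -> mfunT (g i). by move=> /(g_std.1 i) []. Qed.
Let lawg i : D i -> forall U, measurable U -> PG (g i @^-1` U) = normal_prob 0 1 U.
by move=> /(g_std.1 i) []. Qed.

Let std_ig1 i : D i -> ig PG (g i).
by move=> h; exact: (ig_tr (P := PG) (Q := normal_prob (0 : R) 1) (mg h) (lawg h) (@measurable_id _ _ setT)).2 (nid_ig). Qed.

Let std_ig2 i : D i -> ig PG (fun w=> g i w ^+ 2).
move=> h; have mq : mfunT (fun x : R=> x ^+ 2) by exact: measurable_funX.
exact: (ig_tr (P := PG) (Q := normal_prob (0 : R) 1) (mg h) (lawg h) mq).2 (nsqr_ig).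
Qed.

Let std_igM i j : D i -> D j -> ig PG (fun w=> g i w * g j w).
move=> hi hj; apply: ig_le (igD (std_ig2 hi) (std_ig2 hj)).
  by apply: measurable_funM; exact: mg.
by move=> w; rewrite ler_norml; have := sqr_ge0 (g i w - g j w); have := sqr_ge0 (g i w + g j w); nra.
Qed.

Let std_mean i : D i -> Ex PG (g i) = 0.
by move=> h; rewrite -(normal_mean) (Ex_tr (P := PG) (Q := normal_prob (0 : R) 1) (mg h) (lawg h) (nid_ig)). Qed.

Let std_cov i j : D i -> D j -> Ex PG (fun w=> g i w * g j w) = (i == j)%:R.
move=> hi hj; case: eqP=> [<-|/eqP ij].
  by rewrite -(normal_variance) (Ex_tr (P := PG) (Q := normal_prob (0 : R) 1) (mg hi) (lawg hi) (nsqr_ig)).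
rewrite (Ex_mul_indep (mg hi) (mg hj)) ?std_mean ?mul0r //; [|exact: std_ig1|exact: std_ig1|exact: std_igM].
move=> U V mU mV; pose E k := if k == i then g i @^-1` U else g j @^-1` V.
have u : uniq [:: i; j] by rewrite /= inE ij.
have mem k : k \in [:: i; j] -> D k /\ sigma_of (g k) (E k).
  rewrite !inE=> /orP[]/eqP ->; (split; first by []); rewrite /E ?eqxx ?(negbTE ij).
    by exists U=> //; rewrite setTI.
  by rewrite eq_sym (negbTE ij); exists V=> //; rewrite setTI.
have := g_std.2 _ E u mem; rewrite !big_cons !big_nil setIT mule1 /E eqxx.
by rewrite eq_sym (negbTE ij).
Qed.

Variables (s : seq I) (s_uniq : uniq s) (sD : forall i, i \in s -> D i).
Let F (c : I -> R) w := \sum_(i <- s) c i * g i w.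

Let big_sD (V : nmodType) (h : I -> V) : \sum_(i <- s) h i = \sum_(i <- s) (if `[< D i >] then h i else 0).
by rewrite big_seq [RHS]big_seq; eqr=> i /sD /asboolP ->. Qed.

Lemma std_sum_mean c : ig PG (F c) /\ Ex PG (F c) = 0.
have FE w : \sum_(i <- s) (if `[< D i >] then c i * g i w else 0) = F c w by rewrite -big_sD.
have igi i : ig PG (fun w=> if `[< D i >] then c i * g i w else 0).
  by case: asboolP=> [/std_ig1/igZ //|_]; exact: ig_cst.
split; first by apply: ig_eq FE _; exact: ig_sum.
rewrite -(eq_Ex _ FE) Ex_sum // big1 // => i _.
by case: asboolP=> [h|_]; [rewrite ExZ ?std_mean ?mulr0 //; exact: std_ig1|exact: Ex_cst].
Qed.

Lemma std_sum_cov c c' : ig PG (fun w=> F c w * F c' w) /\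
  Ex PG (fun w=> F c w * F c' w) = \sum_(i <- s) c i * c' i.
pose H i j w := if `[< D i >] && `[< D j >] then c i * c' j * (g i w * g j w) else 0.
have FE w : \sum_(i <- s) \sum_(j <- s) H i j w = F c w * F c' w.
  rewrite /F mulr_suml big_seq [RHS]big_seq; eqr=> i /sD/asboolP hi.
  rewrite mulr_sumr big_seq [RHS]big_seq; eqr=> j /sD/asboolP hj. by rewrite /H hi hj mulrACA.
have igH i j : ig PG (H i j).
  rewrite /H; case: asboolP=> /= [hi|_]; last exact: ig_cst.
  by case: asboolP=> /= [hj|_]; [exact/igZ/std_igM|exact: ig_cst].
have igS i : ig PG (fun w=> \sum_(j <- s) H i j w) by exact: ig_sum.
split; first by apply: ig_eq FE _; exact: ig_sum.
rewrite -(eq_Ex _ FE) Ex_sum // big_seq [RHS]big_seq; eqr=> i hi.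
rewrite Ex_sum // (bigD1_seq i) //= [X in _ + X]big_seq_cond big1 ?addr0.
  rewrite /H (asboolT (sD hi)) /= ExZ ?std_cov ?eqxx ?mulr1 //; try exact: sD. by apply: std_igM; exact: sD.
move=> j /andP[hj ji]; rewrite /H (asboolT (sD hi)) (asboolT (sD hj)) /=.
rewrite ExZ ?std_cov ?(eq_sym i) ?(negbTE ji) ?mulr0 //; try exact: sD.
by apply: std_igM; exact: sD.
Qed.

End StandardFamily.

(** * Real coordinates and covariances of the pair laws *)

Section Coordinates.
Variables (d : nat).
Notation crd := (bool * ('I_d * bool))%type.

Lemma meas_part b : mfunT (@part R b).
move=> _ U mU; rewrite setTI; apply: sub_sigma_algebra.
by case: b; [left|right]; exists U=> //; rewrite setTI.
Qed.

Lemma meas_complex {dT : measure_display} {T : measurableType dT} (f : T -> C) :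
  (forall b, mfunT (@part R b \o f)) -> mfunT f.
move=> h; have mR : mfunT (@cRe R \o f) by exact: h true.
have mI : mfunT (@complex.Im R \o f) by exact: h false.
move=> _ U mU; rewrite setTI.
have : preimage_set_system setT f (g_sigma_preimageU (@cRe R) (@complex.Im R)) (f @^-1` U).
  by exists U=> //; rewrite setTI.
rewrite -g_sigma_preimageU_comp; apply: smallest_sub; first exact: sigma_algebra_measurable.
by move=> A [] [V mV <-]; [exact: mR|exact: mI].
Qed.

Lemma meas_rcoord e : mfunT (@rcoord R d e).
by apply: measurableT_comp; [exact: meas_part|exact: measurable_tnth]. Qed.

Lemma mrcoord2 e : mfunT (@rcoord2 R d e).
case: e=> -[] e; rewrite /rcoord2 /=; apply: measurableT_comp.
- exact: meas_rcoord.
- exact: measurable_fst.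
- exact: meas_rcoord.
- exact: measurable_snd.
Qed.

Lemma meas_cvec2 {dT : measure_display} {T : measurableType dT} (f : T -> cvec2 R d) :
  (forall e, mfunT (rcoord2 e \o f)) -> mfunT f.
move=> h; rewrite (_ : f = fun w=> ((f w).1, (f w).2)); last by apply/funext=> w; case: (f w).
by apply: measurable_fun_pair; apply/measurable_fun_tnthP=> k; apply: meas_complex=> b;
  [exact: h (true, (k, b))|exact: h (false, (k, b))].
Qed.

Lemma rotvK : involutive (@rotv R d).
have h : ((sqrt (2 : R))^-1)%:C * ((sqrt (2 : R))^-1)%:C = 2^-1 :> C.
  by rewrite -rmorphM /= -invfM -expr2 sqr_sqrtr // rmorphV ?unitfE ?pnatr_eq0 //= rmorph_nat.
move=> [u v]; rewrite /rotv /=; congr pair; apply: eq_from_tnth=> k; rewrite !tnth_mktuple.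
  by rewrite -mulrDr mulrA h addrACA subrr addr0 -mulr2n -[tnth u k *+ 2]mulr_natl mulKf ?pnatr_eq0.
by rewrite -mulrBr mulrA h opprB [tnth v k - _]addrC addrACA subrr add0r -mulr2n -[tnth v k *+ 2]mulr_natl mulKf ?pnatr_eq0.
Qed.

Lemma part_scale b (c : R) (z : C) : part b (c%:C * z) = c * part b z.
by case: b z=> -[x y] /=; ring. Qed.

Lemma partD b (z w : C) : part b (z + w) = part b z + part b w.
by case: b z w=> -[x y] [x' y'] /=. Qed.

Lemma partN b (z : C) : part b (- z) = - part b z.
by case: b z=> -[x y] /=. Qed.

Lemma part_sum b (I : Type) (s : seq I) (F : I -> C) : part b (\sum_(i <- s) F i) = \sum_(i <- s) part b (F i).
by elim: s=> [|i s IH]; rewrite ?big_nil ?big_cons ?partD ?IH //; case: b. Qed.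

Lemma rcoord2_rotv e (v : cvec2 R d) : rcoord2 e (rotv v) = (sqrt (2 : R))^-1 *
  (rcoord2 (true, e.2) v + (if e.1 then 1 else -1) * rcoord2 (false, e.2) v).
case: e=> -[] [k b]; rewrite /rcoord2 /rcoord /= tnth_mktuple part_scale partD ?partN; ring.
Qed.

Lemma meas_rotv : mfunT (@rotv R d).
apply: meas_cvec2=> e; rewrite (_ : _ \o _ = fun v : cvec2 R d=> (sqrt (2 : R))^-1 *
  (rcoord2 (true, e.2) v + (if e.1 then 1 else -1) * rcoord2 (false, e.2) v)).
  apply: measurable_funM=> //; apply: measurable_funD; first exact: mrcoord2.
  by apply: measurable_funM=> //; exact: mrcoord2.
by apply/funext=> v /=; rewrite rcoord2_rotv.
Qed.

Lemma rcoord_lin_comb L (c : 'I_d -> nat -> C) (g : nat -> R) e :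
  rcoord e (lin_comb L c g) = \sum_(l <- iota 0 L) part e.2 (c e.1 l) * g l.
have -> : iota 0 L = index_iota 0 L by rewrite /index_iota subn0.
rewrite /rcoord tnth_mktuple part_sum big_mkord.
by eqr=> l _; rewrite mulrC part_scale mulrC.
Qed.

End Coordinates.

Section Moments.
Variables (d : nat).
Notation crd := (bool * ('I_d * bool))%type.
Implicit Types (v : cvec2 R d) (e f : crd).

Lemma sqnorm2E v : sqnorm2 v = \sum_(e : crd) rcoord2 e v ^+ 2.
have E : \sum_(b : bool) \sum_(k < d) \sum_(c : bool) rcoord2 (b, (k, c)) v ^+ 2 = \sum_(e : crd) rcoord2 e v ^+ 2.
  under eq_bigr=> b _ do rewrite (pair_bigA _ (fun k c=> rcoord2 (b, (k, c)) v ^+ 2)) /=.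
  by rewrite pair_bigA /=; eqr=> -[b [k c]].
rewrite -E big_bool /= /sqnorm2 /sqnorm; congr (_ + _); eqr=> k _; rewrite big_bool /=.
  rewrite /rcoord2 /rcoord /part /=; case: (tnth v.1 k)=> x y /=. by rewrite sqr_sqrtr // addr_ge0 ?sqr_ge0.
rewrite /rcoord2 /rcoord /part /=; case: (tnth v.2 k)=> x y /=.
by rewrite sqr_sqrtr // addr_ge0 ?sqr_ge0.
Qed.

Lemma sqn2_ge0 v : 0 <= sqnorm2 v.
by rewrite sqnorm2E sumr_ge0 // => e _; exact: sqr_ge0. Qed.

Lemma rcoord2_le v e : rcoord2 e v ^+ 2 <= sqnorm2 v.
by rewrite sqnorm2E (bigD1 e) //= lerDl sumr_ge0 // => f _; exact: sqr_ge0.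
Qed.

Lemma msqnorm2 : mfunT (@sqnorm2 R d).
rewrite (_ : @sqnorm2 R d = fun v=> \sum_(e : crd) rcoord2 e v ^+ 2).
  by apply: measurable_sum=> e; apply: measurable_funX; exact: mrcoord2.
by apply/funext=> v; rewrite sqnorm2E.
Qed.

Variables (mu : probability (cvec2 R d) R) (mu_law : offdiag_law mu).

Lemma sqn_ig2 : ig mu (fun v=> sqnorm2 v ^+ 2).
apply: ig_ge0; last exact: mu_law.2.
  by apply: measurable_funX; exact: msqnorm2.
by move=> v; exact: sqr_ge0.
Qed.

Lemma sqn2_ig : ig mu (@sqnorm2 R d).
apply: ig_le (igD (ig_cst mu 1) sqn_ig2); first exact: msqnorm2.
by move=> v; rewrite ger0_norm ?sqn2_ge0 //; have := sqr_ge0 (sqnorm2 v - 1); have := sqn2_ge0 v; nra.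
Qed.

Lemma rcoord2_ig2 e f : ig mu (fun v=> rcoord2 e v * rcoord2 f v).
apply: ig_le sqn2_ig; first by apply: measurable_funM; exact: mrcoord2.
move=> v; have := rcoord2_le v e; have := rcoord2_le v f; rewrite ler_norml.
have := sqr_ge0 (rcoord2 e v - rcoord2 f v); have := sqr_ge0 (rcoord2 e v + rcoord2 f v).
by move=> h1 h2 h3 h4; apply/andP; split; nra.
Qed.

Lemma rcoord2_ig e : ig mu (rcoord2 e).
apply: ig_le (igD (ig_cst mu 1) sqn2_ig); first exact: mrcoord2.
move=> v; have := rcoord2_le v e; rewrite ler_norml.
have := sqr_ge0 (rcoord2 e v - 1); have := sqr_ge0 (rcoord2 e v + 1).
by move=> h1 h2 h3; apply/andP; split; nra.
Qed.

Lemma rcoord2_mean e : Ex mu (rcoord2 e) = 0.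
by have := mu_law.1 e; rewrite expectation.unlock (ExE (rcoord2_ig e))=> -[].
Qed.

Let cov_Ex (P : probability (cvec2 R d) R) e f : ig P (rcoord2 e) -> ig P (rcoord2 f) ->
  ig P (fun v=> rcoord2 e v * rcoord2 f v) -> Ex P (rcoord2 e) = 0 -> Ex P (rcoord2 f) = 0 ->
  covariance P (rcoord2 e) (rcoord2 f) = (Ex P (fun v=> rcoord2 e v * rcoord2 f v))%:E.
move=> he hf hef e0 f0; rewrite covariance.unlock expectation.unlock (ExE he) (ExE hf) e0 f0 -ExE //.
by apply: eq_integral=> v _; rewrite mulrfctE /= !subr0.
Qed.

(** The covariances of [mu] are those of [gamma], and these are computed on the representation [phi]
    by standard normal variables, as a Gram matrix of the coefficients. *)
Lemma gaussian_cov (dG : measure_display) (G : measurableType dG) (PG : probability G R)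
    (I : eqType) (D : set I) (g : I -> G -> R) (s : seq I) (coef : crd -> I -> R)
    (phi : G -> cvec2 R d) (gamma : probability (cvec2 R d) R) :
  iid_std_normal PG D g -> uniq s -> (forall i, i \in s -> D i) ->
  (forall e w, rcoord2 e (phi w) = \sum_(i <- s) coef e i * g i w) ->
  (forall U, measurable U -> PG (phi @^-1` U) = gamma U) -> same_covariance mu gamma ->
  forall e f, Ex mu (fun v=> rcoord2 e v * rcoord2 f v) = \sum_(i <- s) coef e i * coef f i.
move=> gs us sD phiE law cov e f.
have igc e' : ig PG (rcoord2 e' \o phi).
  apply: (ig_eq (f := fun w=> \sum_(i <- s) coef e' i * g i w))=> [w|]; first by rewrite /= phiE.
  exact: (std_sum_mean gs sD (coef e')).1.
have mphi : mfunT phi by apply: meas_cvec2=> e'; exact: ig_meas.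
have igg e' : ig gamma (rcoord2 e') by exact: (ig_tr mphi law (mrcoord2 e')).1.
have mef : mfunT (fun v=> rcoord2 e v * rcoord2 f v).
  by apply: measurable_funM; exact: mrcoord2.
have [igF ExF] := std_sum_cov gs us sD (coef e) (coef f).
have igef : ig gamma (fun v=> rcoord2 e v * rcoord2 f v).
  apply: (ig_tr mphi law mef).1.
  apply: (ig_eq (f := fun w=> (\sum_(i <- s) coef e i * g i w) * (\sum_(i <- s) coef f i * g i w)))=> [w|//].
  by rewrite /= !phiE.
have m0 e' : Ex gamma (rcoord2 e') = 0.
  rewrite (Ex_tr mphi law) // -(std_sum_mean gs sD (coef e')).2. by apply: eq_Ex=> w; rewrite /= phiE.
have := cov e f; rewrite !cov_Ex ?rcoord2_mean //; try exact: rcoord2_ig; last exact: rcoord2_ig2.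
move=> [->]; rewrite (Ex_tr mphi law) // -ExF.
by apply: eq_Ex=> w; rewrite /= !phiE.
Qed.

End Moments.

Section Selectors.
Variables (d : nat).
Notation crd := (bool * ('I_d * bool))%type.
Notation xl := ('I_d * bool)%type.
Implicit Types (c : crd -> R) (x y : xl).

Definition unit_i (b : bool) : C := if b then - 'i%C else 'i%C.

(* Entry [(i, j)] of the letter [x] as a function of the real coordinates [c] of
   [V_ij]: at the upper position for [selp], at the lower one ([j < i], [c]
   belonging to [V_ji]) for [selm]. *)
Definition sel (b : bool) (x : xl) (c : crd -> R) : C :=
  (c (b, (x.1, true)))%:C + unit_i x.2 * (c (b, (x.1, false)))%:C.
Definition selp x c := sel (~~ x.2) x c.
Definition selm x c := sel x.2 x c.

(** A product of two entries is bilinear in the real coordinates, so its expectation depends on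
    their covariances only; this is the bilinear expression at a covariance array [Gam]. *)
Definition sel2g (b b' : bool) x y (Gam : crd -> crd -> R) : C :=
  (Gam (b, (x.1, true)) (b', (y.1, true)))%:C +
  unit_i x.2 * unit_i y.2 * (Gam (b, (x.1, false)) (b', (y.1, false)))%:C +
  unit_i y.2 * (Gam (b, (x.1, true)) (b', (y.1, false)))%:C +
  unit_i x.2 * (Gam (b, (x.1, false)) (b', (y.1, true)))%:C.
Definition sel2 x y := sel2g (~~ x.2) y.2 x y.

Lemma sel2g_sum (I : Type) (s : seq I) (w : I -> R) (c : I -> crd -> R) b b' x y Gam :
  (forall e f, Gam e f = \sum_(i <- s) w i * (c i e * c i f)) ->
  sel2g b b' x y Gam = \sum_(i <- s) (w i)%:C * (sel b x (c i) * sel b' y (c i)).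
move=> h; rewrite /sel2g !h !rmorph_sum /= !mulr_sumr -!big_split /=.
eqr=> i _; rewrite /sel !rmorphM /=; ring.
Qed.

Lemma sel2_sum (I : Type) (s : seq I) (w : I -> R) (c : I -> crd -> R) x y Gam :
  (forall e f, Gam e f = \sum_(i <- s) w i * (c i e * c i f)) ->
  sel2 x y Gam = \sum_(i <- s) (w i)%:C * (selp x (c i) * selm y (c i)).
exact: sel2g_sum. Qed.

Lemma sel_part x b (z : C) (h : crd -> R) :
  (forall b', h (b, (x.1, b')) = part b' z) -> sel b x h = if x.2 then conjc z else z.
move=> e; rewrite /sel !e /unit_i /=; case: x.2; case: z {e} => u v /=; simpc=> //.
Qed.

End Selectors.

(** * Entry covariances agree with those of the free family *)

Section MatchedCovariance.
Variables (d r : nat).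
Notation crd := (bool * ('I_d * bool))%type.
Variables (mu : 'I_r -> 'I_r -> probability (cvec2 R d) R) (mu_law : forall a b, offdiag_law (mu a b))
  (mu_swap : forall a b U, measurable U -> mu b a U = pushforward (mu a b) (@swapv R d) U)
  (K : matching_coefs R d r) (K_match : matching mu K).

Definition cov_mu a b (e f : crd) : R := Ex (mu a b) (fun v=> rcoord2 e v * rcoord2 f v).

Let iota_sum (V : nmodType) L (F : nat -> V) : \sum_(l <- iota 0 L) F l = \sum_(l < L) F l.
by rewrite -(big_mkord xpredT F) /index_iota subn0. Qed.

Let cross (a b : 'I_r) x y : (a < b)%N -> sel2 x y (cov_mu a b) = gam K a b x y.
move=> ab; have [_ [gamma [_ cov [dG [G [PG [g [gs law]]]]]]]] := K_match.1 a b ab.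
pose coef (e : crd) l : R := part e.2.2 ((if e.1 then mcalpha K a b else mcbeta K a b) e.2.1 l).
have cE e f : cov_mu a b e f = \sum_(l <- iota 0 (mcL K a b)) 1 * (coef e l * coef f l).
  under eq_bigr do rewrite mul1r. apply: (gaussian_cov (mu_law a b) gs (iota_uniq _ _) _ _ law cov)=> [l|[[] e'] w].
  - by rewrite mem_iota.
  - by rewrite /rcoord2 /= rcoord_lin_comb.
  - by rewrite /rcoord2 /= rcoord_lin_comb.
rewrite (sel2_sum x y cE) iota_sum /gam ab; eqr=> l _; rewrite mul1r.
rewrite /selp /selm /cross_fst /cross_snd.
rewrite (sel_part (z := if ~~ x.2 then mcalpha K a b x.1 l else mcbeta K a b x.1 l)); last first.
  by move=> b'; rewrite /coef /=; case: x.2.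
rewrite (sel_part (z := if y.2 then mcalpha K a b y.1 l else mcbeta K a b y.1 l)); last first.
  by move=> b'; rewrite /coef /=; case: y.2.
by case: x.2; case: y.2.
Qed.

(** The rotation is an involution, so the rotated combinations of standard normal variables have the
    law [gamma]; [c0^2 = 1/2] is the factor in the diagonal case of [gam]. *)
Let same (a : 'I_r) x y : sel2 x y (cov_mu a a) = gam K a a x y.
have [_ _ [gamma [_ cov [dG [G [PG [g [gs law]]]]]]]] := K_match.2 a.
pose c0 : R := (sqrt 2)^-1.
pose coef (e : crd) (l : bool * nat) : R := c0 * part e.2.2 (
  if l.1 then mcalphap K a e.2.1 l.2 else if e.1 then mcbetam K a e.2.1 l.2 else - mcbetam K a e.2.1 l.2).
pose s := [seq (true, l) | l <- iota 0 (mcLp K a)] ++ [seq (false, l) | l <- iota 0 (mcLm K a)].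
have su : uniq s.
  rewrite cat_uniq !map_inj_uniq ?iota_uniq=> [|? ? []|? ? []] //=; rewrite andbT.
  by apply/hasPn=> i /mapP[l _ ->]; apply/mapP=> -[].
have sD i : i \in s -> (i.2 < if i.1 then mcLp K a else mcLm K a)%N.
  by rewrite mem_cat=> /orP[] /mapP[l]; rewrite mem_iota /= => h ->.
pose phi0 w : cvec2 R d := (lin_comb (mcLp K a) (mcalphap K a) (fun l=> g (true, l) w),
                         lin_comb (mcLm K a) (mcbetam K a) (fun l=> g (false, l) w)).
have law' U : measurable U -> PG ((@rotv R d \o phi0) @^-1` U) = gamma U.
  move=> mU; have mU' : measurable (@rotv R d @^-1` U).
    by rewrite -[X in measurable X]setTI; exact: meas_rotv.
  transitivity (gamma (@rotv R d @^-1` (@rotv R d @^-1` U))); first exact: law mU'.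
  by congr (gamma _); apply/seteqP; split=> v; rewrite /preimage /= rotvK.
have cE e f : cov_mu a a e f = \sum_(l <- s) 1 * (coef e l * coef f l).
  under eq_bigr do rewrite mul1r. apply: (gaussian_cov (mu_law a a) gs su sD _ law' cov)=> {}e w.
  rewrite /= rcoord2_rotv /rcoord2 /= !rcoord_lin_comb big_cat /= !big_map /= !mulrDr; congr (_ + _).
    by rewrite mulr_sumr; eqr=> l _; rewrite /coef /= mulrA.
  rewrite -/c0 mulrA !mulr_sumr; eqr=> l _; rewrite /coef /=; case: e.1; rewrite ?partN; ring.
have c02 : c0%:C * c0%:C = 2^-1 :> C.
  by rewrite -rmorphM /= -invfM -expr2 sqr_sqrtr // rmorphV ?unitfE ?pnatr_eq0 //= rmorph_nat.
have selc b x' l (z : C) : (forall b', coef (b, (x'.1, b')) l = c0 * part b' z) ->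
    sel b x' (coef^~ l) = c0%:C * (if x'.2 then conjc z else z).
  move=> h; rewrite (sel_part (z := c0%:C * z))=> [|b']; last by rewrite part_scale h.
  by case: x'.2=> //; rewrite conjcM conjcR.
rewrite (sel2_sum x y cE) /gam ltnn big_cat /= !big_map !iota_sum mulrDr mulrN; congr (_ + _).
  rewrite mulr_sumr; eqr=> l _; rewrite mul1r -c02 /selp /selm /same_sym.
  by rewrite (selc _ x _ (mcalphap K a x.1 l)) // (selc _ y _ (mcalphap K a y.1 l)) //; ring.
rewrite mulr_sumr -sumrN; eqr=> l _; rewrite mul1r -c02 /selp /selm /asym.
rewrite (selc _ x _ (if ~~ x.2 then mcbetam K a x.1 l else - mcbetam K a x.1 l)) //.
rewrite (selc _ y _ (if y.2 then mcbetam K a y.1 l else - mcbetam K a y.1 l)) //.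
by case: x.2; case: y.2=> /=; rewrite ?rmorphN /=; ring.
Qed.

Let cov_swap a b e f : cov_mu b a e f = cov_mu a b (~~ e.1, e.2) (~~ f.1, f.2).
have ms : mfunT (@swapv R d).
  by apply: measurable_fun_pair; [exact: measurable_snd|exact: measurable_fst].
rewrite /cov_mu (Ex_tr (P := mu a b) (Q := mu b a) ms _ (rcoord2_ig2 (mu_law b a) e f)).
  by apply: eq_Ex=> v /=; case: e f=> [[] e] [[] f].
by move=> U mU; exact/esym/mu_swap.
Qed.

(** For [b < a] the swap of the two halves of the pair law exchanges the roles of the letters and
    reduces to the ordered pair [(b, a)]. *)
Lemma sel2_gam a b x y : sel2 x y (cov_mu a b) = gam K a b x y.
have [ab|ab|/val_inj ->] := ltngtP a b; [exact: cross| |exact: same].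
rewrite gamC -(cross y x ab) /sel2 /sel2g !(cov_swap b a) /= !negbK.
have sym e f : cov_mu b a e f = cov_mu b a f e by apply: eq_Ex=> v; rewrite mulrC.
rewrite !(sym (x.2, _)); ring.
Qed.

End MatchedCovariance.

(** * Truncation and discretization *)

Section FiniteValued.
Context {dd : measure_display} {T : measurableType dd} (P : probability T R).
Variables (S : finType) (D : T -> S) (mD : forall s, measurable (D @^-1` [set s])).

Definition weight (s : S) : R := fine (P (D @^-1` [set s])).

Lemma weight_ge0 s : 0 <= weight s.
by rewrite /weight fine_ge0. Qed.

Let mI s : mfunT (\1_(D @^-1` [set s]) : T -> R).
exact: measurable_indic. Qed.

Let igI s : ig P (\1_(D @^-1` [set s]) : T -> R).
apply: ig_le (ig_cst P 1)=> // x; rewrite indicE; case: (_ \in _)=> /=; rewrite ?normr1 ?normr0 //.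
Qed.

Let ExI s : Ex P (\1_(D @^-1` [set s]) : T -> R) = weight s.
by rewrite /Ex /Rintegral integral_indic // setIT. Qed.

Lemma fin_Ex (F : S -> R) :
  ig P (F \o D) /\ Ex P (F \o D) = \sum_s weight s * F s.
have E x : \sum_s F s * \1_(D @^-1` [set s]) x = F (D x).
  rewrite (bigD1 (D x)) //= big1=> [|s sx]; rewrite indicE.
    by rewrite mem_set //= mulr1 addr0.
  by rewrite memNset ?mulr0 //= => h; rewrite h eqxx in sx.
have igF s : ig P (fun x=> F s * \1_(D @^-1` [set s]) x) by exact: igZ.
split; first by apply: (ig_eq E); exact: ig_sum.
rewrite -(eq_Ex P E) Ex_sum //; eqr=> s _.
by rewrite ExZ // ExI mulrC.
Qed.

Lemma weight_sum : \sum_s weight s = 1.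
have [_ h] := fin_Ex (fun _ => 1); rewrite (Ex_cst P 1) in h.
by rewrite h; eqr=> s _; rewrite mulr1.
Qed.

End FiniteValued.

Lemma sqr_abs (x y : R) : 0 <= y -> x ^+ 2 <= y ^+ 2 -> `|x| <= y.
by move=> y0; rewrite -[x ^+ 2]real_normK ?num_real // ler_sqr ?nnegrE. Qed.

Section Discretization.
Variables (d : nat).
Notation crd := (bool * ('I_d * bool))%type.
Variables (tau h : R) (tau1 : 1 <= tau) (h0 : 0 < h) (htau : h <= tau ^- 2).
Let tau0 : 0 < tau. exact: lt_le_trans tau1. Qed.

Let cells := Num.truncn (2 * tau / h).
(** [None] is the symbol of a truncated vector, with value 0; otherwise each real coordinate is
    rounded down to a grid of mesh [h] starting at [- tau]. *)
Definition dsym : finType := option {ffun crd -> 'I_cells.+1}.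
Definition disc (v : cvec2 R d) : dsym :=
  if sqnorm2 v <= tau ^+ 2
  then Some [ffun e=> inord (Num.truncn ((rcoord2 e v + tau) / h))] else None.
Definition dval (s : dsym) (e : crd) : R :=
  if s is Some f then h * (f e : nat)%:R - tau else 0.

Lemma dval_in v e : sqnorm2 v <= tau ^+ 2 -> `|dval (disc v) e - rcoord2 e v| <= h.
move=> vt; rewrite /disc vt /= ffunE.
have : rcoord2 e v ^+ 2 <= tau ^+ 2 := letr (rcoord2_le v e) vt.
move=> /(sqr_abs (ltW tau0)); rewrite ler_norml=> /andP[x1 x2].
have y0 : 0 <= (rcoord2 e v + tau) / h by rewrite divr_ge0 ?(ltW h0) // -lerBlDr sub0r.
have /andP[z1 z2] := truncn_itv y0.
rewrite inordK; last first.
  by rewrite ltnS le_truncn // ler_pM2r ?invr_gt0 // mulr_natl mulr2n lerD2r.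
move: z1 z2; rewrite -natr1 ler_pdivlMr // ltr_pdivrMr // => z1 z2.
by rewrite ler_norml; apply/andP; split; lra.
Qed.

Lemma dval_out v e : tau ^+ 2 < sqnorm2 v -> dval (disc v) e = 0.
by rewrite ltNge /disc=> /negbTE ->. Qed.

Lemma dval_le s e : `|dval s e| <= tau.
case: s=> [f|] /=; last by rewrite normr0 ltW.
have y0 : 0 <= 2 * tau / h by rewrite divr_ge0 ?(ltW h0) // mulr_ge0 ?(ltW tau0).
have : (f e : nat)%:R <= 2 * tau / h.
  by apply: letr (andP (truncn_itv y0)).1; rewrite ler_nat -ltnS.
rewrite ler_pdivlMr // => k; have : 0 <= (f e : nat)%:R * h by rewrite mulr_ge0 ?(ltW h0).
by rewrite ler_norml=> k'; apply/andP; split; lra.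
Qed.

Let mtrunc (Q : set nat) : measurable [set x : R | Q (Num.truncn x)].
have m1 n : measurable [set x : R | (n < Num.truncn x)%N].
  rewrite (_ : [set x | _] = `[n.+1%:R, +oo[%classic); first exact: measurable_itv.
  by apply/seteqP; split=> x /=; rewrite in_itv /= andbT truncn_gt_nat.
rewrite (_ : [set x | _] = \bigcup_(n in Q) [set x | Num.truncn x = n]); last first.
  apply/seteqP; split=> x /= => [Qx|[n Qn e]]; [by exists (Num.truncn x)|by rewrite e].
apply: bigcup_measurable=> -[|n] _.
  rewrite (_ : [set x | _] = ~` [set x : R | (0 < Num.truncn x)%N]); first exact: measurableC.
  by apply/seteqP; split=> x /=; [move=> ->|rewrite lt0n=> /negP/negPn/eqP].
rewrite (_ : [set x | _] = [set x : R | (n < Num.truncn x)%N] `\` [set x : R | (n.+1 < Num.truncn x)%N]).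
  exact: measurableD.
apply/seteqP; split=> x /=; first by move=> ->; rewrite !ltnSn ltnn.
by move=> [a /negP]; rewrite -leqNgt=> b; apply/eqP; rewrite eqn_leq b a.
Qed.

Lemma meas_disc s : measurable (disc @^-1` [set s]).
have mS : measurable [set v : cvec2 R d | sqnorm2 v <= tau ^+ 2].
  rewrite -[X in measurable X]setTI. rewrite (_ : [set v | _] = @sqnorm2 R d @^-1` `]-oo, tau ^+ 2]%classic).
    by apply: msqnorm2=> //; exact: measurable_itv.
  by apply/seteqP; split=> v /=; rewrite in_itv.
case: s=> [f|]; last first.
  rewrite (_ : _ @^-1` _ = ~` [set v : cvec2 R d | sqnorm2 v <= tau ^+ 2]); first exact: measurableC.
  by apply/seteqP; split=> v /=; rewrite /disc; case: ifP.
rewrite (_ : _ @^-1` _ = [set v : cvec2 R d | sqnorm2 v <= tau ^+ 2] `&`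
  \bigcap_(e in [set: crd]) [set v | (inord (Num.truncn ((rcoord2 e v + tau) / h)) : 'I_cells.+1) = f e]).
  apply: measurableI=> //; apply: fin_bigcap_measurable; first exact: finite_finset.
  move=> e _; have mg : mfunT (fun v=> (rcoord2 e v + tau) / h).
    apply: measurable_funM=> //; apply: measurable_funD=> //; exact: mrcoord2.
  have := mg measurableT _ (mtrunc [set n | (inord n : 'I_cells.+1) = f e]). by rewrite setTI.
apply/seteqP; split=> v /=; rewrite /disc.
  by case: ifP=> // vt [<-]; split=> // e _; rewrite /= ffunE.
by move=> [-> k]; congr Some; apply/ffunP=> e; rewrite ffunE; exact: k.
Qed.

Variables (mu : probability (cvec2 R d) R) (K2 : R) (mu_law : offdiag_law mu)
  (K2P : Ex mu (fun v=> sqnorm2 v ^+ 2) <= K2).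

Let rho0 (v : cvec2 R d) := sqn2_ge0 v.

Lemma K2_ge0 : 0 <= K2.
apply: letr K2P; rewrite -(Ex_cst mu 0); apply: Ex_le; [exact: ig_cst|exact: sqn_ig2|].
by move=> v; exact: sqr_ge0.
Qed.

Let Erho : Ex mu (@sqnorm2 R d) <= 1 + K2.
apply: letr (_ : Ex mu (fun v=> 1 + sqnorm2 v ^+ 2) <= _).
  apply: Ex_le; [exact: sqn2_ig|by apply: igD; [exact: ig_cst|exact: sqn_ig2]|].
  by move=> v; have := sqr_ge0 (sqnorm2 v - 1); have := rho0 v; nra.
by rewrite ExD ?Ex_cst ?lerD2l //; [exact: ig_cst|exact: sqn_ig2].
Qed.

Definition dw (s : dsym) : R := weight mu disc s.
(** Truncation and rounding destroy the zero mean required by [sa_mean]; the values are recentred by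
    this bias. *)
Definition dmean (e : crd) : R := \sum_s dw s * dval s e.
Definition dcen (s : dsym) (e : crd) : R := dval s e - dmean e.
Definition dcov (e f : crd) : R := \sum_s dw s * (dcen s e * dcen s f).

Let dwE F := fin_Ex mu meas_disc F.

Lemma dw_ge0 s : 0 <= dw s. exact: weight_ge0. Qed.
Lemma dw_sum : \sum_s dw s = 1. exact: weight_sum meas_disc. Qed.

Lemma dcen_mean e : \sum_s dw s * dcen s e = 0.
under eq_bigr do rewrite mulrBr.
by rewrite big_split /= sumrN -mulr_suml dw_sum mul1r subrr.
Qed.

Let t2 : 1 <= tau ^+ 2. by rewrite expr_ge1 // ltW. Qed.

(** As the law is centred, the bias consists of the rounding error [h] and of the truncated part,
    where a coordinate is at most [sqnorm2 v], hence at most its square divided by [tau^2]. *)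
Lemma dmean_le e : `|dmean e| <= (K2 + 1) / tau ^+ 2.
rewrite -[dmean e](dwE (fun s=> dval s e)).2 -[Ex mu _]subr0 -(rcoord2_mean mu_law e).
have t3 : 0 < tau ^- 2 by rewrite invr_gt0 exprn_gt0.
apply: letr (_ : Ex mu (fun v=> h + tau ^- 2 * sqnorm2 v ^+ 2) <= _).
  apply: Ex_dist=> [|||v].
  - exact: (dwE (fun s=> dval s e)).1.
  - exact: rcoord2_ig.
  - by apply: igD; [exact: ig_cst|exact/igZ/sqn_ig2].
  have q0 : 0 <= tau ^- 2 * sqnorm2 v ^+ 2 by rewrite mulr_ge0 ?sqr_ge0 ?(ltW t3).
  case: (leP (sqnorm2 v) (tau ^+ 2))=> vt /=.
    by apply: letr (dval_in e vt) _; rewrite lerDl.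
  rewrite dval_out // sub0r normrN -[leLHS]add0r lerD ?(ltW h0) //. rewrite mulrC ler_pdivlMr ?exprn_gt0 //.
  have x1 : rcoord2 e v ^+ 2 <= sqnorm2 v ^+ 2.
    by apply: letr (rcoord2_le v e) _; rewrite expr2 ler_peMr ?rho0 // (letr t2) ?ltW.
  have {}x1 : `|rcoord2 e v| <= sqnorm2 v by apply: sqr_abs.
  by rewrite [leRHS]expr2 ler_pM // ?exprn_ge0 ?(ltW tau0) // ltW.
rewrite ExD ?Ex_cst ?ExZ //; [|exact: sqn_ig2|exact: ig_cst|exact/igZ/sqn_ig2].
by rewrite [(K2 + 1) / _]mulrC mulrDr mulr1 addrC lerD // ler_wpM2l // ltW.
Qed.

Definition dconst : R := (K2 + 1) ^+ 2 + K2 + 2 * (1 + (1 + K2)) + 1.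

(** Below the truncation a product changes by at most [h] times a bound on the coordinates, above it
    by the squared [sqnorm2] divided by [tau^2]; recentring costs a product of two biases. Each is
    at most a constant over [tau]. *)
Lemma dcov_cov e f : `|dcov e f - Ex mu (fun v=> rcoord2 e v * rcoord2 f v)| <= dconst / tau.
have K0 := K2_ge0.
have t2i : tau ^- 2 <= tau^-1 by rewrite lef_pV2 ?posrE ?exprn_gt0 // expr2 ler_peMr // ltW.
have t20 : 0 <= tau ^- 2 by rewrite invr_ge0 exprn_ge0 // ltW.
have t21 : tau ^- 2 <= 1 by rewrite invf_le1 ?exprn_gt0.
have h1 : h <= 1 by exact: letr htau t21.
have E : dcov e f = Ex mu (fun v=> dval (disc v) e * dval (disc v) f) - dmean e * dmean f.
  rewrite (dwE (fun s=> dval s e * dval s f)).2.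
  have -> : dcov e f = \sum_s (dw s * (dval s e * dval s f) - dmean f * (dw s * dval s e)
      - dmean e * (dw s * dcen s f)).
    by eqr=> s _; rewrite /dcen; ring.
  rewrite !big_split /= !sumrN -!mulr_sumr dcen_mean -/(dmean e); ring.
rewrite E addrAC; apply: letr (ler_normB _ _) _.
have mm : `|dmean e * dmean f| <= (K2 + 1) ^+ 2 / tau.
  rewrite normrM; apply: letr (ler_pM _ _ (dmean_le e) (dmean_le f)) _=> //.
  rewrite mulrACA -expr2 ler_wpM2l ?sqr_ge0 //. by rewrite -[leRHS]mulr1 ler_pM.
suff k : `|Ex mu (fun v=> dval (disc v) e * dval (disc v) f) - Ex mu (fun v=> rcoord2 e v * rcoord2 f v)|
    <= (K2 + 2 * (1 + (1 + K2)) + 1) / tau.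
  by apply: letr (lerD k mm) _; rewrite -mulrDl ler_wpM2r ?invr_ge0 ?(ltW tau0) // /dconst; lra.
pose H (v : cvec2 R d) := tau ^- 2 * (2 * (1 + sqnorm2 v) + 1) + tau ^- 2 * sqnorm2 v ^+ 2.
have igH1 : ig mu (fun v=> 2 * (1 + sqnorm2 v) + 1).
  by apply: igD; [apply: igZ; apply: igD; [exact: ig_cst|exact: sqn2_ig]|exact: ig_cst].
apply: letr (_ : Ex mu H <= _).
  apply: Ex_dist=> [|||v].
  - exact: (dwE (fun s=> dval s e * dval s f)).1.
  - exact: rcoord2_ig2.
  - by apply: igD; [exact: igZ|exact/igZ/sqn_ig2].
  have r0 := rho0 v; rewrite /H; case: (leP (sqnorm2 v) (tau ^+ 2))=> vt.
    apply: letr (_ : tau ^- 2 * (2 * (1 + sqnorm2 v) + 1) <= _); last first.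
      by rewrite lerDl mulr_ge0 // sqr_ge0.
    have a1 := dval_in e vt; have a2 := dval_in f vt. have x1 (g : crd) : `|rcoord2 g v| <= 1 + sqnorm2 v.
      have := rcoord2_le v g; rewrite ler_norml=> u.
      by have := sqr_ge0 (rcoord2 g v - 1); have := sqr_ge0 (rcoord2 g v + 1)=> *; apply/andP; split; nra.
    have -> : dval (disc v) e * dval (disc v) f - rcoord2 e v * rcoord2 f v =
      (dval (disc v) e - rcoord2 e v) * (rcoord2 f v + (dval (disc v) f - rcoord2 f v)) +
      rcoord2 e v * (dval (disc v) f - rcoord2 f v) by ring.
    apply: letr (ler_normD _ _) _; rewrite !normrM.
    have b1 : `|rcoord2 f v + (dval (disc v) f - rcoord2 f v)| <= 1 + sqnorm2 v + 1.
      by apply: letr (ler_normD _ _) _; rewrite lerD // (letr a2).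
    apply: letr (lerD (ler_pM _ _ (letr a1 htau) b1) (ler_pM _ _ (x1 e) (letr a2 htau))) _=> //.
    by rewrite [_ * tau ^- 2]mulrC -mulrDr ler_wpM2l //; lra.
  rewrite !dval_out // mul0r sub0r normrN -[leLHS]add0r lerD //.
    by rewrite mulr_ge0 //; lra.
  rewrite [leRHS]mulrC ler_pdivlMr ?exprn_gt0 // [leRHS]expr2; apply: ler_pM; rewrite ?exprn_ge0 ?(ltW tau0) //; last exact: ltW.
  have := rcoord2_le v e; have := rcoord2_le v f; rewrite ler_norml.
  have := sqr_ge0 (rcoord2 e v - rcoord2 f v); have := sqr_ge0 (rcoord2 e v + rcoord2 f v).
  by move=> ? ? ? ?; apply/andP; split; nra.
rewrite /H ExD ?ExZ //; [|exact: sqn_ig2|exact: igZ|exact/igZ/sqn_ig2].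
have E1 : Ex mu (fun v=> 2 * (1 + sqnorm2 v) + 1) = 2 * (1 + Ex mu (@sqnorm2 R d)) + 1.
  have i1 : ig mu (fun v=> 1 + sqnorm2 v) by apply: igD; [exact: ig_cst|exact: sqn2_ig].
  have i2 : ig mu (fun v=> 2 * (1 + sqnorm2 v)) by exact: igZ.
  rewrite (ExD i2 (ig_cst mu 1)) (ExZ _ i1) (ExD (ig_cst mu 1) (sqn2_ig mu_law)). by rewrite !Ex_cst.
rewrite E1.
rewrite -mulrDr mulrC; apply: ler_pM=> //; have rr := Erho; have kk := K2P.
  apply: addr_ge0; last by rewrite -(Ex_cst mu 0); apply: Ex_le; [exact: ig_cst|exact: sqn_ig2|move=> v; exact: sqr_ge0].
  have : 0 <= Ex mu (@sqnorm2 R d) by rewrite -(Ex_cst mu 0); apply: Ex_le; [exact: ig_cst|exact: sqn2_ig|exact: rho0].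
  lra.
lra.
Qed.

Lemma cov_le e f : `|Ex mu (fun v=> rcoord2 e v * rcoord2 f v)| <= 1 + K2.
apply: letr Erho; rewrite -[Ex mu _]subr0 -(Ex_cst mu 0).
apply: Ex_dist=> [|||v]; [exact: rcoord2_ig2|exact: ig_cst|exact: sqn2_ig|].
have := rcoord2_le v e; have := rcoord2_le v f; rewrite subr0 ler_norml.
have := sqr_ge0 (rcoord2 e v - rcoord2 f v); have := sqr_ge0 (rcoord2 e v + rcoord2 f v).
by move=> ? ? ? ?; apply/andP; split; nra.
Qed.

End Discretization.

(** * Scales and the discretized array *)

Section Roots.

(** The root of order 32 of [n + 1], by five nested square roots, so that all scales are integer
    powers of it. *)
Definition rt5 (n : nat) : R := iter 5 sqrt n.+1%:R.

Lemma rt5_ge1 n : 1 <= rt5 n.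
rewrite /rt5; elim: 5%N=> [|k IH] /=; first by rewrite ler1n.
by rewrite -[leLHS](sqrtr1 R) ler_sqrt // (letr ler01).
Qed.

Lemma rt5_gt0 n : 0 < rt5 n. exact: lt_le_trans (rt5_ge1 n). Qed.

Lemma rt5_exp n : rt5 n ^+ 32 = n.+1%:R.
rewrite /rt5 -[32%N]/(2 * (2 * (2 * (2 * 2))))%N !exprM /= !sqr_sqrtr ?sqrtr_ge0 //.
Qed.

Lemma rt5_sqrt n : sqrt n.+1%:R = rt5 n ^+ 16.
by rewrite -rt5_exp -[32%N]/(16 * 2)%N exprM sqrtr_sqr ger0_norm // exprn_ge0 // ltW // rt5_gt0.
Qed.

Lemma rt5_large (x : R) : evt (fun n=> x <= rt5 n).
pose m := Num.bound `|x|; exists (m ^ 32)%N=> n mn.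
have xm : x <= m%:R by apply: ltW; apply: le_lt_trans (ler_norm x) (archi_boundP (normr_ge0 x)).
apply: letr xm _; rewrite leNgt; apply/negP=> k.
have := ltr_pXn2r (_ : 0 < 32)%N; move/(_ R)=> L.
have : rt5 n ^+ 32 < m%:R ^+ 32 by rewrite L ?nnegrE ?(ltW (rt5_gt0 n)).
by rewrite rt5_exp -natrX ltr_nat ltnNge (leq_trans mn).
Qed.

Lemma rt5_small (K e : R) : 0 < e -> evt (fun n=> K / rt5 n <= e).
move=> e0; apply: evtS (rt5_large (K / e))=> n h.
by rewrite ler_pdivrMr ?rt5_gt0 // mulrC -ler_pdivrMr.
Qed.

End Roots.

Section Model.
Variables (d r : nat).
Notation crd := (bool * ('I_d * bool))%type.
Notation X := ('I_d * bool)%type.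
Variables (mu : 'I_r -> 'I_r -> probability (cvec2 R d) R) (mu_law : forall a b, offdiag_law (mu a b))
  (mu_swap : forall a b U, measurable U -> mu b a U = pushforward (mu a b) (@swapv R d) U)
  (K : matching_coefs R d r) (K_match : matching mu K) (theta : nat -> 'I_r).

(** The exponent satisfies [14 + 1 < 16], so that [taun] times the degree is small against
    [sqrt (n+1)], and [2 * 4 * 14 - 64 = 48 > 32]: a truncated entry has probability of order
    [taun^-4], and pairs of them sharing an index are summable. *)
Definition taun n : R := rt5 n ^+ 14.
Definition hn n : R := n.+1%:R^-1.

Lemma taun_ge1 n : 1 <= taun n. by rewrite expr_ge1 ?rt5_ge1 // ltW // rt5_gt0. Qed.
Lemma hn_gt0 n : 0 < hn n. by rewrite invr_gt0 ltr0n. Qed.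
Lemma hn_taun n : hn n <= taun n ^- 2.
have b1 := rt5_ge1 n; have b0 := rt5_gt0 n.
rewrite /hn /taun -rt5_exp lef_pV2 ?posrE ?exprn_gt0 // -exprM.
exact: ler_weXn2l.
Qed.

Definition Sn n : finType := dsym d (taun n) (hn n).
Definition sn0 n : Sn n := None.
Definition cn_ n a b (s : Sn n) : crd -> R := dcen (mu a b) s.
Definition wn n (i j : 'I_n.+1) (s : Sn n) : R := dw (mu (theta i) (theta j)) s.
Definition Gn n (x : X) (i j : 'I_n.+1) (s : Sn n) : C :=
  if (i < j)%N then selp x (cn_ (theta i) (theta j) s) else selm x (cn_ (theta j) (theta i) s).

Definition kap : R := \sum_a \sum_b Ex (mu a b) (fun v=> sqnorm2 v ^+ 2).

Let Ege0 a b : 0 <= Ex (mu a b) (fun v=> sqnorm2 v ^+ 2).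
rewrite -(Ex_cst (mu a b) 0); apply: Ex_le; [exact: ig_cst|exact: sqn_ig2|].
by move=> v; exact: sqr_ge0.
Qed.

Lemma kapP a b : Ex (mu a b) (fun v=> sqnorm2 v ^+ 2) <= kap.
rewrite /kap (bigD1 a) //= (bigD1 b) //= -addrA lerDl.
by apply: addr_ge0; [|sge0=> a' _]; sge0=> b' _.
Qed.

Lemma kap_ge0 : 0 <= kap.
by sge0=> a _; sge0=> b _. Qed.

Let d_cov n a b := @dcov_cov d (taun n) (hn n) (taun_ge1 n) (hn_gt0 n) (hn_taun n) (mu a b) kap (mu_law a b) (kapP a b).
Lemma wn_ge0 n (i j : 'I_n.+1) s : (i < j)%N -> 0 <= wn i j s.
by move=> _; exact: dw_ge0. Qed.

Lemma wn_sum n (i j : 'I_n.+1) : (i < j)%N -> \sum_s wn i j s = 1.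
by move=> _; exact: dw_sum. Qed.

Lemma conj_sel b (x : X) (c : crd -> R) : conjc (sel b x c) = sel b (xadj x) c.
rewrite /sel /xadj /= conjcD conjcM !conjcR; congr (_ + _ * _).
by rewrite /unit_i; case: x.2; apply/eqP; rewrite eq_complex /= ?opprK oppr0 !eqxx.
Qed.

Lemma Gn_adj n x (i j : 'I_n.+1) s : i != j -> conjc (Gn x i j s) = Gn (xadj x) j i s.
move=> ij; rewrite /Gn; case: (ltngtP i j)=> [h|h|/val_inj e]; last by rewrite e eqxx in ij.
  by rewrite conj_sel.
by rewrite conj_sel /selp /= negbK.
Qed.

Lemma sel_sum (S : finType) (w : S -> R) (c : S -> crd -> R) b (x : X) :
  (forall e, \sum_s w s * c s e = 0) -> \sum_s (w s)%:C * sel b x (c s) = 0.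
move=> h; transitivity (sel b x (fun e=> \sum_s w s * c s e)); last first.
  by rewrite /sel !h mulr0 addr0.
rewrite /sel !rmorph_sum mulr_sumr -big_split; eqr=> s _ /=.
by rewrite !rmorphM /=; ring.
Qed.

Lemma Gn_mean n x (i j : 'I_n.+1) : i != j ->
  \sum_s (wt (sn0 n) (@wn n) (key i j) s)%:C * Gn x i j s = 0.
move=> ij; rewrite /wt /key /Gn; case: (ltngtP i j)=> [h|h|/val_inj e]; last by rewrite e eqxx in ij.
  by rewrite h; apply: sel_sum=> e; exact: dcen_mean.
by rewrite h; apply: sel_sum=> e; exact: dcen_mean.
Qed.

Lemma norm_unit b : normc (unit_i b) = 1.
by case: b; rewrite /unit_i /= ?oppr0 expr0n ?sqrrN expr1n add0r sqrtr1. Qed.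

Lemma normc_sel2g b b' x y (Gam : crd -> crd -> R) (D : R) :
  (forall e f, `|Gam e f| <= D) -> normc (sel2g b b' x y Gam) <= 4 * D.
move=> h; rewrite /sel2g; have -> : 4 * D = D + D + D + D by ring.
do !(apply: letr (le_normcD _ _) _; apply: lerD); by rewrite ?ncM ?norm_unit ?mul1r normcR.
Qed.

Lemma sel2gB b b' x y (Gam Gam' : crd -> crd -> R) :
  sel2g b b' x y Gam - sel2g b b' x y Gam' = sel2g b b' x y (fun e f=> Gam e f - Gam' e f).
by rewrite /sel2g !rmorphB /=; ring. Qed.

Lemma gamGn n x y (i j : 'I_n.+1) : i != j -> gamG (sn0 n) (@wn n) (@Gn n) x y i j =
  if (i < j)%N then sel2 x y (dcov (taun n) (hn n) (mu (theta i) (theta j)))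
  else sel2 y x (dcov (taun n) (hn n) (mu (theta j) (theta i))).
move=> ij; rewrite /gamG (negbTE ij) /wt /key /Gn.
case: (ltngtP i j)=> [h|h|/val_inj e]; last by rewrite e eqxx in ij.
  by rewrite h (sel2_sum x y (fun e f=> erefl)).
rewrite h (sel2_sum y x (fun e f=> erefl)); eqr=> s _; congr (_ * _).
exact: mulrC.
Qed.

Definition sgn2 : R := 4 * (dconst kap + (1 + kap)).
Definition sgn : R := sqrt sgn2.

Let dcov_le n a b e f : `|dcov (taun n) (hn n) (mu a b) e f| <= dconst kap + (1 + kap).
have := d_cov n a b e f; have := cov_le (mu_law a b) (kapP a b) e f=> h1 h2.
have k0 : 0 <= dconst kap by rewrite /dconst; have := kap_ge0; have := sqr_ge0 (kap + 1); nra.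
rewrite -[dcov _ _ _ e f](subrK (Ex (mu a b) (fun v=> rcoord2 e v * rcoord2 f v))).
apply: letr (ler_normD _ _) _; apply: lerD=> //.
apply: letr h2 _; rewrite ler_pdivrMr ?(lt_le_trans ltr01 (taun_ge1 n)) //.
by rewrite ler_peMr // taun_ge1.
Qed.

Let sgn2E : sgn ^+ 2 = sgn2.
rewrite sqr_sqrtr // /sgn2 /dconst; have := kap_ge0; have := sqr_ge0 (kap + 1); nra.
Qed.

Let sgn2_ge0 : 0 <= sgn2. by rewrite -sgn2E sqr_ge0. Qed.

Lemma gamGn_sg n x y (i j : 'I_n.+1) : normc (gamG (sn0 n) (@wn n) (@Gn n) x y i j) <= sgn ^+ 2.
rewrite sgn2E; have [ij|ij] := eqVneq i j; first by rewrite /gamG ij eqxx normcR normr0.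
by rewrite gamGn //; case: ifP=> _; apply: normc_sel2g=> e f; exact: dcov_le.
Qed.

Lemma gamGn_sg' n x y (i j : 'I_n.+1) : normc (gamG' (sn0 n) (@wn n) (@Gn n) x y i j) <= sgn ^+ 2.
rewrite sgn2E; have [ij|ij] := eqVneq i j; first by rewrite /gamG' ij eqxx normcR normr0.
rewrite /gamG' (negbTE ij) /wt /key /Gn.
case: (ltngtP i j)=> [h|h|/val_inj e]; last by rewrite e eqxx in ij.
  by rewrite h -(sel2g_sum _ _ x y (fun e f=> erefl)); apply: normc_sel2g=> e f; exact: dcov_le.
by rewrite h -(sel2g_sum _ _ x y (fun e f=> erefl)); apply: normc_sel2g=> e f; exact: dcov_le.
Qed.

Let dcen_le n a b (s : Sn n) e : `|cn_ a b s e| <= 2 * taun n.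
have vt s' : `|dval s' e| <= taun n := dval_le (taun_ge1 n) (hn_gt0 n) s' e.
apply: letr (ler_normB _ _) _; rewrite mulr_natl mulr2n; apply: lerD=> //.
apply: letr (ler_norm_sum _ _ _) _.
apply: letr (_ : \sum_s' dw (mu a b) s' * taun n <= _).
  by lers=> s' _; rewrite normrM [`|dw _ _|]ger0_norm ?dw_ge0 // ler_wpM2l ?dw_ge0.
by rewrite -mulr_suml dw_sum ?mul1r // hn_gt0.
Qed.

Lemma Gn_bound n x (i j : 'I_n.+1) s : i != j -> normc (Gn x i j s) <= 4 * taun n.
move=> _; have E : 4 * taun n = 2 * taun n + 2 * taun n by ring.
rewrite /Gn E; case: ifP=> _; apply: letr (le_normcD _ _) _; apply: lerD;
  by rewrite ?ncM ?norm_unit ?mul1r normcR dcen_le.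
Qed.

Lemma gamGn_small (e : R) : 0 < e -> evt (fun n=> forall x y (i j : 'I_n.+1), i != j ->
  normc (gamG (sn0 n) (@wn n) (@Gn n) x y i j - gam K (theta i) (theta j) x y) <= e).
move=> e0; apply: evtS (rt5_small (4 * dconst kap) e0)=> n hb x y i j ij.
have k0 : 0 <= dconst kap by rewrite /dconst; have := kap_ge0; have := sqr_ge0 (kap + 1); nra.
have tb : dconst kap / taun n <= dconst kap / rt5 n.
  rewrite ler_wpM2l // lef_pV2 ?posrE ?rt5_gt0 ?exprn_gt0 ?rt5_gt0 //.
  by rewrite /taun exprS ler_peMr ?(ltW (rt5_gt0 _)) // expr_ge1 ?rt5_ge1 // ltW // rt5_gt0.
apply: letr hb; rewrite -mulrA; apply: letr (_ : 4 * (dconst kap / taun n) <= _); last first.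
  by rewrite ler_wpM2l.
rewrite gamGn //; case: ltnP=> h.
  by rewrite -(sel2_gam mu_law mu_swap K_match) /sel2 sel2gB; apply: normc_sel2g=> e' f; exact: d_cov.
by rewrite gamC -(sel2_gam mu_law mu_swap K_match) /sel2 sel2gB; apply: normc_sel2g=> e' f; exact: d_cov.
Qed.

Definition Nn n : nat := Num.truncn (rt5 n).

Lemma Nn_le n : (Nn n)%:R <= rt5 n.
by have /andP[] := truncn_itv (ltW (rt5_gt0 n)). Qed.

Let Nk_le n k : (Nn n + k)%:R <= (1 + k%:R) * rt5 n.
rewrite natrD mulrDl mul1r lerD ?Nn_le // -[leLHS]mulr1.
by apply: ler_wpM2l=> //; exact: rt5_ge1.
Qed.

Lemma Nn_small (k : nat) (e : R) : 0 < e -> evt (fun n=> (Nn n + k)%:R / n.+1%:R <= e).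
move=> e0; apply: evtS (rt5_small (1 + k%:R) e0)=> n; apply: letr.
have b0 := rt5_gt0 n; have b1 := rt5_ge1 n.
rewrite -rt5_exp ler_pdivrMr ?exprn_gt0 //; apply: letr (Nk_le n k) _.
rewrite -mulrA ler_wpM2l ?addr_ge0 // exprS mulKf ?gt_eqF //.
by rewrite exprS ler_peMr ?(ltW b0) // expr_ge1 // ltW.
Qed.

Lemma taun_small (k : nat) (e : R) : 0 < e ->
  evt (fun n=> s_ n * `|4 * taun n| * (2 * (Nn n + k)%:R) <= e).
move=> e0; apply: evtS (rt5_small (8 * (1 + k%:R)) e0)=> n; apply: letr.
have b0 := rt5_gt0 n; have b1 := rt5_ge1 n.
rewrite /s_ rt5_sqrt ger0_norm ?mulr_ge0 ?exprn_ge0 ?(ltW b0) //.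
have -> : rt5 n ^- 16 * (4 * taun n) * (2 * (Nn n + k)%:R) = 8 * (Nn n + k)%:R / rt5 n ^+ 2.
  rewrite /taun; field; by rewrite gt_eqF.
rewrite ler_pdivrMr ?exprn_gt0 // expr2 [leRHS]mulrA divfK ?gt_eqF // -mulrA.
by rewrite ler_wpM2l // Nk_le.
Qed.

(** The exponent is about [rt5 n / t], a power of [n], so the geometric factor beats the polynomial
    one with a summable [n^-2] to spare. *)
Lemma tail_small (q : R) (t : nat) : 0 <= q -> q < 1 -> (0 < t)%N ->
  evt (fun n=> n.+1%:R * q ^+ (Nn n %/ t) <= n.+1%:R ^- 2).
(* As [q'^64 = q], the bound [rt5^2 q'^m <= 1] raised to the power 64 is [(n+1)^4 q^m <= 1]. *)
move=> q0 q1 t0; pose q' := iter 6 sqrt q.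
have q'P : [/\ 0 <= q', q' < 1 & q' ^+ 64 = q].
  have h k : 0 <= iter k sqrt q /\ iter k sqrt q < 1.
    elim: k=> [|k [h0 h1]] //=; split; first exact: sqrtr_ge0. by rewrite -[ltRHS](sqrtr1 R) ltr_sqrt.
  split; [exact: (h 6).1|exact: (h 6).2|].
  by rewrite /q' -[64%N]/(2 * (2 * (2 * (2 * (2 * 2)))))%N !exprM /= !sqr_sqrtr ?sqrtr_ge0.
have [a0 a1 a2] := q'P.
have [m0 hm] := @poly_exp q' (t%:R ^+ 2) 1 a0 a1 (sqr_ge0 _).
apply: evtS (rt5_large ((m0 * t).+1%:R : R))=> n hn'.
have b0 := rt5_gt0 n; have b1 := rt5_ge1 n.
have /andP[_ N2] := truncn_itv (ltW b0); rewrite -/(Nn n) in N2.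
have mN : (m0 * t <= Nn n)%N by apply: ltnW; rewrite -ltnS -(ltr_nat R) (le_lt_trans hn').
set m := (Nn n %/ t)%N.
have mm : (m0 <= m)%N by rewrite leq_divRL.
have := hm m mm; rewrite muln1 -exprMn.
have bt : rt5 n <= t%:R * m.+1%:R.
  apply: letr (ltW N2) _; rewrite -natrM ler_nat mulnC. by rewrite ltn_ceil.
move=> u; have {}u : rt5 n ^+ 2 * q' ^+ m <= 1.
  apply: letr (ltW u); apply: ler_wpM2r; first exact: exprn_ge0. by rewrite leX2 ?(ltW b0) // mulr_ge0.
have {}u : n.+1%:R ^+ 4 * q ^+ m <= 1 :> R.
  rewrite -rt5_exp -a2 -!exprM -[(32 * 4)%N]/(2 * 64)%N [(64 * m)%N]mulnC !exprM -exprMn.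
  by rewrite exprn_ile1 // mulr_ge0 ?exprn_ge0 // ltW.
rewrite -[leRHS]mul1r ler_pdivlMr ?exprn_gt0 ?ltr0n // mulrAC -exprS; apply: letr u.
apply: ler_wpM2r; first exact: exprn_ge0.
by rewrite ler_weXn2l // ler1n.
Qed.

End Model.

Lemma indic_bool (T : Type) (b : T -> bool) x : \1_[set x | b x] x = (b x)%:R :> R.
rewrite indicE; case: (boolP (b x))=> h; first by rewrite mem_set.
by rewrite memNset //=; exact/negP.
Qed.

(** * Borel-Cantelli and tail sums *)

Section Events.
Context {dd : measure_display} {T : measurableType dd} (P : probability T R).
Implicit Types A B : set T.

Definition pr A : R := fine (P A).

Lemma prE A : measurable A -> P A = (pr A)%:E.
by move=> mA; rewrite /pr fineK // fin_num_measure. Qed.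

Lemma ig_indic A : measurable A -> ig P (\1_A : T -> R).
move=> mA; apply: ig_le (ig_cst P 1); first exact: measurable_indic.
by move=> x; rewrite indicE; case: (_ \in _)=> /=; rewrite ?normr1 ?normr0.
Qed.

Lemma Ex_indic A : measurable A -> Ex P (\1_A : T -> R) = pr A.
by move=> mA; rewrite /Ex /Rintegral integral_indic // setIT. Qed.

Lemma pr_ge0 A : 0 <= pr A. by rewrite /pr fine_ge0. Qed.

Lemma pr_le_sum (I : Type) (s : seq I) A (B : I -> set T) :
  measurable A -> (forall i, measurable (B i)) ->
  (forall w, A w -> has (fun i=> `[< B i w >]) s) -> pr A <= \sum_(i <- s) pr (B i).
move=> mA mB h; rewrite -Ex_indic //.
apply: letr (_ : Ex P (fun w=> \sum_(i <- s) \1_(B i) w) <= _).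
  apply: Ex_le; [exact: ig_indic|by apply: ig_sum=> i; exact: ig_indic|move=> w].
  have g0 (s' : seq I) : 0 <= \sum_(i <- s') (\1_(B i) w : R) by sge0=> i _; rewrite indicE.
  rewrite indicE; case: (boolP (w \in A))=> [|_]; last exact: g0.
  move=> /set_mem /h {h}; elim: s=> //= i s IH /orP[/asboolP k|/IH k]; rewrite big_cons.
    by rewrite {1}indicE mem_set // lerDl.
  by apply: letr k _; rewrite lerDr indicE.
rewrite Ex_sum=> [|i]; last exact: ig_indic.
by lers=> i _; rewrite Ex_indic.
Qed.

Lemma markov_pr (f : T -> R) (x : R) A : measurable A -> ig P f -> (forall w, 0 <= f w) -> 0 < x ->
  (forall w, A w -> x <= f w) -> pr A <= Ex P f / x.
move=> mA hf f0 x0 h; rewrite ler_pdivlMr // mulrC -Ex_indic // -ExZ; last exact: ig_indic.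
apply: Ex_le=> [|//|w]; first exact/igZ/ig_indic.
by rewrite indicE; case: (boolP (w \in A))=> [/set_mem/h|_]; rewrite ?mulr1 ?mulr0.
Qed.

(** The events before [n0], where the majorant may fail, are replaced by the empty set; the limit
    superior is unaffected. *)
Lemma bor_cant (E : nat -> set T) (c : nat -> R) (M : R) :
  (forall n, measurable (E n)) -> evt (fun n=> pr (E n) <= c n) -> (forall n, 0 <= c n) ->
  (forall n, \sum_(0 <= i < n) c i <= M) -> \forall w \ae P, evt (fun n=> ~ E n w).
move=> mE [n0 Ec] c0 cM; pose E' n := if (n0 <= n)%N then E n else set0.
have mE' n : measurable (E' n) by rewrite /E'; case: ifP.
exists (lim_sup_set E'); split.
- apply: bigcap_measurable; first by exists 0%N.
  by move=> n _; apply: bigcup_measurable=> k _.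
- apply: lim_sup_set_cvg0=> //.
  apply: le_lt_trans (_ : (M%:E < +oo)%E); last exact: ltry. apply: lime_le; first exact: is_cvg_nneseries.
  apply: nearW=> n; rewrite (eq_bigr (fun i=> (pr (E' i))%:E))=> [|i _]; last exact: prE.
  rewrite sumEFin lee_fin; apply: letr (cM n); lers=> i _.
  by rewrite /E'; case: ifP=> [/Ec //|_]; rewrite /pr measure0.
move=> w /= h n _ /=; apply: contrapT=> k; apply: h; exists (maxn n n0)=> i.
rewrite geq_max=> /andP[ni n0i] Ei; apply: k; exists i=> //.
by rewrite /E' n0i.
Qed.

Variables (S : finType) (D : T -> S) (mD : forall s, measurable (D @^-1` [set s])).

Lemma meas_finite (F : S -> bool) : measurable [set w | F (D w)].
rewrite (_ : [set w | _] = \bigcup_(s in [set s | F s]) D @^-1` [set s]).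
  by apply: fin_bigcup_measurable=> // ; exact: finite_finset.
by apply/seteqP; split=> w /=; [exists (D w)|move=> [s Fs e]; rewrite e].
Qed.

Lemma pr_finite (F : S -> bool) : pr [set w | F (D w)] = \sum_(s | F s) weight P D s.
have mF := meas_finite F.
rewrite -Ex_indic //; transitivity (Ex P ((fun s=> (F s)%:R) \o D)).
  by apply: eq_Ex=> w; exact: indic_bool.
rewrite (fin_Ex P mD _).2 [RHS]big_mkcond; eqr=> s _.
by case: (F s); rewrite ?mulr1 ?mulr0.
Qed.

End Events.

Section TailSums.
Context {dd : measure_display} {T : measurableType dd} (P : probability T R).
Variables (Y : T -> R) (mY : mfunT Y) (Y0 : forall x, 0 <= Y x).

Lemma meas_gt (a : R) : measurable [set x | a < Y x].
rewrite -[X in measurable X]setTI.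
rewrite (_ : [set x | _] = Y @^-1` `]a, +oo[%classic); first by apply: mY=> //; exact: measurable_itv.
by apply/seteqP; split=> x /=; rewrite in_itv /= andbT.
Qed.

Let ind (a : R) x : \1_[set x | a < Y x] x = (a < Y x)%R%:R :> R.
exact: indic_bool. Qed.

Lemma tail_sum1 n : ig P Y -> \sum_(0 <= i < n) pr P [set x | i.+1%:R < Y x] <= Ex P Y.
move=> iY; have m i := meas_gt i.+1%:R.
rewrite (eq_bigr (fun i=> Ex P (\1_[set x | i.+1%:R < Y x] : T -> R)))=> [|i _]; last by rewrite Ex_indic.
rewrite -Ex_sum=> [|i]; last exact: ig_indic.
apply: Ex_le=> [|//|x]; first by apply: ig_sum=> i; exact: ig_indic.
have [//] : \sum_(0 <= i < n) (\1_[set x | i.+1%:R < Y x] x : R) <= Y x /\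
  \sum_(0 <= i < n) (\1_[set x | i.+1%:R < Y x] x : R) <= n%:R.
elim: n=> [|n [h1 h2]]; first by rewrite big_geq.
rewrite big_nat_recr //= ind -natr1; case: ltP=> k /=; last by rewrite addr0; split=> //; rewrite (letr h2) ?lerDl.
by rewrite lerD2r; split=> //; apply: letr (ltW k); rewrite lerD2r.
Qed.

(** Pointwise: the integers [1, ..., k] with [k < Y x] add up to at most [Y x ^+ 2]. *)
Lemma tail_sum2 n : ig P (fun x=> Y x ^+ 2) ->
  \sum_(0 <= i < n) i.+1%:R * pr P [set x | i.+1%:R < Y x] <= Ex P (fun x=> Y x ^+ 2).
move=> iY; have m i := meas_gt i.+1%:R.
have igi i : ig P (fun x=> i.+1%:R * \1_[set x | i.+1%:R < Y x] x) by exact/igZ/ig_indic.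
rewrite (eq_bigr (fun i=> Ex P (fun x=> i.+1%:R * \1_[set x | i.+1%:R < Y x] x)))=> [|i _]; last first.
  by rewrite ExZ ?Ex_indic //; exact: ig_indic.
rewrite -Ex_sum //; apply: Ex_le=> [|//|x]; first exact: ig_sum.
(* The second bound is carried along because it takes over in the step where the last indicator is
   1. *)
have [//] : \sum_(0 <= i < n) i.+1%:R * (\1_[set x | i.+1%:R < Y x] x : R) <= Y x ^+ 2 /\
  \sum_(0 <= i < n) i.+1%:R * (\1_[set x | i.+1%:R < Y x] x : R) <= n%:R ^+ 2.
elim: n=> [|n [h1 h2]]; first by rewrite big_geq // sqr_ge0 expr0n.
have n0 : 0 <= n%:R :> R by [].
rewrite big_nat_recr //= ind -natr1; case: ltP=> k /=; last by rewrite mulr0 addr0; split=> //; nra.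
have b : n%:R ^+ 2 + (n%:R + 1) * 1 <= (n%:R + 1) ^+ 2 :> R by nra.
have {}h2 := letr (lerD h2 (lexx ((n%:R + 1) * 1))) b.
split=> //; apply: letr h2 _; rewrite leX2 ?addr_ge0 //; exact: ltW.
Qed.

End TailSums.

Section Series.

(* Telescoping against [2 / sqrt n]. *)
Lemma sum_rt5 n : \sum_(0 <= i < n) rt5 i ^- 48 <= 3.
case: n=> [|n]; first by rewrite big_geq.
suff : \sum_(0 <= i < n.+1) rt5 i ^- 48 <= 3 - 2 / sqrt n.+1%:R.
  by move=> h; apply: letr h _; rewrite gerBl divr_ge0 ?sqrtr_ge0.
elim: n=> [|n IH].
  by rewrite big_nat1 -[48%N]/(16 * 3)%N exprM -rt5_sqrt !sqrtr1 expr1n invr1; lra.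
rewrite big_nat_recr //=; apply: letr (lerD IH (lexx _)) _.
rewrite -[48%N]/(16 * 3)%N exprM -rt5_sqrt.
set x := sqrt n.+1%:R; set y := sqrt n.+2%:R.
have x0 : 0 < x by rewrite sqrtr_gt0 ltr0n.
have y0 : 0 < y by rewrite sqrtr_gt0 ltr0n.
have xy : x <= y by rewrite ler_sqrt // ler_nat.
have e : y ^+ 2 = x ^+ 2 + 1 by rewrite !sqr_sqrtr ?ler0n // natr1.
have k : y ^- 3 <= 2 / x - 2 / y.
  have -> : 2 / x - 2 / y = (2 * (y - x) * y ^+ 2 / x) * y ^- 3 by field; rewrite !gt_eqF.
  rewrite ler_peMl ?invr_ge0 ?exprn_ge0 ?(ltW y0) // ler_pdivlMr // mul1r.
  have f : (y - x) * (y + x) = 1 by rewrite -[RHS](addrK (x ^+ 2)) [1 + _]addrC -e; ring.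
  have g : 1 <= (y - x) * (2 * y) by apply: letr (_ : (y - x) * (y + x) <= _); [rewrite f|rewrite ler_wpM2l ?subr_ge0 //; lra].
  apply: letr xy _; have -> : 2 * (y - x) * y ^+ 2 = (y - x) * (2 * y) * y by ring. by rewrite ler_peMl // ltW.
lra.
Qed.

Lemma sum_inv2 n : \sum_(0 <= i < n) i.+1%:R ^- 2 <= 3 :> R.
apply: letr (sum_rt5 n); lers=> i _.
have b1 := rt5_ge1 i; have b0 := rt5_gt0 i.
rewrite -rt5_exp -exprM lef_pV2 ?posrE ?exprn_gt0 //.
exact: ler_weXn2l.
Qed.

End Series.

(** * Large entries of the infinite array *)

Section ArrayEvents.
Variables (d r : nat) (theta : nat -> 'I_r) (mu : 'I_r -> 'I_r -> probability (cvec2 R d) R)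
  (nu : 'I_r -> probability (cvec R d) R) (mu_law : forall a b, offdiag_law (mu a b))
  (nu_law : forall a, diag_law (nu a)) (dO : measure_display) (Om : measurableType dO) (P : probability Om R)
  (xi : nat -> nat -> 'I_d -> Om -> R[i]) (xi_model : array_model xi P theta mu nu).

Let mV i j : (i < j)%N -> mfunT (pairV xi i j).
by move=> ij; have [/(_ _ _ ij)[]] := xi_model. Qed.
Let lawV i j : (i < j)%N -> forall U, measurable U -> P (pairV xi i j @^-1` U) = mu (theta i) (theta j) U.
by move=> ij; have [/(_ _ _ ij)[]] := xi_model. Qed.
Let mW i : mfunT (diagW xi i).
by have [_ /(_ i)[]] := xi_model. Qed.
Let lawW i : forall U, measurable U -> P (diagW xi i @^-1` U) = nu (theta i) U.
by have [_ /(_ i)[]] := xi_model. Qed.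

Let mpre i j U : (i < j)%N -> measurable U -> measurable (pairV xi i j @^-1` U).
by move=> ij mU; rewrite -[X in measurable X]setTI; exact: (mV ij). Qed.

Definition omn n (w : Om) : {ffun 'I_n.+1 * 'I_n.+1 -> Sn d n} :=
  [ffun e : 'I_n.+1 * 'I_n.+1=> if (e.1 < e.2)%N then disc (taun n) (hn n) (pairV xi e.1 e.2 w) else sn0 d n].

Notation wtn n := (wt (sn0 d n) (@wn d r mu theta n)).
Let site := (nat * nat)%type.

Let site_event n (o : {ffun 'I_n.+1 * 'I_n.+1 -> Sn d n}) (e : site) : set Om :=
  pairV xi e.1 e.2 @^-1` (disc (taun n) (hn n) @^-1` [set o (inord e.1, inord e.2)]).

Let m_disc n s := @meas_disc d (taun n) (hn n) s.

Let omn_pre n o : omn n @^-1` [set o] =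
  if [forall e : 'I_n.+1 * 'I_n.+1, (e.1 < e.2)%N || (o e == sn0 d n)]
  then \big[setI/setT]_(e <- [seq (e.1 : nat, e.2 : nat) | e : 'I_n.+1 * 'I_n.+1 <- enum {: 'I_n.+1 * 'I_n.+1} & (e.1 < e.2)%N]) site_event o e
  else set0.
case: ifPn=> [/forallP h|]; last first.
  move=> /forallPn[e]; rewrite negb_or=> /andP[e1 e2]; apply/seteqP; split=> w //=.
  by move=> eo; rewrite -eo ffunE (negbTE e1) eqxx in e2.
rewrite big_map big_filter -bigcap_seq_cond; apply/seteqP; split=> w /=.
  move=> <- e /= /andP[_ e12]; rewrite /site_event /preimage /= !inord_val.
  by rewrite ffunE -surjective_pairing /= e12.
move=> k; apply/ffunP=> e; rewrite ffunE; case: ifPn=> e12.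
  by have := k e; rewrite /= mem_enum e12 /site_event /preimage /= !inord_val -surjective_pairing; apply.
by have := h e; rewrite (negbTE e12) /= => /eqP ->.
Qed.

Lemma meas_omn n o : measurable (omn n @^-1` [set o]).
rewrite omn_pre; case: ifP=> // _; rewrite big_map big_filter.
apply: bigsetI_measurable=> e e12; exact: mpre.
Qed.

(** By independence of the pairs above the diagonal, the discretized corner has the product law of
    the model; frozen sites contribute a point mass. *)
Lemma omn_weight n o : weight P (omn n) o = cweight (wtn n) o.
rewrite /weight omn_pre /cweight; case: ifPn=> [/forallP h|]; last first.
  move=> /forallPn[e]; rewrite negb_or=> /andP[e1 e2].
  by rewrite measure0 (bigD1 e) //= /wt (negbTE e1) (negbTE e2) mul0r.
have [_ _ ind] := xi_model.
rewrite ind; last 2 first.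
- rewrite map_inj_in_uniq=> [|[i j] [i' j'] _ _ [/val_inj -> /val_inj ->] //].
  exact/filter_uniq/enum_uniq.
- move=> e /mapP[[i j]]; rewrite mem_filter /= => /andP[ij _] ->; split=> /=; first exact: ltnW.
  rewrite ij; exists (disc (taun n) (hn n) @^-1` [set o (inord i, inord j)]); first exact: m_disc.
  by rewrite setTI.
rewrite big_map big_filter.
rewrite (eq_bigr (fun e : 'I_n.+1 * 'I_n.+1=> (wtn n e (o e))%:E))=> [|[i j] /= ij]; last first.
  rewrite /wt /= ij /wn /dw /weight /site_event /= !inord_val lawV //; last exact: m_disc.
  by rewrite fineK // fin_num_measure //; exact: m_disc.
rewrite -(big_morph EFin EFinM erefl) /= big_enum_cond /= big_mkcond /=; eqr=> e _.
case: ifPn=> // e12; have := h e; rewrite /wt (negbTE e12) /= => ->; by [].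
Qed.

Lemma pr_omn n (F : {ffun 'I_n.+1 * 'I_n.+1 -> Sn d n} -> bool) : pr P [set w | F (omn n w)] = fprob (sn0 d) (@wn d r mu theta) F.
rewrite (pr_finite P (@meas_omn n)) /fprob; eqr=> o _; exact: omn_weight.
Qed.

Definition rho i j w : R := sqnorm2 (pairV xi i j w).

Lemma meas_rho_gt i j a : (i < j)%N -> measurable [set w | a < rho i j w].
by move=> ij; exact: (mpre ij (meas_gt (@msqnorm2 d) a)). Qed.

Let pr_rho i j a : (i < j)%N ->
  pr P [set w | a < rho i j w] = pr (mu (theta i) (theta j)) [set v | a < sqnorm2 v].
by move=> ij; rewrite /pr -(lawV ij) //; exact: meas_gt (@msqnorm2 d) a.
Qed.

Let tail_le j i' i a : (i' < i)%N -> pr P [set w | a < rho i' i w] <=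
  \sum_a' \sum_b' pr (mu a' b') [set v | a < sqnorm2 v] + 0 * j%:R.
move=> ij; rewrite mul0r addr0 pr_rho // (bigD1 (theta i')) //= (bigD1 (theta i)) //= -addrA lerDl.
by apply: addr_ge0; [|sge0=> a' _]; sge0=> b' _; exact: pr_ge0.
Qed.

Let scaled (D : R) : 0 < D -> forall i (f : R), (i.+1%:R * D < f) = (i.+1%:R < f / D).
by move=> D0 i f; rewrite ltr_pdivlMr. Qed.

(** The fourth moment enters here: column [j] has [j] entries above the diagonal, and the sum over
    [j] of [j] times the probability of exceeding [j D] is finite by [tail_sum2]. *)
Lemma offdiag_small (D : R) : 0 < D ->
  \forall w \ae P, evt (fun j=> forall i, (i < j)%N -> rho i j w <= j.+1%:R * D).
move=> D0; pose E j := \bigcup_(i in [set i | (i < j)%N]) [set w | j.+1%:R * D < rho i j w].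
pose c j := j.+1%:R * \sum_a' \sum_b' pr (mu a' b') [set v | j.+1%:R < sqnorm2 v / D].
pose Y (v : cvec2 R d) := sqnorm2 v / D.
have mY : mfunT Y by apply: measurable_funM=> //; exact: msqnorm2.
have Y0 v : 0 <= Y v by rewrite divr_ge0 ?(ltW D0) // sqn2_ge0.
have mE j : measurable (E j) by apply: bigcup_measurable=> i /= ij; exact: meas_rho_gt.
have s0 j : 0 <= \sum_a' \sum_b' pr (mu a' b') [set v | j.+1%:R < sqnorm2 v / D].
  by sge0=> a' _; sge0=> b' _; exact: pr_ge0.
have Y2 a b : ig (mu a b) (fun v=> Y v ^+ 2).
  apply: (ig_eq (f := fun v=> D ^- 2 * sqnorm2 v ^+ 2))=> [v|]; first by rewrite /Y exprMn exprVn mulrC.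
  by apply: igZ; exact: sqn_ig2.
suff : \forall w \ae P, evt (fun j=> ~ E j w).
  apply: filterS=> w; apply: evtS=> j h i ij; rewrite leNgt; apply/negP=> k; apply: h. by exists i.
apply: (@bor_cant _ _ _ _ c (\sum_a' \sum_b' Ex (mu a' b') (fun v=> Y v ^+ 2)))=> //.
- apply: evt_true=> j.
  pose B i := if (i < j)%N then [set w | j.+1%:R * D < rho i j w] else set0.
  apply: letr (_ : \sum_(i <- iota 0 j) pr P (B i) <= _).
    apply: pr_le_sum=> // [i|w [i /= ij h]].
      by rewrite /B; case: ifP=> // ij; exact: meas_rho_gt.
    by apply/hasP; exists i; [rewrite mem_iota|apply/asboolP; rewrite /B ij].
  apply: letr (_ : \sum_(i <- iota 0 j) (\sum_a' \sum_b' pr (mu a' b') [set v | j.+1%:R < sqnorm2 v / D]) <= _).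
    rewrite big_seq [leRHS]big_seq; lers=> i; rewrite mem_iota /= => ij; rewrite /B ij.
    apply: letr (tail_le 0 _ ij) _; rewrite mul0r addr0; lers=> a' _; lers=> b' _.
    rewrite (_ : [set v | _] = [set v : cvec2 R d | j.+1%:R < sqnorm2 v / D]) //.
    by apply/funext=> v /=; rewrite scaled.
  rewrite big_const_seq count_predT size_iota iter_addr_0 -[leLHS]mulr_natl /c. by apply: ler_wpM2r; rewrite ?ler_nat.
- by move=> j; rewrite mulr_ge0.
move=> n; rewrite /c; under eq_bigr do rewrite mulr_sumr; rewrite exchange_big /=.
lers=> a' _; under eq_bigr do rewrite mulr_sumr; rewrite exchange_big /=.
by lers=> b' _; exact: (@tail_sum2 _ _ (mu a' b') Y mY Y0 n (Y2 a' b')).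
Qed.

(** There is one diagonal vector per index, so the second moment suffices, through [tail_sum1]. *)
Lemma diag_small (D : R) : 0 < D ->
  \forall w \ae P, evt (fun i=> sqnorm (diagW xi i w) <= i.+1%:R * D).
move=> D0; pose Y (v : cvec R d) := sqnorm v / D.
have ms : mfunT (@sqnorm R d).
  rewrite (_ : @sqnorm R d = (@sqnorm2 R d) \o (fun v=> (v, [tuple 0 | k < d]))); last first.
    apply/funext=> v /=; rewrite /sqnorm2 /= -[LHS]addr0; congr (_ + _).
    by rewrite /sqnorm big1 // => k _; rewrite tnth_mktuple Normc.normc0 expr0n.
  apply: measurableT_comp; first exact: msqnorm2. exact: measurable_fun_pair.
have s0 v : 0 <= @sqnorm R d v by sge0=> k _; exact: sqr_ge0.
have mY : mfunT Y by exact: measurable_funM.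
have Y0 v : 0 <= Y v by rewrite divr_ge0 ?(ltW D0).
have Yi a : ig (nu a) Y.
  apply: (ig_eq (f := fun v=> D^-1 * sqnorm v))=> [v|]; first by rewrite mulrC.
  by apply: igZ; apply: ig_ge0 ms s0 (nu_law a).2.
pose E i := [set w | i.+1%:R * D < sqnorm (diagW xi i w)].
have mU i : measurable [set v : cvec R d | i.+1%:R * D < sqnorm v] by exact: meas_gt.
have mE i : measurable (E i) by have := mW i measurableT (mU i); rewrite setTI.
suff : \forall w \ae P, evt (fun i=> ~ E i w).
  by apply: filterS=> w; apply: evtS=> i /negP; rewrite -leNgt.
apply: (@bor_cant _ _ _ _ (fun i=> \sum_a pr (nu a) [set v | i.+1%:R < Y v]) (\sum_a Ex (nu a) Y))=> //.
- apply: evt_true=> i; have -> : pr P (E i) = pr (nu (theta i)) [set v | i.+1%:R * D < sqnorm v] by congr fine; exact: lawW.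
  rewrite (bigD1 (theta i)) //= -[leLHS]addr0; apply: lerD.
    rewrite (_ : [set v | _] = [set v : cvec R d | i.+1%:R < Y v]) //. by apply/funext=> v /=; rewrite scaled.
  by sge0=> a _; exact: pr_ge0.
- by move=> i; sge0=> a _; exact: pr_ge0.
move=> n; rewrite exchange_big /=; lers=> a _; exact: tail_sum1.
Qed.

Definition nkey (i j : nat) : site := (minn i j, maxn i j).
Definition big_site a (e : site) w := a < rho e.1 e.2 w.

Let nkeyP i j : i != j -> ((nkey i j).1 < (nkey i j).2)%N.
by rewrite /nkey /=; lia. Qed.

Let pr_two J i j j' : i != j -> i != j' -> j != j' ->
  pr P ([set w | big_site (taun J ^+ 2) (nkey i j) w] `&` [set w | big_site (taun J ^+ 2) (nkey i j') w])
    <= (kap mu) ^+ 2 * rt5 J ^- 112.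
move=> ij ij' jj'; have [_ _ ind] := xi_model.
pose T := [set v : cvec2 R d | taun J ^+ 2 < sqnorm2 v].
have mT : measurable T by exact: meas_gt (@msqnorm2 d) _.
pose E (e : site) := pairV xi e.1 e.2 @^-1` T.
have e12 : nkey i j != nkey i j' by apply/negP=> /eqP[]; lia.
have k1 := nkeyP ij; have k2 := nkeyP ij'.
have mE e : (e.1 < e.2)%N -> measurable (E e) by move=> h; exact: mpre.
have pE e : (e.1 < e.2)%N -> pr P (E e) <= kap mu * rt5 J ^- 56.
  move=> h; have -> : pr P (E e) = pr (mu (theta e.1) (theta e.2)) T by exact: pr_rho.
  apply: letr (markov_pr (x := rt5 J ^+ 56) mT (sqn_ig2 (mu_law _ _)) _ _ _) _.
  - by move=> v; exact: sqr_ge0.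
  - by rewrite exprn_gt0 // rt5_gt0.
  - move=> v; rewrite /T /= /taun -exprM=> k.
    rewrite -[56%N]/(28 * 2)%N exprM leX2 ?exprn_ge0 ?(ltW (rt5_gt0 _)) ?sqn2_ge0 //. exact: ltW.
  by rewrite ler_wpM2r ?invr_ge0 ?exprn_ge0 ?(ltW (rt5_gt0 _)) //; exact: kapP.
have -> : pr P (E (nkey i j) `&` E (nkey i j')) = pr P (E (nkey i j)) * pr P (E (nkey i j')).
  have := ind [:: nkey i j; nkey i j'] E; rewrite !big_cons !big_nil setIT mule1=> h; rewrite [LHS]/pr h.
  - by rewrite (prE _ (mE _ k1)) (prE _ (mE _ k2)).
  - by rewrite /= inE e12.
  by move=> e; rewrite !inE=> /orP[]/eqP ->; (split; [exact: ltnW|rewrite ?k1 ?k2; exists T=> //; rewrite setTI]).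
apply: letr (ler_pM (pr_ge0 _ _) (pr_ge0 _ _) (pE _ k1) (pE _ k2)) _.
by rewrite -expr2 exprMn -exprVn -exprM exprVn.
Qed.

(** Events are grouped by their largest index [J], which makes one Borel-Cantelli argument cover the
    whole array: about [J^2] triples, each of probability [O(rt5 J ^- 112)] by independence of
    distinct pairs. *)
Lemma big_isolated : \forall w \ae P, evt (fun J=> forall i j j', maxn i (maxn j j') = J ->
  i != j -> i != j' -> j != j' ->
  ~ (big_site (taun J ^+ 2) (nkey i j) w /\ big_site (taun J ^+ 2) (nkey i j') w)).
pose B J i j j' := if [&& i != j, i != j' & j != j'] then
  [set w | big_site (taun J ^+ 2) (nkey i j) w] `&` [set w | big_site (taun J ^+ 2) (nkey i j') w] else set0.
have mB J i j j' : measurable (B J i j j').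
  rewrite /B; case: ifP=> // /and3P[ij ij' jj']. by apply: measurableI; apply: meas_rho_gt; exact: nkeyP.
(* The largest index is the common index [i] (flag [true]) or, by the symmetry between [j] and [j'],
   the index [j]. *)
pose Bt J (t : bool * (nat * nat)) := if t.1 then B J J t.2.1 t.2.2 else B J t.2.1 J t.2.2.
pose s J := [seq (b, uv) | b <- [:: true; false], uv <- [seq (u, v) | u <- iota 0 J.+1, v <- iota 0 J.+1]].
pose E J := \big[setU/set0]_(t <- s J) Bt J t.
have mBt J t : measurable (Bt J t) by rewrite /Bt; case: ifP.
have EP J w : E J w <-> has (fun t=> `[< Bt J t w >]) (s J).
  rewrite /E; elim: (s J)=> [|t l IH]; first by rewrite big_nil.
  rewrite big_cons /=; split=> [[/asboolP ->//|/IH ->]|/orP[/asboolP|/IH]]; first by rewrite orbT.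
    by left.
  by right.
have mE J : measurable (E J) by apply: bigsetU_measurable.
suff : \forall w \ae P, evt (fun J=> ~ E J w).
  apply: filterS=> w; apply: evtS=> J nE i j j' mJ ij ij' jj' [b1 b2]; apply: nE; apply/EP.
  have mem t : t.2.1 \in iota 0 J.+1 -> t.2.2 \in iota 0 J.+1 -> t \in s J.
    case: t=> b [u v] hu hv; apply/allpairsP; exists (b, (u, v)); split; [by rewrite !inE; case: (b)| |by []].
    by apply/allpairsP; exists (u, v); split; [exact: hu|exact: hv|].
  case: (eqVneq i J)=> [iJ|iJ].
    apply/hasP; exists (true, (j, j')); first by apply: mem; rewrite mem_iota /=; lia.
    by apply/asboolP; rewrite -iJ in b1 b2 *; rewrite /Bt /B /= ij ij' jj'.
  case: (eqVneq j J)=> [jJ|jJ].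
    apply/hasP; exists (false, (i, j')); first by apply: mem; rewrite mem_iota /=; lia.
    by apply/asboolP; rewrite -jJ in b1 b2 *; rewrite /Bt /B /= ij ij' jj'.
  have j'J : j' = J by lia. apply/hasP; exists (false, (i, j)); first by apply: mem; rewrite mem_iota /=; lia.
  by apply/asboolP; rewrite -j'J in b1 b2 *; rewrite /Bt /B /= ij ij' [j' == j]eq_sym jj'.
pose c J : R := 2 * kap mu ^+ 2 * rt5 J ^- 48.
have k20 : 0 <= 2 * kap mu ^+ 2 by rewrite mulr_ge0 // sqr_ge0.
have c1 J : 0 <= kap mu ^+ 2 * rt5 J ^- 112.
  by rewrite mulr_ge0 ?sqr_ge0 // invr_ge0 exprn_ge0 // ltW // rt5_gt0.
apply: (@bor_cant _ _ _ _ c (2 * kap mu ^+ 2 * 3))=> //.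
- apply: evt_true=> J; apply: letr (_ : \sum_(t <- s J) pr P (Bt J t) <= _).
    by apply: pr_le_sum=> // w /EP.
  apply: letr (_ : \sum_(t <- s J) kap mu ^+ 2 * rt5 J ^- 112 <= _).
    lers=> t _; rewrite /Bt /B.
    by case: t.1; case: ifP=> [/and3P[? ? ?]|_]; [exact: pr_two|rewrite /pr measure0|exact: pr_two|rewrite /pr measure0].
  rewrite big_const_seq count_predT /s size_allpairs size_allpairs !size_iota iter_addr_0.
  rewrite -[leLHS]mulr_natl natrM natrM -rt5_exp /c.
  rewrite [leLHS](_ : _ = 2 * kap mu ^+ 2 * (rt5 J ^+ 32 * rt5 J ^+ 32 * rt5 J ^- 112)); last by rewrite /=; ring.
  rewrite ler_wpM2l // -exprD. have -> : rt5 J ^+ 112 = rt5 J ^+ (32 + 32) * rt5 J ^+ 48 by rewrite -exprD.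
  rewrite invfM mulrA divff ?mul1r // gt_eqF //. by rewrite exprn_gt0 // rt5_gt0.
- by move=> J; rewrite mulr_ge0 // invr_ge0 exprn_ge0 // ltW // rt5_gt0.
by move=> n; rewrite -mulr_sumr ler_wpM2l // sum_rt5.
Qed.

End ArrayEvents.

(** * Comparison of the array with its discretized model *)

Section Schur.

Lemma weighted_cs (I : finType) (a b : I -> R) : (forall i, 0 <= a i) ->
  (\sum_i a i * b i) ^+ 2 <= (\sum_i a i) * \sum_i a i * b i ^+ 2.
move=> a0.
have : 0 <= \sum_i \sum_j a i * a j * (b i - b j) ^+ 2.
  by sge0=> i _; sge0=> j _; rewrite mulr_ge0 ?sqr_ge0 ?mulr_ge0.
have -> : \sum_i \sum_j a i * a j * (b i - b j) ^+ 2 =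
    (\sum_i a i * b i ^+ 2) * (\sum_i a i) + (\sum_i a i) * (\sum_i a i * b i ^+ 2)
    - 2 * ((\sum_i a i * b i) * (\sum_i a i * b i)).
  rewrite !big_distrlr /= mulr_sumr -sumrN -!big_split /=; eqr=> i _.
  rewrite mulr_sumr -sumrN -!big_split /=; eqr=> j _; ring.
by rewrite expr2; lra.
Qed.

Lemma op_schur n (M : 'M[C]_n.+1) (c : R) : 0 <= c ->
  (forall i, \sum_j normc (M i j) <= c) -> (forall j, \sum_i normc (M i j) <= c) -> opnorm M <= c.
move=> c0 row col; apply: op_le=> // v.
rewrite -(ler_pXn2r (n := 2)) ?nnegrE ?mulr_ge0 ?l2_ge0 // exprMn !l2norm_sqr.
apply: letr (_ : \sum_i c * \sum_j normc (M i j) * normc (v j 0) ^+ 2 <= _).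
  lers=> i _; apply: letr (_ : (\sum_j normc (M i j) * normc (v j 0)) ^+ 2 <= _).
    rewrite leX2 ?nc_ge0 ?sumr_ge0 // => [j _|]; first by rewrite mulr_ge0 ?nc_ge0.
    by rewrite mxE; apply: letr (nc_sum _ _ _) _; lers=> j _; rewrite ncM.
  apply: letr (weighted_cs _ _) _=> [j|]; first exact: nc_ge0.
  by rewrite ler_wpM2r ?row // sumr_ge0 // => j _; rewrite mulr_ge0 ?nc_ge0 ?sqr_ge0.
rewrite -mulr_sumr expr2 -mulrA ler_wpM2l // exchange_big /= mulr_sumr; lers=> j _.
by rewrite -mulr_suml ler_wpM2r ?sqr_ge0 // col.
Qed.

(** Passes from a threshold for each index to the threshold [v n] for all indices up to [n]:
    finitely many indices escape the eventual statement, and [v n] outgrows what they require. *)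
Lemma evt_uniform (Q : nat -> R -> Prop) (v : nat -> R) :
  (forall j x y, x <= y -> Q j x -> Q j y) -> (forall j, exists x, Q j x) ->
  (forall i j, (i <= j)%N -> v i <= v j) -> (forall x, evt (fun n=> x <= v n)) ->
  evt (fun j=> Q j (v j)) -> evt (fun n=> forall j, (j <= n)%N -> Q j (v n)).
move=> Qm Qe vm vinf [j0 h].
have [x hx] : exists x, forall j, (j < j0)%N -> Q j x.
  elim: j0 {h} => [|j0 [x hx]]; first by exists 0.
  have [y hy] := Qe j0; exists (Num.max x y)=> j; rewrite ltnS leq_eqVlt=> /orP[/eqP ->|jj].
    by apply: Qm hy; rewrite le_max lexx orbT.
  by apply: Qm (hx j jj); rewrite le_max lexx.
apply: evtS (vinf x)=> n xn j jn.
case: (ltnP j j0)=> jj; first exact: Qm xn (hx j jj).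
exact: Qm (vm _ _ jn) (h j jj).
Qed.

Lemma sum_bool_le1 (I : finType) (b : I -> bool) : (forall i j, b i -> b j -> i = j) ->
  \sum_i (b i)%:R <= 1 :> R.
move=> h; case: (pickP b)=> [i bi|b0]; last by rewrite big1 // => i _; rewrite b0.
rewrite (bigD1 i) //= bi big1 ?addr0 // => j ji; case: (boolP (b j))=> // bj.
by rewrite (h _ _ bi bj) eqxx in ji.
Qed.

End Schur.

Section Comparison.
Variables (d r : nat) (theta : nat -> 'I_r) (mu : 'I_r -> 'I_r -> probability (cvec2 R d) R)
  (nu : 'I_r -> probability (cvec R d) R) (mu_law : forall a b, offdiag_law (mu a b))
  (nu_law : forall a, diag_law (nu a)) (dO : measure_display) (Om : measurableType dO) (P : probability Om R)
  (xi : nat -> nat -> 'I_d -> Om -> R[i]) (xi_model : array_model xi P theta mu nu).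
Notation crd := (bool * ('I_d * bool))%type.

Definition model_mx n (k : 'I_d) w : 'M[C]_n.+1 :=
  Xmx (@Gn d r mu theta n) (k, false) (omn xi n w).

Let eta n : R := (kap mu + 2) / taun n ^+ 2.

Let k0 : 0 <= kap mu. exact: kap_ge0. Qed.
Let t0 n : 0 < taun n. exact: lt_le_trans (taun_ge1 n). Qed.
Let eta0 n : 0 <= eta n. by rewrite divr_ge0 ?addr_ge0 // exprn_ge0 // ltW. Qed.

Let selB b (x : 'I_d * bool) (c c' : crd -> R) : sel b x c - sel b x c' = sel b x (fun e=> c e - c' e).
by rewrite /sel !rmorphB /=; ring. Qed.

Let sel_le b (x : 'I_d * bool) (c : crd -> R) (D : R) : (forall e, `|c e| <= D) -> normc (sel b x c) <= 2 * D.
move=> h; rewrite mulr_natl mulr2n; apply: letr (le_normcD _ _) _; apply: lerD;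
  by rewrite ?ncM ?norm_unit ?mul1r normcR.
Qed.

Let entry_le n a a' (v : cvec2 R d) b (k : 'I_d) (z : C) :
  (forall b', rcoord2 (b, (k, b')) v = part b' z) ->
  normc (z - sel b (k, false) (cn_ mu a a' (disc (taun n) (hn n) v))) <=
    2 * eta n + (if taun n ^+ 2 < sqnorm2 v then sqrt (sqnorm2 v) else 0).
move=> zE; have -> : z = sel b (k, false) (fun e=> rcoord2 e v) by rewrite (sel_part (z := z)).
have m e := @dmean_le d _ _ (taun_ge1 n) (hn_gt0 n) (hn_taun n) (mu a a') _ (mu_law a a') (kapP mu_law a a') e.
have me e : `|dmean (taun n) (hn n) (mu a a') e| <= eta n.
  by apply: letr (m e) _; apply: ler_wpM2r; [by rewrite invr_ge0 exprn_ge0 // ltW|lra].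
case: ltP=> vt.
  have -> : sel b (k, false) (cn_ mu a a' (disc (taun n) (hn n) v)) =
      sel b (k, false) (fun e=> - dmean (taun n) (hn n) (mu a a') e).
    by rewrite /sel /cn_ /dcen !dval_out // !sub0r.
  rewrite [_ + sqrt _]addrC; apply: letr (le_normcD _ _) _; apply: lerD; last first.
    by rewrite normcN; apply: sel_le=> e; rewrite normrN.
  rewrite (sel_part (z := z)) //= -[leLHS]ger0_norm ?nc_ge0 //. apply: sqr_abs; first exact: sqrtr_ge0.
  rewrite sqr_sqrtr ?sqn2_ge0 // normc_sqr sqnorm2E.
  rewrite (bigD1 (b, (k, true))) //= (bigD1 (b, (k, false))) //= ?xpair_eqE ?andbF //.
  by rewrite !zE /part /= addrA lerDl sumr_ge0 // => e _; exact: sqr_ge0.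
rewrite addr0 selB; apply: sel_le=> e; rewrite /cn_ /dcen opprB addrCA.
rewrite addrC; apply: letr (ler_normD _ _) _.
have -> : eta n = taun n ^- 2 + (kap mu + 1) / taun n ^+ 2 by rewrite /eta; field; rewrite gt_eqF.
rewrite lerD ?m //; apply: letr _ (hn_taun n).
by rewrite distrC; exact: (dval_in (taun_ge1 n) (hn_gt0 n) e vt).
Qed.

Let big n w (i j : nat) := (i != j) && `[< big_site xi (taun n ^+ 2) (nkey i j) w >].

Let big_sym n w i j : big n w i j = big n w j i.
by rewrite /big eq_sym /nkey minnC maxnC. Qed.

(** The large error, [sqrt n.+1%:R * D], occurs only on the diagonal and at truncated sites: at most
    two places in a row once the latter are isolated. *)
Let diff_entry n w (k : 'I_d) (D : R) (i j : 'I_n.+1) : 0 <= D ->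
  (forall u v, (u < v)%N -> (v <= n)%N -> rho xi u v w <= n.+1%:R * D ^+ 2) ->
  (forall u, (u <= n)%N -> sqnorm (diagW xi u w) <= n.+1%:R * D ^+ 2) ->
  normc ((corner xi n.+1 k w - model_mx n k w) i j) <=
    s_ n * (2 * eta n + (sqrt n.+1%:R * D) * ((i == j)%:R + (big n w i j)%:R)).
move=> D0 offd diag.
have sq (x : R) : x <= n.+1%:R * D ^+ 2 -> sqrt x <= sqrt n.+1%:R * D.
  move=> h; rewrite -[D]ger0_norm // -sqrtr_sqr -sqrtrM // ler_sqrt //. by rewrite mulr_ge0 // sqr_ge0.
have sD0 : 0 <= sqrt n.+1%:R * D by rewrite mulr_ge0 ?sqrtr_ge0.
have s0 : 0 <= s_ n by rewrite invr_ge0 sqrtr_ge0.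
have e2 : 0 <= 2 * eta n by rewrite mulr_ge0.
have -> : (corner xi n.+1 k w - model_mx n k w) i j = (s_ n)%:C *
    (xi i j k w - (if i == j then 0 else Gn mu theta (k, false) i j (omn xi n w (key i j)))).
  by rewrite !mxE -/(s_ n) mulrBr.
rewrite ncM normcR [`|s_ n|]ger0_norm //; apply: ler_wpM2l=> //.
case: (ltngtP i j)=> [ij|ij|/val_inj ij].
- have nij : i != j by rewrite neq_ltn ij.
  rewrite (negbTE nij) /Gn ij /key ij ffunE /= ij add0r /selp /=.
  apply: letr (entry_le _ _ _ (z := xi i j k w) _) _=> [b'|].
    by rewrite /rcoord2 /rcoord /= tnth_mktuple.
  rewrite lerD2l /big /nkey (minn_idPl (ltnW ij)) (maxn_idPr (ltnW ij)) nij /=.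
  case: ltP=> vt; last by rewrite mulr_ge0.
  rewrite (asboolT (vt : big_site xi (taun n ^+ 2) (i : nat, j : nat) w)) mulr1; apply: sq.
  by apply: offd=> //; rewrite -ltnS.
- have nij : i != j by rewrite neq_ltn ij orbT.
  rewrite (negbTE nij) /Gn (ltnNge i) (ltnW ij) /key (ltnNge i) (ltnW ij) /= ffunE /= ij add0r /selm /=.
  apply: letr (entry_le _ _ _ (z := xi i j k w) _) _=> [b'|].
    by rewrite /rcoord2 /rcoord /= tnth_mktuple.
  rewrite lerD2l /big /nkey (minn_idPr (ltnW ij)) (maxn_idPl (ltnW ij)) nij /=.
  case: ltP=> vt; last by rewrite mulr_ge0.
  rewrite (asboolT (vt : big_site xi (taun n ^+ 2) (j : nat, i : nat) w)) mulr1; apply: sq.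
  by apply: offd=> //; rewrite -ltnS.
rewrite -ij eqxx subr0; apply: letr (_ : sqrt n.+1%:R * D <= _); last first.
  by rewrite -[leLHS]add0r lerD // -[leLHS]mulr1 ler_wpM2l // lerDl.
apply: letr (sq _ (diag i _)); last by rewrite -ltnS.
rewrite -[leLHS]ger0_norm ?nc_ge0 //; apply: sqr_abs; first exact: sqrtr_ge0.
rewrite sqr_sqrtr; last by sge0=> k' _; exact: sqr_ge0.
by rewrite /sqnorm (bigD1 k) //= tnth_mktuple lerDl sumr_ge0 // => k' _; exact: sqr_ge0.
Qed.

Let rt5_mono i j : (i <= j)%N -> rt5 i <= rt5 j.
move=> ij; rewrite /rt5; elim: 5%N=> [|k IH] /=; first by rewrite ler_nat.
by rewrite ler_wsqrtr.
Qed.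

Let n_large (x : R) : evt (fun n=> x <= n.+1%:R).
apply: evtS (rt5_large x)=> n h; apply: letr h _; rewrite -rt5_exp.
by rewrite exprS ler_peMr ?(ltW (rt5_gt0 n)) // expr_ge1 ?rt5_ge1 // ltW // rt5_gt0.
Qed.

Let t2_large (x : R) : evt (fun n=> x <= taun n ^+ 2).
apply: evtS (rt5_large x)=> n h; apply: letr h _; rewrite /taun -exprM.
by rewrite exprS ler_peMr ?(ltW (rt5_gt0 n)) // expr_ge1 ?rt5_ge1 // ltW // rt5_gt0.
Qed.

Let rho_bound w j : exists x, forall u v, (u < v)%N -> (v <= j)%N -> rho xi u v w <= x.
exists (\sum_(v < j.+1) \sum_(u < j.+1) rho xi u v w)=> u v uv vj.
have vl : (v < j.+1)%N by rewrite ltnS.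
have ul : (u < j.+1)%N by apply: leq_trans uv _; apply: leqW.
have p (a b : nat) : 0 <= rho xi a b w by exact: sqn2_ge0.
rewrite (bigD1 (Ordinal vl)) //= (bigD1 (Ordinal ul)) //= -addrA lerDl.
by apply: addr_ge0; [|sge0=> a _]; sge0=> b _.
Qed.

(** Schur's test. After division by [sqrt (n+1)], a row contributes at most [2 D] from the diagonal
    and its single truncated entry, and [2 eta sqrt (n+1) <= 2 D] from the rest, with [4 D <= e].
    [D] runs over reciprocals of integers so that countably many events are intersected. *)
Lemma corner_close : \forall w \ae P, forall (k : 'I_d) (e : R), 0 < e ->
  evt (fun n=> opnorm (corner xi n.+1 k w - model_mx n k w) <= e).
pose Dk (m : nat) : R := m.+1%:R^-1.
have D0 m : 0 < Dk m by rewrite invr_gt0 ltr0n.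
have D20 m : 0 < Dk m ^+ 2 by rewrite exprn_gt0.
have H1 : \forall w \ae P, forall m, evt (fun j=> forall i, (i < j)%N -> rho xi i j w <= j.+1%:R * Dk m ^+ 2).
  by apply: ae_foralln=> m; exact: (offdiag_small mu_law xi_model).
have H2 : \forall w \ae P, forall m, evt (fun i=> sqnorm (diagW xi i w) <= i.+1%:R * Dk m ^+ 2).
  by apply: ae_foralln=> m; exact: (diag_small nu_law xi_model).
have H3 := big_isolated mu_law xi_model.
apply: filterS3 H1 H2 H3=> w h1 h2 h3 k e e0.
have [m hm] : exists m, 4 * Dk m <= e.
  exists (Num.bound (4 / e)); rewrite /Dk ler_pdivrMr ?ltr0n // mulrC -ler_pdivrMr //.
  apply: ltW; apply: lt_trans (archi_boundP _) _; first by rewrite divr_ge0 // ltW. by rewrite ltr_nat.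
have vm i j : (i <= j)%N -> i.+1%:R * Dk m ^+ 2 <= j.+1%:R * Dk m ^+ 2.
  by move=> ij; rewrite ler_wpM2r ?(ltW (D20 m)) // ler_nat.
have vinf x : evt (fun n=> x <= n.+1%:R * Dk m ^+ 2).
  by apply: evtS (n_large (x / Dk m ^+ 2))=> n; rewrite ler_pdivrMr.
have G1 : evt (fun n=> forall j, (j <= n)%N -> forall u, (u < j)%N -> rho xi u j w <= n.+1%:R * Dk m ^+ 2).
  apply: (evt_uniform (Q := fun j x=> forall u, (u < j)%N -> rho xi u j w <= x) _ _ vm vinf (h1 m)).
    by move=> j x y xy h u uj; exact: letr (h u uj) xy.
  by move=> j; have [x hx] := rho_bound w j; exists x=> u uj; exact: hx.
have G2 : evt (fun n=> forall j, (j <= n)%N -> sqnorm (diagW xi j w) <= n.+1%:R * Dk m ^+ 2).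
  apply: (evt_uniform (Q := fun j x=> sqnorm (diagW xi j w) <= x) _ _ vm vinf (h2 m)).
    by move=> j x y xy h; exact: letr h xy.
  by move=> j; exists (sqnorm (diagW xi j w)).
pose Q3 J x := forall i j j', maxn i (maxn j j') = J -> i != j -> i != j' -> j != j' ->
  ~ (big_site xi x (nkey i j) w /\ big_site xi x (nkey i j') w).
have G3 : evt (fun n=> forall J, (J <= n)%N -> Q3 J (taun n ^+ 2)).
  apply: (evt_uniform (Q := Q3) (v := fun n=> taun n ^+ 2) _ _ _ t2_large h3).
  - move=> J x y xy h i j j' mJ ij ij' jj' [b1 b2]; apply: (h i j j')=> //.
    by split; [exact: le_lt_trans b1|exact: le_lt_trans b2].
  - move=> J; have [x hx] := rho_bound w J; exists x=> i j j' mJ ij ij' jj' [b1 _].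
    move: b1; rewrite /big_site ltNge=> /negP; apply; apply: hx; rewrite /nkey /=; lia.
  - move=> i j ij; rewrite leX2 ?(ltW (t0 _)) // /taun.
    by rewrite leX2 ?(ltW (rt5_gt0 _)) // rt5_mono.
have G4 : evt (fun n=> 2 * eta n * sqrt n.+1%:R <= 2 * Dk m).
  apply: evtS (rt5_small (kap mu + 2) (D0 m))=> n h.
  rewrite -mulrA ler_wpM2l //; apply: letr h; have b0 := rt5_gt0 n; have b1 := rt5_ge1 n.
  rewrite /eta rt5_sqrt /taun -exprM.
  have -> : (kap mu + 2) / rt5 n ^+ (14 * 2) * rt5 n ^+ 16 = (kap mu + 2) * rt5 n ^- 12.
    by field; rewrite gt_eqF.
  rewrite ler_wpM2l ?addr_ge0 // lef_pV2 ?posrE ?exprn_gt0 //. by rewrite exprS ler_peMr ?(ltW b0) // expr_ge1 // ltW.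
apply: evtS (evtI (evtI G1 G2) (evtI G3 G4))=> n [[g1 g2] [g3 g4]].
have sn0 : 0 < sqrt n.+1%:R :> R by rewrite sqrtr_gt0 ltr0n.
have ent i j := @diff_entry n w k (Dk m) i j (ltW (D0 m)) (fun u v uv vn=> g1 v vn u uv) g2.
have iso (i j j' : 'I_n.+1) : big n w i j -> big n w i j' -> j = j'.
  move=> /andP[ij /asboolP b1] /andP[ij' /asboolP b2]; apply/eqP/negPn/negP=> jj'.
  apply: (g3 (maxn i (maxn j j')) _ i j j')=> //. by have := ltn_ord i; have := ltn_ord j; have := ltn_ord j'; lia.
pose Tm (i j : 'I_n.+1) : R := s_ n * (2 * eta n + (sqrt n.+1%:R * Dk m) * ((i == j)%:R + (big n w i j)%:R)).
have rowT i : \sum_j Tm i j <= e.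
  rewrite -mulr_sumr big_split /= sumr_const card_ord -mulr_sumr big_split /=.
  rewrite (bigD1 i) //= eqxx big1=> [|j ji]; last by rewrite eq_sym (negbTE ji).
  rewrite addr0 -[2 * eta n *+ n.+1]mulr_natr; have := sum_bool_le1 (@iso i). set B := \sum_j _=> B1.
  apply: letr (_ : s_ n * (2 * eta n * n.+1%:R + sqrt n.+1%:R * Dk m * 2) <= _).
    rewrite ler_wpM2l ?invr_ge0 ?sqrtr_ge0 // lerD2l ler_wpM2l ?mulr_ge0 ?sqrtr_ge0 ?(ltW (D0 m)) //.
    by rewrite -[leRHS]/(1 + 1) lerD2l.
  have -> : s_ n * (2 * eta n * n.+1%:R + sqrt n.+1%:R * Dk m * 2) = 2 * eta n * sqrt n.+1%:R + 2 * Dk m.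
    have -> : n.+1%:R = sqrt n.+1%:R ^+ 2 :> R by rewrite sqr_sqrtr.
    by rewrite /s_ sqrtr_sqr ger0_norm ?sqrtr_ge0 //; field; rewrite gt_eqF.
  by apply: letr hm; lra.
have symT i j : Tm i j = Tm j i by rewrite /Tm eq_sym big_sym.
apply: op_schur=> [|i|j]; first exact: ltW.
  by apply: letr (rowT i); lers=> j _; exact: ent.
by apply: letr (rowT j); lers=> i _; rewrite symT; exact: ent.
Qed.

End Comparison.

(** * Lower norm bounds from traces *)

Section PowerRoots.

Lemma pow_le_root (x y L : R) : 0 <= y -> 0 <= L ->
  (forall k, x ^+ (2 ^ k.+1) <= L * y ^+ (2 ^ k.+1)) -> x <= y.
move=> y0 L0 h; rewrite leNgt; apply/negP=> yx.
have e0 : 0 < x - y by rewrite subr_gt0.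
have [k] := power_gap y0 e0 (mulr_ge0 L0 (sqr_ge0 y)).
rewrite -mulrA -exprD addrC subrK; have -> : (2 + 2 * (2 ^ k).-1 = 2 ^ k.+1)%N.
  by rewrite expnS; have := expn_gt0 2 k; lia.
by rewrite ltNge h.
Qed.

End PowerRoots.

Section TraceNorm.
Variables (A : cstarAlgType R) (tau : {scalar A}) (tauP : faithful_tracial_state tau).
Implicit Types x y z : A.

Lemma star_sqrP x k : star ((star x * x) ^+ k) = (star x * x) ^+ k.
elim: k=> [|k IH]; first by rewrite expr0 star1.
by rewrite {1}exprS starM IH starM starK -exprSr.
Qed.

(* Iterated Cauchy-Schwarz: the moments of [star y * y] bound its norm. *)
Lemma cnorm_le_moments y (c : R) : 0 <= c ->
  (forall k, normc (tau ((star y * y) ^+ (2 ^ k))) <= (c ^+ 2) ^+ (2 ^ k)) -> cnorm y <= c.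
move=> c0 h; apply: (cnorm_le_tnrm tauP)=> // z; set g := star y * y.
have gs k : star (g ^+ k) = g ^+ k by exact: star_sqrP.
set N := tnrm tau z; have N0 : 0 <= N by exact: nrm_ge0.
have cs a b : normc (tau (star a * b)) <= tnrm tau a * tnrm tau b by exact: (CS (tip_P tauP)).
have s0 : tnrm tau (y * z) ^+ 2 <= N * tnrm tau (g * z).
  rewrite (tnrm_sqr tauP); apply: letr (Re_normc _) _; apply: letr (cs z (g * z)). by rewrite starM -!mulrA /g !mulrA.
have sk k : tnrm tau (g ^+ (2 ^ k) * z) ^+ 2 <= N * tnrm tau (g ^+ (2 ^ k.+1) * z).
  rewrite (tnrm_sqr tauP); apply: letr (Re_normc _) _; apply: letr (cs z (g ^+ (2 ^ k.+1) * z)).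
  by rewrite starM gs -!mulrA [_ * (_ * z)]mulrA -exprD expnS mul2n addnn.
have it k : tnrm tau (y * z) ^+ (2 ^ k.+1) <= N ^+ (2 ^ k.+1).-1 * tnrm tau (g ^+ (2 ^ k) * z).
  elim: k=> [|k IH]; first by rewrite expr1 in s0 *. have -> : (2 ^ k.+2 = 2 ^ k.+1 * 2)%N by rewrite expnSr.
  rewrite exprM; apply: letr (_ : (N ^+ (2 ^ k.+1).-1 * tnrm tau (g ^+ (2 ^ k) * z)) ^+ 2 <= _).
    by rewrite leX2 ?exprn_ge0 ?mulr_ge0 ?exprn_ge0 ?nrm_ge0.
  rewrite exprMn; apply: letr (ler_wpM2l _ (sk k)) _; first by rewrite sqr_ge0.
  rewrite mulrA -exprM -exprSr; have -> : ((2 ^ k.+1).-1 * 2).+1 = (2 ^ k.+1 * 2).-1.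
    by have := expn_gt0 2 k.+1; lia.
  by [].
have gb k : tnrm tau (g ^+ (2 ^ k) * z) <= cnorm z * (c ^+ 2) ^+ (2 ^ k).
  rewrite -(tnrm_star tauP) starM gs; apply: letr (tnrmM tauP _ _) _.
  rewrite (cnorm_starE z); apply: ler_wpM2l; first exact: cnorm_ge0.
  rewrite -[leLHS]ger0_norm ?nrm_ge0 //; apply: sqr_abs; first by rewrite exprn_ge0 ?sqr_ge0.
  rewrite (tnrm_sqr tauP) gs -exprD; apply: letr (Re_normc _) _.
  by rewrite addnn -mul2n -expnS -exprM mulnC -expnS; exact: h.
have [z0|zn] := eqVneq N 0.
  by rewrite z0 mulr0 (tnrm_eq0 tauP z0) mulr0 /tnrm (nrm0 (tip_P tauP)).
have Np : 0 < N by rewrite lt_def zn.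
apply: (pow_le_root (L := cnorm z / N))=> [||k]; [by rewrite mulr_ge0|by rewrite divr_ge0 ?cnorm_ge0|].
apply: letr (it k) _; apply: letr (ler_wpM2l _ (gb k)) _; first exact: exprn_ge0.
rewrite -exprM -expnS exprMn; have -> : N ^+ (2 ^ k.+1) = N ^+ (2 ^ k.+1).-1 * N.
  by rewrite -exprSr prednK // expn_gt0.
by rewrite le_eqVlt; apply/orP; left; apply/eqP; field.
Qed.

End TraceNorm.

Section StrongConvergence.
Variables (A : cstarAlgType R) (tau : {scalar A}) (tauP : faithful_tracial_state tau).
Variables (I : Type) (u : forall n, I -> 'M[C]_n.+1) (x : I -> A).
Arguments u : clear implicits.

Definition ncpow (p : ncpoly R I) k : ncpoly R I := iter k (ncmul p) (ncconst I 1).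

Lemma nce_pow (B : starAlgType R) (y : I -> B) p k : nceval (ncpow p k) y = nceval p y ^+ k.
elim: k=> [|k IH]; first by rewrite /ncpow /= nce_const scale1r expr0.
by rewrite /ncpow /= nce_mul -/(ncpow p k) IH exprS.
Qed.

Lemma complex_evt_cvg (v : nat -> C) (l : C) : (forall e : R, 0 < e -> evt (fun n=> normc (v n - l) <= e)) ->
  (v : nat -> C^o) @ \oo --> (l : C^o).
move=> h; apply/cvgrPdist_le=> -[er ei]; rewrite ltcE /= => /andP[/eqP -> e0].
apply/evt_near; apply: evtS (h _ e0)=> n hn.
by rewrite distrC [`|_|](_ : _ = (normc (v n - l))%:C) // lecR.
Qed.

Lemma real_evt_cvg (v : nat -> R) (l : R) : (forall e, 0 < e -> evt (fun n=> `|v n - l| <= e)) ->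
  v @ \oo --> l.
move=> h; apply/cvgrPdist_le=> e e0; apply/evt_near; apply: evtS (h e e0)=> n.
by rewrite distrC.
Qed.

Variables (trace_cvg : forall p (e : R), 0 < e -> evt (fun n=> normc (ntrace (nceval p (u n)) - tau (nceval p x)) <= e)).

(** If the norms stayed below [cnorm y - e] for infinitely many [n], the convergence of the traces
    of the powers of [star y * y] would bound its moments accordingly, contradicting
    [cnorm_le_moments]. *)
Lemma norm_lower p (e : R) : 0 < e -> evt (fun n=> cnorm (nceval p x) - e <= opnorm (nceval p (u n))).
move=> e0; apply: contrapT=> nev; set y := nceval p x in nev *; pose c := cnorm y - e.
have freq n0 : exists2 n, (n0 <= n)%N & opnorm (nceval p (u n)) < c.
  apply: contrapT=> nex; apply: nev; exists n0=> n nn; rewrite leNgt; apply/negP=> k. by apply: nex; exists n.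
have c0 : 0 <= c by have [n _ /ltW] := freq 0%N; apply: letr; exact: op_ge0.
have : cnorm y <= c; last by rewrite /c; lra.
apply: (cnorm_le_moments tauP)=> // k; rewrite leNgt; apply/negP=> hk.
set g := star y * y in hk; pose q := ncpow (ncmul (ncstar p) p) (2 ^ k).
have qx : nceval q x = g ^+ (2 ^ k) by rewrite nce_pow nce_mul nce_star.
have d0 : 0 < (normc (tau (g ^+ (2 ^ k))) - (c ^+ 2) ^+ (2 ^ k)) / 2 by rewrite divr_gt0 // subr_gt0.
have [n0 hn] := trace_cvg q d0; have [n nn un] := freq n0.
have := hn n nn; rewrite qx.
have tr : normc (ntrace (nceval q (u n))) <= (c ^+ 2) ^+ (2 ^ k).
  apply: letr (ntrace_le _) _; rewrite nce_pow; apply: letr (op_exp_le _ _) _.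
  rewrite nce_mul nce_star leX2 ?op_ge0 ?sqr_ge0 //.
  by rewrite op_sqr leX2 ?op_ge0 // ltW.
have := le_normcD (ntrace (nceval q (u n))) (tau (g ^+ (2 ^ k)) - ntrace (nceval q (u n))).
rewrite addrC subrK -[X in _ + normc X]opprB normcN=> a b.
by have := letr a (lerD tr b); move: hk; lra.
Qed.

Variables (norm_upper : forall p (e : R), 0 < e -> evt (fun n=> opnorm (nceval p (u n)) <= cnorm (nceval p x) + e)).

Theorem strong_of_bounds : strong_cvg u tau x.
move=> p; split; first by apply: complex_evt_cvg=> e; exact: trace_cvg.
apply: real_evt_cvg=> e e0; apply: evtS (evtI (norm_lower p e0) (norm_upper p e0))=> n [a b].
by rewrite ler_norml; apply/andP; split; lra.
Qed.

End StrongConvergence.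

(** * Matrix coefficients *)

Section ModuleNorm.
Variables (A : cstarAlgType R) (tau : {scalar A}) (tauP : faithful_tracial_state tau) (q : nat).
Implicit Types (b c : 'cV[A]_q) (T : 'M[A]_q).

Definition mip b c : A := \sum_k star (b k 0) * c k 0.
Definition mstar T : 'M[A]_q := \matrix_(k, l) star (T l k).

Notation dipA := (@dip A (@tip_ A tau) 'I_q).
Let dipP : is_sip dipA := dip_sip (tip_P tauP) _.
Let form b z : {ffun 'I_q -> A} := [ffun k=> b k 0 * z].

Let form_mip b c w z : dipA (form b w) (form c z) = tau (star w * mip b c * z).
rewrite /dip /mip mulr_sumr mulr_suml linear_sum; eqr=> k _.
by rewrite !ffunE /tip_ starM !mulrA.
Qed.

Let form_le b z : nrm dipA (form b z) <= modnorm b * tnrm tau z.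
rewrite -[leLHS]ger0_norm ?nrm_ge0 //; apply: sqr_abs.
  by rewrite mulr_ge0 ?sqrtr_ge0 ?nrm_ge0.
rewrite nrm_sqr // /n2 form_mip exprMn sqr_sqrtr ?cnorm_ge0 //.
apply: letr (Re_normc _) _; have := CS (tip_P tauP) z (mip b b * z).
rewrite /tip_ mulrA=> h; apply: letr h _.
rewrite expr2 mulrCA; apply: ler_wpM2l; first exact: nrm_ge0.
exact: tnrmM.
Qed.

(** Reduced by [cnorm_le_form] to the scalar inequality for the vectors of entries [b k 0 * z]. *)
Lemma module_cs b c : cnorm (mip b c) <= modnorm b * modnorm c.
apply: (cnorm_le_form tauP)=> [|w z]; first by rewrite mulr_ge0 ?sqrtr_ge0.
rewrite -form_mip; apply: letr (CS dipP _ _) _.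
apply: letr (ler_pM _ _ (form_le b w) (form_le c z)) _; rewrite ?nrm_ge0 //.
by rewrite mulrACA.
Qed.

Lemma mod_ge0 b : 0 <= modnorm b. exact: sqrtr_ge0. Qed.

Lemma modnorm_sqr b : modnorm b ^+ 2 = cnorm (mip b b).
by rewrite sqr_sqrtr ?cnorm_ge0. Qed.

Lemma cnorm_le_modnorm b l : cnorm (b l 0) <= modnorm b.
apply: (cnorm_le_tnrm tauP)=> [|z]; first exact: mod_ge0.
apply: letr (form_le b z).
rewrite -[leLHS]ger0_norm ?nrm_ge0 //; apply: sqr_abs; first exact: nrm_ge0.
rewrite /tnrm (nrm_sqr (tip_P tauP)) (nrm_sqr dipP) dip_n2 (bigD1 l) //= ffunE lerDl sumr_ge0 // => k _.
by rewrite -(nrm_sqr (tip_P tauP)) sqr_ge0.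
Qed.

Lemma modnorm_le_sum b : modnorm b <= \sum_k cnorm (b k 0).
have s0 : 0 <= \sum_k cnorm (b k 0) by sge0=> k _; exact: cnorm_ge0.
rewrite -[leLHS]ger0_norm ?mod_ge0 //; apply: sqr_abs=> //.
rewrite modnorm_sqr; apply: letr (cnorm_sum _ _ _) _.
rewrite expr2 mulr_suml; lers=> k _; rewrite cnorm_star expr2.
apply: ler_wpM2l; first exact: cnorm_ge0.
by rewrite (bigD1 k) //= lerDl sumr_ge0 // => j _; exact: cnorm_ge0.
Qed.

Let entry_sum T : R := \sum_k \sum_l cnorm (T k l).

Lemma modnorm_mul T b : modnorm (T *m b) <= entry_sum T * modnorm b.
apply: letr (modnorm_le_sum _) _; rewrite /entry_sum mulr_suml; lers=> k _.
rewrite mxE mulr_suml; apply: letr (cnorm_sum _ _ _) _; lers=> l _.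
apply: letr (cnormM _ _) _; apply: ler_wpM2l; [exact: cnorm_ge0|exact: cnorm_le_modnorm].
Qed.

Let modnormZ (a : R) b : modnorm (\col_k (a%:C *: b k 0)) = `|a| * modnorm b.
rewrite /modnorm -[`|a|]sqrtr_sqr -sqrtrM ?sqr_ge0 //; congr sqrt.
rewrite (eq_bigr (fun k=> (a ^+ 2)%:C *: (star (b k 0) * b k 0)))=> [|k _]; last first.
  by rewrite mxE starJ conjcR -scalerAl -scalerAr scalerA -realcM -expr2.
by rewrite -scaler_sumr cnorm_real ger0_norm ?sqr_ge0.
Qed.

Let mulmxZ (a : R) T b : T *m (\col_k (a%:C *: b k 0)) = \col_k (a%:C *: (T *m b) k 0).
apply/matrixP=> k j; rewrite !mxE scaler_sumr; eqr=> l _.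
by rewrite mxE scalerAr.
Qed.

Let mxset T := [set modnorm (T *m b) | b in [set b | modnorm b <= 1]].

Let modnorm0 : modnorm (0 : 'cV[A]_q) = 0.
by rewrite /modnorm big1 ?cnorm0 ?sqrtr0 // => k _; rewrite mxE mulr0. Qed.

Let mxset_sup T : has_sup (mxset T).
split; first by exists (modnorm (T *m 0)), 0=> //=; rewrite modnorm0.
exists (entry_sum T)=> _ [b /= b1 <-]; apply: letr (modnorm_mul T b) _.
rewrite -[leRHS]mulr1; apply: ler_wpM2l=> //.
by sge0=> k _; sge0=> l _; exact: cnorm_ge0.
Qed.

Lemma mxc_ge0 T : 0 <= mxcnorm T.
apply: letr (mod_ge0 (T *m 0)) _; apply: (ub_le_sup (proj2 (mxset_sup T))).
by exists 0=> //=; rewrite modnorm0.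
Qed.

Lemma mxcnorm_ub T b : modnorm (T *m b) <= mxcnorm T * modnorm b.
have [b0|bn] := eqVneq (modnorm b) 0.
  by apply: letr (modnorm_mul T b) _; rewrite b0 !mulr0.
have bp : 0 < modnorm b by rewrite lt_def bn mod_ge0.
have h : modnorm (T *m (\col_k (((modnorm b)^-1)%:C *: b k 0))) <= mxcnorm T.
  apply: (ub_le_sup (proj2 (mxset_sup T))); exists (\col_k (((modnorm b)^-1)%:C *: b k 0))=> //=.
  by rewrite modnormZ ger0_norm ?invr_ge0 ?mod_ge0 // mulVf.
by move: h; rewrite mulmxZ modnormZ ger0_norm ?invr_ge0 ?mod_ge0 // mulrC ler_pdivrMr.
Qed.

Lemma mxcnorm_le T k : 0 <= k -> (forall b, modnorm (T *m b) <= k * modnorm b) -> mxcnorm T <= k.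
move=> k0 h; apply: ge_sup; first exact: (proj1 (mxset_sup T)).
by move=> _ [b /= b1 <-]; apply: letr (h b) _; rewrite -[leRHS]mulr1; exact: ler_wpM2l.
Qed.

Lemma mxcnorm_le_entries T : mxcnorm T <= \sum_k \sum_l cnorm (T k l).
apply: mxcnorm_le=> [|b]; last exact: modnorm_mul.
by sge0=> k _; sge0=> l _; exact: cnorm_ge0.
Qed.

Lemma entry_le_mxcnorm T k l : cnorm (T k l) <= mxcnorm T.
pose e : 'cV[A]_q := \col_j (j == l)%:R.
have e1 : modnorm e = 1.
  rewrite /modnorm (bigD1 l) //= big1=> [|j jl]; rewrite !mxE ?eqxx ?(negbTE jl) ?mulr0 //.
  by rewrite addr0 mulr1 star1 cnorm1 sqrtr1.
have := mxcnorm_ub T e; rewrite e1 mulr1; apply: letr.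
have -> : T k l = (T *m e) k 0; last exact: cnorm_le_modnorm.
rewrite mxE (bigD1 l) //= big1=> [|j jl]; rewrite mxE ?eqxx ?(negbTE jl) ?mulr0 //.
by rewrite mulr1 addr0.
Qed.

Lemma mxcnormM T T' : mxcnorm (T *m T') <= mxcnorm T * mxcnorm T'.
apply: mxcnorm_le=> [|b]; first by rewrite mulr_ge0 ?mxc_ge0.
rewrite -mulmxA -mulrA; apply: letr (mxcnorm_ub _ _) _.
by apply: ler_wpM2l; [exact: mxc_ge0|exact: mxcnorm_ub].
Qed.

Lemma mip_mstar T b c : mip (T *m b) c = mip b (mstar T *m c).
rewrite /mip; under eq_bigr do rewrite mxE star_sum mulr_suml.
under [RHS]eq_bigr do rewrite mxE mulr_sumr.
rewrite exchange_big; eqr=> l _; eqr=> k _.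
by rewrite starM mxE mulrA.
Qed.

Lemma mstarK T : mstar (mstar T) = T.
by apply/matrixP=> k l; rewrite !mxE starK. Qed.

Lemma mxcnorm_sqr_le T : mxcnorm T ^+ 2 <= mxcnorm (mstar T *m T).
have : mxcnorm T <= sqrt (mxcnorm (mstar T *m T)).
  apply: mxcnorm_le=> [|b]; first exact: sqrtr_ge0.
  rewrite -[leLHS]ger0_norm ?mod_ge0 //; apply: sqr_abs; first by rewrite mulr_ge0 ?sqrtr_ge0.
  rewrite modnorm_sqr mip_mstar exprMn sqr_sqrtr ?mxc_ge0 //.
  apply: letr (module_cs _ _) _; rewrite mulmxA expr2 mulrCA.
  by apply: ler_wpM2l; [exact: mod_ge0|exact: mxcnorm_ub].
by move=> h; rewrite -[leRHS]sqr_sqrtr ?mxc_ge0 // leX2 ?mxc_ge0 ?sqrtr_ge0.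
Qed.

Lemma mxcnorm_mstar_le T : mxcnorm (mstar T) <= mxcnorm T.
have [->|n0] := eqVneq (mxcnorm (mstar T)) 0; first exact: mxc_ge0.
have p : 0 < mxcnorm (mstar T) by rewrite lt_def n0 mxc_ge0.
rewrite -(ler_pM2r p) -expr2; apply: letr (mxcnorm_sqr_le _) _.
by rewrite mstarK; exact: mxcnormM.
Qed.

Lemma mxcnorm_sqr T : mxcnorm (mstar T *m T) = mxcnorm T ^+ 2.
apply/eqP; rewrite eq_le mxcnorm_sqr_le andbT; apply: letr (mxcnormM _ _) _.
by rewrite expr2; apply: ler_wpM2r; [exact: mxc_ge0|exact: mxcnorm_mstar_le].
Qed.

End ModuleNorm.

Section BlockMatrices.
Variables (q n : nat).
Implicit Types F : 'I_q -> 'I_q -> 'M[C]_n.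

Definition blockmx F : 'M[C]_(q * n) := \matrix_(a, b)
  F (mxtens_unindex a).1 (mxtens_unindex b).1 (mxtens_unindex a).2 (mxtens_unindex b).2.

Let blk (v : 'cV[C]_(q * n)) (k : 'I_q) : 'cV[C]_n := \col_i v (mxtens_index (k, i)) 0.

Let sum_index (V : nmodType) (f : 'I_(q * n) -> V) :
  \sum_a f a = \sum_k \sum_i f (mxtens_index (k, i)).
rewrite pair_bigA /= (reindex (@mxtens_index q n)) /=; last first.
  by exists (@mxtens_unindex q n)=> ? _; [exact: mxtens_indexK|exact: mxtens_unindexK].
by eqr=> -[k i] _.
Qed.

Let l2_blk v : l2norm v ^+ 2 = \sum_k l2norm (blk v k) ^+ 2.
rewrite l2norm_sqr sum_index; eqr=> k _; rewrite l2norm_sqr.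
by eqr=> i _; rewrite mxE.
Qed.

Let blk_mul F v k : blk (blockmx F *m v) k = \sum_l F k l *m blk v l.
apply/matrixP=> i j; rewrite ord1 mxE mxE sum_index summxE; eqr=> l _.
by rewrite mxE; eqr=> i' _; rewrite !mxE !mxtens_indexK.
Qed.

Let blk_le v k : l2norm (blk v k) <= l2norm v.
rewrite -[leLHS]ger0_norm ?l2_ge0 //; apply: sqr_abs; first exact: l2_ge0.
by rewrite l2_blk (bigD1 k) //= lerDl sumr_ge0 // => j _; exact: sqr_ge0.
Qed.

Lemma blockmx_le F : opnorm (blockmx F) <= \sum_k \sum_l opnorm (F k l).
apply: op_le=> [|v].
  by sge0=> k _; sge0=> l _; exact: op_ge0.
apply: letr (_ : \sum_k l2norm (blk (blockmx F *m v) k) <= _).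
  have s0 : 0 <= \sum_k l2norm (blk (blockmx F *m v) k) by sge0=> k _; exact: l2_ge0.
  rewrite -[leLHS]ger0_norm ?l2_ge0 //; apply: sqr_abs=> //.
  rewrite l2_blk expr2 mulr_suml; lers=> k _; rewrite expr2. apply: ler_wpM2l; first exact: l2_ge0.
  by rewrite (bigD1 k) //= lerDl sumr_ge0 // => j _; exact: l2_ge0.
rewrite mulr_suml; lers=> k _; rewrite blk_mul mulr_suml.
have l2s (s : seq 'I_q) : l2norm (\sum_(l <- s) F k l *m blk v l) <= \sum_(l <- s) opnorm (F k l) * l2norm v.
  elim: s=> [|l s IH]; first by rewrite !big_nil -(scale0r (0 : 'cV[C]_n)) l2normZ Normc.normc0 mul0r.
  rewrite !big_cons; apply: letr (l2normD _ _) _; apply: lerD=> //.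
  apply: letr (op_ub _ _) _; apply: ler_wpM2l; [exact: op_ge0|exact: blk_le].
exact: l2s.
Qed.

Lemma block_le_blockmx F k l : opnorm (F k l) <= opnorm (blockmx F).
apply: op_le=> [|v]; first exact: op_ge0.
pose w : 'cV[C]_(q * n) := \col_a (if (mxtens_unindex a).1 == l then v (mxtens_unindex a).2 0 else 0).
have bw j : blk w j = if j == l then v else 0.
  apply/matrixP=> i i'; rewrite ord1 !mxE mxtens_indexK /=; case: eqP=> // _; by rewrite mxE.
have lw : l2norm w = l2norm v.
  apply/eqP; rewrite -(eqrXn2 (n := 2)) ?l2_ge0 // l2_blk (bigD1 l) //= bw eqxx big1 ?addr0 // => j jl.
  by rewrite bw (negbTE jl) -(scale0r (0 : 'cV[C]_n)) l2normZ Normc.normc0 mul0r expr0n.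
have := op_ub (blockmx F) w; rewrite lw; apply: letr.
apply: letr (blk_le _ k); rewrite blk_mul (bigD1 l) //= bw eqxx big1 ?addr0 // => j jl.
by rewrite bw (negbTE jl) mulmx0.
Qed.

Lemma blockmx_mul F F' : blockmx F *m blockmx F' = blockmx (fun k l=> \sum_j F k j *m F' j l).
apply/matrixP=> a b; rewrite mxE sum_index mxE summxE; eqr=> j _.
by rewrite mxE; eqr=> i _; rewrite !mxE !mxtens_indexK.
Qed.

Lemma blockmx_hadj F : hadj (blockmx F) = blockmx (fun k l=> hadj (F l k)).
by apply/matrixP=> a b; rewrite !mxE. Qed.

End BlockMatrices.

Section MatrixPolynomials.
Variables (I : Type) (q : nat).
Notation mxp := ('I_q -> 'I_q -> ncpoly R I).

Definition mxentry (Q : mxncpoly R q I) : mxp := fun k l =>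
  flatten [seq ncscale (t.1 k l) t.2 | t : 'M[C]_q * ncpoly R I <- Q].

Lemma mxentryE (A : starAlgType R) (x : I -> A) Q k l :
  nceval (mxentry Q k l) x = \sum_(t <- Q) t.1 k l *: nceval t.2 x.
by rewrite nce_flatten big_map; eqr=> t _; rewrite nce_scale. Qed.

Lemma mxncevalE (A : starAlgType R) (x : I -> A) Q :
  mxnceval Q x = \matrix_(k, l) nceval (mxentry Q k l) x.
apply/matrixP=> k l; rewrite /mxnceval summxE mxE mxentryE.
by eqr=> t _; rewrite mxE.
Qed.

Lemma mxnceval_tensE n (y : I -> 'M[C]_n.+1) Q :
  mxnceval_tens Q y = blockmx (fun k l=> nceval (mxentry Q k l) y).
apply/matrixP=> a b; rewrite /mxnceval_tens summxE mxE mxentryE summxE.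
by eqr=> t _; rewrite !mxE.
Qed.

Definition mxsq (E : mxp) : mxp := fun k l =>
  flatten [seq ncmul (ncstar (E j k)) (E j l) | j <- enum 'I_q].

Lemma mxsqE (A : starAlgType R) (x : I -> A) E k l :
  nceval (mxsq E k l) x = \sum_j star (nceval (E j k) x) * nceval (E j l) x.
rewrite nce_flatten big_map big_enum; eqr=> j _.
by rewrite nce_mul nce_star.
Qed.

Lemma blockmx_sq n (y : I -> 'M[C]_n.+1) E k :
  opnorm (blockmx (fun i j=> nceval (iter k mxsq E i j) y)) =
  opnorm (blockmx (fun i j=> nceval (E i j) y)) ^+ (2 ^ k).
elim: k=> [|k IH]; first by rewrite expr1.
rewrite expnSr exprM -IH -op_sqr blockmx_hadj blockmx_mul; congr opnorm.
by apply/matrixP=> a b; rewrite !mxE mxsqE.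
Qed.

Lemma mxcnorm_sq (A : cstarAlgType R) (tau : {scalar A}) (x : I -> A) E k :
  faithful_tracial_state tau ->
  mxcnorm (\matrix_(i, j) nceval (iter k mxsq E i j) x) =
  mxcnorm (\matrix_(i, j) nceval (E i j) x) ^+ (2 ^ k).
move=> tauP; elim: k=> [|k IH]; first by rewrite expr1.
rewrite expnSr exprM -IH -(mxcnorm_sqr tauP); congr mxcnorm.
apply/matrixP=> i j; rewrite !mxE mxsqE; eqr=> l _.
by rewrite !mxE.
Qed.

End MatrixPolynomials.

Section StrongToMatrix.
Variables (A : cstarAlgType R) (tau : {scalar A}) (tauP : faithful_tracial_state tau).
Variables (I : Type) (u : forall n, I -> 'M[C]_n.+1) (x : I -> A).
Arguments u : clear implicits.
Variables (u_cvg : strong_cvg u tau x).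

Let norm_evt p (e : R) : 0 < e -> evt (fun n=> `|opnorm (nceval p (u n)) - cnorm (nceval p x)| <= e).
by move=> e0; exact: real_cvg_evt (proj2 (u_cvg p)). Qed.

Lemma ntrace_tens q n (Q : mxncpoly R q I) : ntrace (mxnceval_tens Q (u n)) =
  q%:R^-1 * \sum_k ntrace (nceval (mxentry Q k k) (u n)).
rewrite mxnceval_tensE /ntrace /mxtrace natrM invfM -mulrA; congr (_ * _).
rewrite -mulr_sumr; congr (_ * _); rewrite pair_bigA /=.
rewrite (reindex (@mxtens_index q n.+1)) /=; last first.
  by exists (@mxtens_unindex q n.+1)=> ? _; [exact: mxtens_indexK|exact: mxtens_unindexK].
by eqr=> -[k i] _; rewrite mxE mxtens_indexK.
Qed.

(** Both norms are comparable with the norms of the entries up to the factor [L = q^2]. Repeated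
    squaring by [mxsq] raises the norms to the power [2^k], by the C*-identity, while the entries
    remain scalar polynomials; the factor is lost in the root. *)
Theorem strong_to_mx : mx_strong_cvg u tau x.
move=> q q0 Q; split.
  rewrite (_ : (fun n=> _) = (fun n=> q%:R^-1 * \sum_k ntrace (nceval (mxentry Q k k) (u n)) : C^o)); last first.
    by apply/funext=> n; exact: ntrace_tens.
  rewrite /mxtrace_tau mxncevalE; apply: complex_evt_cvg=> e e0. have q1 : 0 < q%:R :> R by rewrite ltr0n.
  have h : evt (fun n=> forall k, normc (ntrace (nceval (mxentry Q k k) (u n)) - tau (nceval (mxentry Q k k) x)) <= e).
    apply: evt_allfin=> k; exact: complex_cvg_evt (proj1 (u_cvg _)).
  apply: evtS h=> n h. rewrite -mulrBr -sumrB ncM. have -> : normc (q%:R^-1 : C) = q%:R^-1.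
    by rewrite -[q%:R^-1 : C](_ : (q%:R^-1)%:C = _) ?normcR ?ger0_norm ?invr_ge0 // rmorphV ?unitfE ?gt_eqF //= rmorph_nat.
  rewrite mulrC ler_pdivrMr //; apply: letr (nc_sum _ _ _) _. apply: letr (_ : \sum_(k < q) e <= _).
    by lers=> k _; rewrite mxE.
  by rewrite sumr_const card_ord mulr_natr.
set T := mxnceval Q x; pose E := mxentry Q.
have TE : T = \matrix_(i, j) nceval (E i j) x by exact: mxncevalE.
pose N n := opnorm (blockmx (fun i j=> nceval (E i j) (u n))).
have N0 n : 0 <= N n by exact: op_ge0.
rewrite (_ : (fun n=> opnorm (mxnceval_tens Q (u n))) = N); last first.
  by apply/funext=> n; rewrite mxnceval_tensE.
have T0 : 0 <= mxcnorm T by exact: (mxc_ge0 tauP).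
have ent k (D : R) : 0 < D -> evt (fun n=> forall ij : 'I_q * 'I_q,
    `|opnorm (nceval (iter k (@mxsq I q) E ij.1 ij.2) (u n)) - cnorm (nceval (iter k (@mxsq I q) E ij.1 ij.2) x)| <= D).
  by move=> D0; apply: evt_allfin=> ij; exact: norm_evt.
pose L : R := q%:R * q%:R.
have sum2 (f g : 'I_q -> 'I_q -> R) : (forall i j, f i j <= g i j) -> \sum_i \sum_j f i j <= \sum_i \sum_j g i j.
  by move=> h; lers=> i _; lers=> j _.
have cst2 (c : R) : \sum_(i < q) \sum_(j < q) c = L * c.
  by rewrite !sumr_const !card_ord -[X in X *+ q]mulr_natl -[LHS]mulr_natl mulrA.
have up k D : 0 < D -> evt (fun n=> N n ^+ (2 ^ k) <= L * (mxcnorm T ^+ (2 ^ k) + D)).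
  move=> D0; apply: evtS (ent k D D0)=> n h; rewrite -blockmx_sq; apply: letr (blockmx_le _) _.
  rewrite -cst2; apply: sum2=> i j; rewrite TE -(mxcnorm_sq _ _ k tauP).
  have := h (i, j); rewrite /= ler_norml=> /andP[_ h']; rewrite -lerBlDl.
  have := entry_le_mxcnorm tauP (\matrix_(i0, j0) nceval (iter k (@mxsq I q) E i0 j0) x) i j. by rewrite mxE; lra.
have low k D : 0 < D -> evt (fun n=> mxcnorm T ^+ (2 ^ k) <= L * (N n ^+ (2 ^ k) + D)).
  move=> D0; apply: evtS (ent k D D0)=> n h; rewrite TE -(mxcnorm_sq _ _ k tauP); apply: letr (mxcnorm_le_entries tauP _) _.
  rewrite -cst2; apply: sum2=> i j; rewrite mxE -blockmx_sq. have := h (i, j); rewrite /= ler_norml=> /andP[h' _].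
  have := block_le_blockmx (fun i0 j0=> nceval (iter k (@mxsq I q) E i0 j0) (u n)) i j. by move=> /=; lra.
have L0 : 0 <= L by rewrite mulr_ge0.
have gap (y e : R) : 0 <= y -> 0 < e -> exists k D, 0 < D /\ L * (y ^+ (2 ^ k) + D) < (y + e) ^+ (2 ^ k).
  move=> y0 e0; have [k hk] : exists k, L * y ^+ (2 ^ k) < (y + e) ^+ (2 ^ k).
    apply: contrapT=> nk; have : y + e <= y; last by lra.
    apply: (pow_le_root y0 L0)=> k; rewrite leNgt; apply/negP=> h; apply: nk. by exists k.+1.
  exists k, (((y + e) ^+ (2 ^ k) - L * y ^+ (2 ^ k)) / (L + 1) / 2).
  set G := (y + e) ^+ _ - _; have G0 : 0 < G by rewrite subr_gt0. have L1 : 0 < L + 1 by lra.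
  split; first by rewrite !divr_gt0. have : L * (G / (L + 1) / 2) < G; last by rewrite mulrDr /G; lra.
  have -> : L * (G / (L + 1) / 2) = (L / (L + 1)) * (G / 2) by field; rewrite gt_eqF.
  apply: le_lt_trans (_ : 1 * (G / 2) < G); last by lra. by apply: ler_wpM2r; [lra|rewrite ler_pdivrMr // mul1r; lra].
apply: real_evt_cvg=> e e0.
have hi : evt (fun n=> N n <= mxcnorm T + e).
  have [k [D [D0 hk]]] := gap _ e T0 e0; apply: evtS (up k D D0)=> n h.
  rewrite -(ler_pXn2r (n := 2 ^ k)) ?expn_gt0 ?nnegrE ?addr_ge0 ?(ltW e0) //. exact: letr h (ltW hk).
have lo : evt (fun n=> mxcnorm T - e <= N n).
  case: (ltP (mxcnorm T) e)=> Te; first by apply: evt_true=> n; apply: letr (N0 n); lra.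
  have y0 : 0 <= mxcnorm T - e by lra. have [k [D [D0 hk]]] := gap _ e y0 e0; apply: evtS (low k D D0)=> n h.
  rewrite leNgt; apply/negP=> nN; move: hk; rewrite subrK ltNge=> /negP; apply.
  apply: letr h _; apply: ler_wpM2l=> //; rewrite lerD2r. by rewrite leX2 // ltW.
apply: evtS (evtI hi lo)=> n [a b].
by rewrite ler_norml; apply/andP; split; lra.
Qed.

End StrongToMatrix.

(** * Small perturbations and rational coefficients *)

Section Perturbation.
Variables (I : Type).
Variables (u v : forall n, I -> 'M[C]_n.+1).
Arguments u : clear implicits.
Arguments v : clear implicits.
Variables (v_bound : forall i, exists2 c : R, 0 <= c & evt (fun n=> opnorm (v n i) <= c))
  (uv_close : forall i (e : R), 0 < e -> evt (fun n=> opnorm (u n i - v n i) <= e)).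

Let eqW (a b : R) : a = b -> a <= b. by move=> ->. Qed.

Let frac_le (a b : R) : 0 <= a -> 0 <= b -> b * (a / (b + 1)) <= a.
move=> a0 b0; rewrite mulrA ler_pdivrMr ?ltr_wpDl // [b * a]mulrC; apply: ler_wpM2l=> //.
by rewrite lerDl.
Qed.

Notation word y w := (\prod_(l <- w) ncletter y l).

Let adj_norm n (M : 'M[C]_n.+1) : opnorm (star M) = opnorm M.
exact: op_hadj. Qed.

Let letter_bound l : exists2 c : R, 0 <= c & evt (fun n=> opnorm (ncletter (v n) l) <= c).
have [c c0 h] := v_bound l.1; exists c; first exact: c0.
apply: evtS h=> n h.
rewrite /ncletter; case: l.2; last exact: h.
exact: (letr (eqW (adj_norm _)) h).
Qed.

Lemma word_bound w : exists2 c : R, 0 <= c & evt (fun n=> opnorm (word (v n) w) <= c).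
elim: w=> [|l w [c c0 h]].
  exists 1=> //; apply: evt_true=> n; rewrite big_nil. by apply: op_le=> // z; rewrite mul1mx mul1r.
have [c' c'0 h'] := letter_bound l; exists (c' * c); first exact: mulr_ge0.
apply: evtS (evtI h h')=> n [a b]; rewrite big_cons.
by apply: letr (opnormM _ _) _; apply: ler_pM; rewrite ?op_ge0.
Qed.

Let letter_close l (e : R) : 0 < e -> evt (fun n=> opnorm (ncletter (u n) l - ncletter (v n) l) <= e).
move=> e0; apply: evtS (uv_close l.1 e0)=> n h; rewrite /ncletter; case: l.2; last exact: h.
have -> : star (u n l.1) - star (v n l.1) = star (u n l.1 - v n l.1); last exact: (letr (eqW (adj_norm _)) h).
change (adjmx (u n l.1) - adjmx (v n l.1) = adjmx (u n l.1 - v n l.1)).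
by apply/matrixP=> i j; rewrite !mxE rmorphB.
Qed.

Let word_close w (e : R) : 0 < e -> evt (fun n=> opnorm (word (u n) w - word (v n) w) <= e).
elim: w e=> [|l w IH] e e0.
  by apply: evt_true=> n; rewrite !big_nil subrr opnorm0 ltW.
have [c c0 h] := word_bound w; have [c' c'0 h'] := letter_bound l.
have d0 : 0 < e / 2 / (c + 1) by rewrite !divr_gt0 // ltr_wpDl.
(* The minimum with 1 bounds the word in [u] by [c + 1]. *)
have d'0 : 0 < Num.min 1 (e / 2 / (c' + 1)) by rewrite lt_min ltr01 !divr_gt0 // ltr_wpDl.
apply: evtS (evtI (evtI h h') (evtI (letter_close l d0) (IH _ d'0)))=> n [[a b] [a' b']].
rewrite !big_cons.
have -> : ncletter (u n) l * word (u n) w - ncletter (v n) l * word (v n) w =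
  (ncletter (u n) l - ncletter (v n) l) * word (u n) w + ncletter (v n) l * (word (u n) w - word (v n) w).
  by rewrite mulrBl mulrBr addrA subrK.
have b1 : opnorm (word (u n) w - word (v n) w) <= 1 by apply: letr b' _; rewrite ge_min lexx.
have b2 : opnorm (word (u n) w - word (v n) w) <= e / 2 / (c' + 1) by apply: letr b' _; rewrite ge_min lexx orbT.
have a2 : opnorm (word (u n) w) <= c + 1.
  by rewrite -[word (u n) w](subrK (word (v n) w)) addrC; apply: letr (opnormD _ _) _; exact: lerD.
apply: letr (opnormD _ _) _; have -> : e = e / 2 + e / 2 by field.
apply: lerD; apply: letr (opnormM _ _) _.
  apply: letr (ler_pM _ _ a' a2) _; rewrite ?op_ge0 // divfK //. by rewrite gt_eqF // ltr_wpDl.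
apply: letr (ler_pM (op_ge0 _) (op_ge0 _) b b2) _.
by apply: frac_le=> //; rewrite divr_ge0 // ltW.
Qed.

Lemma nce_close p (e : R) : 0 < e -> evt (fun n=> opnorm (nceval p (u n) - nceval p (v n)) <= e).
elim: p e=> [|[z w] p IH] e e0.
  by apply: evt_true=> n; rewrite !nce_nil subrr opnorm0 ltW.
have e2 : 0 < e / 2 by rewrite divr_gt0.
have d0 : 0 < e / 2 / (normc z + 1) by rewrite divr_gt0 // ltr_wpDl // nc_ge0.
apply: evtS (evtI (IH _ e2) (word_close w d0))=> n [a b].
rewrite !nce_cons /= opprD addrACA -scalerBr; apply: letr (opnormD _ _) _.
have -> : e = e / 2 + e / 2 by field.
apply: lerD; last exact: a.
apply: letr (opnormZ_le _ _) _.
apply: letr (ler_wpM2l (nc_ge0 z) b) _.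
by apply: frac_le; [exact: ltW|exact: nc_ge0].
Qed.

End Perturbation.

Section RationalPolynomials.
Variables (I : Type).

Definition ratc (z : rat * rat) : C := (ratr z.1)%:C + 'i%C * (ratr z.2)%:C.

(** Each polynomial has its own null event, and only countably many can be discarded. Gaussian
    rational coefficients suffice, uniformly in large [n], because the variables stay bounded. *)
Definition rpoly (s : seq (rat * rat * seq (I * bool))) : ncpoly R I :=
  [seq (ratc m.1, m.2) | m : rat * rat * seq (I * bool) <- s].

Lemma ratc_dense (z : C) (e : R) : 0 < e -> exists t, normc (z - ratc t) <= e.
move=> e0; have dense (x : R) : exists t : rat, `|x - ratr t| <= e / 2.
  have h : x - e / 2 < x + e / 2 by lra. have [t] := rat_in_itvoo h; rewrite in_itv /= => /andP[a b]; exists t.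
  by rewrite ler_norml; apply/andP; split; lra.
have [s hs] := dense (cRe z); have [t ht] := dense (complex.Im z); exists (s, t).
have -> : z - ratc (s, t) = (cRe z - ratr s)%:C + 'i%C * (complex.Im z - ratr t)%:C.
  by rewrite [z in LHS]complexE /ratc /= !rmorphB /=; ring.
apply: letr (le_normcD _ _) _; have -> : e = e / 2 + e / 2 by field.
apply: lerD; first by rewrite normcR.
by rewrite ncM (norm_unit false) mul1r normcR.
Qed.

Variables (A : cstarAlgType R) (x : I -> A) (v : forall n, I -> 'M[C]_n.+1).
Arguments v : clear implicits.
Variables (v_bound : forall i, exists2 c : R, 0 <= c & evt (fun n=> opnorm (v n i) <= c)).

Lemma ratpoly_dense p (e : R) : 0 < e -> exists s,
  evt (fun n=> opnorm (nceval p (v n) - nceval (rpoly s) (v n)) <= e) /\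
  cnorm (nceval p x - nceval (rpoly s) x) <= e.
elim: p e=> [|[z w] p IH] e e0.
  exists [::]; rewrite /rpoly /=; split; last by rewrite !nce_nil subrr cnorm0 ltW.
  by apply: evt_true=> n; rewrite !nce_nil subrr opnorm0 ltW.
have e2 : 0 < e / 2 by rewrite divr_gt0.
have [s [h1 h2]] := IH _ e2.
have [c c0 hc] := word_bound v_bound w; set y := \prod_(l <- w) ncletter x l.
have D0 : 0 < c + cnorm y + 1 by rewrite ltr_wpDl // addr_ge0 ?cnorm_ge0.
have [t ht] := ratc_dense z (divr_gt0 e2 D0); exists ((t, w) :: s).
have small b : 0 <= b -> b <= c + cnorm y + 1 -> normc (z - ratc t) * b <= e / 2.
  move=> b0 bc; apply: letr (ler_pM _ _ ht bc) _; rewrite ?nc_ge0 // divfK //. by rewrite gt_eqF.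
have E : e = e / 2 + e / 2 by field.
split; last first.
  rewrite /rpoly /= !nce_cons /= -/y opprD addrACA -scalerBl E.
  apply: letr (cnormD _ _) _; apply: lerD; last exact: h2. rewrite cnormZ.
  by apply: small; [exact: cnorm_ge0|rewrite -addrA; have := cnorm_ge0 y; lra].
apply: evtS (evtI h1 hc)=> n [a b].
rewrite /rpoly /= !nce_cons /= opprD addrACA -scalerBl E.
apply: letr (opnormD _ _) _; apply: lerD; last exact: a.
apply: letr (opnormZ_le _ _) _.
apply: small; first exact: op_ge0.
by apply: letr b _; rewrite -addrA lerDl addr_ge0 ?cnorm_ge0.
Qed.

Variables (tau : {scalar A}) (tauP : faithful_tracial_state tau)
  (rat_upper : forall s (e : R), 0 < e -> evt (fun n=> opnorm (nceval (rpoly s) (v n)) <= cnorm (nceval (rpoly s) x) + e))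
  (rat_trace : forall s (e : R), 0 < e -> evt (fun n=> normc (ntrace (nceval (rpoly s) (v n)) - tau (nceval (rpoly s) x)) <= e))
  (u : forall n, I -> 'M[C]_n.+1).
Arguments u : clear implicits.
Variables (uv_close : forall i (e : R), 0 < e -> evt (fun n=> opnorm (u n i - v n i) <= e)).

Let approx p (e : R) : 0 < e -> exists s,
  evt (fun n=> opnorm (nceval p (u n) - nceval (rpoly s) (v n)) <= e) /\
  cnorm (nceval p x - nceval (rpoly s) x) <= e.
move=> e0; have e2 : 0 < e / 2 by rewrite divr_gt0.
have [s [h1 h2]] := ratpoly_dense p e2; exists s; split; last by apply: letr h2 _; lra.
apply: evtS (evtI h1 (nce_close v_bound uv_close p e2))=> n [a b].
rewrite -[nceval p (u n)](subrK (nceval p (v n))) -addrA; apply: letr (opnormD _ _) _.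
have -> : e = e / 2 + e / 2 by field.
exact: lerD b a.
Qed.

Lemma ntraceB n (M N : 'M[C]_n) : ntrace (M - N) = ntrace M - ntrace N.
by rewrite /ntrace linearB /= mulrBr. Qed.

(** The error is divided into thirds: approximation at the matrices, convergence for the rational
    polynomial, approximation in the limit. *)
Lemma strong_of_rational : strong_cvg u tau x.
have tele (x1 y1 z1 t1 : C) : x1 - t1 = (x1 - y1) + (y1 - z1) + (z1 - t1) by ring.
have gen (a b : R) : a / 3 + (a / 3 + b + a / 3) <= b + a by lra.
apply: (strong_of_bounds tauP)=> p e e0; have e3 : 0 < e / 3 by rewrite divr_gt0.
  have [s [h1 h2]] := approx p e3; apply: evtS (evtI h1 (rat_trace s e3))=> n [a b].
  have -> : ntrace (nceval p (u n)) - tau (nceval p x) = ntrace (nceval p (u n) - nceval (rpoly s) (v n)) +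
      (ntrace (nceval (rpoly s) (v n)) - tau (nceval (rpoly s) x)) + tau (nceval (rpoly s) x - nceval p x).
    by rewrite ntraceB linearB /=; exact: tele.
  have -> : e = e / 3 + e / 3 + e / 3 by field. apply: letr (le_normcD _ _) _; apply: lerD.
    by apply: letr (le_normcD _ _) _; apply: lerD; [exact: letr (ntrace_le _) a|exact: b].
  by apply: letr (tau_le tauP _) _; rewrite cnormB.
have [s [h1 h2]] := approx p e3; apply: evtS (evtI h1 (rat_upper s e3))=> n [a b].
have n1 : opnorm (nceval p (u n)) <= e / 3 + opnorm (nceval (rpoly s) (v n)).
  rewrite -[nceval p (u n)](subrK (nceval (rpoly s) (v n))); apply: letr (opnormD _ _) _. exact: lerD a (lexx _).
have n2 : cnorm (nceval (rpoly s) x) <= e / 3 + cnorm (nceval p x).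
  rewrite -[nceval (rpoly s) x](subrK (nceval p x)); apply: letr (cnormD _ _) _.
  by apply: lerD; [rewrite cnormB; exact: h2|exact: lexx].
apply: letr n1 _; apply: letr (lerD (lexx _) b) _.
exact: letr (lerD (lexx _) (lerD n2 (lexx _))) (gen _ _).
Qed.

End RationalPolynomials.

(** * Almost sure convergence of the corners *)

Section MainTheorem.
Variables (d r m : nat) (theta : nat -> 'I_r) (mu : 'I_r -> 'I_r -> probability (cvec2 R d) R)
  (nu : 'I_r -> probability (cvec R d) R) (mu_law : forall a b, offdiag_law (mu a b))
  (mu_swap : forall a b U, measurable U -> mu b a U = pushforward (mu a b) (@swapv R d) U)
  (nu_law : forall a, diag_law (nu a)) (Acomp : forall n : nat, 'I_m -> 'M[R[i]]_n.+1) (B : cstarAlgType R)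
  (tauB : {scalar B}) (tauB_state : faithful_tracial_state tauB) (p : 'I_r -> B) (a : 'I_m -> B).
Let PA n := join_vars (type_proj R theta n.+1) (@Acomp n).
Variables (PA_cvg : strong_cvg PA tauB (join_vars p a)) (A : cstarAlgType R) (tauA : {scalar A})
  (tauA_state : faithful_tracial_state tauA) (iota : {lrmorphism B -> A})
  (iota_star : forall x, iota (star x) = star (iota x)) (iota_tau : forall x, tauA (iota x) = tauB x)
  (K : matching_coefs R d r) (src : source_label r -> A) (K_match : matching mu K)
  (src_free : free_sources tauA (range iota) K src) (dO : measure_display) (Om : measurableType dO)
  (P : probability Om R) (xi : nat -> nat -> 'I_d -> Om -> R[i]) (xi_model : array_model xi P theta mu nu).
Notation V := (('I_r + 'I_m) + 'I_d)%type.
Notation word := (seq (ncpoly R ('I_r + 'I_m) + 'I_d * bool)).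

(** Relations among the [p_b] are inherited from the type projections, since norms converge. *)
Let limit_zero q : (forall n, nceval q (PA n) = 0) -> nceval q (join_vars p a) = 0.
move=> h; apply: cnorm_eq0; have [_ c] := PA_cvg q.
apply: (cvg_unique _ c)=> //; rewrite (_ : (fun n=> _) = (fun=> 0)); first exact: cvg_cst.
by apply/funext=> n; rewrite h opnorm0.
Qed.

Let pvar b : ncpoly R ('I_r + 'I_m) := ncvar (inl b).

Let p_star b : star (p b) = p b.
have := @limit_zero (ncstar (pvar b) ++ ncscale (-1) (pvar b)).
rewrite nce_add nce_star nce_scale nce_var scaleN1r=> h.
apply/eqP; rewrite -subr_eq0; apply/eqP; apply: h=> n.
rewrite nce_add nce_star nce_scale nce_var scaleN1r /PA /= type_projE.
have cj (c e : bool) : conjc ((c%:R : C) *+ e) = c%:R *+ e.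
  by case: c; case: e; apply/eqP; rewrite eq_complex /= ?oppr0 !eqxx.
apply/matrixP=> i j; rewrite !mxE cj; have [->|ij] := eqVneq i j; first by rewrite subrr.
by rewrite /= !mulr0n subr0.
Qed.

Let p_orth b c : p b * p c = if b == c then p b else 0.
have := @limit_zero (ncmul (pvar b) (pvar c) ++ ncscale (if b == c then -1 else 0) (pvar b)).
rewrite nce_add nce_mul nce_scale !nce_var=> h.
have {}h : p b * p c + (if b == c then -1 else 0) *: p b = 0.
  apply: h=> n; rewrite nce_add nce_mul nce_scale !nce_var /PA /= !type_projE.
  rewrite -[_ * _]/(_ *m _) mulmx_diag; apply/matrixP=> i j; rewrite !mxE.
  case: (i == j); rewrite ?mulr1n ?mulr0n ?mulr0 ?addr0 //.
  case: (eqVneq b c)=> [->|bc]; first by case: (_ == c); rewrite ?mulr1 ?mulr0 ?mulN1r ?subrr ?addr0.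
  rewrite mul0r addr0; case: eqP=> [ib|]; rewrite ?mul0r // ib (negbTE bc) mulr0 //.
by move: h; case: (b == c)=> /eqP; rewrite ?scaleN1r ?subr_eq0 ?scale0r ?addr0=> /eqP.
Qed.

Let letter_word (l : V * bool) : ncpoly R ('I_r + 'I_m) + 'I_d * bool :=
  match l.1 with inl j=> inl [:: (1, [:: (j, l.2)])] | inr k=> inr (k, l.2) end.
(** The scalar of a monomial becomes a constant coefficient at the head of its word. *)
Let words_of (q : ncpoly R V) : seq word :=
  [seq inl (ncconst _ t.1) :: [seq letter_word l | l <- t.2] | t <- q].

Let lim_vars : V -> A := join_vars (join_vars (iota \o p) (iota \o a)) (matched_family (iota \o p) K src).
Let model_vars w n : V -> 'M[C]_n.+1 := join_vars (PA n) (fun k=> model_mx theta mu xi n k w).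
Let array_vars w n : V -> 'M[C]_n.+1 := join_vars (PA n) (fun k=> corner xi n.+1 k w).

Let Gm n := @Gn d r mu theta n.
Let Ym n (vs : seq word) om := @Ymx d r 'I_m PA (Sn d) Gm n vs om.
Let yv vs := Yv K iota p src a vs.

Let limit_words q : yv (words_of q) = nceval q lim_vars.
rewrite /yv /Yv big_map /nceval; eqr=> t _.
rewrite /wB /= wval_cons /= /cB nce_const linearZ /= rmorph1 -scalerAl mul1r; congr (_ *: _).
elim: t.2=> [|l s IH]; first by rewrite /wval !big_nil.
rewrite /= wval_cons big_cons -IH; congr (_ * _).
case: l=> -[[b|j]|k] e; rewrite /letter_word /= /cB ?nce_cons ?nce_nil /= ?big_seq1 ?addr0 ?scale1r //.
- by case: e=> //=; rewrite iota_star.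
- by case: e=> //=; rewrite iota_star.
Qed.

Let model_words q n w : Ym (words_of q) (omn xi n w) = nceval q (model_vars w n).
rewrite /Ym /Ymx big_map /nceval; eqr=> t _.
rewrite /Wmx big_cons nce_const -scalerAl mul1r big_map; congr (_ *: _).
eqr=> -[[[b|j]|k] e] _; rewrite /letter_word /= ?nce_cons ?nce_nil ?big_seq1 ?addr0 ?scale1r //.
case: e=> //; rewrite -[RHS]/(adjmx _) /model_mx -(Xmx_adj (G := Gm)) //.
by move=> n' x i j s; exact: Gn_adj.
Qed.

Notation vcode := (seq (rat * rat * seq (V * bool))).

Let ae_bound (E : nat -> set Om) : (forall n, measurable (E n)) ->
  (exists q t, [/\ 0 <= q, q < 1, (0 < t)%N & evt (fun n=> pr P (E n) <= n.+1%:R * q ^+ (Nn n %/ t))]) ->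
  \forall w \ae P, evt (fun n=> ~ E n w).
move=> mE [q [t [q0 q1 t0 h]]].
apply: (bor_cant mE (c := fun n=> n.+1%:R ^- 2) (M := 3))=> [|n|n].
- by apply: evtS (evtI h (tail_small q0 q1 t0))=> n [b c]; exact: letr b c.
- by rewrite invr_ge0 exprn_ge0.
- exact: sum_inv2.
Qed.

Let t_ge0 n : 0 <= 4 * taun n.
by rewrite mulr_ge0 // (letr ler01 (taun_ge1 n)). Qed.

Let s_ge0 : 0 <= sgn mu. exact: sqrtr_ge0. Qed.

Let w_ge0 n (i j : 'I_n.+1) s : (i < j)%N -> 0 <= @wn d r mu theta n i j s.
exact: wn_ge0. Qed.
Let w_sum n (i j : 'I_n.+1) : (i < j)%N -> \sum_s @wn d r mu theta n i j s = 1.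
exact: wn_sum. Qed.
Let G_adj n x (i j : 'I_n.+1) s : i != j -> conjc (Gm x i j s) = Gm (xadj x) j i s.
exact: Gn_adj. Qed.
Let G_mean n x (i j : 'I_n.+1) : i != j ->
  \sum_s (wt (sn0 d n) (@wn d r mu theta n) (key i j) s)%:C * Gm x i j s = 0.
exact: Gn_mean. Qed.
Let G_cov n x y (i j : 'I_n.+1) :
  normc (gamG (sn0 d n) (@wn d r mu theta n) (@Gm n) x y i j) <= sgn mu ^+ 2.
exact: gamGn_sg. Qed.
Let G_cov' n x y (i j : 'I_n.+1) :
  normc (gamG' (sn0 d n) (@wn d r mu theta n) (@Gm n) x y i j) <= sgn mu ^+ 2.
exact: gamGn_sg'. Qed.
Let G_bound n x (i j : 'I_n.+1) s : i != j -> normc (Gm x i j s) <= 4 * taun n.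
exact: Gn_bound. Qed.
Let G_limit (e : R) : 0 < e -> evt (fun n=> forall x y (i j : 'I_n.+1), i != j ->
  normc (gamG (sn0 d n) (@wn d r mu theta n) (@Gm n) x y i j - gam K (theta i) (theta j) x y) <= e).
exact: (gamGn_small mu_law mu_swap K_match). Qed.

Let norm_ae (q : ncpoly R V) (e : R) : 0 < e ->
  \forall w \ae P, evt (fun n=> opnorm (nceval q (model_vars w n)) <= cnorm (nceval q lim_vars) + e).
move=> e0.
pose F n (om : {ffun 'I_n.+1 * 'I_n.+1 -> Sn d n}) := cnorm (yv (words_of q)) + e < opnorm (Ym (words_of q) om).
have : \forall w \ae P, evt (fun n=> ~ F n (omn xi n w)).
  apply: ae_bound=> [n|]; first exact: (meas_finite (meas_omn xi_model (n := n))).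
  have [q' [t [h1 h2 h3 h4]]] := norm_tail tauA_state tauB_state iota_star iota_tau p_star p_orth src_free
    (fun n b=> erefl) PA_cvg w_ge0 w_sum G_adj G_mean s_ge0 G_cov G_cov' t_ge0 G_bound
    (@Nn_small) (@taun_small) G_limit (words_of q) e0.
  exists q', t; split=> //; apply: evtS h4=> n; apply: letr. by rewrite (pr_omn xi_model (F n)).
apply: filterS=> w; apply: evtS=> n /negP; rewrite -leNgt.
by rewrite limit_words model_words.
Qed.

Let trace_ae (q : ncpoly R V) (e : R) : 0 < e ->
  \forall w \ae P, evt (fun n=> normc (ntrace (nceval q (model_vars w n)) - tauA (nceval q lim_vars)) <= e).
move=> e0.
pose F n (om : {ffun 'I_n.+1 * 'I_n.+1 -> Sn d n}) := e < normc (ntrace (Ym (words_of q) om) - tauA (yv (words_of q))).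
have : \forall w \ae P, evt (fun n=> ~ F n (omn xi n w)).
  apply: ae_bound=> [n|]; first exact: (meas_finite (meas_omn xi_model (n := n))).
  have [q' [t [h1 h2 h3 h4]]] := trace_tail tauA_state iota_star iota_tau p_star p_orth src_free
    (fun n b=> erefl) PA_cvg w_ge0 w_sum G_adj G_mean s_ge0 G_cov G_cov' t_ge0 G_bound
    (@Nn_small) (@taun_small) G_limit (words_of q) e0.
  exists q', t; split=> //; apply: evtS h4=> n; apply: letr. by rewrite (pr_omn xi_model (F n)).
apply: filterS=> w; apply: evtS=> n /negP; rewrite -leNgt.
by rewrite limit_words model_words.
Qed.

Let rational_ae : \forall w \ae P, forall (s : vcode) (k : nat),
  evt (fun n=> opnorm (nceval (rpoly s) (model_vars w n)) <= cnorm (nceval (rpoly s) lim_vars) + k.+1%:R^-1) /\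
  evt (fun n=> normc (ntrace (nceval (rpoly s) (model_vars w n)) - tauA (nceval (rpoly s) lim_vars)) <= k.+1%:R^-1).
have k0 k : 0 < k.+1%:R^-1 :> R by rewrite invr_gt0.
(* One event for all rational polynomials and all precisions, by encoding the pairs as integers. *)
have : \forall w \ae P, forall i : nat, if @unpickle (vcode * nat)%type i is Some (s, k) then
  evt (fun n=> opnorm (nceval (rpoly s) (model_vars w n)) <= cnorm (nceval (rpoly s) lim_vars) + k.+1%:R^-1) /\
  evt (fun n=> normc (ntrace (nceval (rpoly s) (model_vars w n)) - tauA (nceval (rpoly s) lim_vars)) <= k.+1%:R^-1)
  else True. apply: ae_foralln=> i; case: (@unpickle (vcode * nat)%type i)=> [[s k]|]; last exact: aeW.
  by apply: filterS2 (norm_ae (rpoly s) (k0 k)) (trace_ae (rpoly s) (k0 k))=> w h1 h2; split.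
apply: filterS=> w h s k; have := h (pickle (s, k)); rewrite pickleK; exact: id.
Qed.

Lemma array_strong_ae : \forall w \ae P, mx_strong_cvg (array_vars w) tauA lim_vars.
apply: filterS2 rational_ae (corner_close mu_law nu_law xi_model)=> w h cl.
have small (e : R) : 0 < e -> exists k : nat, k.+1%:R^-1 <= e.
  move=> e0; exists (Num.bound e^-1); rewrite -[leRHS]invrK lef_pV2 ?posrE ?invr_gt0 //.
  apply: ltW; apply: lt_trans (archi_boundP _) _; first by rewrite invr_ge0 ltW. by rewrite ltr_nat.
apply: (strong_to_mx tauA_state); apply: (strong_of_rational (v := model_vars w))=> //.
(* Boundedness of a variable is the upper bound for the polynomial consisting of that variable
   alone. *)
- move=> i; have [+ _] := h [:: ((1, 0), [:: (i, false)])] 0%N.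
  rewrite /rpoly /= nce_cons nce_nil addr0 big_seq1 /ratc rmorph1 rmorph0 mulr0 addr0 scale1r=> b.
  exists (cnorm (lim_vars i) + 1); first by rewrite addr_ge0 ?cnorm_ge0.
  apply: evtS b=> n; rewrite nce_cons nce_nil addr0 big_seq1 /= rmorph1 scale1r. by rewrite invr1.
- move=> s e e0; have [k hk] := small e e0; apply: evtS (h s k).1=> n b.
  by apply: letr b _; rewrite lerD2l.
- move=> s e e0; have [k hk] := small e e0; apply: evtS (h s k).2=> n b.
  exact: letr b hk.
move=> [j|k] e e0; last exact: cl.
by apply: evt_true=> n; rewrite /array_vars /model_vars /= subrr opnorm0 ltW.
Qed.

End MainTheorem.

End StrongConvergenceOfArrays.

Theorem theorem2p3 (R : realType) (d r m : nat)
  (d_gt0 : (1 <= d)%N) (r_gt0 : (1 <= r)%N) (m_gt0 : (1 <= m)%N)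
  (theta : nat -> 'I_r) (pi_ : 'I_r -> R)
  (pi_gt0 : forall a, 0 < pi_ a)
  (cvg_pi : forall a,
     (fun n => ntrace (type_proj R theta n.+1 a) : R[i]^o) @ \oo
       --> ((pi_ a)%:C : R[i]^o))
  (mu : 'I_r -> 'I_r -> probability (cvec2 R d) R)
  (mu_law : forall a b, offdiag_law (mu a b))
  (mu_swap : forall a b U, measurable U ->
     mu b a U = pushforward (mu a b) (@swapv R d) U)
  (nu : 'I_r -> probability (cvec R d) R)
  (nu_law : forall a, diag_law (nu a))
  (Acomp : forall n : nat, 'I_m -> 'M[R[i]]_n.+1)
  (B : cstarAlgType R) (tauB : {scalar B})
  (tauB_state : faithful_tracial_state tauB)
  (p : 'I_r -> B) (a : 'I_m -> B)
  (PA_cvg : strong_cvg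
     (fun n => join_vars (type_proj R theta n.+1) (Acomp n))
     tauB (join_vars p a))
  (A : cstarAlgType R) (tauA : {scalar A})
  (tauA_state : faithful_tracial_state tauA)
  (iota : {lrmorphism B -> A})
  (iota_star : forall x, iota (star x) = star (iota x))
  (iota_tau : forall x, tauA (iota x) = tauB x)
  (K : matching_coefs R d r) (K_match : matching mu K)
  (src : source_label r -> A)
  (src_free : free_sources tauA (range iota) K src)
  (dO : measure_display) (Om : measurableType dO) (P : probability Om R)
  (xi : nat -> nat -> 'I_d -> Om -> R[i])
  (xi_model : array_model xi P theta mu nu) :
  exists Om0 : set Om,
    [/\ measurable Om0, P Om0 = 1%E &
      forall w, Om0 w ->
        mx_strong_cvg
          (fun n => join_vars (join_vars (type_proj R theta n.+1) (Acomp n))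
                              (fun k => corner xi n.+1 k w))
          tauA
          (join_vars (join_vars (iota \o p) (iota \o a))
                     (matched_family (iota \o p) K src))].
Proof.
have [N [mN N0 h]] := array_strong_ae mu_law mu_swap nu_law tauB_state PA_cvg tauA_state
  iota_star iota_tau K_match src_free xi_model.
exists (~` N); split; [exact: measurableC|by rewrite probability_setC // N0 sube0|].
by move=> w Nw; apply: contrapT => k; apply: Nw; exact: h.
Qed.
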